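(* Let $\alpha>0$, let $1\le d\le 4$ be an integer, and let $1<p<\lambda(d)$, where $\lambda(1)=\lambda(2)=\infty$ and $\lambda(d)=1+\frac{4}{d-2}$ for $d=3,4$. Let $(u_0,u_1)\in\mathcal H=H^1(\mathbb R^d)\times L^2(\mathbb R^d)$ and let $u$ be the maximal forward solution of $$u_{tt}-\Delta u+u+2\alpha u_t-|u|^{p-1}u=0,\qquad u(0)=u_0,\quad \partial_tu(0)=u_1 .$$ Then one of the following holds: (i) $u$ blows up at a finite positive time; or (ii) $u$ is global forward in time with unbounded trajectory, i.e. $u$ exists on $[0,\infty)$ and $\sup_{t\ge 0}\|(u(t),\partial_tu(t))\|_{\mathcal H}=\infty$; or (iii) $u$ exists on $[0,\infty)$, $\lim_{t\to\infty}\partial_tu(t)=0$ in $L^2(\mathbb R^d)$, and for every time sequence $t_n\to\infty$ there exist, after passing to a subsequence, an integer $0\le J<\infty$, equilibrium points $Q^1,\dots,Q^J$, and points $x_{j,n}\in\mathbb R^d$ ($1\le j\le J$) such that $$u(t_n)=\sum_{j=1}^{J}Q^j(\cdot-x_{j,n})+o_{H^1}(1)\quad\text{as } n\to\infty,$$ and $\lim_{n\to\infty}|x_{j,n}-x_{i,n}|=\infty$ for all $i\ne j$.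
   Context: Functions are real-valued. A solution on $[0,T)$ means a function $u$ with $(u,\partial_tu)\in C([0,T);\mathcal H)$ and $|u|^{p-1}u\in L^1_{loc}([0,T);L^2(\mathbb R^d))$ satisfying the equation in the sense of distributions (equivalently, Duhamel's formula). The Cauchy problem is locally well-posed in $\mathcal H$, so there is a unique maximal forward solution on some $[0,T_+)$, $0<T_+\le\infty$; it ''blows up at finite positive time'' if $T_+<\infty$ and is ''global forward in time'' if $T_+=\infty$. An equilibrium point is a function $Q\in H^1(\mathbb R^d)$ with $-\Delta Q+Q-|Q|^{p-1}Q=0$ (a time-independent solution). The notation $o_{H^1}(1)$ denotes a sequence tending to $0$ in $H^1(\mathbb R^d)$. *)

(* Defs.v *)
From HB Require Import structures.
From mathcomp Require Import all_boot all_order all_algebra.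
From mathcomp Require Import all_classical all_reals all_analysis.

Set Implicit Arguments.
Unset Strict Implicit.
Unset Printing Implicit Defensive.
Import Order.TTheory GRing.Theory Num.Theory.
Import numFieldNormedType.Exports.

Local Open Scope classical_set_scope.
Local Open Scope ring_scope.

Section measurable_rV.
Context {R : realType} (n : nat).

Let coord : 'I_n -> 'rV[R]_n -> R := fun i x => x ord0 i.

Let rV_set0 : g_sigma_preimage coord set0.
Proof. exact: sigma_algebra0. Qed.

Let rV_setC A : g_sigma_preimage coord A -> g_sigma_preimage coord (~` A).
Proof. exact: sigma_algebraC. Qed.

Let rV_bigcup (F : (set 'rV[R]_n)^nat) :
  (forall i, g_sigma_preimage coord (F i)) ->
  g_sigma_preimage coord (\bigcup_i (F i)).
Proof. exact: sigma_algebra_bigcup. Qed.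

(* The product (= Borel) sigma-algebra on row vectors, as for n.-tuple. *)
HB.instance Definition _ := @isMeasurable.Build default_measure_display
  'rV[R]_n (g_sigma_preimage coord) rV_set0 rV_setC rV_bigcup.

Lemma measurable_coord_rV (i : 'I_n) :
  measurable_fun [set: 'rV[R]_n] (fun x : 'rV[R]_n => x ord0 i).
Proof.
move=> _ Y mY; rewrite setTI; apply: sub_sigma_algebra => /=.
rewrite -bigcup_seq/=; exists i => /=; first by rewrite mem_index_enum.
by exists Y => //; rewrite setTI.
Qed.

Lemma measurable_fun_rV d (T : measurableType d) (f : T -> 'rV[R]_n) :
  (forall i, measurable_fun [set: T] (fun x => f x ord0 i)) ->
  measurable_fun [set: T] f.
Proof.
move=> mf; have sub : g_sigma_preimage (fun i => coord i \o f) `<=` measurable.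
  apply: smallest_sub; first exact: sigma_algebra_measurable.
  rewrite -bigcup_seq/=; apply: bigcup_sub => i _ A [B mB <-].
  exact: mf.
move: sub; rewrite g_sigma_preimage_comp => sub _ A mA.
by apply: sub; exists A.
Qed.

End measurable_rV.

Section lebesgue_rV.
Context {R : realType}.

Definition cons_rV n (z : R * 'rV[R]_n) : 'rV[R]_n.+1 :=
  \row_i if unlift ord0 i is Some j then z.2 ord0 j else z.1.

Let uncons_rV n (x : 'rV[R]_n.+1) : R * 'rV[R]_n :=
  (x ord0 ord0, \row_i x ord0 (lift ord0 i)).

Let cons_rVK n : cancel (@cons_rV n) (@uncons_rV n).
Proof.
move=> [a x]; rewrite /uncons_rV /cons_rV; congr pair => /=.
  by rewrite mxE unlift_none.
by apply/rowP => i; rewrite !mxE liftK.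
Qed.

Let measurable_cons_rV n : measurable_fun setT (@cons_rV n).
Proof.
apply: measurable_fun_rV => i; rewrite /cons_rV.
case: (unliftP ord0 i) => [j ->|->].
  under eq_fun do rewrite mxE liftK.
  exact: (measurableT_comp (measurable_coord_rV j) measurable_snd).
by under eq_fun do rewrite mxE unlift_none; exact: measurable_fst.
Qed.

Let measurable_uncons_rV n : measurable_fun setT (@uncons_rV n).
Proof.
apply/measurable_fun_pairP; split; first exact: measurable_coord_rV.
apply: measurable_fun_rV => i /=.
under eq_fun do rewrite mxE.
exact: measurable_coord_rV.
Qed.

Section succ.
Context (n : nat) (mu : {sigma_finite_measure set 'rV[R]_n -> \bar R}).

Definition lebesgue_rV_succ : set 'rV[R]_n.+1 -> \bar R :=
  pushforward (@lebesgue_measure R \x mu)%E (@cons_rV n).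

Let succ0 : lebesgue_rV_succ set0 = 0%E.
Proof. by rewrite /lebesgue_rV_succ /pushforward preimage_set0 measure0. Qed.

Let succ_ge0 A : (0 <= lebesgue_rV_succ A)%E.
Proof. by rewrite /lebesgue_rV_succ /pushforward measure_ge0. Qed.

Let succ_sigma_additive : semi_sigma_additive lebesgue_rV_succ.
Proof.
have mf := @measurable_cons_rV n.
move=> F mF tF mUF; rewrite /lebesgue_rV_succ /pushforward preimage_bigcup.
apply: measure_semi_sigma_additive.
- by move=> k; rewrite -[X in measurable X]setTI; exact: mf.
- apply/trivIsetP => /= i j _ _ ij; rewrite -preimage_setI.
  by move/trivIsetP : tF => /(_ _ _ _ _ ij) ->//; rewrite preimage_set0.
- by rewrite -preimage_bigcup -[X in measurable X]setTI; exact: mf.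
Qed.

HB.instance Definition _ := isMeasure.Build _ _ _ lebesgue_rV_succ
  succ0 succ_ge0 succ_sigma_additive.

Let succ_sigma_finite : sigma_finite setT lebesgue_rV_succ.
Proof.
have /sigma_finiteP[F [TF ndF Foo]] := sigma_finiteT (@lebesgue_measure R).
have /sigma_finiteP[G [TG ndG Goo]] := sigma_finiteT mu.
exists (fun k => @uncons_rV n @^-1` (F k `*` G k)).
  rewrite -preimage_bigcup (_ : \bigcup_k _ = setT) ?preimage_setT//.
  apply/seteqP; split => // -[x y] _.
  have [i _ Fix] : (\bigcup_k F k) x by rewrite -TF.
  have [j _ Gjy] : (\bigcup_k G k) y by rewrite -TG.
  exists (maxn i j) => //; split => /=.
    by move: x Fix; exact/subsetPset/ndF/leq_maxl.
  by move: y Gjy; exact/subsetPset/ndG/leq_maxr.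
move=> k; have [mF Fk] := Foo k; have [mG Gk] := Goo k; split.
  rewrite -[X in measurable X]setTI; apply: measurable_uncons_rV => //.
  exact: measurableX.
rewrite /lebesgue_rV_succ /pushforward -comp_preimage.
rewrite (_ : _ \o _ = id); last by apply/funext => z; exact: cons_rVK.
by rewrite preimage_id product_measure1E// lte_mul_pinfty// ge0_fin_numE.
Qed.

HB.instance Definition _ := Measure_isSigmaFinite.Build _ _ _ lebesgue_rV_succ
  succ_sigma_finite.
End succ.

(* Lebesgue measure on R^n, as an iterated product: point mass for n = 0, and
   the image of (lebesgue_measure \x lebesgue_rV n) under cons_rV for n.+1. *)
Fixpoint lebesgue_rV n : {sigma_finite_measure set 'rV[R]_n -> \bar R} :=
  if n is m.+1 then lebesgue_rV_succ (lebesgue_rV m)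
  else @dirac _ 'rV[R]_0 0 R.

End lebesgue_rV.

Section test_functions.
Context {R : realType} {V : normedModType R}.

(* C^oo: every iterated directional derivative of f is differentiable. *)
Definition smooth (f : V -> R) :=
  forall (vs : seq V) (x : V),
    differentiable (foldr (fun v (g : V -> R) => 'D_v g) f vs) x.

Definition test_function (D : set V) (f : V -> R) :=
  let supp := closure [set x | f x != 0] in
  [/\ smooth f, compact supp & supp `<=` D].

End test_functions.

Section sobolev.
Context {R : realType} {d : nat}.
Implicit Types f g : 'rV[R]_d -> R.

Definition euclidean_norm (x : 'rV[R]_d) : R :=
  Num.sqrt (\sum_(k < d) x ord0 k ^+ 2).

Definition basis_rV (i : 'I_d) : 'rV[R]_d := delta_mx ord0 i.

Definition laplacian f : 'rV[R]_d -> R :=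
  fun x => \sum_(i < d) 'D_(basis_rV i) ('D_(basis_rV i) f) x.

(* Elements of L^2 and H^1 are represented by functions; equality in these
   spaces is equality almost everywhere. *)
Definition in_L2 f := f \in Lfun (@lebesgue_rV R d) 2%:E.

Definition L2_norm f : \bar R := 'N[@lebesgue_rV R d]_2%:E[EFin \o f].

Definition is_weak_derivative (i : 'I_d) f g :=
  forall phi : 'rV[R]_d -> R, test_function setT phi ->
    \int[lebesgue_rV d]_x (f x * 'D_(basis_rV i) phi x) =
    - \int[lebesgue_rV d]_x (g x * phi x).

Definition in_H1 f :=
  in_L2 f /\ forall i, exists2 g, in_L2 g & is_weak_derivative i f g.

(* A representative of the L^2 weak derivative, unique almost everywhere; it is
   0 by convention when there is none. *)
Definition weak_derivative (i : 'I_d) f : 'rV[R]_d -> R :=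
  xget (cst 0) [set g | in_L2 g /\ is_weak_derivative i f g].

Definition H1_norm f : \bar R :=
  ((L2_norm f `^ 2 + \sum_(i < d) L2_norm (weak_derivative i f) `^ 2)
    `^ 2^-1)%E.

Definition in_energy_space f g := in_H1 f /\ in_L2 g.

Definition energy_norm f g : \bar R :=
  ((H1_norm f `^ 2 + L2_norm g `^ 2) `^ 2^-1)%E.

Definition cvg_to0_H1 (r : nat -> 'rV[R]_d -> R) :=
  (forall n, in_H1 (r n)) /\ H1_norm (r n) @[n --> \oo] --> 0%E.

End sobolev.

Section bochner.
Context {R : realType} {d : nat}.
Implicit Types f s : R -> 'rV[R]_d -> R.

Definition L2_valued_simple s :=
  exists (m : nat) (A : 'I_m -> set R) (a : 'I_m -> 'rV[R]_d -> R),
    [/\ forall k, measurable (A k), forall k, in_L2 (a k) &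
        s = fun t x => \sum_(k < m) \1_(A k) t * a k x].

Definition L2_strongly_measurable (D : set R) f :=
  exists2 s : nat -> R -> 'rV[R]_d -> R, forall n, L2_valued_simple (s n) &
    {ae lebesgue_measure, forall t, D t ->
       in_L2 (f t) /\ L2_norm (s n t \- f t) @[n --> \oo] --> 0%E}.

(* "Locally" on [0, T) means on every [0, b] with b < T: integrability up to
   t = 0 is required. *)
Definition L1loc_L2 (T : \bar R) f :=
  forall b : R, 0 <= b -> (b%:E < T)%E ->
    L2_strongly_measurable `[0, b] f /\
    (\int[lebesgue_measure]_(t in `[0%R, b]) L2_norm (f t) < +oo)%E.

End bochner.

Section damped_klein_gordon.
Context {R : realType} {d : nat}.
Implicit Types (alpha p : R) (T : \bar R) (u ut : R -> 'rV[R]_d -> R).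

Definition critical_exponent (n : nat) : \bar R :=
  if (n <= 2)%N then +oo%E else (1 + 4 / (n%:R - 2))%:E.

Definition nonlinearity p (f : 'rV[R]_d -> R) : 'rV[R]_d -> R :=
  fun x => `|f x| `^ (p - 1) * f x.

Definition lifespan T : set R := [set t | 0 <= t /\ (t%:E < T)%E].

Definition spacetime T : set (R * 'rV[R]_d) :=
  [set z | 0 < z.1 /\ (z.1%:E < T)%E].

Definition dt (phi : R * 'rV[R]_d -> R) : R * 'rV[R]_d -> R :=
  'D_((1, 0) : R * 'rV[R]_d) phi.

(* Iterated rather than joint integral: u is a curve of representatives, which
   need not be jointly measurable. *)
Definition spacetime_integral T (F : R * 'rV[R]_d -> R) : R :=
  \int[lebesgue_measure]_(t in lifespan T) \int[lebesgue_rV d]_x F (t, x).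

Definition is_time_derivative T u ut :=
  forall phi, test_function (spacetime T) phi ->
    spacetime_integral T (fun z => u z.1 z.2 * dt phi z) =
    - spacetime_integral T (fun z => ut z.1 z.2 * phi z).

(* u_tt - Delta u + u + 2 alpha u_t - |u|^(p-1) u = 0 in D'((0, T) x R^d) *)
Definition solves_in_distributions alpha p T u :=
  forall phi, test_function (spacetime T) phi ->
    spacetime_integral T (fun z =>
      u z.1 z.2 * (dt (dt phi) z - laplacian (fun x => phi (z.1, x)) z.2
                   + phi z - 2 * alpha * dt phi z)
      - nonlinearity p (u z.1) z.2 * phi z) = 0.

(* (u, ut) is in C([0, T); H) *)
Definition energy_continuous T u ut :=
  forall t, lifespan T t -> in_energy_space (u t) (ut t) /\
    energy_norm (u s \- u t) (ut s \- ut t)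
      @[s --> within (lifespan T) (nbhs t)] --> 0%E.

Definition is_solution alpha p (u0 u1 : 'rV[R]_d -> R) T u ut :=
  [/\ energy_continuous T u ut /\ is_time_derivative T u ut,
      L1loc_L2 T (fun t => nonlinearity p (u t)),
      solves_in_distributions alpha p T u,
      u 0 = u0 %[ae lebesgue_rV d] &
      ut 0 = u1 %[ae lebesgue_rV d]].

(* Maximal: u is not the restriction of a solution on a longer interval. *)
Definition is_maximal_solution alpha p (u0 u1 : 'rV[R]_d -> R) T u ut :=
  [/\ (0 < T)%E, is_solution alpha p u0 u1 T u ut &
      forall T' v vt, (T < T')%E -> is_solution alpha p u0 u1 T' v vt ->
        ~ (forall t, lifespan T t -> v t = u t %[ae lebesgue_rV d])].

Definition is_equilibrium p (Q : 'rV[R]_d -> R) :=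
  in_H1 Q /\
  forall phi, test_function setT phi ->
    \int[lebesgue_rV d]_x (Q x * (- laplacian phi x + phi x)
                           - nonlinearity p Q x * phi x) = 0.

End damped_klein_gordon.

(* Main.v *)
(** Along a global bounded solution the energy dissipates, so the L2 norm of u_t is
    square integrable in time. Hence time averages of the equation and of the virial
    (Nehari) functional over windows of fixed length starting at t_n vanish in the
    limit: every weak limit, along an ultrafilter, of a translate of u(t_n) is an
    equilibrium. Each nonzero equilibrium costs a fixed amount of H1 norm, so one can
    subtract only finitely many of them, and a maximal family leaves a remainder all of
    whose translates converge weakly to 0. Subcritically such a remainder vanishes in
    L^{p+1}; averages over dyadic cubes replace the Fourier side of the Sobolev
    embedding, and (2^d/4)^{(p-1)/2} < 4 is the form in which p < lambda(d) enters.
    The virial identity then turns L^{p+1} smallness into H1 smallness. *)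

Require Import Defs.
From HB Require Import structures.
From mathcomp Require Import all_boot all_order all_algebra.
From mathcomp Require Import all_classical all_reals all_analysis measurable_realfun.
From mathcomp Require Import ring lra.
Set Implicit Arguments.
Unset Strict Implicit.
Unset Printing Implicit Defensive.
Import Order.TTheory GRing.Theory Num.Theory.
Import numFieldNormedType.Exports.
Local Open Scope classical_set_scope.
Local Open Scope ring_scope.

(** * Stability of smooth functions under sums, products and affine substitutions *)

Section smooth_calculus.
Context {R : realType}.
Implicit Types V W : normedModType R.

(** The energy inequality is not obtained by multiplying the equation by u_t: at a fixed time the
    equation pairs with H1 functions only, and u_t lies in L2. The multiplier is the symmetric
    difference u(t+h) - u(t-h). Convexity of |.|^(p+1) takes the place of differentiating the
    potential, at the price of pairing the nonlinearity with a second difference that is o(h) in L2;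
    this is where integrability of the nonlinearity in L1_loc(L2) enters. Convexity yields one
    inequality, the one that bounds the dissipation. The velocity is kept inside the virial
    functional |u_t|^2 + |u|_H1^2 - |u|_{p+1}^{p+1}. It combines the energy, which converges, with
    the potential, which drifts little over unit time; so it tends to 0 itself, not merely in time
    average. Expanded around the profiles it leaves |u_t|^2 + |remainder|_H1^2, and both vanish
    together. All limits are taken along an ultrafilter finer than the tails of the naturals, so
    that bounded quantities converge at once; an actual subsequence is extracted only at the end,
    from finitely many smallness conditions per index. *)

Lemma smooth_differentiable V (f : V -> R) x : smooth f -> differentiable f x.
Proof. by move=> /(_ [::] x). Qed.

Lemma smooth_derivable V (f : V -> R) x v : smooth f -> derivable f x v.
Proof. by move=> sf; exact/diff_derivable/smooth_differentiable. Qed.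

Lemma smooth_continuous V (f : V -> R) : smooth f -> continuous f.
Proof. by move=> sf x; exact/differentiable_continuous/smooth_differentiable. Qed.

Lemma smooth_derive V (f : V -> R) v : smooth f -> smooth ('D_v f).
Proof.
by move=> sf vs x; have := sf (rcons vs v) x; rewrite -cats1 foldr_cat.
Qed.

(* Coinduction: a class of differentiable functions stable under directional
   derivatives consists of smooth functions. *)
Lemma smooth_coind V (P : (V -> R) -> Prop) :
  (forall f, P f -> (forall x, differentiable f x) /\ (forall v, P ('D_v f))) ->
  forall f, P f -> smooth f.
Proof.
move=> PP f Pf vs; elim/last_ind: vs f Pf => [|vs v IH] f Pf.
  by have [] := PP _ Pf.
by rewrite -cats1 foldr_cat /=; apply: IH; have [_] := PP _ Pf; apply.
Qed.

Lemma smooth_cst V (c : R) : smooth (cst c : V -> R).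
Proof.
apply: (@smooth_coind _ (fun f => exists c, f = cst c)); last by exists c.
move=> _ [k ->]; split=> [x|v]; first exact: differentiable_cst.
by exists 0; apply/funext => x; rewrite derive_cst.
Qed.

Lemma smooth_add V (f g : V -> R) :
  smooth f -> smooth g -> smooth (fun x => f x + g x).
Proof.
move=> sf sg; apply: (@smooth_coind _ (fun h =>
  exists f g : V -> R, [/\ smooth f, smooth g & h = f + g])); last by exists f, g.
move=> _ {f g sf sg} [f [g [sf sg ->]]]; split=> [x|v].
  by apply: differentiableD; exact: smooth_differentiable.
exists ('D_v f), ('D_v g); split; [exact: smooth_derive..|].
by apply/funext => x; rewrite deriveD//; exact: smooth_derivable.
Qed.

(** Single products are not stable under derivatives; Leibniz's rule forces this closure, to which
    [smooth_coind] then applies. *)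
Inductive sum_of_products V : (V -> R) -> Prop :=
| sop_mul f g : smooth f -> smooth g -> sum_of_products (f * g)
| sop_add f g : sum_of_products f -> sum_of_products g -> sum_of_products (f + g).

Lemma smooth_mul V (f g : V -> R) :
  smooth f -> smooth g -> smooth (fun x => f x * g x).
Proof.
move=> sf sg; apply: (@smooth_coind _ (@sum_of_products V)); last exact: sop_mul.
move=> h {f g sf sg}; elim=> {h} [f g sf sg|f g _ [df Df] _ [dg Dg]]; split=> [x|v].
- by apply: differentiableM; exact: smooth_differentiable.
- rewrite (_ : 'D_v (f * g) = f * 'D_v g + g * 'D_v f).
    by apply: sop_add; apply: sop_mul => //; exact: smooth_derive.
  by apply/funext => x; rewrite deriveM//; exact: smooth_derivable.
- exact: differentiableD.
- rewrite (_ : 'D_v (f + g) = 'D_v f + 'D_v g); first exact: sop_add.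
  by apply/funext => x; rewrite deriveD//; exact: diff_derivable.
Qed.

Lemma smooth_scale V (c : R) (f : V -> R) : smooth f -> smooth (fun x => c * f x).
Proof. by move=> sf; apply: smooth_mul => //; exact: smooth_cst. Qed.

Lemma smooth_prod V (I : Type) (s : seq I) (f : I -> V -> R) :
  (forall i, smooth (f i)) -> smooth (fun x => \prod_(i <- s) f i x).
Proof.
move=> sf; elim: s => [|i s IH].
  by under eq_fun do rewrite big_nil; exact: smooth_cst.
by under eq_fun do rewrite big_cons; exact: smooth_mul.
Qed.

(** The two difference quotients coincide term by term: moving by h *: v before [A] is moving by h
    *: L v after it. *)
Lemma derive_comp_affine V W (A : V -> W) (L : V -> W) (f : W -> R) v x :
  (forall h u a, A (h *: u + a) = h *: L u + A a) ->
  'D_v (fun x => f (A x)) x = 'D_(L v) f (A x).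
Proof. by move=> AL; rewrite /derive /=; under eq_fun do rewrite AL. Qed.

Lemma smooth_comp_affine V W (A : V -> W) (L : V -> W) (f : W -> R) :
  (forall x, differentiable A x) ->
  (forall h u a, A (h *: u + a) = h *: L u + A a) ->
  smooth f -> smooth (fun x => f (A x)).
Proof.
move=> dA AL sf; apply: (@smooth_coind _ (fun h =>
  exists2 f : W -> R, smooth f & h = fun x => f (A x))); last by exists f.
move=> _ {f sf} [f sf ->]; split=> [x|v].
  exact: (differentiable_comp (dA x) (smooth_differentiable (A x) sf)).
exists ('D_(L v) f); first exact: smooth_derive.
by apply/funext => x; exact: derive_comp_affine.
Qed.

Lemma smooth_comp_scale_shift V (s : R) (a : V) (f : V -> R) :
  smooth f -> smooth (fun x => f (s *: x + a)).
Proof.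
apply: (@smooth_comp_affine _ _ (fun x => s *: x + a) (fun x => s *: x)) => [x|h u b].
  by apply: differentiableD => //; exact: differentiableZ.
by rewrite scalerDr !scalerA mulrC addrA.
Qed.

Lemma derive_comp_scale_shift V (s : R) (a : V) (f : V -> R) v x :
  'D_v (fun x => f (s *: x + a)) x = 'D_(s *: v) f (s *: x + a).
Proof.
apply: (@derive_comp_affine _ _ (fun x => s *: x + a) (fun x => s *: x)) => h u b.
by rewrite scalerDr !scalerA mulrC addrA.
Qed.

Lemma deriveZv V (f : V -> R) (s : R) v x :
  differentiable f x -> 'D_(s *: v) f x = s * 'D_v f x.
Proof. by move=> df; rewrite !deriveE// linearZ. Qed.

Lemma derive_real (f : R -> R) v x : differentiable f x ->
  'D_v f x = v * 'D_1 f x.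
Proof. by move=> df; rewrite -[v in 'D_v f x]mulr1; exact: deriveZv. Qed.

Lemma smooth_comp_fst V W (f : V -> R) : smooth f -> smooth (fun z : V * W => f z.1).
Proof.
apply: (@smooth_comp_affine _ _ fst fst) => // x.
by apply: linear_differentiable => y; exact: cvg_fst.
Qed.

Lemma smooth_comp_snd V W (f : W -> R) : smooth f -> smooth (fun z : V * W => f z.2).
Proof.
apply: (@smooth_comp_affine _ _ snd snd) => // x.
by apply: linear_differentiable => y; exact: cvg_snd.
Qed.

Lemma smooth_comp_coord n (i : 'I_n) (f : R -> R) :
  smooth f -> smooth (fun x : 'rV[R]_n => f (x ord0 i)).
Proof.
apply: (@smooth_comp_affine _ _ (fun x : 'rV[R]_n => x ord0 i) (fun x => x ord0 i)).
  by move=> x; exact: differentiable_coord.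
by move=> h u a; rewrite !mxE.
Qed.

End smooth_calculus.

(** * Smooth cutoffs on the line, from exp(-1/x) *)

Section smooth_cutoff.
Context {R : realType}.

(** The function x^(-k) exp(-1/x) extended by 0. Differentiation brings out powers of 1/x, so the
    whole family in [k] is carried along: its linear span is stable under derivatives. *)
Definition flat (k : nat) (x : R) : R :=
  if 0 < x then (x^-1) ^+ k * expR (- x^-1) else 0.

Lemma flat_ge0 k x : 0 <= flat k x.
Proof.
rewrite /flat; case: ifPn => // x0.
by rewrite mulr_ge0 ?expR_ge0// exprn_ge0// invr_ge0 ltW.
Qed.

(** With y = 1/x this is exp(y) >= y^(k+2)/(k+2)!. A quadratic bound is exactly what makes the
    derivative at 0 vanish. *)
Lemma flat_le_sqr k x : flat k x <= (k.+2)`!%:R * x ^+ 2.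
Proof.
rewrite /flat; case: ifPn => x0; last by rewrite mulr_ge0// sqr_ge0.
have y0 : 0 < x^-1 by rewrite invr_gt0.
have := expR_ge1Dxn k.+1 (ltW y0).
rewrite expRN; move: y0; rewrite -[x in x ^+ 2]invrK; move: (x^-1) => y y0 le_exp.
have e0 := expR_gt0 y.
rewrite ler_pdivrMr// exprVn mulrAC ler_pdivlMr ?exprn_gt0// -exprD addn2.
have f0 : 0 < (k.+2)`!%:R :> R by rewrite ltr0n fact_gt0.
rewrite -ler_pdivrMl// mulrC.
by apply: le_trans le_exp; rewrite lerDr.
Qed.

Lemma is_derive_flat k x :
  is_derive x (1 : R) (flat k) (- k%:R * flat k.+1 x + flat k.+2 x).
Proof.
have [x0|x0|x0] := ltrgtP 0 x.
- apply: (@near_eq_is_derive R R R (fun y : R => (y^-1) ^+ k * expR (- y^-1))).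
    by near=> y; rewrite /flat ifT//; near: y; exact: lt_nbhsr.
  rewrite /flat x0.
  have dV : is_derive x (1 : R) (fun y : R => y^-1) (- (x^-1) ^+ 2).
    apply: is_derive_eq; first by apply: (@is_deriveV _ id) => //; rewrite gt_eqF.
    by rewrite exprVn /GRing.scale /= mulr1.
  have dN : is_derive x (1 : R) (fun y : R => - y^-1) ((x^-1) ^+ 2).
    by apply: is_derive_eq (is_deriveN dV) _; rewrite opprK.
  have dE : is_derive x (1 : R) (fun y => expR (- y^-1)) ((x^-1) ^+ 2 * expR (- x^-1)).
    apply: is_derive_eq (is_derive1_comp (is_derive_expR _) dN) _.
    by rewrite mulrC.
  have dX : is_derive x (1 : R) (fun y : R => (y^-1) ^+ k) (- k%:R * (x^-1) ^+ k.+1).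
    case: k => [|k].
      under eq_fun do rewrite expr0.
      by rewrite oppr0 mul0r; exact: is_derive_cst.
    rewrite (_ : (fun y : R => y^-1 ^+ k.+1) = (fun y : R => y^-1) ^+ k.+1); last first.
      by apply/funext => y; rewrite exprfctE.
    apply: is_derive_eq (is_deriveX k.+1 dV) _.
    rewrite /GRing.scale /= -mulr_natr exprS !exprS; ring.
  have := @is_deriveM _ _ (fun y : R => y^-1 ^+ k) (fun y => expR (- y^-1)) x 1 _ _ dX dE.
  move=> /is_derive_eq; apply.
  rewrite /GRing.scale /= !exprS; ring.
- apply: (@near_eq_is_derive R R R (cst 0)).
    by near=> y; rewrite /flat ifF//; apply/negbTE; rewrite -leNgt ltW//; near: y; exact: lt_nbhsl.
  rewrite /flat ifF ?ifF; try by apply/negbTE; rewrite -leNgt ltW.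
  by rewrite mulr0 addr0; exact: is_derive_cst.
- rewrite -x0 /flat ltxx mulr0 addr0.
  (* At the origin [flat_le_sqr] bounds the difference quotient by a multiple of |h|. *)
  have key : (fun h : R => h^-1 *: (flat k (h *: 1 + 0) - flat k 0)) @ 0^' --> (0 : R).
    apply/cvgrPdist_le => e e0.
    have e' : 0 < e / (k.+2)`!%:R by rewrite divr_gt0// ltr0n fact_gt0.
    near=> h; have h0 : h != 0 by near: h; exact: nbhs_dnbhs_neq.
    rewrite sub0r normrN {2}/flat ltxx subr0 addr0 {1}/GRing.scale /= {1}/GRing.scale /= mulr1.
    rewrite normrM normfV ler_pdivrMl ?normr_gt0// ger0_norm ?flat_ge0//.
    apply: le_trans (flat_le_sqr _ _) _.
    rewrite -(real_normK (num_real h)) expr2 mulrA mulrC ler_wpM2l// mulrC -ler_pdivlMr ?ltr0n ?fact_gt0//.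
    by near: h; apply: dnbhs0_le.
  apply: DeriveDef; first by apply/cvg_ex; exists 0.
  exact/cvg_lim.
Unshelve. all: by end_near. Qed.

Inductive flat_span : (R -> R) -> Prop :=
| flat_span_base k c : flat_span (fun x => c * flat k x)
| flat_span_add f g : flat_span f -> flat_span g -> flat_span (f + g).

Lemma smooth_flat k : smooth (flat k).
Proof.
rewrite (_ : flat k = fun x => 1 * flat k x); last by apply/funext => x; rewrite mul1r.
apply: (@smooth_coind _ _ flat_span); last exact: flat_span_base.
move=> h; elim=> {h} [{}k c|f g _ [df Df] _ [dg Dg]]; split=> [x|v].
- by apply: differentiableZ; apply/derivable1_diffP; have [] := is_derive_flat k x.
- have dk x : differentiable (flat k) x.
    by apply/derivable1_diffP; have [] := is_derive_flat k x.
  rewrite (_ : 'D_v _ = (fun x => (v * c * - k%:R) * flat k.+1 x) +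
                        (fun x => (v * c) * flat k.+2 x)).
    by apply: flat_span_add; exact: flat_span_base.
  apply/funext => x; rewrite derive_real; last exact: differentiableZ.
  rewrite (deriveZ (f:=flat k) c) ; last by have [] := is_derive_flat k x.
  have [_ ->] := is_derive_flat k x.
  by rewrite /GRing.scale /= fctE; ring.
- exact: differentiableD.
- rewrite (_ : 'D_v (f + g) = 'D_v f + 'D_v g); first exact: flat_span_add.
  by apply/funext => x; rewrite deriveD//; exact: diff_derivable.
Qed.

(* Increases to the indicator of ]a, b[ as m tends to infinity. *)
Definition bump (a b : R) (m : nat) (x : R) : R :=
  flat 0 (m%:R * (x - a)) * flat 0 (m%:R * (b - x)).

Lemma smooth_bump a b m : smooth (bump a b m).
Proof.
apply: smooth_mul.
  have := @smooth_comp_scale_shift _ _ m%:R (- (m%:R * a)) _ (smooth_flat 0).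
  by congr smooth; apply/funext => x; rewrite /GRing.scale /= mulrBr.
have := @smooth_comp_scale_shift _ _ (- m%:R) (m%:R * b) _ (smooth_flat 0).
by congr smooth; apply/funext => x; rewrite /GRing.scale /= mulrBr mulNr addrC.
Qed.

Lemma flat0_le1 x : flat 0 x <= 1.
Proof.
rewrite /flat; case: ifPn => // x0; rewrite expr0 mul1r -expR0 ler_expR.
by rewrite oppr_le0 invr_ge0 ltW.
Qed.

Lemma bump_ge0 a b m x : 0 <= bump a b m x.
Proof. by rewrite mulr_ge0 ?flat_ge0. Qed.

Lemma bump_le1 a b m x : bump a b m x <= 1.
Proof.
by rewrite -[leRHS]mulr1 ler_pM ?flat_ge0 ?flat0_le1.
Qed.

Lemma bump_eq0 a b m x : ~~ (a < x < b) -> bump a b m x = 0.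
Proof.
rewrite /bump negb_and -!leNgt => /orP[xa|bx].
  by rewrite {1}/flat ifF ?mul0r//; apply/negbTE; rewrite -leNgt mulr_ge0_le0// subr_le0.
by rewrite mulrC {1}/flat ifF ?mul0r//; apply/negbTE; rewrite -leNgt mulr_ge0_le0// subr_le0.
Qed.

Lemma bump_gt0 a b m x : (0 < m)%N -> a < x < b -> 0 < bump a b m x.
Proof.
move=> m0 /andP[ax xb]; rewrite /bump mulr_gt0// /flat !pmulr_rgt0 ?ltr0n// subr_gt0.
  by rewrite ax expr0 mul1r expR_gt0.
by rewrite xb expr0 mul1r expR_gt0.
Qed.

Lemma cvg_flat0 y : 0 < y -> flat 0 (m%:R * y) @[m --> \oo] --> (1 : R).
Proof.
move=> y0; have h0 : - (m.+1%:R^-1 * y^-1) @[m --> \oo] --> (0 : R).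
  rewrite -[X in _ --> X]oppr0 -(mul0r y^-1).
  by apply: cvgN; apply: cvgMl; exact: cvg_harmonic.
have := cvg_comp _ _ h0 (@continuous_expR R 0).
rewrite expR0 => h; rewrite -(cvg_shiftn 1) /=.
rewrite (_ : (fun m : nat => _) = expR \o (fun m => - (m.+1%:R^-1 * y^-1)))//.
apply/funext => m.
by rewrite addn1 /flat mulr_gt0// ?ltr0n// expr0 mul1r invfM.
Qed.

Lemma cvg_bump a b x :
  bump a b m x @[m --> \oo] --> (if a < x < b then 1 else 0 : R).
Proof.
have [/andP[ax xb]|axb] := boolP (a < x < b).
  by rewrite -[X in _ --> X]mulr1; apply: cvgM; apply: cvg_flat0; rewrite subr_gt0.
by under eq_fun do rewrite bump_eq0//; exact: cvg_cst.
Qed.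

End smooth_cutoff.

(** * Open boxes as a generating pi-system of the product sigma-algebra *)

Section boxes.
Context {R : realType} {d : nat}.
Local Notation rV := 'rV[R]_d.

Definition obox (a b : rV) : set rV :=
  [set x | forall i, a ord0 i < x ord0 i < b ord0 i].

Lemma measurable_fun_coord (i : 'I_d) :
  measurable_fun [set: rV] (fun x : rV => x ord0 i).
Proof. exact: measurable_coord_rV. Qed.

Lemma measurable_obox a b : measurable (obox a b).
Proof.
rewrite (_ : obox a b = \bigcap_(i in [set: 'I_d])
    ((fun x : rV => x ord0 i) @^-1` `]a ord0 i, b ord0 i[%classic)).
  apply: fin_bigcap_measurable => // i _; rewrite -[X in measurable X]setTI.
  by apply: measurable_fun_coord => //; exact: measurable_itv.
apply/seteqP; split=> x /= h i; first by move=> _ /=; rewrite in_itv/=; exact: h.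
by have := h i I; rewrite /= in_itv.
Qed.

Lemma rV_norm_ltP (x : rV) e : 0 < e ->
  (forall i, `|x ord0 i| < e) <-> `|x| < e.
Proof.
move=> e0; have -> : (`|x| < e) = (`|0 - x| < e) by rewrite sub0r normrN.
have <- : @ball _ rV 0 e x <-> `|0 - x| < e by rewrite -ball_normE.
split=> [h|[_ h] i].
  by split=> // i j; rewrite (ord1 i) /ball/= mxE sub0r normrN.
by have := h ord0 i; rewrite /ball/= mxE sub0r normrN.
Qed.

Lemma coord_le_norm (x : rV) i : `|x ord0 i| <= `|x|.
Proof.
rewrite leNgt; apply/negP => h.
have e0 : 0 < `|x ord0 i| by exact: le_lt_trans h.
by have /rV_norm_ltP := h; move=> /(_ e0)/(_ i); rewrite ltxx.
Qed.

Lemma rV_norm_le (x : rV) e : 0 <= e -> (forall i, `|x ord0 i| <= e) -> `|x| <= e.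
Proof.
move=> e0 xe; apply/ler_addgt0Pr => r r0; apply/ltW/rV_norm_ltP => [|i].
  by rewrite ltr_wpDl.
by apply: le_lt_trans (xe i) _; rewrite ltrDl.
Qed.

Lemma rV_bounded_nat (x : rV) :
  exists n : nat, forall i, - n%:R < x ord0 i < n%:R.
Proof.
exists (\max_i (Num.truncn `|x ord0 i|)).+1 => i; rewrite -ltr_norml.
apply: lt_le_trans (truncnS_gt _) _; rewrite ler_nat ltnS.
exact: (leq_bigmax i).
Qed.

Lemma bigcup_obox_nat :
  \bigcup_n obox (const_mx (- n%:R)) (const_mx n%:R) = [set: rV].
Proof.
apply/seteqP; split=> // x _; have [n hn] := rV_bounded_nat x.
by exists n => // i; rewrite !mxE.
Qed.

(** Sets of the form x_i > c generate, and each is a countable union of open boxes: one side starts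
    at c and all other ends recede to infinity with [n]. *)
Lemma measurable_rVE :
  @measurable _ rV = <<s [set B | exists a b, B = obox a b] >>.
Proof.
apply/seteqP; split; last first.
  apply: smallest_sub; first exact: sigma_algebra_measurable.
  by move=> _ [a [b ->]]; exact: measurable_obox.
apply: smallest_sub; first exact: smallest_sigma_algebra.
rewrite -bigcup_seq/=; apply: bigcup_sub => i _ _ [B mB <-].
set G := [set B | _].
have mi : measurable_fun [set: g_sigma_algebraType G] (fun x : rV => x ord0 i).
  apply: (measurability _ (RGenOInfty.measurableE R)).
  move=> _ [_ [c ->] <-]; rewrite setTI.
  rewrite (_ : _ @^-1` _ = \bigcup_n
     obox (\row_j (if j == i then c else - n%:R)) (const_mx n%:R)).
    by apply: bigcupT_measurable => n; apply: sub_sigma_algebra; eexists; eexists.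
  apply/seteqP; split=> x /=.
    rewrite in_itv/= andbT => cx; have [n hn] := rV_bounded_nat x.
    exists n => // j; rewrite !mxE; case: eqP => [->|_]; last exact: hn.
    by rewrite cx; have /andP[] := hn i.
  by move=> [n _ /(_ i)]; rewrite !mxE eqxx in_itv/= andbT => /andP[].
exact: mi.
Qed.

Lemma obox_setI : setI_closed [set B | exists a b : rV, B = obox a b].
Proof.
move=> _ _ [a [b ->]] [a' [b' ->]].
exists (\row_i Num.max (a ord0 i) (a' ord0 i)), (\row_i Num.min (b ord0 i) (b' ord0 i)).
apply/seteqP; split=> x /=.
  by move=> [h h'] i; rewrite !mxE gt_max lt_min; have /andP[-> ->] := h i; have /andP[-> ->] := h' i.
by move=> h; split=> i; have := h i; rewrite !mxE gt_max lt_min => /andP[/andP[? ?] /andP[? ?]]; apply/andP.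
Qed.

Lemma measure_rV_unique (m1 m2 : {measure set rV -> \bar R}) :
  (forall a b, m1 (obox a b) = m2 (obox a b)) ->
  (forall a b, (m1 (obox a b) < +oo)%E) ->
  forall A, measurable A -> m1 A = m2 A.
Proof.
move=> m12 m1oo A mA.
apply: (measure_unique [set B | exists a b : rV, B = obox a b]
   (fun n => obox (const_mx (- n%:R)) (const_mx n%:R))) => //.
- exact: measurable_rVE.
- exact: obox_setI.
- by move=> i; do 2 eexists.
- exact: bigcup_obox_nat.
- by move=> _ [a [b ->]].
Qed.

(** An open set is the union of the rational boxes it contains, a union over a countable type. *)
Lemma open_measurable_rV (O : set rV) : open O -> measurable O.
Proof.
move=> oO; set F := fun r : {ffun 'I_d -> rat * rat} =>
  obox (\row_i ratr (r i).1) (\row_i ratr (r i).2).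
have -> : O = \bigcup_(r : {ffun 'I_d -> rat * rat}) (if `[<F r `<=` O>] then F r else set0).
  apply/seteqP; split=> [x Ox|x [r _]]; last by case: ifPn => // /asboolP + Fr; exact.
  have /nbhs_ballP[e /= e0 eO] : nbhs x O by exact: open_nbhs_nbhs.
  have /fin_all_exists[r hr] : forall i : 'I_d, exists r : rat * rat,
      [/\ x ord0 i - e < ratr r.1 :> R, ratr r.1 < x ord0 i,
          x ord0 i < ratr r.2 & ratr r.2 < x ord0 i + e].
    move=> i; have h1 : x ord0 i - e < x ord0 i by rewrite ltrBlDr ltrDl.
    have h2 : x ord0 i < x ord0 i + e by rewrite ltrDl.
    have [r1 /[!in_itv]/= /andP[? ?]] := rat_in_itvoo h1.
    have [r2 /[!in_itv]/= /andP[? ?]] := rat_in_itvoo h2.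
    by exists (r1, r2).
  exists [ffun i => r i] => //; rewrite ifT; last first.
    apply/asboolP => y /= Fy; apply: eO; split => // i j; rewrite (ord1 i).
    have := Fy j; rewrite !mxE !ffunE => /andP[y1 y2]; have [r1 _ _ r2] := hr j.
    by rewrite /ball /= distrC ltr_distl (lt_trans r1)// (lt_trans y2).
  by move=> i; rewrite !mxE !ffunE; have [_ -> ->] := hr i.
apply: countable_bigcupT_measurable => [|r]; first exact: countableP.
by case: ifP => // _; exact: measurable_obox.
Qed.

Lemma continuous_measurable_rV (f : rV -> R) : continuous f ->
  measurable_fun setT f.
Proof.
move=> /continuousP cf; apply: (measurability _ (RGenOpens.measurableE R)).
move=> _ [_ [a [b ->]] <-]; rewrite setTI; apply: open_measurable_rV.
by apply: cf; exact: interval_open.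
Qed.

End boxes.

(** * Lebesgue measure of boxes and translation invariance *)

Section lebesgue_rV_theory.
Context {R : realType}.

Lemma lebesgue_rV_obox n (a b : 'rV[R]_n) :
  lebesgue_rV n (obox a b) =
  (\prod_(i < n) Num.max 0 (b ord0 i - a ord0 i))%:E.
Proof.
elim: n a b => [|n IH] a b.
  rewrite big_ord0 /= diracE mem_set//; first by case.
rewrite big_ord_recl EFinM /= /lebesgue_rV_succ /pushforward.
rewrite (_ : _ @^-1` _ = `]a ord0 ord0, b ord0 ord0[%classic `*`
   obox (\row_i a ord0 (lift ord0 i)) (\row_i b ord0 (lift ord0 i))).
  rewrite product_measure1E; [|exact: measurable_itv|exact: measurable_obox].
  rewrite IH; congr (_ * _)%E; last by congr (_%:E); apply: eq_bigr => i _; rewrite !mxE.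
  apply: etrans; first exact: lebesgue_measure_itv.
  rewrite /= lte_fin; case: ltP => h.
    by rewrite -EFinD max_r// subr_ge0 ltW.
  by rewrite max_l// subr_le0.
apply/seteqP; split=> [[t x]|[t x]].
  move=> h; split=> /=; first by have := h ord0; rewrite /cons_rV mxE unlift_none in_itv.
  by move=> i; have := h (lift ord0 i); rewrite /cons_rV !mxE liftK.
move=> [/=]; rewrite in_itv/= => h1 h2 i; rewrite /cons_rV mxE.
by case: unliftP => [j ->|->//]; have := h2 j; rewrite !mxE.
Qed.

Lemma lebesgue_rV_obox_lty n (a b : 'rV[R]_n) : (lebesgue_rV n (obox a b) < +oo)%E.
Proof. by rewrite lebesgue_rV_obox ltry. Qed.

Section preserving.
Context {d : nat} (phi : 'rV[R]_d -> 'rV[R]_d).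
Local Notation mu := (@lebesgue_rV R d).
Hypothesis mphi : measurable_fun setT phi.
Hypothesis phi_obox : forall a b, mu (phi @^-1` obox a b) = mu (obox a b).

Let nu : {measure set 'rV[R]_d -> \bar R}.
Proof.
by refine [the {measure set _ -> \bar R} of measure_function.pushforward mu phi].
Defined.

(** The pushforward of [mu] agrees with [mu] on boxes, so uniqueness of measures applies. Invariance
    under translations is the instance used throughout. *)
Lemma preserving_measure A : measurable A -> mu (phi @^-1` A) = mu A.
Proof.
move=> mA; symmetry.
apply: (@measure_rV_unique _ _ mu nu) => //.
  by move=> a b; exact/esym/phi_obox.
exact: lebesgue_rV_obox_lty.
Qed.

Lemma preserving_ge0_integral (f : 'rV[R]_d -> \bar R) :
  measurable_fun setT f -> (forall y, 0 <= f y)%E ->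
  (\int[mu]_x f (phi x) = \int[mu]_x f x)%E.
Proof.
move=> mf f0; transitivity (\int[nu]_x f x)%E.
  by rewrite (@ge0_integral_pushforward _ _ _ _ _ _ mphi mu setT f) ?preimage_setT.
by apply: eq_measure_integral => A mA _; exact: preserving_measure.
Qed.

Lemma preserving_integral (f : 'rV[R]_d -> \bar R) :
  measurable_fun setT f -> (\int[mu]_x f (phi x) = \int[mu]_x f x)%E.
Proof.
move=> mf; rewrite integralE [RHS]integralE; congr (_ - _)%E.
  under eq_integral do rewrite (funepos_comp f phi)/=.
  apply: (@preserving_ge0_integral (f^\+)%E) => //; exact: measurable_funepos.
under eq_integral do rewrite (funeneg_comp f phi)/=.
apply: (@preserving_ge0_integral (f^\-)%E) => //; exact: measurable_funeneg.
Qed.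

Lemma preserving_Rintegral (f : 'rV[R]_d -> R) :
  measurable_fun setT f -> \int[mu]_x f (phi x) = \int[mu]_x f x.
Proof.
move=> mf; rewrite /Rintegral (preserving_integral (f := EFin \o f))//.
exact/measurable_EFinP.
Qed.

Lemma preserving_integrable (f : 'rV[R]_d -> \bar R) :
  mu.-integrable setT f -> mu.-integrable setT (fun x => f (phi x)).
Proof.
move=> /integrableP[mf foo]; apply/integrableP; split.
  exact: (measurableT_comp mf mphi).
rewrite (preserving_ge0_integral (f := fun x => `|f x|%E))//.
exact: measurableT_comp.
Qed.

End preserving.

Section shift_reflection.
Context {d : nat}.
Local Notation mu := (@lebesgue_rV R d).
Implicit Types z : 'rV[R]_d.

Lemma measurable_shift z : measurable_fun setT (fun x : 'rV[R]_d => x + z).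
Proof.
apply: measurable_fun_rV => i; under eq_fun do rewrite mxE.
by apply: measurable_funD => //; exact: measurable_coord_rV.
Qed.

Lemma shift_obox z a b : mu ((fun x => x + z) @^-1` obox a b) = mu (obox a b).
Proof.
rewrite (_ : _ @^-1` _ = obox (a - z) (b - z)).
  rewrite !lebesgue_rV_obox; congr EFin; apply: eq_bigr => i _.
  by rewrite !mxE opprB addrA subrK.
by apply/seteqP; split=> x /= h i; have := h i; rewrite !mxE ltrBlDr ltrBrDr.
Qed.

Definition ge0_integral_shift z := preserving_ge0_integral (measurable_shift z) (shift_obox z).
Definition Rintegral_shift z := preserving_Rintegral (measurable_shift z) (shift_obox z).
Definition integrable_shift z := preserving_integrable (measurable_shift z) (shift_obox z).

End shift_reflection.
End lebesgue_rV_theory.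

(** * Semi-inner products: Cauchy-Schwarz, Riesz representation, density *)

Section semi_inner_product.
Context {R : realType} {V : lmodType R}.
Variables (dom : V -> Prop) (b : V -> V -> R).

(** One framework for L2 and H1, whose elements are genuine functions: membership is the predicate
    [dom], and the form is only semidefinite because b f f = 0 says that f vanishes almost
    everywhere. *)
Record semi_inner := SemiInner {
  sip_dom0 : dom 0;
  sip_domD : forall f g, dom f -> dom g -> dom (f + g);
  sip_domZ : forall a f, dom f -> dom (a *: f);
  sip_sym : forall f g, b f g = b g f;
  sip_addl : forall f g h, dom f -> dom g -> dom h -> b (f + g) h = b f h + b g h;
  sip_scalel : forall a f g, dom f -> dom g -> b (a *: f) g = a * b f g;
  sip_ge0 : forall f, dom f -> 0 <= b f f }.

Definition sip_complete := forall u : nat -> V, (forall n, dom (u n)) ->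
  (forall e, 0 < e -> exists N, forall m n, (N <= m)%N -> (N <= n)%N ->
     b (u m - u n) (u m - u n) <= e) ->
  exists2 l, dom l & forall e, 0 < e -> exists N, forall n, (N <= n)%N ->
     b (u n - l) (u n - l) <= e.

Hypothesis sip : semi_inner.

Lemma sip_domB f g : dom f -> dom g -> dom (f - g).
Proof.
by move=> df dg; rewrite -scaleN1r; apply: (sip_domD sip) => //; exact: (sip_domZ sip).
Qed.

Lemma sip_addr f g h : dom f -> dom g -> dom h -> b h (f + g) = b h f + b h g.
Proof. by move=> df dg dh; rewrite !(sip_sym sip h) (sip_addl sip). Qed.

Lemma sip_scaler a f g : dom f -> dom g -> b g (a *: f) = a * b g f.
Proof. by move=> df dg; rewrite !(sip_sym sip g) (sip_scalel sip). Qed.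

Lemma sip_subl f g h : dom f -> dom g -> dom h -> b (f - g) h = b f h - b g h.
Proof.
move=> df dg dh; rewrite -scaleN1r (sip_addl sip)//; last exact: (sip_domZ sip).
by rewrite (sip_scalel sip)// mulN1r.
Qed.

Lemma sip_subr f g h : dom f -> dom g -> dom h -> b h (f - g) = b h f - b h g.
Proof. by move=> df dg dh; rewrite !(sip_sym sip h) sip_subl. Qed.

Lemma sip_sqrD f g (t : R) : dom f -> dom g ->
  b (f + t *: g) (f + t *: g) = b f f + 2 * t * b f g + t ^+ 2 * b g g.
Proof.
move=> df dg; have dt := sip_domZ sip t dg; have ds := sip_domD sip df dt.
rewrite (sip_addl sip)// !sip_addr// !(sip_scalel sip)// !sip_scaler//.
by rewrite (sip_sym sip g f); ring.
Qed.

Lemma sip_sqrB f g : dom f -> dom g -> b (f - g) (f - g) = b f f - 2 * b f g + b g g.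
Proof.
move=> df dg; rewrite -scaleN1r sip_sqrD// sqrrN expr1n mul1r; ring.
Qed.

Lemma sip_CS_sqr f g : dom f -> dom g -> b f g ^+ 2 <= b f f * b g g.
Proof.
move=> df dg; have ff := sip_ge0 sip df; have gg := sip_ge0 sip dg.
have pos t : 0 <= b f f + 2 * t * b f g + t ^+ 2 * b g g.
  by rewrite -sip_sqrD//; apply: (sip_ge0 sip); apply: (sip_domD sip) => //; exact: (sip_domZ sip).
have [g0|g0] := eqVneq (b g g) 0.
  rewrite g0 mulr0; have [fg0|fg0] := eqVneq (b f g) 0; first by rewrite fg0 expr0n.
  (* When b g g = 0 the quadratic is affine in t; if b f g were nonzero, this t would make it equal
     to -1. *)
  have := pos (- (b f f + 1) / (2 * b f g)); rewrite g0 mulr0 addr0.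
  rewrite (_ : 2 * _ * _ = - (b f f + 1)); last by field.
  by rewrite opprD addrA subrr sub0r oppr_ge0 ler10.
have := pos (- b f g / b g g).
rewrite (_ : _ + _ = (b f f * b g g - b f g ^+ 2) / b g g); last by field.
by rewrite pmulr_lge0 ?subr_ge0// invr_gt0 lt_neqAle eq_sym g0.
Qed.

Definition snorm f := Num.sqrt (b f f).

Lemma snorm_ge0 f : 0 <= snorm f. Proof. exact: sqrtr_ge0. Qed.

Lemma snorm_sqr f : dom f -> snorm f ^+ 2 = b f f.
Proof. by move=> df; rewrite sqr_sqrtr// (sip_ge0 sip). Qed.

Lemma sip_CS f g : dom f -> dom g -> `|b f g| <= snorm f * snorm g.
Proof.
move=> df dg.
rewrite -ler_sqr ?nnegrE ?mulr_ge0 ?snorm_ge0//.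
by rewrite exprMn !snorm_sqr// real_normK ?num_real// sip_CS_sqr.
Qed.

Lemma snormD f g : dom f -> dom g -> snorm (f + g) <= snorm f + snorm g.
Proof.
move=> df dg; rewrite -ler_sqr ?nnegrE ?addr_ge0 ?snorm_ge0// sqrrD !snorm_sqr//; last first.
  exact: (sip_domD sip).
rewrite -[g in leLHS]scale1r sip_sqrD// expr1n mul1r mulr1 lerD2r lerD2l.
by rewrite -[leRHS]mulr_natl ler_wpM2l// (le_trans (ler_norm _))// sip_CS.
Qed.

Lemma snormZ a f : dom f -> snorm (a *: f) = `|a| * snorm f.
Proof.
move=> df; rewrite /snorm (sip_scalel sip)// ?sip_scaler//; last exact: (sip_domZ sip).
by rewrite mulrA -expr2 sqrtrM ?sqr_ge0// sqrtr_sqr.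
Qed.

Lemma snormB f g : dom f -> dom g -> snorm (f - g) <= snorm f + snorm g.
Proof.
move=> df dg; rewrite -scaleN1r (le_trans (snormD _ _))//; first exact: (sip_domZ sip).
by rewrite snormZ// normrN1 mul1r.
Qed.

Lemma snorm_distC f g : dom f -> dom g -> snorm (f - g) = snorm (g - f).
Proof.
move=> df dg; rewrite -opprB -[- (g - f)]scaleN1r snormZ ?normrN1 ?mul1r//; exact: sip_domB.
Qed.

Section minimization.
Variables (D : V -> Prop) (l : V -> R).
Hypotheses (Ddom : forall f, D f -> dom f) (D0 : D 0)
  (DD : forall f g, D f -> D g -> D (f + g)) (DZ : forall a f, D f -> D (a *: f)).
Hypotheses (lD : forall f g, D f -> D g -> l (f + g) = l f + l g)
  (lZ : forall a f, D f -> l (a *: f) = a * l f).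
Variable C : R.
Hypothesis lC : forall f, D f -> `|l f| <= C * snorm f.
Hypothesis compl : sip_complete.

Let J f := b f f - 2 * l f.

Let J_lb f : D f -> - C ^+ 2 <= J f.
Proof.
move=> Df; have := lC Df; rewrite ler_norml => /andP[_ h].
rewrite /J -snorm_sqr//; last exact: Ddom.
have := sqr_ge0 (snorm f - C); rewrite sqrrB; move: (snorm f) (l f) h => s t h.
by rewrite -mulr_natl; lra.
Qed.

(* Riesz: a minimizing sequence of |f|^2 - 2 l(f) over D is Cauchy by the
   parallelogram identity, and its limit represents l on D. *)
Lemma sip_riesz : exists g, [/\ dom g, forall f, D f -> b g f = l f &
  forall e, 0 < e -> exists2 f, D f & b (f - g) (f - g) <= e].
Proof.
pose S := [set J f | f in D].
have S0 : has_inf S.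
  by split; [exists (J 0), 0|exists (- C ^+ 2) => _ [f Df <-]; exact: J_lb].
pose m := inf S.
have mJ f : D f -> m <= J f by move=> Df; apply: ge_inf; [case: S0|exists f].
have /choice[u hu] : forall n : nat, exists f, D f /\ J f <= m + n.+1%:R^-1.
  move=> n; have [|_ [f Df <-] /ltW ?] := @inf_adherent _ S n.+1%:R^-1 _ S0.
    by rewrite invr_gt0.
  by exists f.
have uD n : D (u n) by case: (hu n).
have udom n : dom (u n) by exact: Ddom.
have para i j : b (u i - u j) (u i - u j) <= 2 * (i.+1%:R^-1 + j.+1%:R^-1).
  have h : D (2^-1 *: (u i + u j)) by apply/DZ/DD.
  have := mJ _ h; rewrite /J lZ ?lD//; last exact: DD.
  rewrite (sip_scalel sip)//; [|by apply: (sip_domD sip)|exact: Ddom].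
  rewrite sip_scaler//; try by apply: (sip_domD sip).
  have := (sip_sqrD 1 (udom i) (udom j)); rewrite scale1r => ->.
  rewrite sip_sqrB//; have := (hu i).2; have := (hu j).2; rewrite /J expr1n mulr1.
  by move: (i.+1%:R^-1 : R) (j.+1%:R^-1 : R) => x y; lra.
have inv_small (e : R) : 0 < e -> exists N, forall n, (N <= n)%N -> n.+1%:R^-1 <= e.
  move=> e0; exists (Num.truncn e^-1) => n Nn.
  rewrite invf_ple ?posrE ?ltr0n//; apply/ltW/(lt_le_trans (truncnS_gt _)).
  by rewrite ler_nat ltnS.
have [|g gdom ug] := compl udom.
  move=> e e0; have [|N hN] := inv_small (e / 4); first by lra.
  exists N => i j Ni Nj; apply: le_trans (para i j) _.
  move: (hN _ Ni) (hN _ Nj); move: (i.+1%:R^-1 : R) (j.+1%:R^-1 : R) => x y.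
  lra.
exists g; split=> // [f Df|e e0]; last first.
  by have [N hN] := ug _ e0; exists (u N) => //; exact: hN.
have fdom := Ddom Df; have ff := sip_ge0 sip fdom.
have approx (e : R) : 0 < e -> `|b g f - l f| <= e.
  move=> e0.
  pose t := e / (2 * (b f f + 1)).
  have bf1 : 0 < 2 * (b f f + 1) by lra.
  have t0 : 0 < t by rewrite divr_gt0.
  (* Comparing the functional at u_n + t f and u_n - t f with its infimum bounds the defect of the
     Euler equation by half of 1/((n+1) t) + t (b f f); t is fixed first, to make the second part
     small. *)
  have key n : `|b (u n) f - l f| <= (n.+1%:R^-1 / t + t * b f f) / 2.
    have sgn s : s = 1 \/ s = -1 ->
        - (s * (b (u n) f - l f)) <= (n.+1%:R^-1 / t + t * b f f) / 2.
      move=> s1; have Dn : D (u n + (s * t) *: f) by apply/DD => //; exact: DZ.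
      have := mJ _ Dn; rewrite /J sip_sqrD// lD//; last exact: DZ.
      rewrite lZ//; have := (hu n).2; rewrite /J => h1 h2.
      have s2 : (s * t) ^+ 2 = t ^+ 2 by case: s1 => ->; rewrite ?mul1r ?mulN1r ?sqrrN.
      rewrite s2 in h2.
      rewrite -(ler_pM2l t0) -subr_ge0.
      move: h1 h2; move: (n.+1%:R^-1 : R) => y h1 h2.
      have -> : t * ((y / t + t * b f f) / 2) - t * - (s * (b (u n) f - l f)) =
        (y + t ^+ 2 * b f f + 2 * (s * t) * (b (u n) f - l f)) / 2.
        by field; rewrite gt_eqF.
      lra.
    rewrite ler_norml; apply/andP; split.
      by have := sgn 1 (or_introl erefl); rewrite mul1r lerNl.
    by have := sgn (-1) (or_intror erefl); rewrite mulN1r opprK.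
  have tf : t * b f f <= e / 2.
    rewrite /t mulrAC ler_pdivrMr// (_ : e / 2 * _ = e * (b f f + 1)); last by field.
    by rewrite ler_pM2l//; lra.
  have [|N1 hN1] := inv_small (t * e / 2); first by rewrite divr_gt0// mulr_gt0.
  pose r := (e / 4) / (snorm f + 1).
  have r0 : 0 < r by rewrite !divr_gt0//; have := snorm_ge0 f; lra.
  have [N2 hN2] := ug (r ^+ 2) (exprn_gt0 2 r0).
  have kk := key (maxn N1 N2); have h1 := hN1 _ (leq_maxl N1 N2).
  have h2 := hN2 _ (leq_maxr N1 N2); move: (maxn N1 N2) kk h1 h2 => n kk h1 h2.
  have h3 : `|b g f - b (u n) f| <= e / 4.
    rewrite -sip_subl// (le_trans (sip_CS _ _))//; first exact: sip_domB.
    have : snorm (g - u n) <= r.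
      rewrite snorm_distC// -ler_sqr ?nnegrE ?snorm_ge0 ?(ltW r0)// snorm_sqr//.
      exact: sip_domB.
    move=> /ler_wpM2r => /(_ _ (snorm_ge0 f)) /le_trans; apply.
    rewrite /r mulrAC ler_pdivrMr; last by have := snorm_ge0 f; lra.
    by rewrite ler_pM2l ?lerDl//; lra.
  have h4 : n.+1%:R^-1 / t <= e / 2.
    by rewrite ler_pdivrMr// (_ : e / 2 * t = t * e / 2) //; ring.
  have -> : b g f - l f = (b g f - b (u n) f) + (b (u n) f - l f) by ring.
  apply: le_trans (ler_normD _ _) _; move: (n.+1%:R^-1 / t) kk h4 => y kk h4; lra.
apply/eqP; rewrite -subr_eq0 -normr_le0; apply/ler_addgt0Pr => e e0.
by rewrite add0r; exact: approx.
Qed.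

End minimization.

Section density.
Variable D : V -> Prop.
Hypotheses (Ddom : forall f, D f -> dom f) (D0 : D 0)
  (DD : forall f g, D f -> D g -> D (f + g)) (DZ : forall a f, D f -> D (a *: f)).
Hypothesis compl : sip_complete.
Hypothesis Dperp : forall w, dom w -> (forall f, D f -> b w f = 0) -> b w w = 0.

(** The Riesz representative g of f |-> b u f on D is the projection of u onto the closure of D: it
    is a limit of elements of D, and g - u is orthogonal to D, hence null by [Dperp]. *)
Lemma sip_dense u e : dom u -> 0 < e -> exists2 f, D f & snorm (f - u) <= e.
Proof.
move=> udom e0.
have [] := @sip_riesz D (b u) Ddom D0 DD DZ _ _ (snorm u) _ compl.
- by move=> f g /Ddom ? /Ddom ?; exact: sip_addr.
- by move=> a f /Ddom ?; exact: sip_scaler.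
- by move=> f /Ddom ?; exact: sip_CS.
move=> g [gdom gu gD]; have [f Df fg] := gD _ (exprn_gt0 2 e0); exists f => //.
have fdom := Ddom Df.
have gu0 : snorm (g - u) = 0.
  apply/eqP; rewrite sqrtr_eq0 Dperp//; first exact: sip_domB.
  by move=> h Dh; rewrite sip_subl ?gu ?subrr//; exact: Ddom.
have -> : f - u = (f - g) + (g - u) by rewrite addrA subrK.
apply: le_trans (snormD _ _) _; [exact: sip_domB..|].
rewrite gu0 addr0 -ler_sqr ?nnegrE ?snorm_ge0 ?(ltW e0)// snorm_sqr//.
exact: sip_domB.
Qed.

(** Take f in D close to g: then |g|^2 is at most c |g| up to a small error. Norm bounds thus have
    to be checked against D only. *)
Lemma sip_dual_bound g c : dom g -> 0 <= c ->
  (forall f, D f -> b g f <= c * snorm f) -> snorm g <= c.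
Proof.
move=> gdom c0 gc; have n0 := snorm_ge0 g.
have key e : 0 < e -> snorm g ^+ 2 <= c * snorm g + e * (c + snorm g).
  move=> e0; have [f Df fg] := sip_dense gdom e0; have fdom := Ddom Df.
  have fgd : dom (f - g) by exact: sip_domB.
  have h1 := gc _ Df.
  have h2 : b g f = snorm g ^+ 2 + b g (f - g) by rewrite sip_subr// snorm_sqr//; ring.
  have h3 := sip_CS gdom fgd.
  have h4 : snorm f <= snorm g + e.
    by rewrite -[f in leLHS](subrK g) addrC (le_trans (snormD _ _))// lerD2l.
  have h5 : - b g (f - g) <= snorm g * e.
    apply: le_trans (le_trans (ler_norm _) _) (ler_wpM2l n0 fg).
    by rewrite normrN.
  have h6 := ler_wpM2l c0 h4; lra.
rewrite leNgt; apply/negP => h.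
have g0 : 0 < snorm g by exact: le_lt_trans h.
have s0 : 0 < c + snorm g by lra.
(* This accuracy makes the error half of |g| (|g| - c), which is contradictory if c < |g|. *)
have := key ((snorm g * (snorm g - c)) / (2 * (c + snorm g))).
rewrite (_ : _ / _ * (c + snorm g) = snorm g * (snorm g - c) / 2); last first.
  by field; rewrite gt_eqF.
have P : 0 < snorm g * (snorm g - c) by rewrite mulr_gt0// subr_gt0.
move=> /(_ _); rewrite expr2; have -> : 0 < snorm g * (snorm g - c) / (2 * (c + snorm g)).
  by rewrite divr_gt0// mulr_gt0.
move=> /(_ isT); move: P; lra.
Qed.

End density.
End semi_inner_product.

(** * The space L2 and its completeness *)

HB.lock Definition ip {R : realType} {d : nat} (f g : 'rV[R]_d -> R) : R :=
  \int[lebesgue_rV d]_x (f x * g x).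

Section L2_space.
Context {R : realType} {d : nat}.
Local Notation rV := 'rV[R]_d.
Local Notation mu := (@lebesgue_rV R d).
Implicit Types f g h : rV -> R.

Lemma ipE f g : ip f g = \int[mu]_x (f x * g x).
Proof. by rewrite ip.unlock. Qed.

Lemma L2_normE f : L2_norm f = ((\int[mu]_x ((f x) ^+ 2)%:E) `^ 2^-1)%E.
Proof.
rewrite /L2_norm unlock /=; congr (_ `^ _)%E; apply: eq_integral => x _ /=.
by rewrite powR_mulrn// real_normK// num_real.
Qed.

Lemma in_L2P f : in_L2 f <->
  measurable_fun setT f /\ (\int[mu]_x ((f x) ^+ 2)%:E < +oo)%E.
Proof.
have fin : finite_norm mu 2%:E f <-> (\int[mu]_x ((f x) ^+ 2)%:E < +oo)%E.
  rewrite /finite_norm -/(L2_norm f) L2_normE.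
  have i0 : (0 <= \int[mu]_x ((f x) ^+ 2)%:E)%E.
    by apply: integral_ge0 => x _; rewrite lee_fin sqr_ge0.
  by split=> [/lty_poweRy|/poweR_lty]; apply.
split.
  by rewrite /in_L2 inE => /andP[]; rewrite !inE => mf /= nf; split => //; exact/fin.
by move=> [mf /fin nf]; rewrite /in_L2 inE; apply/andP; split; rewrite inE.
Qed.

Lemma in_L2_measurable f : in_L2 f -> measurable_fun setT f.
Proof. by move=> /in_L2P[]. Qed.

Lemma in_L2_integrable_sqr f : in_L2 f ->
  mu.-integrable setT (EFin \o (fun x => f x ^+ 2)).
Proof.
move=> /in_L2P[mf foo]; apply/integrableP; split.
  by apply/measurable_EFinP; apply: measurable_funX.
by under eq_integral do rewrite /= ger0_norm ?sqr_ge0//.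
Qed.

Lemma integrable_sqr_in_L2 f : measurable_fun setT f ->
  mu.-integrable setT (EFin \o (fun x => f x ^+ 2)) -> in_L2 f.
Proof.
move=> mf /integrableP[_ h]; apply/in_L2P; split=> //.
by apply: le_lt_trans h; under [leRHS]eq_integral do rewrite /= ger0_norm ?sqr_ge0//.
Qed.

Lemma le_in_L2 f g : measurable_fun setT f -> in_L2 g ->
  (forall x, `|f x| <= `|g x|) -> in_L2 f.
Proof.
move=> mf g2 fg; apply: integrable_sqr_in_L2 => //.
apply: le_integrable (in_L2_integrable_sqr g2) => //.
  by apply/measurable_EFinP; apply: measurable_funX.
move=> x _ /=; rewrite lee_fin !normrX ler_sqr ?nnegrE//.
Qed.

Lemma in_L2_integrable_mul f g : in_L2 f -> in_L2 g ->
  mu.-integrable setT (EFin \o (fun x => f x * g x)).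
Proof.
move=> f2 g2; apply: (@le_integrable _ _ _ mu setT _ _
   (fun x => ((f x ^+ 2)%:E + (g x ^+ 2)%:E)%E)) => //.
- apply/measurable_EFinP; apply: measurable_funM; exact: in_L2_measurable.
- move=> x _ /=; rewrite lee_fin [leRHS]ger0_norm ?addr_ge0 ?sqr_ge0//.
  rewrite -(real_normK (num_real (f x))) -(real_normK (num_real (g x))) normrM.
  have := sqr_ge0 (`|f x| - `|g x|); rewrite sqrrB -mulr_natl.
  have := mulr_ge0 (normr_ge0 (f x)) (normr_ge0 (g x)); lra.
- by apply: integrableD => //; exact: in_L2_integrable_sqr.
Qed.

Lemma ip_ge0 f : 0 <= ip f f.
Proof. by rewrite ipE; apply: Rintegral_ge0 => x _; rewrite -expr2 sqr_ge0. Qed.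

Lemma ipC f g : ip f g = ip g f.
Proof. by rewrite !ipE; apply: eq_Rintegral => x _; rewrite mulrC. Qed.

Lemma in_L2D f g : in_L2 f -> in_L2 g -> in_L2 (f + g).
Proof.
move=> f2 g2; apply: integrable_sqr_in_L2.
  by apply: measurable_funD; exact: in_L2_measurable.
apply: (@le_integrable _ _ _ mu setT _ _
   (fun x => (2%:E * ((f x ^+ 2)%:E + (g x ^+ 2)%:E))%E)) => //.
- apply/measurable_EFinP; apply: measurable_funX; apply: measurable_funD;
  exact: in_L2_measurable.
- move=> x _ /=; rewrite lee_fin fctE.
  rewrite ger0_norm ?sqr_ge0// ger0_norm; last by rewrite mulr_ge0// addr_ge0// sqr_ge0.
  by rewrite -subr_ge0 (_ : _ - _ = (f x - g x) ^+ 2) ?sqr_ge0//; ring.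
- apply: integrableZl => //; apply: integrableD => //; exact: in_L2_integrable_sqr.
Qed.

Lemma in_L2Z a f : in_L2 f -> in_L2 (a *: f).
Proof.
move=> f2; apply: integrable_sqr_in_L2.
  by apply: measurable_funM => //; exact: in_L2_measurable.
rewrite (_ : EFin \o _ = (fun x => ((a ^+ 2)%:E * (f x ^+ 2)%:E)%E)).
  by apply: integrableZl => //; exact: in_L2_integrable_sqr.
by apply/funext => x /=; rewrite -EFinM -exprMn.
Qed.

Lemma in_L20 : in_L2 (0 : rV -> R).
Proof.
apply/in_L2P; split; first exact: measurable_cst.
rewrite (_ : (fun _ => _) = cst 0%E); first by rewrite integral0.
by apply/funext => x; rewrite expr0n.
Qed.

Lemma L2_semi_inner : semi_inner (@in_L2 R d) (@ip R d).
Proof.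
split.
- exact: in_L20.
- exact: in_L2D.
- exact: in_L2Z.
- exact: ipC.
- move=> f g h f2 g2 h2; rewrite !ipE -RintegralD//; try exact: in_L2_integrable_mul.
  by apply: eq_Rintegral => x _; rewrite mulrDl.
- move=> a f g f2 g2; rewrite !ipE -RintegralZl//; last exact: in_L2_integrable_mul.
  by apply: eq_Rintegral => x _; rewrite mulrA.
- by move=> f _; exact: ip_ge0.
Qed.

Lemma in_L2B f g : in_L2 f -> in_L2 g -> in_L2 (f - g).
Proof. exact: (sip_domB L2_semi_inner). Qed.

Lemma EFin_ip f g : in_L2 f -> in_L2 g ->
  (ip f g)%:E = (\int[mu]_x (f x * g x)%:E)%E.
Proof.
by move=> f2 g2; rewrite ipE fineK//; apply: integrable_fin_num => //; exact: in_L2_integrable_mul.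
Qed.

Lemma EFin_ip_sqr f : in_L2 f -> (ip f f)%:E = (\int[mu]_x (f x ^+ 2)%:E)%E.
Proof. by move=> f2; rewrite EFin_ip//. Qed.

Lemma L2_norm_snorm f : in_L2 f -> L2_norm f = (snorm ip f)%:E.
Proof.
move=> f2; rewrite L2_normE -EFin_ip_sqr// /snorm poweR_EFin.
by rewrite -powR12_sqrt ?ip_ge0.
Qed.

Lemma ae_ip f g h : in_L2 f -> in_L2 g -> in_L2 h ->
  f = g %[ae mu] -> ip f h = ip g h.
Proof.
move=> f2 g2 h2 fg; apply: EFin_inj; rewrite !EFin_ip//.
apply: ae_eq_integral => //.
- apply/measurable_EFinP; apply: measurable_funM; exact: in_L2_measurable.
- apply/measurable_EFinP; apply: measurable_funM; exact: in_L2_measurable.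
- by apply: filterS fg => x /(_ I) -> _.
Qed.

Lemma nneseries_le (a : nat -> \bar R) (C : \bar R) : (forall k, (0 <= a k)%E) ->
  (forall n, (\sum_(0 <= i < n) a i <= C)%E) -> (\sum_(i <oo) a i <= C)%E.
Proof.
move=> a0 aC; apply: lime_le; first exact: is_cvg_nneseries.
by apply: nearW => n; exact: aC.
Qed.

Lemma limn_einf_le (a : nat -> \bar R) (C : \bar R) :
  (\forall n \near \oo, (a n <= C)%E) -> (limn_einf a <= C)%E.
Proof.
move=> aC; rewrite limn_einf_lim; apply: lime_le; first exact: is_cvg_einfs.
apply: filterS aC => n; apply: le_trans; apply: ereal_inf_lbound.
by exists n => /=.
Qed.

Lemma geometric_steps_cvg (v : nat -> R) (C z : R) : 0 <= C -> 0 <= z < 1 ->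
  (forall k, `|v k.+1 - v k| <= C * z ^+ k) -> cvg (v @ \oo).
Proof.
move=> C0 /andP[z0 z1] hv.
have : cvgn (series (fun k => v k.+1 - v k)).
  apply: normed_cvg; apply: series_le_cvg (is_cvg_geometric_series (a := C) (z := z) _).
  - by move=> k /=.
  - by move=> k; rewrite /geometric /= mulr_ge0 ?exprn_ge0.
  - exact: hv.
  - by rewrite ger0_norm.
move=> /cvg_ex[l hl]; apply/cvg_ex; exists (l + v 0%N).
have h : series (fun k => v k.+1 - v k) k + v 0%N @[k --> \oo] --> l + v 0%N.
  by apply: cvgD => //; exact: cvg_cst.
apply: cvg_trans h; apply: near_eq_cvg; apply: nearW => k.
by rewrite /series /= telescope_sumr// subrK.
Qed.

Lemma cvg_to_EFin (v : nat -> R) (l : R) : v k @[k --> \oo] --> l ->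
  ((v k)%:E @[k --> \oo] --> l%:E)%E.
Proof. by move=> vl; apply: cvg_EFin => //; exact: nearW. Qed.

(** Riesz-Fischer: a rapidly converging subsequence converges almost everywhere, and Fatou's lemma
    along it bounds the L2 distance from u_n to the pointwise limit. *)
Lemma L2_complete : sip_complete (@in_L2 R d) (@ip R d).
Proof.
move=> u u2 cu.
have /choice[N hN] : forall k : nat, exists N, forall m n, (N <= m)%N -> (N <= n)%N ->
    ip (u m - u n) (u m - u n) <= (8^-1) ^+ k.
  by move=> k; apply: cu; rewrite exprn_gt0// invr_gt0.
pose M k := (k + \sum_(i < k.+1) N i)%N.
have MS k : (M k <= M k.+1)%N by rewrite /M (big_ord_recr k.+1) /= leq_add ?leq_addr.
have NM k : (N k <= M k)%N by rewrite /M big_ord_recr /= addnA leq_addl.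
have Mmono : {homo M : i j / (i <= j)%N} by apply: homo_leq => //; exact: leq_trans.
pose v k := u (M k).
have v2 k : in_L2 (v k) by exact: u2.
have mv k : measurable_fun setT (v k) by exact: in_L2_measurable.
(* Squared distances are at most 8^-k along the subsequence. The weight 2^k leaves a summable
   majorant and still forces pointwise steps of size C 2^(-k/2), so the values are Cauchy wherever
   the series is finite. *)
pose g k x := ((2 ^+ k * (v k.+1 x - v k x) ^+ 2)%:E : \bar R).
have g0 k x : (0 <= g k x)%E by rewrite lee_fin mulr_ge0 ?sqr_ge0 ?exprn_ge0.
have mg k : measurable_fun setT (g k).
  apply/measurable_EFinP; apply: measurable_funM => //.
  by apply: measurable_funX; apply: measurable_funB.
have ig k : (\int[mu]_x g k x <= ((2^-1) ^+ k)%:E)%E.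
  rewrite /g; under eq_integral do rewrite EFinM.
  rewrite ge0_integralZl_EFin ?exprn_ge0//; last 2 first.
    by move=> x _; rewrite lee_fin sqr_ge0.
    by apply/measurable_EFinP; apply: measurable_funX; apply: measurable_funB.
  rewrite -(EFin_ip_sqr (in_L2B (v2 k.+1) (v2 k))) -EFinM lee_fin.
  have h := hN k _ _ (leq_trans (NM k) (MS k)) (NM k).
  apply: le_trans (ler_wpM2l _ h) _; first by rewrite exprn_ge0.
  rewrite -exprMn; apply: lerXn2r; rewrite ?nnegrE; lra.
have Sfin : (\int[mu]_x (\sum_(k <oo) g k x) <= 2%:E)%E.
  rewrite integral_nneseries//; apply: nneseries_le => [k|n].
    by apply: integral_ge0 => x _; exact: g0.
  apply: (@le_trans _ _ (\sum_(0 <= i < n) ((2^-1) ^+ i)%:E)%E).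
    by apply: lee_sum => i _; exact: ig.
  rewrite sumEFin lee_fin.
  suff : \sum_(0 <= i < n) 2^-1 ^+ i = 2 - 2 * 2^-1 ^+ n :> R.
    by move=> ->; rewrite gerBl mulr_ge0// exprn_ge0.
  elim: n => [|n IH]; first by rewrite big_geq// expr0; lra.
  by rewrite big_nat_recr//= IH exprS; lra.
have mS : measurable_fun setT (fun x => \sum_(k <oo) g k x)%E.
  by apply: ge0_emeasurable_sum => // k x _ _; exact: g0.
have Sint : mu.-integrable setT (fun x => \sum_(k <oo) g k x)%E.
  apply/integrableP; split=> //; apply: (@le_lt_trans _ _ 2%:E); last exact: ltry.
  apply: le_trans Sfin; rewrite le_eqVlt; apply/orP; left; apply/eqP.
  by apply: eq_integral => x _; rewrite gee0_abs//; exact: nneseries_ge0.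
(* The upper limit is defined at every point, hence measurable without a choice of null set; it is
   the true limit almost everywhere. *)
pose f x := fine (limn_esup (fun k => (v k x)%:E)).
have vf : {ae mu, forall x, v k x @[k --> \oo] --> f x}.
  have := integrable_ae measurableT Sint; apply: filterS => x /(_ I) Sx.
  have cv : cvg (v k x @[k --> \oo]).
    pose C := fine (\sum_(k <oo) g k x)%E.
    have C0 : 0 <= C by apply: fine_ge0; exact: nneseries_ge0.
    apply: (@geometric_steps_cvg _ (Num.sqrt C) (Num.sqrt 2^-1)) => [||k].
    - exact: sqrtr_ge0.
    - by rewrite sqrtr_ge0 /= -[ltRHS]sqrtr1 ltr_sqrt//; lra.
    - have : (g k x <= C%:E)%E.
        rewrite /C fineK//; apply: le_trans (nneseries_lim_ge k.+1 _); last by [].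
        by rewrite big_nat_recr//= leeDr// sume_ge0.
      rewrite lee_fin => h.
      have k2 : 0 < 2 ^+ k :> R by rewrite exprn_gt0.
      rewrite -ler_sqr ?nnegrE ?mulr_ge0 ?exprn_ge0 ?sqrtr_ge0//.
      rewrite exprMn -exprM mulnC exprM !sqr_sqrtr// real_normK ?num_real//.
      by rewrite exprVn ler_pdivlMr// mulrC.
  have [l vl] := (cvg_ex _).1 cv; suff -> : f x = l by [].
  have := (cvg_limn_einf_sup (cvg_to_EFin vl)).2.
  by rewrite /f => ->.
have mf : measurable_fun setT f.
  apply: (@measurableT_comp _ _ _ _ _ _ (@fine R)) => //; last first.
    by apply: measurable_fun_limn_esup => k; exact/measurable_EFinP.
have key e : 0 < e -> exists K, forall n, (K <= n)%N ->
    (\int[mu]_x ((u n x - f x) ^+ 2)%:E <= e%:E)%E.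
  move=> e0; have [K hK] := cu _ e0; exists K => n Kn.
  pose h k x := (((u n x - v k x) ^+ 2)%:E : \bar R).
  have mh k : measurable_fun setT (h k).
    apply/measurable_EFinP; apply: measurable_funX; apply: measurable_funB => //.
    exact: in_L2_measurable.
  have -> : (\int[mu]_x ((u n x - f x) ^+ 2)%:E =
             \int[mu]_x limn_einf (h^~ x))%E.
    apply: ae_eq_integral => //.
    - apply/measurable_EFinP; apply: measurable_funX; apply: measurable_funB => //.
      exact: in_L2_measurable.
    - rewrite /limn_einf; apply: measurableT_comp => //.
      apply: measurable_fun_limn_esup => k; exact: measurableT_comp.
    - apply: filterS vf => x vfx _; apply/esym.
      apply: (cvg_limn_einf_sup _).1; apply: cvg_to_EFin.
      apply: (@cvg_comp _ _ _ (fun k => u n x - v k x) (fun y => y ^+ 2)).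
        by apply: cvgB; [exact: cvg_cst|exact: vfx].
      exact: exprn_continuous.
  apply: le_trans (fatou _ _ _ _) _ => //.
    by move=> k x _; rewrite lee_fin sqr_ge0.
  apply: limn_einf_le; exists K => // k /= Kk.
  rewrite -(EFin_ip_sqr (in_L2B (u2 n) (v2 k))) lee_fin; apply: hK => //.
  exact: leq_trans Kk (leq_addr _ _).
have f2 : in_L2 f.
  have [K hK] := key 1 ltr01.
  have uf2 : in_L2 (u K - f).
    apply/in_L2P; split.
      by apply: measurable_funB => //; exact: in_L2_measurable.
    by apply: le_lt_trans (hK K (leqnn _)) _; exact: ltry.
  rewrite (_ : f = u K - (u K - f)); first exact: in_L2B.
  by rewrite opprB addrC subrK.
exists f => // e e0; have [K hK] := key e e0; exists K => n Kn.
by rewrite -lee_fin (EFin_ip_sqr (in_L2B (u2 n) f2)); exact: hK.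
Qed.

End L2_space.

Lemma cvg_prod_seq {R : realType} (I : Type) (s : seq I) (f : nat -> I -> R)
    (l : I -> R) : (forall i, f m i @[m --> \oo] --> l i) ->
  \prod_(i <- s) f m i @[m --> \oo] --> \prod_(i <- s) l i.
Proof.
move=> fl; elim: s => [|i s IH].
  by under eq_fun do rewrite big_nil; rewrite big_nil; exact: cvg_cst.
by under eq_fun do rewrite big_cons; rewrite big_cons; exact: cvgM.
Qed.

(** * Test functions: construction, density in L2, translations *)

Section test_function_theory.
Context {R : realType} {d : nat}.
Local Notation rV := 'rV[R]_d.
Local Notation mu := (@lebesgue_rV R d).
Implicit Types (phi psi : rV -> R) (z : rV).

Local Notation test := (@test_function R 'rV[R]_d setT).

Lemma test_intro phi M : smooth phi -> (forall x, M < `|x| -> phi x = 0) -> test phi.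
Proof.
move=> sphi phi0; split=> //.
have cl : closed [set x : rV | `|x| <= M].
  apply: (@closed_comp _ _ (fun x : rV => `|x|) [set y | y <= M]) => //.
  by move=> x _; exact: norm_continuous.
have sub : closure [set x | phi x != 0] `<=` [set x | `|x| <= M].
  rewrite [X in _ `<=` X]((closure_id _).1 cl); apply: closure_subset => x /= px.
  by rewrite leNgt; apply: contra px => /phi0 ->.
apply: (subclosed_compact _ _ sub); first exact: closed_closure.
apply: bounded_closed_compact => //.
by exists M; split; [exact: num_real|move=> r Mr x /= xM; exact: le_trans xM (ltW Mr)].
Qed.

Lemma test_smooth phi : test phi -> smooth phi.
Proof. by case. Qed.

Lemma test_support phi : test phi ->
  exists2 M, 0 < M & forall x, M < `|x| -> phi x = 0.
Proof.
move=> [_ /compact_bounded[M [_ hM]] _]; exists (Num.max M 0 + 1).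
  by rewrite ltr_wpDl// le_max lexx orbT.
move=> x xM; apply/eqP; apply: contraLR xM => px; rewrite -leNgt.
apply: hM; last exact: subset_closure.
by rewrite (@le_lt_trans _ _ (Num.max M 0)) ?le_max ?lexx// ltrDl.
Qed.

Lemma test_add phi psi : test phi -> test psi -> test (phi + psi).
Proof.
move=> tphi tpsi; have [M M0 hM] := test_support tphi; have [N N0 hN] := test_support tpsi.
apply: (@test_intro _ (Num.max M N)); first exact: smooth_add (test_smooth _) (test_smooth _).
by move=> x; rewrite gt_max => /andP[Mx Nx]; rewrite fctE hM// hN// addr0.
Qed.

Lemma test_scale a phi : test phi -> test (a *: phi).
Proof.
move=> tphi; have [M M0 hM] := test_support tphi.
apply: (@test_intro _ M); first exact: smooth_scale (test_smooth tphi).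
by move=> x Mx; rewrite fctE hM// scaler0.
Qed.

Lemma test0 : test (0 : rV -> R).
Proof. by apply: (@test_intro _ 0) => //; exact: smooth_cst. Qed.

Lemma test_derive v phi : test phi -> test ('D_v phi).
Proof.
move=> tphi; have [M M0 hM] := test_support tphi.
apply: (@test_intro _ M); first exact: smooth_derive (test_smooth tphi).
move=> x Mx; rewrite (@near_eq_derive _ _ _ phi (cst 0)) ?derive_cst//.
have : open [set y : rV | M < `|y|].
  apply: (@open_comp _ _ (fun y : rV => `|y|) [set y | M < y]); last exact: open_gt.
  by move=> y _; exact: norm_continuous.
move=> /(_ x Mx); apply: filterS => y; exact: hM.
Qed.

Lemma test_comp_scale_shift (s : R) z phi : s != 0 -> test phi ->
  test (fun x => phi (s *: x + z)).
Proof.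
move=> s0 tphi; have [M M0 hM] := test_support tphi.
apply: (@test_intro _ ((M + `|z|) / `|s|)).
  exact: smooth_comp_scale_shift (test_smooth tphi).
move=> x; rewrite ltr_pdivrMr ?normr_gt0// => h; apply: hM.
rewrite -(ltrD2r `|z|); apply: lt_le_trans h _; rewrite mulrC -normrZ.
by rewrite -[X in `|X| <= _](addrK z); exact: ler_normB.
Qed.

Lemma test_shift z phi : test phi -> test (fun x => phi (x + z)).
Proof.
move=> tphi; rewrite (_ : (fun x => _) = (fun x => phi (1 *: x + z))).
  by apply: test_comp_scale_shift => //; exact: oner_neq0.
by apply/funext => x; rewrite scale1r.
Qed.

Lemma test_reflect z phi : test phi -> test (fun x => phi (z - x)).
Proof.
move=> tphi; rewrite (_ : (fun x => _) = (fun x => phi (-1 *: x + z))).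
  by apply: test_comp_scale_shift => //; rewrite oppr_eq0 oner_neq0.
by apply/funext => x; rewrite scaleN1r addrC.
Qed.

Lemma test_continuous phi : test phi -> continuous phi.
Proof. by move=> /test_smooth/smooth_continuous. Qed.

Lemma test_measurable phi : test phi -> measurable_fun setT phi.
Proof. by move=> /test_continuous/continuous_measurable_rV. Qed.

Lemma test_bounded phi : test phi -> exists2 C, 0 <= C & forall x, `|phi x| <= C.
Proof.
move=> tphi; have [M M0 hM] := test_support tphi.
pose A := [set x : rV | `|x| <= M].
have cA : compact A.
  apply: bounded_closed_compact.
    by exists M; split; [exact: num_real|move=> r Mr x /= xM; exact: le_trans xM (ltW Mr)].
  apply: (@closed_comp _ _ (fun x : rV => `|x|) [set y | y <= M]); last exact: closed_le.
  by move=> x _; exact: norm_continuous.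
have cphi : compact (phi @` A).
  apply: continuous_compact => //; apply: continuous_subspaceT.
  exact: test_continuous.
have [C [_ hC]] := compact_bounded cphi.
exists (Num.max C 0 + 1); first by rewrite addr_ge0// le_max lexx orbT.
move=> x; have [xM|Mx] := leP `|x| M.
  apply: hC; last by exists x.
  by rewrite (@le_lt_trans _ _ (Num.max C 0)) ?le_max ?lexx// ltrDl.
by rewrite hM// normr0 addr_ge0// le_max lexx orbT.
Qed.

Lemma bounded_support_integrable (f : rV -> R) C M : measurable_fun setT f ->
  (forall x, `|f x| <= C) -> (forall x, M < `|x| -> f x = 0) ->
  mu.-integrable setT (EFin \o f).
Proof.
move=> mf fC f0; pose B := obox (const_mx (- (M + 1)) : rV) (const_mx (M + 1)).
have mB : measurable B by exact: measurable_obox.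
apply: (@le_integrable _ _ _ mu setT _ _ (fun x => (C%:E * (\1_B x)%:E)%E)) => //.
- exact/measurable_EFinP.
- move=> x _ /=; rewrite lee_fin; have [Mx|xM] := ltP M `|x|.
    by rewrite f0// normr0.
  rewrite (_ : \1_B x = 1) ?mulr1; first exact: le_trans (fC x) (ler_norm _).
  rewrite indicE mem_set// => i; rewrite !mxE -ltr_norml.
  by rewrite (le_lt_trans (coord_le_norm _ _))// (le_lt_trans xM)// ltrDl.
- apply: integrableZl => //; apply/integrableP; split.
    exact/measurable_EFinP/measurable_indic.
  under eq_integral do rewrite /= ger0_norm//.
  by rewrite integral_indic// setIT lebesgue_rV_obox_lty.
Qed.

Lemma test_integrable phi : test phi -> mu.-integrable setT (EFin \o phi).
Proof.
move=> tphi; have [M M0 hM] := test_support tphi; have [C C0 hC] := test_bounded tphi.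
exact: bounded_support_integrable (test_measurable tphi) hC hM.
Qed.

Lemma test_in_L2 phi : test phi -> in_L2 phi.
Proof.
move=> tphi; have [M M0 hM] := test_support tphi; have [C C0 hC] := test_bounded tphi.
apply: integrable_sqr_in_L2; first exact: test_measurable.
apply: (@bounded_support_integrable _ (C ^+ 2) M).
- by apply: measurable_funX; exact: test_measurable.
- by move=> x; rewrite normrX ler_sqr ?nnegrE.
- by move=> x Mx; rewrite hM// expr0n.
Qed.

Definition box_bump (a b : rV) (m : nat) : rV -> R :=
  fun x => \prod_(i < d) bump (a ord0 i) (b ord0 i) m (x ord0 i).

Lemma box_bump_ge0 a b m x : 0 <= box_bump a b m x.
Proof. by apply: prodr_ge0 => i _; exact: bump_ge0. Qed.

Lemma box_bump_le1 a b m x : box_bump a b m x <= 1.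
Proof. by apply: prodr_ile1 => i _; rewrite bump_ge0 bump_le1. Qed.

Lemma box_bump_eq0 a b m x : ~ obox a b x -> box_bump a b m x = 0.
Proof.
move=> /existsNP[i /negP h]; apply/eqP; rewrite /box_bump prodf_seq_eq0.
by apply/hasP; exists i; rewrite ?mem_index_enum//= bump_eq0.
Qed.

Lemma box_bump_gt0 a b m x : (0 < m)%N -> obox a b x -> 0 < box_bump a b m x.
Proof. by move=> m0 h; apply: prodr_gt0 => i _; exact: bump_gt0. Qed.

Lemma test_box_bump a b m : test (box_bump a b m).
Proof.
apply: (@test_intro _ (`|a| + `|b|)).
  by apply: smooth_prod => i; apply: smooth_comp_coord; exact: smooth_bump.
move=> x abx; apply: box_bump_eq0 => h; move: abx; apply/negP; rewrite -leNgt.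
apply: rV_norm_le => [|i]; first by rewrite addr_ge0.
have /andP[h1 h2] := h i; have := coord_le_norm a i; have := coord_le_norm b i.
rewrite !ler_norml => /andP[_ hb] /andP[ha _]; have := normr_ge0 a; have := normr_ge0 b.
by move=> b0 a0; apply/andP; split; lra.
Qed.

Lemma cvg_box_bump a b x :
  box_bump a b m x @[m --> \oo] --> (\1_(obox a b) x : R).
Proof.
have -> : \1_(obox a b) x =
    \prod_(i < d) (if a ord0 i < x ord0 i < b ord0 i then 1 else 0 : R).
  rewrite indicE; have [/set_mem h|/negP nh] := boolP (x \in obox a b).
    by rewrite big1// => i _; rewrite h.
  have /existsNP[i /negP h] : ~ obox a b x by move=> h; apply: nh; rewrite inE.
  by rewrite (bigD1 i)//= (negPf h) mul0r.
by apply: cvg_prod_seq => i; exact: cvg_bump.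
Qed.

(* Box bumps converge to indicators of open boxes, which form a generating
   pi-system. *)
Lemma test_total g : in_L2 g -> (forall phi, test phi -> ip g phi = 0) -> ip g g = 0.
Proof.
move=> g2 g0; have mg := in_L2_measurable g2.
have ind2 a b : in_L2 (\1_(obox a b) : rV -> R).
  apply/in_L2P; split; first by apply: measurable_indic; exact: measurable_obox.
  under eq_integral do rewrite indicE expr2 -natrM mulnb andbb -indicE.
  by rewrite integral_indic// ?setIT ?lebesgue_rV_obox_lty//; exact: measurable_obox.
have gbox a b : (\int[mu]_x (g x * \1_(obox a b) x)%:E = 0)%E.
  have [] := @dominated_convergence _ _ _ mu setT measurableT
    (fun m x => (g x * box_bump a b m x)%:E) (fun x => (g x * \1_(obox a b) x)%:E)
    (fun x => (`|g x * \1_(obox a b) x|)%:E).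
  - move=> m; apply/measurable_EFinP; apply: measurable_funM => //.
    by apply: test_measurable; exact: test_box_bump.
  - apply/measurable_EFinP; apply: measurable_funM => //.
    by apply: measurable_indic; exact: measurable_obox.
  - by apply: aeW => x _; apply: cvg_to_EFin; apply: cvgMr; exact: cvg_box_bump.
  - have := integrable_abse (in_L2_integrable_mul g2 (ind2 a b)).
    by [].
  - apply: aeW => x m _; rewrite /= lee_fin !normrM ler_wpM2l//.
    rewrite ger0_norm ?box_bump_ge0// indicE.
    have [_|/negP nx] := boolP (x \in _); first by rewrite normr1 box_bump_le1.
    by rewrite normr0 box_bump_eq0// => xab; apply: nx; rewrite inE.
  - move=> _ _ h; have := cvg_unique _ h; apply => //.
    apply: cvg_near_cst; apply: nearW => m.
    rewrite /= -(EFin_ip g2 (test_in_L2 (test_box_bump a b m))) g0//.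
    exact: test_box_bump.
(* Cutting off to a cube makes [gB] integrable; the measurable sets over which its integral vanishes
   then form a Dynkin system containing the boxes. Integrating over the sets where [gB] has constant
   sign gives [gB] = 0 almost everywhere. *)
have gN N : {ae mu, forall x, obox (const_mx (- N%:R)) (const_mx N%:R) x -> g x = 0}.
  set B := obox _ _; have mB : measurable B by exact: measurable_obox.
  pose gB x := (g x * \1_B x)%:E.
  have iB : mu.-integrable setT gB by exact: (in_L2_integrable_mul g2 (ind2 _ _)).
  have mgB : measurable_fun setT gB by exact: (measurable_int mu).
  have zero A : measurable A -> (\int[mu]_(x in A) gB x = 0)%E.
    move=> mA; rewrite measurable_rVE in mA.
    apply: (dynkin_induction (P := fun A => \int[mu]_(x in A) gB x = 0)%E
      measurable_rVE (@obox_setI R d)) mA.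
    - exact: gbox.
    - move=> _ [a [b ->]]; rewrite integral_mkcond -[RHS](gbox
        (\row_i Num.max (a ord0 i) (- N%:R)) (\row_i Num.min (b ord0 i) N%:R)).
      apply: eq_integral => x _; rewrite patchE /gB !indicE.
      have -> : (x \in obox (\row_i Num.max (a ord0 i) (- N%:R))
                    (\row_i Num.min (b ord0 i) N%:R)) = (x \in obox a b) && (x \in B).
        apply/idP/andP => [/set_mem h|[/set_mem h1 /set_mem h2]].
          by split; apply/mem_set => i; have := h i; rewrite !mxE gt_max lt_min =>
            /andP[/andP[? ?] /andP[? ?]]; apply/andP.
        apply/mem_set => i; have := h1 i; have := h2 i; rewrite !mxE gt_max lt_min.
        by move=> /andP[-> ->] /andP[-> ->].
      by case: (x \in obox a b) => //=; rewrite mulr0.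
    - move=> S mS S0.
      have := @integral_setU _ _ _ mu S (~` S) gB mS (measurableC mS) _ _.
      rewrite setUv S0 add0e => <- //; first exact: gbox.
      by rewrite disj_set2E setICr.
    - move=> F mF tF F0; rewrite integral_bigcup//; last first.
        by apply: integrableS iB => //; exact: bigcup_measurable.
      by rewrite eseries0.
  pose A := [set x | (0 <= gB x)%E].
  have mA : measurable A.
    by rewrite -[A]setTI; exact: emeasurable_fun_c_infty.
  have h0 : (\int[mu]_x `|gB x| = 0)%E.
    rewrite -(setUv A) integral_setU//; last 3 first.
    - exact: measurableC.
    - by rewrite setUv; exact: measurableT_comp.
    - by rewrite disj_set2E setICr.
    rewrite (eq_integral gB); last by move=> x; rewrite inE => h; rewrite gee0_abs.
    rewrite zero// add0e; apply/eqP; rewrite -oppe_eq0 -integral_ge0N; last by [].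
    apply/eqP; rewrite -[RHS](zero _ (measurableC mA)); apply: eq_integral => x.
    rewrite inE => /negP; rewrite -ltNge => /ltW h.
    by rewrite (lee0_abs h) oppeK.
  have := (ae_eq_integral_abs mu measurableT mgB).1 h0.
  apply: filterS => x /(_ I) + Bx; rewrite /gB indicE mem_set// mulr1.
  by move=> [].
have g00 : g = 0 %[ae mu].
  have := ae_foralln gN; apply: filterS => x hx _.
  by have [n hn] := rV_bounded_nat x; apply: (hx n) => i; rewrite !mxE.
have := ae_ip g2 in_L20 g2 g00; move=> ->.
by rewrite -(scale0r g) (sip_scalel L2_semi_inner)// mul0r.
Qed.

Definition trans z (f : rV -> R) : rV -> R := fun x => f (x + z).

Lemma in_L2_trans z f : in_L2 f -> in_L2 (trans z f).
Proof.
move=> f2; apply: integrable_sqr_in_L2.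
  apply: (measurableT_comp (in_L2_measurable f2)); exact: measurable_shift.
exact: (integrable_shift z (in_L2_integrable_sqr f2)).
Qed.

Lemma ip_trans z f g : in_L2 f -> in_L2 g -> ip (trans z f) (trans z g) = ip f g.
Proof.
move=> f2 g2; rewrite !ipE; apply: (Rintegral_shift z (f := fun x => f x * g x)).
by apply: measurable_funM; exact: in_L2_measurable.
Qed.

Lemma trans_trans y z f : trans y (trans z f) = trans (y + z) f.
Proof. by apply/funext => x; rewrite /trans addrA. Qed.

Lemma trans0 f : trans 0 f = f.
Proof. by apply/funext => x; rewrite /trans addr0. Qed.

Lemma transB z f g : trans z (f - g) = trans z f - trans z g.
Proof. by []. Qed.

Lemma ip_transl z f g : in_L2 f -> in_L2 g -> ip (trans z f) g = ip f (trans (- z) g).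
Proof.
move=> f2 g2; rewrite -[in LHS](trans0 g) -(subrr z) -trans_trans ip_trans//.
exact: in_L2_trans.
Qed.

Lemma test_dense g e : in_L2 g -> 0 < e ->
  exists2 phi, test phi & snorm ip (phi - g) <= e.
Proof.
exact: (sip_dense L2_semi_inner test_in_L2 test0 test_add test_scale L2_complete
  test_total).
Qed.

Lemma L2_dual_bound (g : rV -> R) c : in_L2 g -> 0 <= c ->
  (forall phi, test phi -> ip g phi <= c * snorm ip phi) -> snorm ip g <= c.
Proof.
exact: (sip_dual_bound L2_semi_inner test_in_L2 test0 test_add test_scale L2_complete
  test_total).
Qed.

End test_function_theory.

(** * Mean value estimates and difference quotients of translates *)

Lemma is_derive_littleo {R : realType} (k : R -> R) (s l : R) :
  (forall e, 0 < e -> exists2 r, 0 < r & forall t, `|t| < r ->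
     `|k (s + t) - k s - t * l| <= e * `|t|) -> is_derive s 1 k l.
Proof.
move=> hk.
have key : h^-1 *: (k (h *: 1 + s) - k s) @[h --> 0^'] --> l.
  apply/cvgrPdist_le => e e0; have [r r0 hr] := hk e e0; near=> t.
  have t0 : t != 0 by near: t; exact: nbhs_dnbhs_neq.
  have tr : `|t| < r by near: t; apply: dnbhs0_lt.
  have := hr t tr; rewrite -ler_pdivrMr ?normr_gt0// -normfV -normrM.
  rewrite distrC (_ : (_ - _) / t = t^-1 *: (k (t *: 1 + s) - k s) - l)//.
  by rewrite /GRing.scale /= mulr1 (addrC t s); field.
apply: DeriveDef; first by apply/cvg_ex; exists l.
exact/cvg_lim.
Unshelve. all: by end_near. Qed.

Lemma is_derive_quadratic {R : realType} (k : R -> R) (s l C : R) :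
  (forall t, `|t| <= 1 -> `|k (s + t) - k s - t * l| <= C * t ^+ 2) ->
  is_derive s 1 k l.
Proof.
move=> h; apply: is_derive_littleo => e e0.
have C1 : 0 < `|C| + 1 by rewrite ltr_wpDl.
exists (Num.min 1 (e / (`|C| + 1))); first by rewrite lt_min ltr01 divr_gt0.
move=> t; rewrite lt_min => /andP[t1 te]; apply: le_trans (h t (ltW t1)) _.
rewrite -(real_normK (num_real t)) expr2 mulrA ler_wpM2r//.
apply: le_trans (ler_wpM2r (normr_ge0 t) (ler_norm C)) _.
have : `|t| * (`|C| + 1) <= e by rewrite -ler_pdivlMr// ltW.
by have := normr_ge0 t; have := normr_ge0 C; move: (`|t|) (`|C|) => a b *; lra.
Qed.

Lemma mvt_real {R : realType} (h dh : R -> R) (a b : R) :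
  (forall t, Num.min a b <= t <= Num.max a b -> is_derive t 1 h (dh t)) ->
  exists2 c, Num.min a b <= c <= Num.max a b & h b - h a = dh c * (b - a).
Proof.
wlog ab : a b / a <= b => [H|] hd.
  have [ab|] := boolP (a <= b); first exact: H.
  rewrite -ltNge => /ltW ba; have [t|c cab hc] := H b a ba; first by rewrite minC maxC; exact: hd.
  by exists c; [rewrite minC maxC|rewrite -opprB hc -mulrN opprB].
rewrite min_l// max_r// in hd *.
have [||c] := @MVT_segment _ h dh a b ab.
- by move=> t; rewrite in_itv/= => /andP[/ltW ? /ltW ?]; apply: hd; apply/andP.
- apply: derivable_within_continuous => t; rewrite in_itv/= => /hd.
  by case.
by rewrite in_itv/= => cab ->; exists c.
Qed.

Lemma min0_max0_norm {R : realDomainType} (c t : R) :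
  Num.min 0 t <= c <= Num.max 0 t -> `|c| <= `|t|.
Proof.
have [t0|t0] := leP 0 t => /andP[h1 h2].
  by rewrite !ger0_norm.
by rewrite !ler0_norm ?lerN2// ltW.
Qed.

Lemma is_derive_along {R : realType} (V : normedModType R) (phi : V -> R) (x v : V) (s : R) :
  smooth phi -> is_derive s 1 (fun s => phi (x + s *: v)) ('D_v phi (x + s *: v)).
Proof.
move=> sphi; have := @smooth_derivable _ _ _ (x + s *: v) v sphi.
rewrite /derivable /derive => d.
have E : (fun h : R => h^-1 *: (phi (x + (h *: 1 + s) *: v) - phi (x + s *: v))) =
         (fun h : R => h^-1 *: (phi (h *: v + (x + s *: v)) - phi (x + s *: v))).
  apply/funext => h; congr (_ *: (phi _ - _)).
  have -> : h *: (1 : R) = h by rewrite /GRing.scale/= mulr1.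
  by rewrite scalerDl addrCA.
apply: DeriveDef; first by rewrite /derivable /= E.
by rewrite /derive /= E.
Qed.

Section translation_quotients.
Context {R : realType} {d : nat}.
Local Notation rV := 'rV[R]_d.
Local Notation mu := (@lebesgue_rV R d).
Local Notation test := (@test_function R 'rV[R]_d setT).
Implicit Types (phi : rV -> R) (v : rV).

Lemma bounded_support_in_L2 (f : rV -> R) C M : measurable_fun setT f ->
  (forall x, `|f x| <= C) -> (forall x, M < `|x| -> f x = 0) -> in_L2 f.
Proof.
move=> mf fC fM; apply: integrable_sqr_in_L2 => //.
apply: (@bounded_support_integrable _ _ _ (C ^+ 2) M).
- exact: measurable_funX.
- by move=> x; rewrite normrX lerXn2r ?nnegrE// (le_trans _ (fC x)).
- by move=> x Mx; rewrite fM// expr0n.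
Qed.

(** The margin 1 makes this open cube contain the closed ball of radius M for the maximum norm. *)
Definition box_indic (M : R) : rV -> R :=
  \1_(obox (const_mx (- (M + 1)) : rV) (const_mx (M + 1))).

Lemma in_L2_box_indic M : in_L2 (box_indic M).
Proof.
apply/in_L2P; split; first by apply: measurable_indic; exact: measurable_obox.
under eq_integral do rewrite /box_indic indicE expr2 -natrM mulnb andbb -indicE.
by rewrite integral_indic// ?setIT ?lebesgue_rV_obox_lty//; exact: measurable_obox.
Qed.

Lemma box_indic1 M x : `|x| <= M -> box_indic M x = 1.
Proof.
move=> xM; rewrite /box_indic indicE mem_set// => i; rewrite !mxE -ltr_norml.
by rewrite (le_lt_trans (coord_le_norm _ _))// (le_lt_trans xM)// ltrDl.
Qed.

Lemma box_indic_ge0 M x : 0 <= box_indic M x.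
Proof. by rewrite /box_indic indicE. Qed.

Lemma le_snorm (f g : rV -> R) : in_L2 f -> in_L2 g ->
  (forall x, `|f x| <= `|g x|) -> snorm ip f <= snorm ip g.
Proof.
move=> f2 g2 fg; rewrite ler_sqrt ?ip_ge0// !ipE; apply: le_Rintegral => //.
- exact: in_L2_integrable_mul.
- exact: in_L2_integrable_mul.
move=> x _; rewrite -!expr2 -(real_normK (num_real (f x))) -(real_normK (num_real (g x))).
by rewrite ler_sqr ?nnegrE.
Qed.

Lemma bounded_support_snorm (f : rV -> R) C M : measurable_fun setT f -> 0 <= C ->
  (forall x, `|f x| <= C) -> (forall x, M < `|x| -> f x = 0) ->
  snorm ip f <= C * snorm ip (box_indic M).
Proof.
move=> mf C0 fC fM; have f2 := bounded_support_in_L2 mf fC fM.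
have b2 := in_L2_box_indic M.
rewrite -[C in leRHS]ger0_norm// -(snormZ L2_semi_inner)//.
apply: le_snorm => //; first exact: in_L2Z.
move=> x; rewrite fctE normrZ (ger0_norm (box_indic_ge0 _ _)) (ger0_norm C0).
have [Mx|xM] := ltP M `|x|; first by rewrite fM// normr0 mulr_ge0// box_indic_ge0.
by rewrite box_indic1// mulr1.
Qed.

(** Two applications of the mean value theorem. C bounds the second derivative along v, and M
    encloses the supports of all translates with |t| <= 1; so the quadratic remainder is uniform and
    lives on a fixed cube, and it can be integrated. *)
Lemma test_quotient phi v : test phi -> exists C M, [/\ 0 <= C, 0 <= M &
  forall t, `|t| <= 1 -> (forall x, `|phi (x + t *: v) - phi x - t * 'D_v phi x| <= C * t ^+ 2) /\
    (forall x, M < `|x| -> phi (x + t *: v) - phi x - t * 'D_v phi x = 0)].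
Proof.
move=> tphi; have tD := test_derive v tphi; have tDD := test_derive v tD.
have [C C0 hC] := test_bounded tDD.
have [M M0 hM] := test_support tphi; have [N N0 hN] := test_support tD.
exists C, (Num.max M N + `|v|); split=> //.
  by rewrite addr_ge0// le_max (ltW M0).
move=> t t1; split=> x.
  have [|c cb] := @mvt_real _ (fun s => phi (x + s *: v)) (fun s => 'D_v phi (x + s *: v)) 0 t.
    by move=> s _; apply: is_derive_along; exact: test_smooth.
  rewrite scale0r addr0 subr0 => ->.
  have [|c' cb'] := @mvt_real _ (fun s => 'D_v phi (x + s *: v))
       (fun s => 'D_v ('D_v phi) (x + s *: v)) 0 c.
    by move=> s _; apply: is_derive_along; exact: test_smooth.
  rewrite scale0r addr0 subr0 => h.
  rewrite (_ : _ - t * _ = t * ('D_v phi (x + c *: v) - 'D_v phi x)); last by ring.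
  have ct := min0_max0_norm cb; rewrite h !normrM -(real_normK (num_real t)) expr2.
  by rewrite mulrCA; apply: ler_pM; rewrite ?mulr_ge0// ler_wpM2l.
move=> h; have h1 : M < `|x|.
  by apply: le_lt_trans h; rewrite (@le_trans _ _ (Num.max M N)) ?le_max ?lexx ?lerDl.
have h2 : N < `|x|.
  by apply: le_lt_trans h; rewrite (@le_trans _ _ (Num.max M N)) ?le_max ?lexx ?orbT ?lerDl.
rewrite (hM x)// hN// mulr0 !subr0 hM//.
have : `|x| <= `|x + t *: v| + `|v|.
  rewrite -[X in `|X| <= _](addrK (t *: v)) (le_trans (ler_normB _ _))// lerD2l.
  by rewrite normrZ ler_piMl.
have : M <= Num.max M N by rewrite le_max lexx.
lra.
Qed.

Lemma derive_coord (phi : rV -> R) v x : differentiable phi x ->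
  'D_v phi x = \sum_(i < d) v ord0 i * 'D_(basis_rV i) phi x.
Proof.
move=> dphi; rewrite deriveE// {1}(row_sum_delta v) linear_sum.
by apply: eq_bigr => i _; rewrite linearZ deriveE.
Qed.

Lemma ip_sum_r (f : rV -> R) n (F : 'I_n -> rV -> R) : in_L2 f -> (forall i, in_L2 (F i)) ->
  in_L2 (\sum_(i < n) F i) /\ ip f (\sum_(i < n) F i) = \sum_(i < n) ip f (F i).
Proof.
move=> f2; elim: n F => [|n IH] F F2.
  rewrite !big_ord0; split; first exact: in_L20.
  by rewrite ipC -(scale0r f) (sip_scalel L2_semi_inner)// mul0r.
have [h1 h2] := IH (fun i => F (widen_ord (leqnSn n) i)) (fun i => F2 _).
rewrite !big_ord_recr /=; split; first exact: in_L2D.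
by rewrite (sip_addr L2_semi_inner)// h2.
Qed.

Lemma is_derive_ip_trans (f phi : rV -> R) v (s : R) : in_L2 f -> test phi ->
  is_derive s 1 (fun s => ip f (trans (s *: v) phi)) (ip f (trans (s *: v) ('D_v phi))).
Proof.
move=> f2 tphi; have tD := test_derive v tphi.
have [C [M [C0 M0 hq]]] := test_quotient v tphi.
apply: (@is_derive_quadratic _ _ _ _ (snorm ip f * (C * snorm ip (box_indic M)))) => t t1.
have [hC hM] := hq t t1.
pose r x := phi (x + t *: v) - phi x - t * 'D_v phi x.
have mr : measurable_fun setT r.
  apply: measurable_funB; first apply: measurable_funB.
  - by apply: test_measurable; exact: test_shift.
  - exact: test_measurable.
  - by apply: measurable_funM => //; exact: test_measurable.
have Ct : 0 <= C * t ^+ 2 by rewrite mulr_ge0// sqr_ge0.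
have r2 := bounded_support_in_L2 mr hC hM.
have rn := bounded_support_snorm mr Ct hC hM.
have p2 : in_L2 (trans (s *: v) phi) by apply/in_L2_trans/test_in_L2.
have D2 : in_L2 (trans (s *: v) ('D_v phi)) by apply/in_L2_trans/test_in_L2.
have -> : trans ((s + t) *: v) phi =
    trans (s *: v) phi + (t *: trans (s *: v) ('D_v phi) + trans (s *: v) r).
  apply/funext => x; rewrite /trans /r scalerDl addrA !fctE.
  by have sE (a b : R) : a *: b = a * b by []; rewrite sE; ring.
have r2' : in_L2 (trans (s *: v) r) by exact: in_L2_trans.
have tD2 := in_L2Z t D2; have tDr2 := in_L2D tD2 r2'.
rewrite (sip_addr L2_semi_inner p2 tDr2 f2) (sip_addr L2_semi_inner tD2 r2' f2).
rewrite (sip_scaler L2_semi_inner)//.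
rewrite (_ : _ - _ = ip f (trans (s *: v) r)); last by ring.
apply: le_trans (sip_CS L2_semi_inner f2 r2') _; rewrite -mulrA.
apply: ler_wpM2l; first exact: snorm_ge0.
rewrite /snorm ip_trans// -/(snorm ip r); apply: le_trans rn _.
by rewrite mulrAC.
Qed.

End translation_quotients.

(** * The space H1: weak derivatives, completeness, translations *)

HB.lock Definition wder {R : realType} {d : nat} (i : 'I_d) (f : 'rV[R]_d -> R) :=
  weak_derivative i f.

Section H1_space.
Context {R : realType} {d : nat}.
Local Notation rV := 'rV[R]_d.
Local Notation mu := (@lebesgue_rV R d).
Local Notation test := (@test_function R 'rV[R]_d setT).
Implicit Types (f g h w phi : rV -> R) (i : 'I_d).

Lemma in_H1_L2 f : in_H1 f -> in_L2 f. Proof. by case. Qed.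
Hint Resolve in_H1_L2 : core.

Lemma weak_derivativeP i f : in_H1 f ->
  in_L2 (wder i f) /\ is_weak_derivative i f (wder i f).
Proof.
rewrite wder.unlock => -[_ /(_ i)[g g2 fg]].
by apply: (@xgetPex _ (cst 0) [set g | in_L2 g /\ is_weak_derivative i f g]); exists g.
Qed.

Lemma in_L2_wd i f : in_H1 f -> in_L2 (wder i f).
Proof. by move=> /(weak_derivativeP i)[]. Qed.
Hint Resolve in_L2_wd : core.

Lemma ip_wd i f phi : in_H1 f -> test phi ->
  ip (wder i f) phi = - ip f ('D_(basis_rV i) phi).
Proof.
by move=> /(weak_derivativeP i)[_ h] tphi; rewrite !ipE (h _ tphi) opprK.
Qed.

Lemma is_weak_derivativeP i f g :
  (forall phi, test phi -> ip g phi = - ip f ('D_(basis_rV i) phi)) <->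
  is_weak_derivative i f g.
Proof.
split=> h phi tphi; first by have := h _ tphi; rewrite !ipE => ->; rewrite opprK.
by rewrite !ipE (h _ tphi) opprK.
Qed.

Lemma L2_test_unique f g : in_L2 f -> in_L2 g ->
  (forall phi, test phi -> ip f phi = ip g phi) -> forall h, in_L2 h -> ip f h = ip g h.
Proof.
move=> f2 g2 fg h h2; apply/eqP; rewrite -subr_eq0 -(sip_subl L2_semi_inner)//.
have fg2 := in_L2B f2 g2.
have : ip (f - g) (f - g) = 0.
  apply: test_total => // phi tphi; rewrite (sip_subl L2_semi_inner)// ?fg ?subrr//.
  exact: test_in_L2.
move=> h0; have := sip_CS_sqr L2_semi_inner fg2 h2.
by rewrite h0 mul0r => h1; rewrite -sqrf_eq0 eq_le h1 sqr_ge0.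
Qed.

Lemma wd_unique i f g h : in_L2 g -> is_weak_derivative i f g -> in_H1 f -> in_L2 h ->
  ip (wder i f) h = ip g h.
Proof.
move=> g2 /is_weak_derivativeP fg f1; apply: L2_test_unique => // [|phi tphi].
  exact: in_L2_wd.
by rewrite fg// ip_wd.
Qed.

(** A chosen representative of a weak derivative is determined only up to a null set, so identities
    for [wder] are stated, here and below, through pairings with L2 functions. *)
Lemma in_H1_intro f (g : 'I_d -> rV -> R) : in_L2 f ->
  (forall i, in_L2 (g i)) ->
  (forall i phi, test phi -> ip (g i) phi = - ip f ('D_(basis_rV i) phi)) ->
  in_H1 f /\ forall i h, in_L2 h -> ip (wder i f) h = ip (g i) h.
Proof.
move=> f2 g2 fg; have f1 : in_H1 f.
  by split=> // i; exists (g i) => //; apply/is_weak_derivativeP; exact: fg.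
split=> // i h h2; apply: wd_unique => //; apply/is_weak_derivativeP; exact: fg.
Qed.

Lemma H1_addP f g : in_H1 f -> in_H1 g -> in_H1 (f + g) /\
  forall i h, in_L2 h -> ip (wder i (f + g)) h =
     ip (wder i f) h + ip (wder i g) h.
Proof.
move=> f1 g1; have [||i phi tphi|h1 h2] := @in_H1_intro (f + g)
  (fun i => wder i f + wder i g); last first.
- by split=> // i h hL; rewrite h2// (sip_addl L2_semi_inner)//; exact: in_L2_wd.
- have t2 := test_in_L2 tphi; have tD := test_in_L2 (test_derive (basis_rV i) tphi).
  rewrite (sip_addl L2_semi_inner)//; try exact: in_L2_wd.
  by rewrite !ip_wd// (sip_addl L2_semi_inner)// ?opprD//; exact: in_H1_L2.
- by move=> i; apply: in_L2D; exact: in_L2_wd.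
- by apply: in_L2D; exact: in_H1_L2.
Qed.

Lemma H1_scaleP a f : in_H1 f -> in_H1 (a *: f) /\
  forall i h, in_L2 h -> ip (wder i (a *: f)) h = a * ip (wder i f) h.
Proof.
move=> f1; have [||i phi tphi|h1 h2] := @in_H1_intro (a *: f)
  (fun i => a *: wder i f); last first.
- by split=> // i h hL; rewrite h2// (sip_scalel L2_semi_inner)//; exact: in_L2_wd.
- have t2 := test_in_L2 tphi; have tD := test_in_L2 (test_derive (basis_rV i) tphi).
  rewrite (sip_scalel L2_semi_inner)//; last exact: in_L2_wd.
  by rewrite !ip_wd// (sip_scalel L2_semi_inner)// ?mulrN//; exact: in_H1_L2.
- by move=> i; apply: in_L2Z; exact: in_L2_wd.
- by apply: in_L2Z; exact: in_H1_L2.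
Qed.

Lemma derive_trans z v phi x : 'D_v (trans z phi) x = trans z ('D_v phi) x.
Proof.
have := @derive_comp_scale_shift _ _ 1 z phi v x; rewrite !scale1r /trans => <-.
by congr ('D_v _ x); apply/funext => y; rewrite scale1r.
Qed.

Lemma H1_transP z f : in_H1 f -> in_H1 (trans z f) /\
  forall i h, in_L2 h -> ip (wder i (trans z f)) h =
    ip (trans z (wder i f)) h.
Proof.
move=> f1; apply: in_H1_intro.
- exact/in_L2_trans/in_H1_L2.
- by move=> i; apply: in_L2_trans; exact: in_L2_wd.
move=> i phi tphi; have tD := test_derive (basis_rV i) tphi.
rewrite !ip_transl//;
  try first [exact: in_L2_wd|exact: test_in_L2|exact: in_H1_L2].
have tt : test (trans (- z) phi) by exact: (test_shift (- z) tphi).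
rewrite (ip_wd i f1 tt).
by congr (- ip f _); apply/funext => x; rewrite derive_trans.
Qed.

Definition ip1 f g : R :=
  ip f g + \sum_(i < d) ip (wder i f) (wder i g).

Lemma in_H10 : in_H1 (0 : rV -> R).
Proof.
have [||i phi tphi|] := @in_H1_intro 0 (fun=> 0) => //; try by move=> *; exact: in_L20.
have t2 := test_in_L2 tphi; have tD := test_in_L2 (test_derive (basis_rV i) tphi).
by rewrite -(scale0r phi) !(sip_scalel L2_semi_inner)// !mul0r oppr0.
Qed.

Lemma H1_semi_inner : semi_inner (@in_H1 R d) (ip1).
Proof.
split.
- exact: in_H10.
- by move=> f g f1 g1; have [] := H1_addP f1 g1.
- by move=> a f f1; have [] := H1_scaleP a f1.
- move=> f g; rewrite /ip1 (ipC f g).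
  rewrite (eq_bigr (fun i => ip (wder i g) (wder i f)))// => i _.
  exact: ipC.
- move=> f g h f1 g1 h1; rewrite /ip1 (sip_addl L2_semi_inner)//; try exact: in_H1_L2.
  rewrite addrACA; congr (_ + _); rewrite -big_split/=; apply: eq_bigr => i _.
  by have [_ ->] := H1_addP f1 g1 => //; exact: in_L2_wd.
- move=> a f g f1 g1; rewrite /ip1 (sip_scalel L2_semi_inner)//; try exact: in_H1_L2.
  rewrite mulrDr; congr (_ + _); rewrite big_distrr/=; apply: eq_bigr => i _.
  by have [_ ->] := H1_scaleP a f1 => //; exact: in_L2_wd.
- move=> f f1; rewrite addr_ge0 ?ip_ge0//; apply: sumr_ge0 => i _; exact: ip_ge0.
Qed.

Lemma in_H1B f g : in_H1 f -> in_H1 g -> in_H1 (f - g).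
Proof. exact: (sip_domB H1_semi_inner). Qed.

Lemma ip_wdB i f g h : in_H1 f -> in_H1 g -> in_L2 h ->
  ip (wder i (f - g)) h = ip (wder i f) h - ip (wder i g) h.
Proof.
move=> f1 g1 h2; rewrite -scaleN1r; have [g1' hg] := H1_scaleP (-1) g1.
by have [_ ->] := H1_addP f1 g1'; rewrite // hg// mulN1r.
Qed.

Lemma snorm_wd_diff i f g : in_H1 f -> in_H1 g ->
  snorm ip (wder i (f - g)) = snorm ip (wder i f - wder i g).
Proof.
move=> f1 g1; have fg1 := in_H1B f1 g1; have fi := in_L2_wd i f1; have gi := in_L2_wd i g1.
have h2 := in_L2_wd i fg1; have fgi := in_L2B fi gi.
by rewrite /snorm ip_wdB// -(sip_subl L2_semi_inner)// ipC ip_wdB// -(sip_subl L2_semi_inner).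
Qed.

Lemma ip_le_ip1 f : in_H1 f -> ip f f <= ip1 f f.
Proof. by move=> f1; rewrite /ip1 lerDl sumr_ge0// => i _; exact: ip_ge0. Qed.

Lemma ip_wd_le_ip1 i f : in_H1 f ->
  ip (wder i f) (wder i f) <= ip1 f f.
Proof.
move=> f1; rewrite /ip1 (bigD1 i)//= addrCA lerDl addr_ge0 ?ip_ge0// sumr_ge0// => j _.
exact: ip_ge0.
Qed.

Lemma snorm_le_H1 f : in_H1 f -> snorm ip f <= snorm ip1 f.
Proof. by move=> f1; rewrite ler_sqrt ?ip_le_ip1// (sip_ge0 H1_semi_inner). Qed.

Lemma snorm_wd_le_H1 i f : in_H1 f -> snorm ip (wder i f) <= snorm ip1 f.
Proof. by move=> f1; rewrite ler_sqrt ?ip_wd_le_ip1// (sip_ge0 H1_semi_inner). Qed.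

Lemma H1_norm_snorm f : in_H1 f -> H1_norm f = (snorm ip1 f)%:E.
Proof.
move=> f1; have sq g : in_L2 g -> (L2_norm g `^ 2 = (ip g g)%:E)%E.
  move=> g2; rewrite L2_norm_snorm// poweR_EFin powR_mulrn ?snorm_ge0//.
  by rewrite (snorm_sqr L2_semi_inner).
rewrite /H1_norm sq; last exact: in_H1_L2.
rewrite (eq_bigr (fun i => (ip (wder i f) (wder i f))%:E)).
  rewrite sumEFin -EFinD poweR_EFin powR12_sqrt//.
  exact: (sip_ge0 H1_semi_inner).
by move=> i _; have := in_L2_wd i f1; rewrite wder.unlock => /sq.
Qed.

Lemma energy_norm_snorm f g : in_H1 f -> in_L2 g ->
  energy_norm f g = (Num.sqrt (ip1 f f + ip g g))%:E.
Proof.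
move=> f1 g2; rewrite /energy_norm H1_norm_snorm// L2_norm_snorm//.
rewrite !poweR_EFin !powR_mulrn ?snorm_ge0//.
rewrite (snorm_sqr L2_semi_inner)// (snorm_sqr H1_semi_inner)//.
by rewrite powR12_sqrt// addr_ge0 ?ip_ge0// (sip_ge0 H1_semi_inner).
Qed.

(** The functions and each of their weak derivatives are Cauchy in L2; the limits are related by
    weak differentiation since both pairings with a fixed test function pass to the limit. *)
Lemma H1_complete : sip_complete (@in_H1 R d) ip1.
Proof.
move=> u u1 cu.
have [|u' u'2 hu'] := @L2_complete R d u (fun n => in_H1_L2 (u1 n)).
  move=> e e0; have [N hN] := cu e e0; exists N => m n Nm Nn.
  by apply: le_trans (hN _ _ Nm Nn); apply: ip_le_ip1; exact: in_H1B.
have wdsq i m n : ip (wder i (u m) - wder i (u n))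
    (wder i (u m) - wder i (u n)) =
    ip (wder i (u m - u n)) (wder i (u m - u n)).
  by apply/eqP; rewrite -eqr_sqrt ?ip_ge0// -/(snorm ip _) -/(snorm ip _) snorm_wd_diff.
have /fin_all_exists2[g g2 hg] : forall i, exists2 l, in_L2 l & forall e, 0 < e ->
    exists N, forall n, (N <= n)%N -> ip (wder i (u n) - l) (wder i (u n) - l) <= e.
  move=> i; apply: L2_complete => [n|e e0]; first exact: in_L2_wd.
  have [N hN] := cu e e0; exists N => m n Nm Nn.
  rewrite wdsq; apply: le_trans (hN _ _ Nm Nn); apply: ip_wd_le_ip1; exact: in_H1B.
have lim0 (x y : R) : (forall e, 0 < e -> `|x - y| <= e) -> x = y.
  move=> h; apply/eqP; rewrite -subr_eq0 -normr_le0; apply/ler_addgt0Pr => e e0.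
  by rewrite add0r h.
have weakl (v : nat -> rV -> R) l phi : (forall n, in_L2 (v n)) -> in_L2 l -> in_L2 phi ->
   (forall e, 0 < e -> exists N, forall n, (N <= n)%N -> ip (v n - l) (v n - l) <= e) ->
   forall e, 0 < e -> exists N, forall n, (N <= n)%N -> `|ip (v n) phi - ip l phi| <= e.
  move=> v2 l2 p2 hv e e0; have n0 := snorm_ge0 ip phi.
  pose r := e / (snorm ip phi + 1); have r0 : 0 < r by rewrite divr_gt0//; lra.
  have [N hN] := hv _ (exprn_gt0 2 r0); exists N => n Nn.
  rewrite -(sip_subl L2_semi_inner)//; have vl2 := in_L2B (v2 n) l2.
  apply: le_trans (sip_CS L2_semi_inner vl2 p2) _.
  have : snorm ip (v n - l) <= r.
    rewrite -ler_sqr ?nnegrE ?snorm_ge0 ?(ltW r0)// (snorm_sqr L2_semi_inner)//.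
    exact: hN.
  move=> /(ler_wpM2r n0) /le_trans; apply; rewrite /r mulrAC ler_pdivrMr; last by lra.
  by rewrite ler_pM2l//; lra.
have [i phi tphi|uH uw] := @in_H1_intro u' g u'2 g2.
  have p2 := test_in_L2 tphi; have D2 := test_in_L2 (test_derive (basis_rV i) tphi).
  apply: lim0 => e e0; have e2 : 0 < e / 2 by lra.
  have [N1 h1] := weakl _ _ _ (fun n => in_L2_wd i (u1 n)) (g2 i) p2 (hg i) _ e2.
  have [N2 h2] := weakl _ _ _ (fun n => in_H1_L2 (u1 n)) u'2 D2 hu' _ e2.
  have := h1 _ (leq_maxl N1 N2); have := h2 _ (leq_maxr N1 N2).
  rewrite ip_wd// !ler_norml => /andP[? ?] /andP[? ?]; apply/andP; split; lra.
exists u' => // e e0.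
have wdlim i n : ip (wder i (u n - u')) (wder i (u n - u')) =
   ip (wder i (u n) - g i) (wder i (u n) - g i).
  have un1 := u1 n; have ui := in_L2_wd i un1; have d1 := in_H1B un1 uH.
  have di := in_L2_wd i d1; have ugi := in_L2B ui (g2 i).
  have key h : in_L2 h -> ip (wder i (u n - u')) h = ip (wder i (u n) - g i) h.
    by move=> h2; rewrite ip_wdB// uw// (sip_subl L2_semi_inner).
  by rewrite key// ipC key.
(* One share for the function and one for each of its d derivatives. *)
pose r := e / d.+1%:R; have r0 : 0 < r by rewrite divr_gt0.
have [N0 hN0] := hu' r r0.
have /fin_all_exists[N hN] : forall i, exists N, forall n, (N <= n)%N ->
    ip (wder i (u n) - g i) (wder i (u n) - g i) <= r.
  by move=> i; exact: hg.
exists (maxn N0 (\max_i N i)) => n; rewrite geq_max => /andP[n0 ni].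
rewrite /ip1 (@le_trans _ _ (r + \sum_(i < d) r))//.
  apply: lerD; first exact: hN0.
  apply: ler_sum => i _; rewrite wdlim; apply: hN; apply: leq_trans ni.
  exact: (leq_bigmax i).
by rewrite sumr_const card_ord -mulrS -mulr_natr /r divfK// pnatr_eq0.
Qed.

(* Dual form of |f(. + z) - f| <= |z| |grad f|: move the difference onto tests. *)
Lemma translation_estimate z f : in_H1 f ->
  snorm ip (trans z f - f) <= `|z| * \sum_(i < d) snorm ip (wder i f).
Proof.
move=> f1; have f2 := in_H1_L2 f1; have t2 := in_L2_trans z f2.
have tf2 := in_L2B t2 f2.
apply: L2_dual_bound => // [|phi tphi].
  by rewrite mulr_ge0// sumr_ge0// => i _; exact: snorm_ge0.
have p2 := test_in_L2 tphi.
rewrite (sip_subl L2_semi_inner)// ip_transl//.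
have [|c _] := @mvt_real _ (fun s => ip f (trans (s *: - z) phi))
  (fun s => ip f (trans (s *: - z) ('D_(- z) phi))) 0 1.
  by move=> s _; exact: is_derive_ip_trans.
rewrite scale1r scale0r trans0 subr0 mulr1 => ->.
have tc : test (trans (c *: - z) phi) by exact: (test_shift _ tphi).
have tci i : in_L2 (- z ord0 i *: 'D_(basis_rV i) (trans (c *: - z) phi)).
  by apply/in_L2Z/test_in_L2/test_derive.
have -> : trans (c *: - z) ('D_(- z) phi) =
    \sum_(i < d) (- z ord0 i *: 'D_(basis_rV i) (trans (c *: - z) phi)).
  apply/funext => x; rewrite -derive_trans derive_coord; last first.
    exact: smooth_differentiable (test_smooth tc).
  by rewrite fct_sumE; apply: eq_bigr => i _; rewrite !mxE.
have [_ ->] := ip_sum_r f2 tci.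
rewrite -mulrA mulr_suml mulr_sumr; apply: ler_sum => i _.
have tD := test_in_L2 (test_derive (basis_rV i) tc).
rewrite (sip_scaler L2_semi_inner)// mulNr -mulrN -ip_wd//.
have w2 := in_L2_wd i f1; have tc2 := test_in_L2 tc.
apply: le_trans (ler_norm _) _; rewrite normrM ler_pM ?coord_le_norm//.
rewrite -[snorm ip phi](_ : snorm ip (trans (c *: - z) phi) = _); last first.
  by rewrite /snorm ip_trans.
exact: (sip_CS L2_semi_inner).
Qed.

(** Integration by parts from translation invariance: for chi = phi psi, the integral of chi(. + t
    e_i) - chi is 0 and differs from t times the integral of D_i chi by O(t^2); letting t tend to 0,
    the latter integral vanishes. *)
Lemma test_in_H1 phi : test phi -> in_H1 phi /\
  forall i h, in_L2 h -> ip (wder i phi) h = ip ('D_(basis_rV i) phi) h.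
Proof.
move=> tphi; apply: in_H1_intro; first exact: test_in_L2.
  by move=> i; exact/test_in_L2/test_derive.
move=> i psi tpsi.
pose chi x := phi x * psi x.
have tchi : test chi.
  have [M M0 hM] := test_support tphi; apply: (@test_intro _ _ _ M).
    by apply: smooth_mul; exact: test_smooth.
  by move=> x /hM; rewrite /chi => ->; rewrite mul0r.
have tD := test_derive (basis_rV i) tphi; have tE := test_derive (basis_rV i) tpsi.
have tdchi := test_derive (basis_rV i) tchi.
suff h : \int[mu]_x ('D_(basis_rV i) chi x) = 0.
  apply/eqP; rewrite -subr_eq0 opprK !ipE -RintegralD//; try by
    apply: in_L2_integrable_mul; exact: test_in_L2.
  apply/eqP; rewrite -[RHS]h; apply: eq_Rintegral => x _.
  rewrite deriveM; [|exact: smooth_derivable (test_smooth _)..].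
  by rewrite /GRing.scale /= addrC (mulrC (psi x)).
have [C [M [C0 M0 hq]]] := test_quotient (basis_rV i) tchi.
set I0 := (X in X = 0).
pose K := fine (\int[mu]_x (box_indic M x)%:E)%E.
have bint : mu.-integrable setT (EFin \o box_indic M).
  apply: (@bounded_support_integrable _ _ _ 1 (M + 1 + 1)).
  - by apply: measurable_indic; exact: measurable_obox.
  - by move=> x; rewrite /box_indic indicE; case: (_ \in _); rewrite ?normr1 ?normr0.
  - move=> x Mx; rewrite /box_indic indicE memNset// => xb; move: Mx; apply/negP.
    rewrite -leNgt; apply: rV_norm_le; first lra.
    by move=> j; have := xb j; rewrite !mxE -ltr_norml => /ltW /le_trans; apply; lra.
have key t : 0 < t -> t <= 1 -> `|I0| <= C * K * t.
  move=> t0 t1; have [|hC hM] := hq t; first by rewrite ger0_norm// ltW.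
  pose r x := chi (x + t *: basis_rV i) - chi x - t * 'D_(basis_rV i) chi x.
  have ti : mu.-integrable setT (EFin \o (fun x => chi (x + t *: basis_rV i))).
    exact/test_integrable/test_shift.
  have ci := test_integrable tchi; have di := test_integrable tdchi.
  have tdi : mu.-integrable setT (EFin \o (fun x => t * 'D_(basis_rV i) chi x)).
    by apply: (test_integrable (test_scale t tdchi)).
  have ri : \int[mu]_x r x = - (t * I0).
    rewrite /r RintegralB//; last exact: (integrableB measurableT ti ci).
    rewrite RintegralB// RintegralZl// (Rintegral_shift (t *: basis_rV i) (f := chi)).
      by rewrite subrr sub0r.
    exact: test_measurable.
  have mr : measurable_fun setT r.
    apply: measurable_funB; first apply: measurable_funB.
    - by apply: test_measurable; exact: test_shift.
    - exact: test_measurable.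
    - by apply: measurable_funM => //; exact: test_measurable.
  have rint : mu.-integrable setT (EFin \o r) by exact: bounded_support_integrable mr hC hM.
  have : `|\int[mu]_x r x| <= \int[mu]_x (C * t ^+ 2 * box_indic M x).
    apply: le_trans (le_normr_Rintegral _ _) _ => //; apply: le_Rintegral => //.
    - exact: (integrable_abse rint).
    - rewrite (_ : _ \o _ = fun x => ((C * t ^+ 2)%:E * (box_indic M x)%:E)%E) //.
      exact: integrableZl.
    move=> x _; have [Mx|xM] := ltP M `|x|.
      by rewrite /r hM// normr0 mulr_ge0 ?box_indic_ge0// mulr_ge0// sqr_ge0.
    by rewrite box_indic1// mulr1; exact: hC.
  rewrite RintegralZl// ri normrN normrM (gtr0_norm t0) -/K.
  move=> h; rewrite -(ler_pM2l t0); apply: le_trans h _.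
  by rewrite expr2 le_eqVlt; apply/orP; left; apply/eqP; rewrite /K /Rintegral; ring.
apply/eqP; rewrite -normr_le0; apply/ler_addgt0Pr => e e0; rewrite add0r.
have K0 : 0 <= C * K by rewrite mulr_ge0// fine_ge0// integral_ge0// => x _; rewrite lee_fin box_indic_ge0.
have t0 : 0 < Num.min 1 (e / (C * K + 1)) by rewrite lt_min ltr01 divr_gt0//; lra.
have := key _ t0 _; rewrite ge_min lexx => /(_ isT) /le_trans; apply.
apply: (@le_trans _ _ (C * K * (e / (C * K + 1)))).
  by rewrite ler_wpM2l// ge_min lexx orbT.
by rewrite mulrA ler_pdivrMr; [rewrite mulrC ler_pM2l//; lra|lra].
Qed.

(** Continuity of translations: replace f by a nearby test function, for which
    [translation_estimate] gives a Lipschitz bound. *)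
Lemma trans_cvg f e : in_L2 f -> 0 < e ->
  exists2 r, 0 < r & forall z, `|z| < r -> snorm ip (trans z f - f) <= e.
Proof.
move=> f2 e0; have e3 : 0 < e / 3 by lra.
have [phi tphi hphi] := test_dense f2 e3.
have [p1 _] := test_in_H1 tphi; have p2 := test_in_L2 tphi.
pose S := \sum_(i < d) snorm ip (wder i phi).
have S0 : 0 <= S by apply: sumr_ge0 => i _; exact: snorm_ge0.
exists (e / 3 / (S + 1)); first by rewrite divr_gt0//; lra.
move=> z; rewrite ltr_pdivlMr; last by lra.
move=> hz; have hest := translation_estimate z p1.
have tf2 := in_L2_trans z f2; have tp2 := in_L2_trans z p2.
have pf2 := in_L2B p2 f2; have tpp2 := in_L2B tp2 p2.
have tfp2 : in_L2 (trans z (f - phi)) by apply: in_L2_trans; exact: in_L2B.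
have -> : trans z f - f = trans z (f - phi) + ((trans z phi - phi) + (phi - f)).
  by apply/funext => x; rewrite /trans !fctE; ring.
have n1 : snorm ip (trans z (f - phi)) = snorm ip (phi - f).
  by rewrite {1}/snorm ip_trans; [rewrite -/(snorm ip _) (snorm_distC L2_semi_inner)|exact: in_L2B..].
apply: le_trans (snormD L2_semi_inner _ _) _ => //; first exact: in_L2D.
rewrite n1; have := snormD L2_semi_inner tpp2 pf2.
rewrite -/S in hest; have : `|z| * S <= `|z| * (S + 1) by rewrite ler_wpM2l//; lra.
lra.
Qed.

End H1_space.

(** * Fubini for correlation integrals *)

Section Fubini_convolution.
Context {R : realType} {d : nat}.
Local Notation rV := 'rV[R]_d.
Local Notation mu := (@lebesgue_rV R d).
Local Notation test := (@test_function R 'rV[R]_d setT).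
Implicit Types (a b : rV -> R) (phi : rV -> R).

Lemma integrable_scale (c : R) (f : rV -> R) : mu.-integrable setT (EFin \o f) ->
  mu.-integrable setT (EFin \o (fun x => c * f x)).
Proof.
move=> fi; rewrite (_ : _ \o _ = (fun x => c%:E * (f x)%:E)%E)//.
exact: integrableZl.
Qed.

Lemma Rintegral_Fubini (F : rV * rV -> R) :
  (mu \x mu)%E.-integrable setT (EFin \o F) ->
  (forall x, mu.-integrable setT (EFin \o (fun y => F (x, y)))) ->
  (forall y, mu.-integrable setT (EFin \o (fun x => F (x, y)))) ->
  \int[mu]_x (\int[mu]_y F (x, y)) = \int[mu]_y (\int[mu]_x F (x, y)) /\
  mu.-integrable setT (EFin \o (fun x => \int[mu]_y F (x, y))).
Proof.
move=> iF F1 F2.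
have E1 : EFin \o (fun x => \int[mu]_y F (x, y)) =
    fun x => (\int[mu]_y (F (x, y))%:E)%E.
  apply/funext => x /=; rewrite /Rintegral fineK//.
  exact: integrable_fin_num (F1 x).
have E2 : EFin \o (fun y => \int[mu]_x F (x, y)) =
    fun y => (\int[mu]_x (F (x, y))%:E)%E.
  apply/funext => y /=; rewrite /Rintegral fineK//.
  exact: integrable_fin_num (F2 y).
split.
- congr fine; have := Fubini iF; rewrite /= => h.
  transitivity (\int[mu]_x \int[mu]_y (F (x, y))%:E)%E.
    by apply: eq_integral => x _; exact: (congr1 (fun f => f x) E1).
  by rewrite h; apply: eq_integral => y _; exact/esym/(congr1 (fun f => f y) E2).
- by rewrite E1; exact: (integrable_fubini_F iF).
Qed.

Lemma Rintegral_sum n (F : 'I_n -> rV -> R) :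
  (forall i, mu.-integrable setT (EFin \o F i)) ->
  mu.-integrable setT (EFin \o (fun x => \sum_(i < n) F i x)) /\
  \int[mu]_x (\sum_(i < n) F i x) = \sum_(i < n) \int[mu]_x F i x.
Proof.
elim: n F => [|n IH] F iF.
  have E : (fun x => \sum_(i < 0) F i x) = cst 0 :> (rV -> R).
    by apply/funext => x; rewrite big_ord0.
  rewrite big_ord0 E; split; first exact: integrable0.
  by rewrite /Rintegral integral0.
have [h1 h2] := IH _ (fun i => iF (widen_ord (leqnSn n) i)).
have E : (fun x => \sum_(i < n.+1) F i x) =
    (fun x => \sum_(i < n) F (widen_ord (leqnSn n) i) x + F ord_max x).
  by apply/funext => x; rewrite big_ord_recr.
rewrite E big_ord_recr /= RintegralD//; split; last by rewrite h2.
exact: (integrableD measurableT h1 (iF ord_max)).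
Qed.

Lemma measurable_fun_add_rV : measurable_fun setT (fun p : rV * rV => p.1 + p.2).
Proof.
apply: measurable_fun_rV => i; under eq_fun do rewrite mxE.
apply: measurable_funD; apply: (measurableT_comp (measurable_coord_rV i)).
  exact: measurable_fst.
exact: measurable_snd.
Qed.

Lemma measurable_fun_sub_rV : measurable_fun setT (fun p : rV * rV => p.2 - p.1).
Proof.
apply: measurable_fun_rV => i; under eq_fun do rewrite !mxE.
apply: measurable_funB; apply: (measurableT_comp (measurable_coord_rV i)).
  exact: measurable_snd.
exact: measurable_fst.
Qed.

Lemma in_L2_norm a : in_L2 a -> in_L2 (fun x => `|a x|).
Proof.
move=> a2; apply: (le_in_L2 _ a2); last by move=> x; rewrite normr_id.
by apply: measurableT_comp => //; exact: in_L2_measurable.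
Qed.

Lemma snorm_norm a : snorm ip (fun x => `|a x|) = snorm ip a.
Proof.
rewrite /snorm !ipE; congr Num.sqrt; apply: eq_Rintegral => x _.
by rewrite -!expr2 real_normK ?num_real.
Qed.

Lemma product_kernel_integrable a b phi : in_L2 a -> in_L2 b -> test phi ->
  (mu \x mu)%E.-integrable setT (EFin \o (fun p : rV * rV => a p.1 * (phi p.2 * b (p.1 + p.2)))).
Proof.
move=> a2 b2 tphi.
have mG : measurable_fun setT (fun p : rV * rV => a p.1 * (phi p.2 * b (p.1 + p.2))).
  apply: measurable_funM.
    by apply: (measurableT_comp (in_L2_measurable a2)); exact: measurable_fst.
  apply: measurable_funM.
    by apply: (measurableT_comp (test_measurable tphi)); exact: measurable_snd.
  by apply: (measurableT_comp (in_L2_measurable b2)); exact: measurable_fun_add_rV.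
apply/integrable21ltyP; first exact/measurable_EFinP.
have a2' := in_L2_norm a2; have b2' := in_L2_norm b2.
apply: (@le_lt_trans _ _ (\int[mu]_z ((snorm ip a * snorm ip b)%:E * `|(phi z)%:E|))%E).
  apply: ge0_le_integral => //.
  - by move=> z _; apply: integral_ge0 => x _.
  - have mG' : measurable_fun setT
        (fun p : rV * rV => `|(a p.1 * (phi p.2 * b (p.1 + p.2)))%:E|)%E.
      by apply: measurableT_comp => //; exact/measurable_EFinP.
    exact: (measurable_fun_fubini_tonelli_G _ mG' (fun=> abse_ge0 _)).
  - apply: measurable_funeM; apply: measurableT_comp => //.
    by apply/measurable_EFinP; exact: test_measurable.
  move=> z _; under eq_integral do
    rewrite /= mulrCA normrM (normrM (a _)) EFinM.
  have tb2 := in_L2_trans z b2'.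
  rewrite ge0_integralZl_EFin//; last first.
    apply/measurable_EFinP; apply: measurable_funM; first exact: in_L2_measurable.
    exact: (in_L2_measurable tb2).
  rewrite (_ : (\int[mu]_x _)%E = (ip (fun x => `|a x|) (trans z (fun x => `|b x|)))%:E); last first.
    by rewrite EFin_ip.
  rewrite /= -!EFinM lee_fin mulrC ler_wpM2r//.
  apply: le_trans (ler_norm _) _; apply: le_trans (sip_CS L2_semi_inner a2' tb2) _.
  by rewrite snorm_norm {2}/snorm ip_trans// -/(snorm ip _) snorm_norm.
rewrite ge0_integralZl_EFin//.
- have /integrableP[_ h] := test_integrable tphi.
  by rewrite lte_mul_pinfty// lee_fin mulr_ge0// snorm_ge0.
- by apply: measurableT_comp => //; apply/measurable_EFinP; exact: test_measurable.
- by rewrite mulr_ge0// snorm_ge0.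
Qed.

Lemma difference_kernel_integrable a b phi : in_L2 a -> in_L2 b -> test phi ->
  (mu \x mu)%E.-integrable setT (EFin \o (fun p : rV * rV => a p.1 * (phi (p.2 - p.1) * b p.2))).
Proof.
move=> a2 b2 tphi.
have mH : measurable_fun setT (fun p : rV * rV => a p.1 * (phi (p.2 - p.1) * b p.2)).
  apply: measurable_funM.
    by apply: (measurableT_comp (in_L2_measurable a2)); exact: measurable_fst.
  apply: measurable_funM.
    by apply: (measurableT_comp (test_measurable tphi)); exact: measurable_fun_sub_rV.
  by apply: (measurableT_comp (in_L2_measurable b2)); exact: measurable_snd.
apply/integrable12ltyP; first exact/measurable_EFinP.
have iG := product_kernel_integrable a2 b2 tphi.
have h := (integrable12ltyP mu mu (measurable_int _ iG)).1 iG.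
have E (x : rV) : (\int[mu]_y `|(a x * (phi (y - x) * b y))%:E| =
    \int[mu]_z `|(a x * (phi z * b (x + z)))%:E|)%E.
  have mx : measurable_fun setT (fun y : rV => `|(a x * (phi (y - x) * b y))%:E|%E).
    apply: measurableT_comp => //; apply/measurable_EFinP; apply: measurable_funM => //.
    apply: measurable_funM; last exact: in_L2_measurable.
    by apply: test_measurable; exact: (test_shift (- x) tphi).
  rewrite -(ge0_integral_shift x mx)//; apply: eq_integral => z _.
  by rewrite addrK (addrC z).
apply: le_lt_trans h; rewrite le_eqVlt; apply/orP; left; apply/eqP.
by apply: eq_integral => x _; exact: E.
Qed.

Lemma continuous_ip_trans a b : in_L2 a -> in_L2 b ->
  continuous (fun z => ip a (trans z b)).
Proof.
move=> a2 b2 z0; have F := nbhs_filter z0; apply/(cvgrPdist_le (F := nbhs z0)) => e e0.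
have n0 := snorm_ge0 ip a.
have r0 : 0 < e / (snorm ip a + 1) by rewrite divr_gt0//; lra.
have [r rp hr] := trans_cvg b2 r0.
near=> z; have zr : `|z - z0| < r.
  by near: z; have := @nbhsx_ballx _ _ z0 r rp; apply: filterS => z; rewrite -ball_normE /= distrC.
have t1 := in_L2_trans z b2; have t2 := in_L2_trans z0 b2.
rewrite distrC.
rewrite -(sip_subr L2_semi_inner)//.
have -> : trans z b - trans z0 b = trans z0 (trans (z - z0) b - b).
  by apply/funext => x; rewrite /trans !fctE -addrA (addrCA z0) subrr addr0.
have t3 : in_L2 (trans (z - z0) b - b) by apply: in_L2B => //; exact: in_L2_trans.
apply: le_trans (sip_CS L2_semi_inner a2 (in_L2_trans z0 t3)) _.
rewrite {2}/snorm ip_trans// -/(snorm ip _).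
apply: le_trans (ler_wpM2l n0 (hr _ zr)) _.
by rewrite mulrA ler_pdivrMr; [rewrite mulrC ler_pM2l//; lra|lra].
Unshelve. all: by end_near. Qed.

Lemma test_mul_integrable phi (c : rV -> R) : test phi -> continuous c ->
  mu.-integrable setT (EFin \o (fun z => phi z * c z)).
Proof.
move=> tphi cc; have [M M0 hM] := test_support tphi; have [C C0 hC] := test_bounded tphi.
pose A := [set x : rV | `|x| <= M].
have cA : compact A.
  apply: bounded_closed_compact.
    by exists M; split; [exact: num_real|move=> r Mr x /= xM; exact: le_trans xM (ltW Mr)].
  apply: (@closed_comp _ _ (fun x : rV => `|x|) [set y | y <= M]); last exact: closed_le.
  by move=> x _; exact: norm_continuous.
have cphi : compact (c @` A).
  by apply: continuous_compact => //; apply: continuous_subspaceT.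
have [K [_ hK]] := compact_bounded cphi.
apply: (@bounded_support_integrable _ _ _ (C * (Num.max K 0 + 1)) M).
- apply: measurable_funM; first exact: test_measurable.
  exact: continuous_measurable_rV.
- move=> x; rewrite normrM; have [xM|Mx] := leP `|x| M; last first.
    by rewrite hM// normr0 mul0r mulr_ge0// addr_ge0// le_max lexx orbT.
  apply: ler_pM => //; apply: hK; last by exists x.
  by rewrite (@le_lt_trans _ _ (Num.max K 0)) ?le_max ?lexx// ltrDl.
- by move=> x Mx; rewrite hM// mul0r.
Qed.

(** All three integrals are the double integral of a(x) phi(y - x) b(y), with either variable
    integrated first. Having both orders lets a derivative be moved from one factor to the kernel
    and the other factor be freed in turn. *)
Lemma trans_average a b phi : in_L2 a -> in_L2 b -> test phi ->
  [/\ \int[mu]_z (phi z * ip a (trans z b)) =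
        \int[mu]_x (a x * ip (fun y => phi (y - x)) b),
      \int[mu]_z (phi z * ip a (trans z b)) =
        \int[mu]_y (b y * ip (fun x => phi (y - x)) a),
      mu.-integrable setT (EFin \o (fun x => a x * ip (fun y => phi (y - x)) b)) &
      mu.-integrable setT (EFin \o (fun y => b y * ip (fun x => phi (y - x)) a))].
Proof.
move=> a2 b2 tphi; have p2 := test_in_L2 tphi.
have q2 x : in_L2 (fun y => phi (y - x)) by exact: (test_in_L2 (test_shift (- x) tphi)).
have s2 y : in_L2 (fun x => phi (y - x)) by exact: (test_in_L2 (test_reflect y tphi)).
have bx2 x : in_L2 (fun z => b (x + z)).
  have := in_L2_trans x b2; congr in_L2; apply/funext => z.
  by rewrite /trans addrC.
have iG := product_kernel_integrable a2 b2 tphi.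
have iM (c : R) f : mu.-integrable setT (EFin \o f) ->
    mu.-integrable setT (EFin \o (fun x => c * f x)).
  by move=> fi; exact: integrable_scale.
have ipM (c : R) f g : in_L2 f -> in_L2 g -> \int[mu]_x (c * (f x * g x)) = c * ip f g.
  by move=> f2 g2; rewrite RintegralZl ?ipE//; exact: in_L2_integrable_mul.
have [|G1 G2] := Rintegral_Fubini iG (fun x => iM (a x) _ (in_L2_integrable_mul p2 (bx2 x))).
  move=> z; have := iM (phi z) _ (in_L2_integrable_mul a2 (in_L2_trans z b2)).
  by congr integrable; apply/funext => x; rewrite /trans /=; congr EFin; ring.
have inner1 x : \int[mu]_z (a x * (phi z * b (x + z))) = a x * ip (fun y => phi (y - x)) b.
  rewrite (RintegralZl (a x) measurableT (in_L2_integrable_mul p2 (bx2 x))).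
  congr (a x * _); rewrite ipE -[RHS](Rintegral_shift x); last first.
    by apply: measurable_funM; exact: in_L2_measurable.
  by apply: eq_Rintegral => z _; rewrite addrK (addrC z).
have conv1 : \int[mu]_z (phi z * ip a (trans z b)) =
        \int[mu]_x (a x * ip (fun y => phi (y - x)) b).
  transitivity (\int[mu]_z \int[mu]_x (a x * (phi z * b (x + z)))).
    apply: eq_Rintegral => z _; rewrite -(ipM _ _ _ a2 (in_L2_trans z b2)).
    by apply: eq_Rintegral => x _; rewrite mulrCA.
  by rewrite -[LHS]G1; apply: eq_Rintegral => x _; exact: inner1.
have tn : test (fun x => phi (0 - x)) by exact: test_reflect.
have iH := difference_kernel_integrable b2 a2 tn.
have HE y x : phi (0 - (x - y)) = phi (y - x) by rewrite sub0r opprB.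
have [||H1 H2] := Rintegral_Fubini iH.
- move=> y; have := iM (b y) _ (in_L2_integrable_mul (s2 y) a2).
  by congr integrable; apply/funext => x /=; rewrite HE.
- move=> x; have := iM (a x) _ (in_L2_integrable_mul (q2 x) b2).
  by congr integrable; apply/funext => y /=; rewrite HE; congr EFin; ring.
have inner y : \int[mu]_x (b y * (phi (0 - (x - y)) * a x)) =
    b y * ip (fun x => phi (y - x)) a.
  by rewrite -(ipM _ _ _ (s2 y) a2); apply: eq_Rintegral => x _; rewrite HE.
split; first exact: conv1.
- rewrite conv1; transitivity (\int[mu]_x \int[mu]_y (b y * (phi (0 - (x - y)) * a x))).
    apply: eq_Rintegral => x _; rewrite -(ipM _ _ _ (q2 x) b2); apply: eq_Rintegral => y _.
    by rewrite HE; ring.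
  by rewrite -[LHS]H1; apply: eq_Rintegral => y _; exact: inner.
- by move: G2; congr integrable; apply/funext => x /=; rewrite inner1.
- by move: H2; congr integrable; apply/funext => y /=; rewrite inner.
Qed.

End Fubini_convolution.

(** * Density of test functions in H1 *)

Section H1_density.
Context {R : realType} {d : nat}.
Local Notation rV := 'rV[R]_d.
Local Notation mu := (@lebesgue_rV R d).
Local Notation test := (@test_function R 'rV[R]_d setT).
Implicit Types (w phi : rV -> R).

Lemma derive_reflect phi (y v x : rV) : test phi ->
  'D_v (fun x => phi (y - x)) x = - 'D_v phi (y - x).
Proof.
move=> tphi; have := @derive_comp_scale_shift _ _ (-1) y phi v x.
rewrite !scaleN1r (addrC (- x)) => h.
rewrite (_ : (fun x => phi (y - x)) = (fun x => phi (-1 *: x + y))).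
  rewrite h -scaleN1r deriveZv ?mulN1r//.
  exact: smooth_differentiable (test_smooth tphi).
by apply/funext => z; rewrite scaleN1r addrC.
Qed.

(* If w is H1-orthogonal to all test functions then z |-> (w, w(. + z))_H1,
   which is continuous, vanishes as a distribution by Fubini. *)
Lemma test_total_H1 w : in_H1 w -> (forall phi, test phi -> ip1 w phi = 0) -> ip1 w w = 0.
Proof.
move=> w1 wperp; have w2 := in_H1_L2 w1; have g2 i := in_L2_wd i w1.
pose L z := ip w (trans z w) + \sum_(i < d) ip (wder i w) (trans z (wder i w)).
have cL : continuous L.
  have cs (s : seq 'I_d) : continuous (fun z => \sum_(i <- s) ip (wder i w) (trans z (wder i w))).
    elim: s => [|i s IH] z.
      rewrite (_ : (fun z => _) = cst 0); first exact: cst_continuous.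
      by apply/funext => y; rewrite big_nil.
    rewrite (_ : (fun z => _) = fun z => ip (wder i w) (trans z (wder i w)) +
      \sum_(i <- s) ip (wder i w) (trans z (wder i w))); last first.
      by apply/funext => y; rewrite big_cons.
    by apply: continuousD; [exact: (continuous_ip_trans (g2 i) (g2 i))|exact: IH].
  by move=> z; apply: continuousD; [exact: (continuous_ip_trans w2 w2)|exact: cs].
have L0 : L 0 = ip1 w w.
  by rewrite /L /ip1 trans0; congr (_ + _); apply: eq_bigr => i _; rewrite trans0.
have iL phi a : test phi -> in_L2 a ->
    mu.-integrable setT (EFin \o (fun z => phi z * ip a (trans z a))).
  by move=> tphi a2; apply: test_mul_integrable => //; exact: continuous_ip_trans.
have zero phi : test phi -> \int[mu]_z (phi z * L z) = 0.
  move=> tphi; have tD i := test_derive (basis_rV i) tphi.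
  have chi y : test (fun x => phi (y - x)) by exact: test_reflect.
  (* One of the two weak derivatives is moved onto phi, and the order of integration is then
     exchanged. With the undifferentiated w outside, the sum over i assembles the H1 pairing of w
     with the test function x |-> phi(y - x), which vanishes. *)
  have wterm i : \int[mu]_z (phi z * ip (wder i w) (trans z (wder i w))) =
      \int[mu]_y (w y * ip (wder i w) ('D_(basis_rV i) (fun x => phi (y - x)))) /\
      mu.-integrable setT (EFin \o (fun y => w y * ip (wder i w) ('D_(basis_rV i) (fun x => phi (y - x))))).
    have [-> _ _ _] := trans_average (g2 i) (g2 i) tphi.
    have [E1 E2 E4 E3] := trans_average (g2 i) w2 (tD i).
    have F y : ip (wder i w) ('D_(basis_rV i) (fun x => phi (y - x))) =
        - ip (fun x => 'D_(basis_rV i) phi (y - x)) (wder i w).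
      have r2 := test_in_L2 (test_reflect y (tD i)).
      rewrite ipC -mulN1r -(sip_scalel L2_semi_inner)//; congr ip.
      by apply/funext => x; rewrite derive_reflect// fctE scaleN1r.
    have FF : (fun y => w y * ip (wder i w) ('D_(basis_rV i) (fun x => phi (y - x)))) =
        (fun y => - 1 * (w y * ip (fun x => 'D_(basis_rV i) phi (y - x)) (wder i w))).
      by apply/funext => y; rewrite F; ring.
    split; last by rewrite FF; exact: integrable_scale.
    rewrite FF RintegralZl// -E2 E1 -RintegralZl//.
    apply: eq_Rintegral => x _; have tx := test_shift (- x) tphi.
    rewrite (ipC _ (wder i w)) (ip_wd i w1 tx) mulrN mulN1r (ipC _ w); congr (- (_ * ip w _)).
    by apply/funext => y; have := derive_trans (- x) (basis_rV i) phi y; rewrite /trans.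
  have [_ W1 _ W2] := trans_average w2 w2 tphi.
  have iLi i := iL _ _ tphi (g2 i).
  have [S1 S2] := Rintegral_sum iLi.
  have [S3 S4] := Rintegral_sum (fun i => (wterm i).2).
  transitivity (\int[mu]_z (phi z * ip w (trans z w) +
      \sum_(i < d) phi z * ip (wder i w) (trans z (wder i w)))).
    by apply: eq_Rintegral => z _; rewrite /L mulrDr mulr_sumr.
  rewrite RintegralD//; last exact: iL.
  rewrite S2 (eq_bigr _ (fun i _ => (wterm i).1)) -S4 W1 -RintegralD//.
  transitivity (\int[mu]_(y in [set: rV]) (cst 0 : rV -> R) y); last first.
    by rewrite /Rintegral integral0.
  apply: eq_Rintegral => y _; rewrite -mulr_sumr -mulrDr /=.
  rewrite (_ : _ + _ = ip1 w (fun x => phi (y - x))); first by rewrite wperp// mulr0.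
  rewrite /ip1 ipC; congr (_ + _); apply: eq_bigr => i _.
  have [_ h] := test_in_H1 (chi y).
  by rewrite ipC [in RHS]ipC h.
apply/eqP; rewrite eq_le (sip_ge0 H1_semi_inner)// andbT -L0 leNgt; apply/negP => Lpos.
have /cvgrPdist_lt/(_ _ Lpos) := cL 0; rewrite -nbhs_ballE => -[r /= r0 hr].
have Lr z : `|z| < r -> 0 < L z.
  move=> zr; have := hr z; rewrite -ball_normE /= sub0r normrN => /(_ zr).
  by rewrite ltr_distl => /andP[_]; rewrite ltrBlDr gtrDl || lra.
pose r2 := r / 2; have r20 : 0 < r2 by rewrite divr_gt0.
pose phi := box_bump (const_mx (- r2) : rV) (const_mx r2) 1.
have tphi : test phi by exact: test_box_bump.
have pos z : 0 <= phi z * L z.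
  have [zb|zb] := pselect (obox (const_mx (- r2) : rV) (const_mx r2) z).
    rewrite mulr_ge0 ?box_bump_ge0// ltW// Lr// (@le_lt_trans _ _ r2)//; last first.
      by rewrite /r2; lra.
    apply: rV_norm_le; first exact: ltW.
    by move=> i; have := zb i; rewrite !mxE -ltr_norml => /ltW.
  by rewrite /phi box_bump_eq0// mul0r.
have iphi : mu.-integrable setT (EFin \o (fun z => phi z * L z)) by exact: test_mul_integrable.
have : (\int[mu]_z `|(phi z * L z)%:E| = 0)%E.
  transitivity (\int[mu]_z (phi z * L z)%:E)%E.
    by apply: eq_integral => z _; rewrite gee0_abs// lee_fin.
  by rewrite -[LHS]fineK ?(integrable_fin_num _ iphi)//; congr EFin; exact: zero.
move=> /(ae_eq_integral_abs mu measurableT (measurable_int _ iphi)).1 h.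
have [N [mN N0 sN]] := h.
have sub : obox (const_mx (- r2) : rV) (const_mx r2) `<=` N.
  move=> z zb; apply: sN => /= /(_ I) [] /eqP; apply/negP; rewrite mulf_neq0//.
    by rewrite gt_eqF//; exact: box_bump_gt0.
  rewrite gt_eqF// Lr// (@le_lt_trans _ _ r2)//; last by rewrite /r2; lra.
  apply: rV_norm_le; first exact: ltW.
  by move=> i; have := zb i; rewrite !mxE -ltr_norml => /ltW.
have : (mu (obox (const_mx (- r2)%R : rV) (const_mx r2)) <= 0)%E.
  rewrite -N0; apply: le_measure => //; rewrite inE//; exact: measurable_obox.
rewrite lebesgue_rV_obox lee_fin; apply/negP; rewrite -ltNge; apply: prodr_gt0 => i _.
by rewrite !mxE lt_max opprK addr_gt0// orbT.
Qed.

Lemma test_dense_H1 w e : in_H1 w -> 0 < e ->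
  exists2 phi, test phi & snorm ip1 (phi - w) <= e.
Proof.
apply: (sip_dense H1_semi_inner (fun f tf => (test_in_H1 tf).1) (@test0 R d)
  (@test_add R d) (@test_scale R d) (@H1_complete R d) test_total_H1).
Qed.

End H1_density.

(** * Dyadic cubes and their measurability *)

Section dyadic_cells.
Context {R : realType} {d : nat}.
Local Notation rV := 'rV[R]_d.
Local Notation mu := (@lebesgue_rV R d).
Implicit Types (f g w : rV -> R) (x y z : rV) (k : nat).

(** Encodes the half-open dyadic cube of side 2^-k around x by integers, so that cubes are the
    fibres of a map into a countable type. *)
Definition cell k x : {ffun 'I_d -> int} := [ffun i => Num.floor (2 ^+ k * x ord0 i)].

Definition cell_indic k x : rV -> R := fun y => (cell k x == cell k y)%:R.

Lemma cell_indicC k x y : cell_indic k x y = cell_indic k y x.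
Proof. by rewrite /cell_indic eq_sym. Qed.

Lemma floorE (t : R) (n : int) : (Num.floor t == n) = (n%:~R <= t < n%:~R + 1).
Proof. by rewrite floor_eq intrD. Qed.

Lemma cellP k x y : cell k x = cell k y <->
  forall i, (Num.floor (2 ^+ k * x ord0 i))%:~R <= 2 ^+ k * y ord0 i <
            (Num.floor (2 ^+ k * x ord0 i))%:~R + 1.
Proof.
split=> [/ffunP h i|h].
  by rewrite -floorE; have := h i; rewrite !ffunE => ->.
by apply/ffunP => i; rewrite !ffunE; apply/esym/eqP; rewrite floorE.
Qed.

Lemma cellS k x y : cell k.+1 x = cell k.+1 y -> cell k x = cell k y.
Proof.
move=> /cellP h; apply/cellP => i; have := h i.
set m := Num.floor (2 ^+ k.+1 * x ord0 i); set n := Num.floor (2 ^+ k * x ord0 i).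
have := floor_itv (2 ^+ k.+1 * x ord0 i); have := floor_itv (2 ^+ k * x ord0 i).
rewrite -/m -/n !intrD !exprS -!mulrA.
move: (2 ^+ k * x ord0 i) (2 ^+ k * y ord0 i) => s t /andP[s1 s2] /andP[s3 s4] /andP[t1 t2].
have nm : 2 * n <= m.
  by rewrite -ltzD1 -(ltr_int R) intrD intrM; apply: le_lt_trans s4; rewrite ler_pM2l.
have mn : m < 2 * n + 2.
  rewrite -(ltr_int R) intrD intrM; apply: le_lt_trans s3 _.
  by have := s2; rewrite -(ltr_pM2l (ltr0Sn R 1)) mulrDr mulr1.
have nm' : (2 * n)%:~R <= m%:~R :> R by rewrite ler_int.
have mn' : m%:~R + 1 <= (2 * n + 2)%:~R :> R.
  by rewrite -[1]/(1%:~R) -intrD ler_int lezD1.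
by move: nm' mn'; rewrite intrD !intrM => a b; apply/andP; split; lra.
Qed.

Lemma cell_norm k x y : cell k x = cell k y ->
  forall i, `|y ord0 i - x ord0 i| < (2 ^+ k)^-1.
Proof.
move=> /cellP h i; have := h i; have := floor_itv (2 ^+ k * x ord0 i).
rewrite intrD; move: (Num.floor _)%:~R => n /andP[a b] /andP[c e].
have k0 : 0 < 2 ^+ k :> R by rewrite exprn_gt0.
rewrite -(ltr_pM2l k0) mulfV ?gt_eqF// -{1}(gtr0_norm k0) -normrM mulrBr ltr_norml.
apply/andP; split; lra.
Qed.

Lemma measurable_cell k (z : {ffun 'I_d -> int}) : measurable [set x | cell k x = z].
Proof.
rewrite (_ : [set x | _] = \bigcap_(i in [set: 'I_d])
    ((fun x : rV => Num.floor (2 ^+ k * x ord0 i)) @^-1` [set z i])).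
  apply: fin_bigcap_measurable => // i _.
  rewrite (_ : _ @^-1` _ = (fun x : rV => 2 ^+ k * x ord0 i) @^-1` `[(z i)%:~R, (z i)%:~R + 1[%classic).
    rewrite -[X in measurable X]setTI.
    have mi : measurable_fun setT (fun x : rV => 2 ^+ k * x ord0 i).
      by apply: measurable_funM => //; exact: measurable_coord_rV.
    by apply: mi => //; exact: measurable_itv.
  apply/seteqP; split=> x /=; rewrite in_itv/= -floorE; first by move=> ->.
  by move/eqP.
apply/seteqP; split=> x /=.
  by move=> <- i _ /=; rewrite ffunE.
by move=> h; apply/ffunP => i; rewrite ffunE h.
Qed.

Lemma cell_constant_measurable k f : (forall x y, cell k x = cell k y -> f x = f y) ->
  measurable_fun setT f.
Proof.
move=> fc _ B mB; rewrite setTI.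
rewrite (_ : f @^-1` B = \bigcup_(z : {ffun 'I_d -> int})
   (if `[< exists2 x, cell k x = z & B (f x) >] then [set x | cell k x = z] else set0)).
  apply: countable_bigcupT_measurable => [|z]; first exact: countableP.
  by case: ifP => // _; exact: measurable_cell.
apply/seteqP; split=> [x Bx|x [z _]].
  by exists (cell k x) => //; rewrite ifT//; apply/asboolP; exists x.
by case: ifP => // /asboolP[y yz By] /= xz; rewrite /preimage /= (fc x y)// xz.
Qed.

Lemma measurable_cell_indic2 k :
  measurable_fun setT (fun p : rV * rV => cell_indic k p.1 p.2).
Proof.
rewrite (_ : (fun _ => _) = \1_(\bigcup_(z : {ffun 'I_d -> int})
   ([set x | cell k x = z] `*` [set x | cell k x = z]))).
  apply: measurable_indic; apply: countable_bigcupT_measurable => [|z]; first exact: countableP.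
  by apply: measurableX; exact: measurable_cell.
apply/funext => -[x y]; rewrite /cell_indic indicE /=; congr ((nat_of_bool _)%:R).
apply/idP/idP => [/eqP e|/set_mem[z _ [/= -> ->]]//].
by apply/mem_set; exists (cell k x).
Qed.

Lemma measurable_cell_indic k x : measurable_fun setT (cell_indic k x).
Proof.
by apply: (@cell_constant_measurable k) => y z; rewrite /cell_indic => ->.
Qed.

End dyadic_cells.

(** * Lebesgue measure of half-open boxes *)

Section half_open_boxes.
Context {R : realType}.

Definition hbox n (a b : 'rV[R]_n) : set 'rV[R]_n :=
  [set x | forall i, a ord0 i <= x ord0 i < b ord0 i].

Lemma measurable_hbox n (a b : 'rV[R]_n) : measurable (hbox a b).
Proof.
rewrite (_ : hbox a b = \bigcap_(i in [set: 'I_n])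
    ((fun x : 'rV[R]_n => x ord0 i) @^-1` `[a ord0 i, b ord0 i[%classic)).
  apply: fin_bigcap_measurable => // i _; rewrite -[X in measurable X]setTI.
  by apply: measurable_fun_coord => //; exact: measurable_itv.
apply/seteqP; split=> x /= h i; first by move=> _ /=; rewrite in_itv/=; exact: h.
by have := h i I; rewrite /= in_itv.
Qed.

Lemma lebesgue_rV_hbox n (a b : 'rV[R]_n) : (forall i, a ord0 i <= b ord0 i) ->
  lebesgue_rV n (hbox a b) = (\prod_(i < n) (b ord0 i - a ord0 i))%:E.
Proof.
elim: n a b => [|n IH] a b ab.
  rewrite big_ord0 /= diracE mem_set//; first by case.
rewrite big_ord_recl EFinM /= /lebesgue_rV_succ /pushforward.
rewrite (_ : _ @^-1` _ = `[a ord0 ord0, b ord0 ord0[%classic `*`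
   hbox (\row_i a ord0 (lift ord0 i)) (\row_i b ord0 (lift ord0 i))).
  rewrite product_measure1E; [|exact: measurable_itv|exact: measurable_hbox].
  rewrite IH; last by move=> i; rewrite !mxE.
  congr (_ * _)%E; last by congr (_%:E); apply: eq_bigr => i _; rewrite !mxE.
  apply: etrans; first exact: lebesgue_measure_itv.
  rewrite /= lte_fin; case: ltP => h; first by rewrite -EFinD.
  have := ab ord0; rewrite le_eqVlt ltNge h orbF => /eqP ->.
  by rewrite subrr.
apply/seteqP; split=> [[t x]|[t x]].
  move=> h; split=> /=; first by have := h ord0; rewrite /cons_rV mxE unlift_none in_itv.
  by move=> i; have := h (lift ord0 i); rewrite /cons_rV !mxE liftK.
move=> [/=]; rewrite in_itv/= => h1 h2 i; rewrite /cons_rV mxE.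
by case: unliftP => [j ->|->//]; have := h2 j; rewrite !mxE.
Qed.

End half_open_boxes.

(** * Averages over dyadic cubes and the Poincare inequality *)

Section dyadic_averages.
Context {R : realType} {d : nat}.
Local Notation rV := 'rV[R]_d.
Local Notation mu := (@lebesgue_rV R d).
Implicit Types (f g w : rV -> R) (x y z : rV) (k : nat).

Lemma integral_cell_indic k x :
  (\int[mu]_y (cell_indic k x y)%:E = ((2 ^+ k)^-1 ^+ d)%:E)%E.
Proof.
have k0 : 0 < 2 ^+ k :> R by rewrite exprn_gt0.
pose m (i : 'I_d) : R := (Num.floor (2 ^+ k * x ord0 i))%:~R.
pose B := hbox (\row_i (m i / 2 ^+ k)) (\row_i ((m i + 1) / 2 ^+ k)).
rewrite (_ : cell_indic k x = \1_B); last first.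
  apply/funext => y; rewrite /cell_indic indicE; congr ((nat_of_bool _)%:R).
  apply/idP/idP => [/eqP/cellP h|/set_mem h].
    apply/mem_set => i; rewrite !mxE ler_pdivrMr// ltr_pdivlMr// mulrC; exact: h.
  apply/eqP/cellP => i; have := h i; rewrite !mxE ler_pdivrMr// ltr_pdivlMr// mulrC; exact.
rewrite integral_indic// ?setIT; last exact: measurable_hbox.
apply: etrans.
  by apply: lebesgue_rV_hbox => i; rewrite !mxE ler_pM2r ?invr_gt0// lerDl.
rewrite (eq_bigr (fun=> (2 ^+ k)^-1)).
  by rewrite prodr_const card_ord.
by move=> i _; rewrite !mxE -mulrBl addrC addKr mul1r.
Qed.

Lemma cell_indic_ge0 k x y : 0 <= cell_indic k x y. Proof. exact: ler0n. Qed.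

Lemma in_L2_cell_indic k x : in_L2 (cell_indic k x).
Proof.
apply/in_L2P; split; first exact: measurable_cell_indic.
rewrite (_ : (fun _ => _) = fun y => (cell_indic k x y)%:E).
  by rewrite integral_cell_indic ltry.
by apply/funext => y; rewrite /cell_indic expr2 -natrM mulnb andbb.
Qed.

Lemma ip_cell_indic k x : ip (cell_indic k x) (cell_indic k x) = (2 ^+ k)^-1 ^+ d.
Proof.
apply: EFin_inj; rewrite EFin_ip_sqr; last exact: in_L2_cell_indic.
rewrite -(integral_cell_indic k x); apply: eq_integral => y _.
by rewrite /cell_indic expr2 -natrM mulnb andbb.
Qed.

(** Conditional expectation on the dyadic cubes of side 2^-k; the factor is the inverse volume of a
    cube. *)
Definition avg k f : rV -> R := fun x => (2 ^+ k) ^+ d * ip (cell_indic k x) f.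

Lemma avg_cell k f x y : cell k x = cell k y -> avg k f x = avg k f y.
Proof. by move=> e; rewrite /avg /cell_indic e. Qed.

Lemma measurable_avg k f : measurable_fun setT (avg k f).
Proof. exact: (cell_constant_measurable (@avg_cell k f)). Qed.

Lemma vol0 k : 0 < (2 ^+ k) ^+ d :> R.
Proof. by rewrite !exprn_gt0. Qed.

Lemma avg_bound k f x : in_L2 f -> `|avg k f x| <= Num.sqrt ((2 ^+ k) ^+ d) * snorm ip f.
Proof.
move=> f2; rewrite /avg normrM gtr0_norm ?vol0//.
apply: le_trans (ler_wpM2l (ltW (vol0 k)) (sip_CS L2_semi_inner (in_L2_cell_indic k x) f2)) _.
rewrite mulrA ler_wpM2r ?snorm_ge0// /snorm ip_cell_indic.
rewrite -{1}(sqr_sqrtr (ltW (vol0 k))) expr2 -mulrA -sqrtrM ?(ltW (vol0 k))//.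
by rewrite -exprMn mulfV ?expr1n ?sqrtr1 ?mulr1// gt_eqF// exprn_gt0.
Qed.

Lemma avgB k f g x : in_L2 f -> in_L2 g -> avg k (f - g) x = avg k f x - avg k g x.
Proof.
by move=> f2 g2; rewrite /avg (sip_subr L2_semi_inner) ?mulrBr//; exact: in_L2_cell_indic.
Qed.

Lemma avg_constant k f x : measurable_fun setT f ->
  (forall y, cell k x = cell k y -> f y = f x) -> avg k f x = f x.
Proof.
move=> mf fc; rewrite /avg (_ : ip _ _ = f x * (2 ^+ k)^-1 ^+ d).
  by rewrite mulrCA -exprMn mulfV ?expr1n ?mulr1// gt_eqF// exprn_gt0.
rewrite -(ip_cell_indic k x) -(sip_scaler L2_semi_inner); [|exact: in_L2_cell_indic..].
rewrite !ipE; apply: eq_Rintegral => y _; rewrite fctE /cell_indic.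
case: eqP => [/fc ->|_]; last by rewrite !mul0r.
by rewrite mul1r mul1r /GRing.scale/= mulr1.
Qed.

(* Jensen on a cell, in the form used both for |f| and for differences. *)
Lemma avg_jensen k (g : rV -> R) x : in_L2 g ->
  (((avg k g x) ^+ 2)%:E <= ((2 ^+ k) ^+ d)%:E * \int[mu]_y (cell_indic k x y * g y ^+ 2)%:E)%E.
Proof.
move=> g2; have c2 := in_L2_cell_indic k x.
have cg2 : in_L2 (fun y => cell_indic k x y * g y).
  apply: (le_in_L2 _ g2).
    by apply: measurable_funM; [exact: measurable_cell_indic|exact: in_L2_measurable].
  move=> y; rewrite normrM ler_piMl// /cell_indic.
  by case: eqP; rewrite ?normr1 ?normr0.
have idem y : cell_indic k x y * cell_indic k x y = cell_indic k x y.
  by rewrite /cell_indic -natrM mulnb andbb.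
have E1 : ip (cell_indic k x) g = ip (cell_indic k x) (fun y => cell_indic k x y * g y).
  by rewrite !ipE; apply: eq_Rintegral => y _; rewrite mulrA idem.
have E2 : (\int[mu]_y (cell_indic k x y * g y ^+ 2)%:E =
    (ip (fun y => cell_indic k x y * g y) (fun y => cell_indic k x y * g y))%:E)%E.
  rewrite EFin_ip_sqr//; apply: eq_integral => y _.
  by rewrite exprMn [in RHS]expr2 idem.
rewrite E2 -EFinM lee_fin /avg E1 exprMn.
apply: le_trans (ler_wpM2l (sqr_ge0 _) (sip_CS_sqr L2_semi_inner c2 cg2)) _.
rewrite ip_cell_indic mulrA ler_wpM2r ?ip_ge0// expr2 -mulrA -exprMn mulfV ?expr1n ?mulr1//.
Qed.

(** Jensen on each cube, then Tonelli: by symmetry of [cell_indic], integrating it over its first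
    variable again gives the volume of a cube, which cancels the normalisation. *)
Lemma avg_contraction k f : in_L2 f -> in_L2 (avg k f) /\ ip (avg k f) (avg k f) <= ip f f.
Proof.
move=> f2; have mf := in_L2_measurable f2.
have m2 : measurable_fun setT (fun p : rV * rV => (cell_indic k p.1 p.2 * f p.2 ^+ 2)%:E).
  apply/measurable_EFinP; apply: measurable_funM; first exact: measurable_cell_indic2.
  by apply: measurable_funX; apply: (measurableT_comp mf); exact: measurable_snd.
have p0 (p : rV * rV) : (0 <= (cell_indic k p.1 p.2 * f p.2 ^+ 2)%:E)%E.
  by rewrite lee_fin mulr_ge0 ?sqr_ge0// cell_indic_ge0.
have key : (\int[mu]_x ((avg k f x) ^+ 2)%:E <= \int[mu]_y (f y ^+ 2)%:E)%E.
  apply: (@le_trans _ _ (\int[mu]_x (((2 ^+ k) ^+ d)%:E *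
      \int[mu]_y (cell_indic k x y * f y ^+ 2)%:E)))%E.
    apply: ge0_le_integral => //.
    - by move=> x _; rewrite lee_fin sqr_ge0.
    - by apply/measurable_EFinP; apply: measurable_funX; exact: measurable_avg.
    - by apply: measurable_funeM; exact: (measurable_fun_fubini_tonelli_F _ m2 p0).
    - by move=> x _; exact: avg_jensen.
  rewrite ge0_integralZl_EFin ?(ltW (vol0 k))//; last 2 first.
  - by move=> x _; apply: integral_ge0 => y _; exact: (p0 (x, y)).
  - exact: (measurable_fun_fubini_tonelli_F _ m2 p0).
  rewrite (fubini_tonelli _ m2 p0) -ge0_integralZl_EFin ?(ltW (vol0 k))//; last 2 first.
  - by move=> y _; apply: integral_ge0 => x _; exact: (p0 (x, y)).
  - exact: (measurable_fun_fubini_tonelli_G _ m2 p0).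
  rewrite le_eqVlt; apply/orP; left; apply/eqP; apply: eq_integral => y _ /=.
  under eq_integral do rewrite mulrC EFinM.
  rewrite ge0_integralZl_EFin ?sqr_ge0//; last 2 first.
  - by move=> x _; rewrite lee_fin cell_indic_ge0.
  - apply/measurable_EFinP; rewrite (_ : (fun _ => _) = cell_indic k y).
      exact: measurable_cell_indic.
    by apply/funext => x; rewrite cell_indicC.
  under eq_integral do rewrite cell_indicC.
  by rewrite integral_cell_indic -!EFinM mulrCA -exprMn mulfV ?expr1n ?mulr1.
have a2 : in_L2 (avg k f).
  apply/in_L2P; split; first exact: measurable_avg.
  by apply: le_lt_trans key _; have /in_L2P[] := f2.
by split=> //; rewrite -lee_fin !EFin_ip_sqr.
Qed.

Definition grad_norm w : R := \sum_(i < d) snorm ip (wder i w).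

Lemma grad_norm_ge0 w : 0 <= grad_norm w.
Proof. by apply: sumr_ge0 => i _; exact: snorm_ge0. Qed.

(** Two points of a cube of side h = 2^-k differ by a vector of the box with half-side h. Jensen
    therefore bounds |w - avg k w|^2 by an average of |w(x + z) - w(x)|^2 over such z, to which
    [translation_estimate] applies. The factor 2^d is the ratio of the volume of that box to the
    volume of the cube. *)
Lemma dyadic_poincare k w : in_H1 w ->
  ip (w - avg k w) (w - avg k w) <= 2 ^+ d * ((2 ^+ k)^-1 * grad_norm w) ^+ 2.
Proof.
move=> w1; have w2 := in_H1_L2 w1; have mw := in_L2_measurable w2.
have [a2 _] := avg_contraction k w2; have wa2 := in_L2B w2 a2.
pose h : R := (2 ^+ k)^-1; have h0 : 0 < h by rewrite invr_gt0 exprn_gt0.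
pose B := obox (const_mx (- h) : rV) (const_mx h).
have mB : measurable B by exact: measurable_obox.
have m1B : measurable_fun setT (\1_B : rV -> R) by exact: measurable_indic.
pose F (p : rV * rV) := (\1_B p.2 * (w (p.1 + p.2) - w p.1) ^+ 2)%:E : \bar R.
have mF : measurable_fun setT F.
  apply/measurable_EFinP; apply: measurable_funM.
    by apply: (measurableT_comp m1B); exact: measurable_snd.
  apply: measurable_funX; apply: measurable_funB.
    by apply: (measurableT_comp mw); exact: measurable_fun_add_rV.
  by apply: (measurableT_comp mw); exact: measurable_fst.
have F0 p : (0 <= F p)%E by rewrite lee_fin mulr_ge0 ?sqr_ge0// indicE ler0n.
have pt x : (((w - avg k w) x ^+ 2)%:E <= ((2 ^+ k) ^+ d)%:E * \int[mu]_z F (x, z))%E.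
  have c2 := in_L2_cell_indic k x.
  pose g y := cell_indic k x y * (w y - w x).
  have mg : measurable_fun setT g.
    apply: measurable_funM; first exact: measurable_cell_indic.
    by apply: measurable_funB.
  have g2 : in_L2 g.
    have -> : g = (fun y => cell_indic k x y * w y) - (w x *: cell_indic k x).
      by apply/funext => y; rewrite /g !fctE /GRing.scale /=; ring.
    apply: in_L2B; last exact: in_L2Z.
    apply: (le_in_L2 _ w2).
      by apply: measurable_funM => //; exact: measurable_cell_indic.
    move=> y; rewrite normrM ler_piMl// /cell_indic.
    by case: eqP; rewrite ?normr1 ?normr0.
  have -> : (w - avg k w) x = - avg k g x.
    have -> : avg k g x = avg k w x - w x * ((2 ^+ k) ^+ d * ip (cell_indic k x) (cell_indic k x)).
      rewrite /avg mulrCA -mulrBr; congr (_ * _).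
      rewrite -(sip_scaler L2_semi_inner)// -(sip_subr L2_semi_inner)//; last exact: in_L2Z.
      rewrite !ipE; apply: eq_Rintegral => y _; rewrite /g !fctE /GRing.scale /=.
      by rewrite /cell_indic; case: eqP => _; rewrite ?mul1r ?mulr1 ?mul0r.
    rewrite ip_cell_indic -exprMn mulfV ?expr1n ?mulr1; first by rewrite opprB.
    by rewrite gt_eqF// exprn_gt0.
  rewrite sqrrN; apply: le_trans (avg_jensen k x g2) _.
  rewrite lee_pmul2l ?lte_fin ?vol0//.
  have mxF : measurable_fun setT (fun y => F (x, y - x)).
    apply/measurable_EFinP; apply: measurable_funM.
      by apply: (measurableT_comp m1B); exact: (measurable_shift (- x)).
    apply: measurable_funX; apply: measurable_funB; last exact: (@measurable_cst _ _ _ _ setT (w x)).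
    rewrite (_ : (fun _ => _) = w)//; apply/funext => y /=.
    by rewrite addrC subrK.
  have -> : (\int[mu]_z F (x, z) = \int[mu]_y F (x, (y - x)%R))%E.
    rewrite -(ge0_integral_shift x mxF)//; apply: eq_integral => z _.
    by rewrite addrK.
  apply: ge0_le_integral => //.
  - by move=> y _; rewrite lee_fin mulr_ge0 ?sqr_ge0// cell_indic_ge0.
  - apply/measurable_EFinP; apply: measurable_funM; last exact: measurable_funX.
    exact: measurable_cell_indic.
  move=> y _; rewrite /F /= lee_fin /g /cell_indic addrCA subrr addr0.
  case: eqP => [e|_]; last by rewrite mul0r mulr_ge0 ?sqr_ge0// indicE ler0n.
  rewrite !mul1r indicE mem_set ?mul1r// => i; rewrite !mxE -ltr_norml.
  by have := cell_norm e i.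
rewrite -lee_fin EFin_ip_sqr//.
have mFF := measurable_fun_fubini_tonelli_F F mF F0.
have mFG := measurable_fun_fubini_tonelli_G F mF F0.
apply: (@le_trans _ _ (\int[mu]_x (((2 ^+ k) ^+ d)%:E * \int[mu]_z F (x, z))))%E.
  apply: ge0_le_integral => //.
  - by move=> x _; rewrite lee_fin sqr_ge0.
  - by apply/measurable_EFinP; apply: measurable_funX; exact: in_L2_measurable.
  - by apply: measurable_funeM; exact: (mFF mu).
rewrite ge0_integralZl_EFin ?(ltW (vol0 k))//; last 2 first.
- by move=> x _; apply: integral_ge0 => z _.
- exact: (mFF mu).
rewrite (fubini_tonelli F mF F0).
apply: (@le_trans _ _ (((2 ^+ k) ^+ d)%:E * \int[mu]_z (((h * grad_norm w) ^+ 2)%:E * (\1_B z)%:E)))%E.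
  rewrite lee_pmul2l ?lte_fin ?vol0//; apply: ge0_le_integral => //.
  - by move=> z _; apply: integral_ge0 => x _.
  - exact: (mFG mu).
  - by apply: measurable_funeM; apply/measurable_EFinP; exact: measurable_indic.
  move=> z _; rewrite /F /=.
  have tz2 := in_L2_trans z w2; have dz2 := in_L2B tz2 w2.
  under eq_integral do rewrite EFinM.
  rewrite ge0_integralZl_EFin ?indicE ?ler0n//; last 2 first.
  - by move=> x _; rewrite lee_fin sqr_ge0.
  - by apply/measurable_EFinP; apply: measurable_funX; exact: (in_L2_measurable dz2).
  rewrite (_ : (\int[mu]_x _)%E = (ip (trans z w - w) (trans z w - w))%:E); last first.
    by rewrite EFin_ip_sqr.
  rewrite muleC; have [/set_mem zB|_] := boolP (z \in B); last by rewrite !mule0.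
  rewrite !mule1 lee_fin -(snorm_sqr L2_semi_inner)// lerXn2r ?nnegrE ?snorm_ge0//.
    by rewrite mulr_ge0 ?grad_norm_ge0// ltW.
  apply: le_trans (translation_estimate z w1) _; rewrite ler_wpM2r ?grad_norm_ge0//.
  apply: rV_norm_le; first exact: ltW.
  by move=> i; have := zB i; rewrite !mxE -ltr_norml => /ltW.
rewrite ge0_integralZl_EFin ?sqr_ge0//; last first.
  by apply/measurable_EFinP; exact: measurable_indic.
rewrite integral_indic// setIT.
rewrite [X in (_ * (_ * X) <= _)%E](_ : _ =
  (\prod_(i < d) Num.max 0 ((const_mx h : rV) ord0 i - (const_mx (- h)%R : rV) ord0 i)%R)%:E);
  last exact: lebesgue_rV_obox.
rewrite (eq_bigr (fun=> 2 * h)); last first.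
  by move=> i _; rewrite !mxE opprK max_r ?addr_ge0 ?(ltW h0)// mulrDl mul1r.
rewrite prodr_const card_ord -!EFinM lee_fin exprMn le_eqVlt; apply/orP; left; apply/eqP.
have hk : (2 ^+ k) ^+ d * h ^+ d = 1.
  by rewrite -exprMn /h mulfV ?expr1n// gt_eqF// exprn_gt0.
rewrite [(2 * h) ^+ d]exprMn; move: hk (2 ^+ d : R) (h ^+ 2 * grad_norm w ^+ 2).
move: ((2 ^+ k) ^+ d) (h ^+ d) => s t st u v.
by transitivity ((s * t) * (u * v)); [ring|rewrite st mul1r].
Qed.

End dyadic_averages.

(** * Pointwise inequalities for powers and for the nonlinearity *)

Section power_inequalities.
Context {R : realType}.
Implicit Types (a b c r q eta theta : R).

(** In this form Young's inequality is the tangent-line inequality for the convex function b |-> b^r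
    at the point a; the convexity estimates below derive from it. *)
Lemma young_powR r a b : 1 < r -> 0 <= a -> 0 <= b ->
  r * (a `^ (r - 1) * b) <= (r - 1) * a `^ r + b `^ r.
Proof.
move=> r1 a0 b0; have r0 : 0 < r by rewrite (lt_trans _ r1).
have r10 : 0 < r - 1 by rewrite subr_gt0.
have := @conjugate_powR _ (a `^ (r - 1)) b (r / (r - 1)) r (powR_ge0 _ _) b0
  (divr_gt0 r0 r10) r0.
rewrite -powRrM (_ : (r - 1) * (r / (r - 1)) = r); last by field; rewrite gt_eqF.
rewrite invf_div -[X in _ + X = _ -> _]div1r -mulrDl subrK divff ?gt_eqF// => /(_ erefl).
move=> h; rewrite -ler_pdivlMl//; apply: le_trans h _; rewrite le_eqVlt.
by apply/orP; left; apply/eqP; field; rewrite !gt_eqF.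
Qed.

(** Convexity of |.|^q with weights 1 - r and r at the points a/(1 - r) and b/r. The weights are
    left free so that a telescoping sum can be split repeatedly with a geometrically convergent
    constant. *)
Lemma convex_split q r a b : 1 < q -> 0 < r < 1 ->
  `|a + b| `^ q <= (1 - r) * ((1 - r)^-1 `^ q) * `|a| `^ q + r * (r^-1 `^ q) * `|b| `^ q.
Proof.
move=> q1 /andP[r0 r1]; have q0 : 0 < q by rewrite (lt_trans _ q1).
have s0 : 0 < 1 - r by rewrite subr_gt0.
apply: (@le_trans _ _ ((`|a| + `|b|) `^ q)).
  by apply: ge0_ler_powR; rewrite ?nnegrE ?addr_ge0// ?ler_normD// ltW.
rewrite -!mulrA -!powRM ?invr_ge0 ?(ltW r0) ?(ltW s0)//.
set x := (1 - r)^-1 * `|a|; set y := r^-1 * `|b|.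
have x0 : 0 <= x by rewrite mulr_ge0// invr_ge0 ltW.
have y0 : 0 <= y by rewrite mulr_ge0// invr_ge0 ltW.
have eS : `|a| + `|b| = (1 - r) * x + r * y.
  by rewrite /x /y !mulrA !mulfV ?gt_eqF// !mul1r.
have S0 : 0 <= `|a| + `|b| by rewrite addr_ge0.
move: eS S0; set S := `|a| + `|b| => eS S0.
have hx := young_powR q1 S0 x0; have hy := young_powR q1 S0 y0.
have hS : S `^ (q - 1) * S = S `^ q by rewrite mulrC mulr_powRB1.
have e : q * S `^ q = (1 - r) * (q * (S `^ (q - 1) * x)) + r * (q * (S `^ (q - 1) * y)).
  by rewrite -hS {2}eS; ring.
have h1 := ler_wpM2l (ltW s0) hx; have h2 := ler_wpM2l (ltW r0) hy.
have {h1 h2}h3 := lerD h1 h2; rewrite -e in h3.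
by move: h3; move: (S `^ q) (x `^ q) (y `^ q) => A X Y h3; lra.
Qed.

Lemma convex_half q a b : 1 < q ->
  `|a + b| `^ q <= 2 `^ q * (`|a| `^ q + `|b| `^ q).
Proof.
move=> q1; have h : 0 < (2^-1 : R) < 1 by apply/andP; split; lra.
apply: le_trans (convex_split a b q1 h) _.
rewrite (_ : 1 - 2^-1 = 2^-1 :> R); last by field.
rewrite invrK -mulrDr -mulrA ler_piMl//; last by lra.
Qed.

Definition nl p a := `|a| `^ (p - 1) * a.

Lemma norm_nl p a : 0 < p -> `|nl p a| = `|a| `^ p.
Proof. by move=> p0; rewrite normrM ger0_norm ?powR_ge0// mulrC mulr_powRB1. Qed.

Lemma nl_mul_self p a : 0 < p -> nl p a * a = `|a| `^ (p + 1).
Proof.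
move=> p0; rewrite /nl -mulrA -[X in _ * X]ger0_norm; last by rewrite -expr2 sqr_ge0.
rewrite normrM mulrA [X in X * _]mulrC mulr_powRB1// powRD ?powRr1//.
by rewrite gt_eqF// ltr_pwDl.
Qed.

Lemma powR_succ p a : 0 < p -> 0 <= a -> a `^ p * a = a `^ (p + 1).
Proof.
move=> p0 a0; rewrite powRD ?powRr1//.
by rewrite gt_eqF// ltr_pwDl.
Qed.

(** Either |c| <= eta |a| or |a| <= |c|/eta, and in each case one of the two terms dominates by
    itself. *)
Lemma young_eta p eta a c : 0 < p -> 0 < eta ->
  `|nl p a * c| <= eta * `|a| `^ (p + 1) + (eta^-1) `^ p * `|c| `^ (p + 1).
Proof.
move=> p0 e0; rewrite normrM norm_nl//.
have [h|/ltW h] := leP `|c| (eta * `|a|).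
  rewrite (@le_trans _ _ (`|a| `^ p * (eta * `|a|)))// ?ler_wpM2l ?powR_ge0//.
  by rewrite mulrCA powR_succ// lerDl mulr_ge0 ?powR_ge0.
have h' : `|a| <= eta^-1 * `|c| by rewrite ler_pdivlMl.
apply: (@le_trans _ _ ((eta^-1 * `|c|) `^ p * `|c|)).
  rewrite ler_wpM2r//; apply: ge0_ler_powR; rewrite ?nnegrE ?(ltW p0)//.
  by rewrite mulr_ge0// invr_ge0 ltW.
rewrite powRM// ?invr_ge0 ?(ltW e0)// -mulrA powR_succ//.
by rewrite lerDr mulr_ge0 ?powR_ge0 ?ltW.
Qed.

(** [nl p] is the gradient of the convex function |.|^(p+1)/(p+1). This inequality is what replaces
    the time derivative of the potential energy. *)
Lemma potential_convex p a b : 1 < p ->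
  `|b| `^ (p + 1) + (p + 1) * (nl p b * (a - b)) <= `|a| `^ (p + 1).
Proof.
move=> p1; have p0 : 0 < p by rewrite (lt_trans _ p1).
have q1 : 1 < p + 1 by rewrite ltrDr.
have := young_powR q1 (normr_ge0 b) (normr_ge0 a); rewrite addrK => h.
rewrite mulrBr nl_mul_self// mulrBr.
have : nl p b * a <= `|b| `^ p * `|a| by rewrite -norm_nl// -normrM ler_norm.
rewrite -(ler_pM2l (lt_trans ltr01 q1)).
by move: h; set X := `|b| `^ (p + 1); set Y := `|b| `^ p * _; set Z := nl p b * a; lra.
Qed.

Lemma powR_sub p a b : 1 < p -> 0 <= b -> b <= a ->
  a `^ p - b `^ p <= p * (a `^ (p - 1) * (a - b)).
Proof.
move=> p1 b0 ba; have a0 := le_trans b0 ba; have p0 : 0 < p by rewrite (lt_trans _ p1).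
have := young_powR p1 a0 b0; have := mulr_powRB1 a0 p0.
by move: (a `^ p) (b `^ p) (a `^ (p - 1)) => A B C <-; lra.
Qed.

Lemma nl_dist p s a b : 1 < p -> `|a| <= s -> `|b| <= s ->
  `|nl p a - nl p b| <= p * (s `^ (p - 1) * `|a - b|).
Proof.
move=> p1; have p0 : 0 < p by rewrite (lt_trans _ p1).
have nlN x : nl p (- x) = - nl p x by rewrite /nl normrN mulrN.
have s1 x : 0 <= x -> x <= s -> x `^ (p - 1) <= s `^ (p - 1).
  move=> x0 xs; apply: ge0_ler_powR; rewrite ?nnegrE ?subr_ge0 ?(ltW p1)//.
  exact: le_trans xs.
have nlp x : 0 <= x -> nl p x = x `^ p.
  by move=> x0; rewrite /nl ger0_norm// mulrC mulr_powRB1.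
have main x y : 0 <= y -> y <= x -> x <= s ->
    `|nl p x - nl p y| <= p * (s `^ (p - 1) * `|x - y|).
  move=> y0 yx xs; have x0 := le_trans y0 yx.
  rewrite !nlp// !ger0_norm ?subr_ge0//; last first.
    by apply: ge0_ler_powR; rewrite ?nnegrE ?(ltW p0).
  apply: le_trans (powR_sub p1 y0 yx) _.
  by rewrite ler_wpM2l ?(ltW p0)// ler_wpM2r ?subr_ge0// s1.
have main2 x y : 0 <= x -> 0 <= y -> x <= s -> y <= s ->
    `|nl p x - nl p y| <= p * (s `^ (p - 1) * `|x - y|).
  move=> x0 y0 xs ys; have [/main->//|/ltW xy] := leP y x.
  by rewrite distrC [`|x - y|]distrC main.
have opp x y : 0 <= x -> 0 <= y -> x <= s -> y <= s ->
    `|nl p x - nl p (- y)| <= p * (s `^ (p - 1) * `|x - - y|).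
  move=> x0 y0 xs ys; rewrite nlN !opprK !nlp// !ger0_norm ?addr_ge0 ?powR_ge0//.
  rewrite -(mulr_powRB1 x0 p0) -(mulr_powRB1 y0 p0).
  apply: (@le_trans _ _ (s `^ (p - 1) * (x + y))).
    by rewrite mulrDr [_ * x]mulrC [_ * y]mulrC lerD// ler_wpM2l// s1.
  by rewrite ler_peMl ?mulr_ge0 ?powR_ge0 ?addr_ge0// ltW.
have [a0|/ltW a0] := leP 0 a; have [b0|/ltW b0] := leP 0 b.
- by rewrite (ger0_norm a0) (ger0_norm b0); exact: main2.
- rewrite (ger0_norm a0) (ler0_norm b0) => ? ?.
  by rewrite -(opprK b); apply: opp; rewrite ?oppr_ge0.
- rewrite (ler0_norm a0) (ger0_norm b0) => ? ?.
  rewrite distrC [`|a - b|]distrC.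
  by rewrite -(opprK a); apply: opp; rewrite ?oppr_ge0.
- rewrite (ler0_norm a0) (ler0_norm b0) => ? ?.
  have := @main2 (- a) (- b); rewrite !nlN -!opprD !normrN => h.
  by apply: h; rewrite ?oppr_ge0.
Qed.

(** Let s be the largest of |a|, |b|, |c|, and th = eta/p. If |a - b| <= th s, the Lipschitz bound p
    s^(p-1) |a - b| costs only eta s^(p+1); otherwise s <= |a - b|/th, and |a - b|^(p+1) controls
    everything. *)
Lemma nl_diff_eta p eta : 1 < p -> 0 < eta -> exists2 C, 0 <= C & forall a b c,
  `|(nl p a - nl p b) * c| <=
    eta * (`|a| `^ (p + 1) + `|b| `^ (p + 1) + `|c| `^ (p + 1)) + C * `|a - b| `^ (p + 1).
Proof.
move=> p1 e0; have p0 : 0 < p by rewrite (lt_trans _ p1).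
pose th := eta / p; have th0 : 0 < th by rewrite divr_gt0.
exists (2 * (th^-1) `^ (p + 1)); first by rewrite mulr_ge0 ?powR_ge0.
move=> a b c; set s := Num.max `|a| (Num.max `|b| `|c|).
have as_ : `|a| <= s by rewrite le_max lexx.
have bs : `|b| <= s by rewrite !le_max lexx orbT.
have cs : `|c| <= s by rewrite !le_max lexx !orbT.
have s0 : 0 <= s := le_trans (normr_ge0 a) as_.
have sq : s `^ (p + 1) <= `|a| `^ (p + 1) + `|b| `^ (p + 1) + `|c| `^ (p + 1).
  have := powR_ge0 `|a| (p + 1); have := powR_ge0 `|b| (p + 1).
  have := powR_ge0 `|c| (p + 1).
  rewrite /s /Order.max; case: ifP => _; first case: ifP => _; move: (_ `^ _) (_ `^ _) (_ `^ _) => A B C; lra.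
have [h|/ltW h] := leP `|a - b| (th * s).
  apply: (@le_trans _ _ (eta * s `^ (p + 1))); last first.
    by apply: ler_wpDr; [rewrite !mulr_ge0 ?powR_ge0|rewrite ler_wpM2l// ltW].
  rewrite normrM; apply: (@le_trans _ _ (p * (s `^ (p - 1) * (th * s)) * s)).
    apply: ler_pM => //; apply: le_trans (nl_dist p1 as_ bs) _.
    by rewrite ler_wpM2l ?(ltW p0)// ler_wpM2l ?powR_ge0.
  rewrite -powR_succ// -(mulr_powRB1 s0 p0) /th le_eqVlt; apply/orP; left.
  by apply/eqP; move: (s `^ _) => z; field; rewrite gt_eqF.
have h' : s <= th^-1 * `|a - b| by rewrite ler_pdivlMl.
apply: (@le_trans _ _ (2 * s `^ (p + 1))).
  rewrite normrM -powR_succ// mulrA; apply: ler_pM => //.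
  apply: le_trans (ler_normB _ _) _; rewrite !norm_nl// mulr2n mulrDl mul1r.
  by apply: lerD; apply: ge0_ler_powR; rewrite ?nnegrE ?(ltW p0).
apply: ler_wpDl.
  by rewrite mulr_ge0 ?(ltW e0)// !addr_ge0 ?powR_ge0.
rewrite -mulrA ler_wpM2l// -powRM ?invr_ge0 ?(ltW th0)//.
apply: ge0_ler_powR; rewrite ?nnegrE ?addr_ge0 ?(ltW p0)//.
by rewrite mulr_ge0// invr_ge0 ltW.
Qed.

End power_inequalities.

(** * The q-th power integral *)

Section modular.
Context {R : realType} {d : nat}.
Local Notation rV := 'rV[R]_d.
Local Notation mu := (@lebesgue_rV R d).
Implicit Types (f g w : rV -> R) (x y z : rV) (k N : nat) (q : R).

(** The q-th power of the L^q norm. Without the root, pointwise inequalities integrate directly, and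
    finiteness need not be known beforehand since values are extended reals. *)
Definition modular q f : \bar R := (\int[mu]_x (`|f x| `^ q)%:E)%E.

Lemma measurable_norm_powR q f : measurable_fun setT f ->
  measurable_fun setT (fun x => `|f x| `^ q).
Proof.
move=> mf; have mn : measurable_fun setT (fun x => `|f x|) by exact: measurableT_comp.
exact: (measurableT_comp (@measurable_powR R q) mn).
Qed.

Lemma modular_ge0 q f : (0 <= modular q f)%E.
Proof. by apply: integral_ge0 => x _; rewrite lee_fin powR_ge0. Qed.

Lemma modular_le q f g (c e : R) (h : rV -> R) : measurable_fun setT f -> measurable_fun setT g ->
  measurable_fun setT h -> 0 <= c -> 0 <= e ->
  (forall x, `|h x| `^ q <= c * `|f x| `^ q + e * `|g x| `^ q) ->
  (modular q h <= c%:E * modular q f + e%:E * modular q g)%E.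
Proof.
move=> mf mg mh c0 e0 H; rewrite /modular.
have m1 := measurable_norm_powR q mf; have m2 := measurable_norm_powR q mg.
rewrite -ge0_integralZl_EFin//; last exact/measurable_EFinP.
rewrite -ge0_integralZl_EFin//; last exact/measurable_EFinP.
rewrite -ge0_integralD//; first last.
- by apply: measurable_funeM; exact/measurable_EFinP.
- by move=> x _; rewrite -EFinM lee_fin mulr_ge0 ?powR_ge0.
- by apply: measurable_funeM; exact/measurable_EFinP.
- by move=> x _; rewrite -EFinM lee_fin mulr_ge0 ?powR_ge0.
apply: ge0_le_integral => //.
- by apply/measurable_EFinP; exact: measurable_norm_powR.
- by apply: emeasurable_funD; apply: measurable_funeM; exact/measurable_EFinP.
- by move=> x _; rewrite -!EFinM -EFinD lee_fin.
Qed.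

Lemma modular_interpolation q f (m : R) : 2 < q -> in_L2 f ->
  (forall x, `|f x| <= m) -> (modular q f <= (m `^ (q - 2) * ip f f)%:E)%E.
Proof.
move=> q2 f2 fm; have mf := in_L2_measurable f2; rewrite EFinM EFin_ip_sqr//.
rewrite -ge0_integralZl_EFin ?powR_ge0//; last 2 first.
- by move=> x _; rewrite lee_fin sqr_ge0.
- by apply/measurable_EFinP; exact: measurable_funX.
apply: ge0_le_integral => //.
- by apply/measurable_EFinP; exact: measurable_norm_powR.
- by apply: measurable_funeM; apply/measurable_EFinP; exact: measurable_funX.
move=> x _; rewrite -EFinM lee_fin -real_normK ?num_real// -powR_mulrn//.
have q0 : 0 < q by rewrite (lt_trans _ q2).
have -> : `|f x| `^ q = `|f x| `^ (q - 2) * `|f x| `^ 2 by rewrite -powRD subrK// gt_eqF.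
rewrite ler_wpM2r ?powR_ge0//; apply: ge0_ler_powR; rewrite ?nnegrE ?subr_ge0 ?(ltW q2)//.
exact: le_trans (fm x).
Qed.

End modular.

(** * A subcritical Sobolev inequality with decay in the dyadic scale *)

Section sobolev_inequality.
Context {R : realType} {d : nat} (q : R) (q2 : 2 < q).
Context (A : R) (A0 : 0 < A) (A2 : A ^+ 2 = 2 ^+ d / 4) (Aq : A `^ (q - 2) < 4).
Local Notation rV := 'rV[R]_d.
Local Notation mu := (@lebesgue_rV R d).
Implicit Types (f g w : rV -> R) (x y z : rV) (k N : nat).

Let q0 : 0 < q. Proof. by rewrite (lt_trans _ q2). Qed.
Let q1 : 1 < q. Proof. by rewrite (lt_trans _ q2)// ltr1n. Qed.
Let qne : q != 0. Proof. by rewrite gt_eqF. Qed.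

(** The balance between consecutive scales: each one gains 1/4 from the square in the Poincare
    inequality and loses A^(q-2) from the sup bound on averages. Subcriticality is the statement
    that this ratio is below 1. *)
Let rho : R := A `^ (q - 2) / 4.

Let rho0 : 0 < rho. Proof. by rewrite divr_gt0// powR_gt0. Qed.
Let rho1 : rho < 1. Proof. by rewrite ltr_pdivrMr// mul1r. Qed.

Let avg_H1_L2 k w : in_H1 w -> in_L2 (avg k w) /\ in_L2 (w - avg k w).
Proof.
move=> w1; have w2 := in_H1_L2 w1; have [a2 _] := avg_contraction k w2.
by split=> //; exact: in_L2B.
Qed.

Let avg_step k w : in_H1 w ->
  avg k.+1 (w - avg k w) = avg k.+1 w - avg k w.
Proof.
move=> w1; have w2 := in_H1_L2 w1; have [a2 wa2] := avg_H1_L2 k w1.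
apply/funext => x; rewrite avgB//; rewrite [avg k.+1 (avg k w) x]avg_constant//.
- exact: measurable_avg.
- by move=> y e; apply: avg_cell; apply/esym; exact: cellS.
Qed.

Let S : R := (2 ^+ d) `^ (q - 2) * 2 ^+ d.

(** By [avg_step] the increment avg_{k+1} w - avg_k w is an average of w - avg_k w, hence small in
    L2 by Poincare and bounded in sup norm; interpolation between L2 and the sup norm gives the q-th
    power. *)
Let step_modular k w : in_H1 w ->
  (modular q (avg k.+1 w - avg k w)%R <= (S * rho ^+ k * grad_norm w `^ q)%:E)%E.
Proof.
move=> w1; have w2 := in_H1_L2 w1; have [a2 wa2] := avg_H1_L2 k w1.
rewrite -avg_step//; have [b2 bc] := avg_contraction k.+1 wa2.
have G0 := grad_norm_ge0 w; set G := grad_norm w in G0 *.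
have P := dyadic_poincare k w1; rewrite -/G in P.
have D0 : 0 < 2 ^+ d :> R by rewrite exprn_gt0.
(* [avg_bound] at scale k+1 costs 2^(d(k+1)/2), Poincare at scale k gives 2^(d/2) 2^-k G; the
   product is 2^d (2^(d/2)/2)^k G. *)
pose m := A ^+ k * (2 ^+ d * G).
have m0 : 0 <= m by rewrite mulr_ge0 ?exprn_ge0 ?mulr_ge0 ?(ltW D0) ?(ltW A0).
have bm x : `|avg k.+1 (w - avg k w) x| <= m.
  apply: le_trans (avg_bound k.+1 x wa2) _.
  rewrite -(ler_pXn2r (n := 2))// ?nnegrE ?mulr_ge0 ?sqrtr_ge0 ?snorm_ge0//.
  rewrite exprMn sqr_sqrtr ?exprn_ge0// (snorm_sqr L2_semi_inner)//.
  apply: le_trans (ler_wpM2l _ P) _; first by rewrite !exprn_ge0.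
  rewrite /m [(A ^+ k * _) ^+ 2]exprMn [(A ^+ k) ^+ 2]exprAC A2 [(2 ^+ k.+1) ^+ d]exprAC exprS expr_div_n.
  rewrite (_ : 4 ^+ k = 2 ^+ k ^+ 2); last by rewrite exprAC expr2 -natrM.
  have : 2 ^+ k != 0 :> R by rewrite gt_eqF// exprn_gt0.
  move: (2 ^+ d) (2 ^+ k) ((2 ^+ d) ^+ k) => X Y Z Y0.
  by rewrite le_eqVlt; apply/orP; left; apply/eqP; field.
apply: le_trans (modular_interpolation q2 b2 bm) _; rewrite lee_fin.
apply: le_trans (ler_wpM2l (powR_ge0 _ _) (le_trans bc P)) _.
have eG : G `^ q = G `^ (q - 2) * G ^+ 2.
  by rewrite -powR_mulrn// -powRD subrK// (negbTE qne).
rewrite /m !powRM ?mulr_ge0 ?exprn_ge0 ?(ltW A0) ?(ltW D0)// eG /rho /S.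
have -> : (A ^+ k) `^ (q - 2) = (A `^ (q - 2)) ^+ k.
  by rewrite -powR_mulrn ?(ltW A0)// powRAC powR_mulrn ?powR_ge0.
rewrite expr_div_n (_ : 4 ^+ k = 2 ^+ k ^+ 2); last by rewrite exprAC expr2 -natrM.
have : 2 ^+ k != 0 :> R by rewrite gt_eqF// exprn_gt0.
move: (G `^ (q - 2)) ((A `^ (q - 2)) ^+ k) ((2 ^+ d : R) `^ (q - 2)) => V W X.
move: (2 ^+ d : R) (2 ^+ k : R) => Y Z Z0.
by rewrite le_eqVlt; apply/orP; left; apply/eqP; field.
Qed.

(** In [convex_split] the tail of the telescoping sum is charged the factor r (1/r)^q, while it
    starts one scale later and gains rho. With r = rho^(1/q) the product is r itself ([r_rho]),
    below 1, and [B] below is the fixed point of the resulting affine recursion. *)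
Let r : R := rho `^ q^-1.
Let r01 : 0 < r < 1.
Proof.
have e1 : 1 = 1 `^ q^-1 :> R by rewrite powR1.
rewrite /r powR_gt0//= [X in _ < X]e1; apply: gt0_ltr_powR => //.
- by rewrite invr_gt0.
- by rewrite nnegrE ltW.
- by rewrite nnegrE.
Qed.
Let r_rho : r * (r^-1 `^ q) * rho = r.
Proof.
have rr : r `^ q = rho by rewrite /r -powRrM mulVf// powRr1// ltW.
have r0 : 0 < r by case/andP: r01.
rewrite -powR_inv1 ?(ltW r0)// -powRrM mulN1r powRN rr -mulrA mulVf ?mulr1//.
by rewrite gt_eqF.
Qed.

Let B : R := (1 - r) * ((1 - r)^-1 `^ q) * S / (1 - r).

Let S0 : 0 <= S. Proof. by rewrite mulr_ge0 ?powR_ge0// exprn_ge0. Qed.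
Let r'0 : 0 < 1 - r. Proof. by rewrite subr_gt0; case/andP: r01. Qed.
Let r'00 : 0 <= (1 - r) * ((1 - r)^-1 `^ q).
Proof. by rewrite mulr_ge0 ?powR_ge0// ltW. Qed.
Let r0 : 0 <= r * (r^-1 `^ q).
Proof. by rewrite mulr_ge0 ?powR_ge0//; case/andP: r01 => /ltW. Qed.
Let B0 : 0 <= B. Proof. by rewrite divr_ge0 ?(ltW r'0)// mulr_ge0. Qed.

Let telescoped N k w : in_H1 w ->
  (modular q (avg (N + k) w - avg k w)%R <= (B * rho ^+ k * grad_norm w `^ q)%:E)%E.
Proof.
move=> w1; elim: N k => [|N IH] k.
  rewrite add0n subrr /modular (eq_integral (fun=> 0%E)); last first.
    by move=> x _; rewrite normr0 powR0.
  by rewrite integral0 lee_fin mulr_ge0 ?powR_ge0// (mulr_ge0 B0)// exprn_ge0 ?(ltW rho0).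
have ma j := measurable_avg j w.
apply: (@le_trans _ _ (((1 - r) * ((1 - r)^-1 `^ q))%:E * modular q (avg k.+1 w - avg k w)%R +
   (r * (r^-1 `^ q))%:E * modular q (avg (N + k.+1) w - avg k.+1 w)%R))%E.
  apply: modular_le => //; try exact: measurable_funB.
  move=> x; rewrite addSnnS; apply: le_trans (convex_split _ _ q1 r01).
  by rewrite le_eqVlt; apply/orP; left; apply/eqP; congr (`|_| `^ _); rewrite !fctE; ring.
apply: (@le_trans _ _ (((1 - r) * ((1 - r)^-1 `^ q))%:E * (S * rho ^+ k * grad_norm w `^ q)%:E +
   (r * (r^-1 `^ q))%:E * (B * rho ^+ k.+1 * grad_norm w `^ q)%:E))%E.
  apply: leeD; apply: lee_wpmul2l; rewrite ?lee_fin//.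
  exact: step_modular.
rewrite -!EFinM -EFinD lee_fin exprS.
have -> : (1 - r) * (1 - r)^-1 `^ q * (S * rho ^+ k * grad_norm w `^ q) +
   r * r^-1 `^ q * (B * (rho * rho ^+ k) * grad_norm w `^ q) =
   ((1 - r) * (1 - r)^-1 `^ q * S + r * r^-1 `^ q * rho * B) * (rho ^+ k * grad_norm w `^ q).
  by ring.
rewrite r_rho -[leRHS]mulrA ler_wpM2r ?mulr_ge0 ?exprn_ge0 ?powR_ge0 ?(ltW rho0)// /B.
move: (_ `^ q) => X; rewrite le_eqVlt; apply/orP; left; apply/eqP; field.
by rewrite gt_eqF.
Qed.

(** [telescoped] reaches scale N + k only. The rest, w - avg_{N+k} w, tends to 0 in L2, and
    truncation at m turns this into convergence of the q-th power integral as N grows; the surviving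
    constant does not depend on m. *)
Lemma truncated_modular w k (m : nat) : in_H1 w ->
  (modular q (fun x => Num.min `|(w - avg k w)%R x| m%:R)%R <=
    (2 `^ q * (B * rho ^+ k * grad_norm w `^ q))%:E)%E.
Proof.
move=> w1; have w2 := in_H1_L2 w1; have ma j := measurable_avg j w.
have mw := in_L2_measurable w2.
pose h N := fun x => Num.min `|(w - avg (N + k) w) x| m%:R.
have mh N : measurable_fun setT (h N).
  apply: measurable_minr => //; apply: measurableT_comp => //.
  exact: measurable_funB.
have h_le N x : `|h N x| <= `|(w - avg (N + k) w) x| /\ `|h N x| <= m%:R.
  rewrite ger0_norm; last by rewrite le_min normr_ge0 ler0n.
  by rewrite !ge_min lexx lexx orbT.
have h2 N : in_L2 (h N).
  apply: (le_in_L2 (mh N) (proj2 (avg_H1_L2 (N + k) w1))) => x.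
  by have [] := h_le N x.
pose c := 2 `^ q * (m%:R `^ (q - 2) * (2 ^+ d * grad_norm w ^+ 2)).
have bound N : (modular q (h 0%N) <= (2 `^ q * (B * rho ^+ k * grad_norm w `^ q))%:E +
     (c * (4^-1) ^+ N)%:E)%E.
  apply: (@le_trans _ _ ((2 `^ q)%:E * modular q (avg (N + k) w - avg k w)%R +
     (2 `^ q)%:E * modular q (h N)))%E.
    apply: modular_le; rewrite ?powR_ge0//; first exact: measurable_funB.
    move=> x; rewrite -mulrDr.
    have := convex_half `|(avg (N + k) w - avg k w) x| `|h N x| q1.
    rewrite !normr_id; apply: le_trans; apply: ge0_ler_powR; rewrite ?nnegrE ?(ltW q0)//.
    rewrite [leRHS]ger0_norm ?addr_ge0// [leLHS]ger0_norm ?le_min ?normr_ge0 ?ler0n//.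
    rewrite [X in _ + X]ger0_norm ?le_min ?normr_ge0 ?ler0n// /h add0n.
    have tri : `|(w - avg k w) x| <= `|(avg (N + k) w - avg k w) x| + `|(w - avg (N + k) w) x|.
      apply: le_trans (ler_normD _ _); rewrite le_eqVlt; apply/orP; left.
      by apply/eqP; congr (`|_|); rewrite !fctE; ring.
    have [hm|/ltW hm] := leP `|(w - avg (N + k) w) x| m%:R.
      by rewrite ge_min tri.
    by rewrite ge_min lerDr normr_ge0 orbT.
  apply: leeD.
    rewrite [X in (_ <= X)%E]EFinM; apply: lee_wpmul2l; rewrite ?lee_fin ?powR_ge0//.
    exact: telescoped.
  have := modular_interpolation q2 (h2 N) (fun x => proj2 (h_le N x)).
  move=> /(lee_wpmul2l (powR_ge0 2 q : (0 <= (2 `^ q)%:E)%E)) /le_trans; apply.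
  rewrite -EFinM lee_fin /c -!mulrA ler_wpM2l ?powR_ge0// ler_wpM2l ?powR_ge0//.
  have hh : ip (h N) (h N) <= ip (w - avg (N + k) w) (w - avg (N + k) w).
    have [_ wa2] := avg_H1_L2 (N + k) w1.
    rewrite -!(snorm_sqr L2_semi_inner)// lerXn2r ?nnegrE ?snorm_ge0//.
    by apply: le_snorm => // x; have [] := h_le N x.
  apply: le_trans hh (le_trans (dyadic_poincare (N + k) w1) _).
  rewrite ler_wpM2l ?exprn_ge0// exprMn [leRHS]mulrA -expr2 [leLHS]mulrC ler_wpM2l ?sqr_ge0//.
  rewrite -exprVn -exprM mulnC exprM.
  rewrite (_ : (2^-1) ^+ 2 = 4^-1 :> R); last by field.
  by apply: ler_wiXn2l; rewrite ?leq_addr// ?invr_ge0// invf_le1// ler1n.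
have hlim : (2 `^ q * (B * rho ^+ k * grad_norm w `^ q))%:E + (c * (4^-1) ^+ N)%:E
    @[N --> \oo] --> (2 `^ q * (B * rho ^+ k * grad_norm w `^ q) + c * 0)%:E.
  under eq_fun do rewrite -EFinD.
  apply: cvg_to_EFin; apply: cvgD; first exact: cvg_cst.
  apply: cvgMr; apply: cvg_expr; rewrite ger0_norm ?invr_ge0// invf_lt1// ltr1n//.
rewrite mulr0 addr0 in hlim.
rewrite -(cvg_lim _ hlim)//; apply: lime_ge; first by apply/cvg_ex; eexists; exact: hlim.
by near=> N; exact: bound.
Unshelve. all: end_near. Qed.

(** Monotone convergence in the truncation level. The factor z^k is what makes fine scales uniformly
    negligible on H1-bounded sets; this is the only form in which subcriticality is used
    afterwards. *)
Lemma dyadic_sobolev : exists C z : R, [/\ 0 <= C, 0 <= z < 1 & forall w k, in_H1 w ->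
  (modular q (w - avg k w)%R <= (C * z ^+ k * grad_norm w `^ q)%:E)%E].
Proof.
exists (2 `^ q * B), rho; split; first by rewrite mulr_ge0 ?powR_ge0 ?B0.
  by rewrite (ltW rho0) rho1.
move=> w k w1; have w2 := in_H1_L2 w1; have [_ /in_L2_measurable mD] := avg_H1_L2 k w1.
pose g (m : nat) (x : rV) := (`|Num.min `|(w - avg k w) x| m%:R| `^ q)%:E.
have le_min1 (m n : nat) x : (m <= n)%N ->
    (Num.min `|(w - avg k w) x| m%:R <= Num.min `|(w - avg k w) x| n%:R).
  by move=> mn; rewrite le_min !ge_min lexx /= ler_nat mn orbT.
have min0 (m : nat) x : 0 <= Num.min `|(w - avg k w) x| m%:R.
  by rewrite le_min normr_ge0 ler0n.
have mg m : measurable_fun setT (g m).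
  apply/measurable_EFinP; apply: measurable_norm_powR; apply: measurable_minr => //.
  exact: measurableT_comp.
have nd (x : rV) : setT x -> {homo (fun n => g n x) : m n / (m <= n)%N >-> (m <= n)%E}.
  move=> _ m n mn; rewrite lee_fin; apply: ge0_ler_powR; rewrite ?nnegrE ?(ltW q0)//.
  by rewrite (ger0_norm (min0 m x)) (ger0_norm (min0 n x)); exact: le_min1.
have hlim : (\int[mu]_x g m x)%E @[m --> \oo] --> (\int[mu]_x limn (g^~ x))%E.
  by apply: cvg_monotone_convergence => // n x _; rewrite lee_fin powR_ge0.
have -> : modular q (w - avg k w)%R = (\int[mu]_x limn (g^~ x))%E.
  apply: eq_integral => x _; apply/esym/cvg_lim => //; apply: cvg_to_EFin.
  apply: cvg_near_cst.
  near=> n; rewrite min_l ?normr_id//.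
  near: n; exists (Num.trunc `|(w - avg k w) x|).+1 => // n /= hn.
  apply: le_trans (ltW (truncnS_gt _)) _; rewrite ler_nat//.
rewrite -(cvg_lim _ hlim)//; apply: lime_le; first by apply/cvg_ex; eexists; exact: hlim.
by near=> m; apply: le_trans (truncated_modular k m w1) _; rewrite lee_fin !mulrA.
Unshelve. all: end_near. Qed.

End sobolev_inequality.

Lemma geometric_small {R : realType} (C z e : R) : 0 <= z < 1 -> 0 < e ->
  exists k : nat, C * z ^+ k <= e.
Proof.
move=> /andP[z0 z1] e0.
have h : C * z ^+ k @[k --> \oo] --> C * 0.
  by apply: cvgMr; apply: cvg_expr; rewrite ger0_norm.
rewrite mulr0 in h; move/cvgrPdist_le : h => /(_ _ e0)[k _ /(_ k (leqnn k))] /=.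
by rewrite sub0r normrN => hk; exists k; apply: le_trans (ler_norm _) hk.
Qed.

Lemma finite_cells {R : realType} {d : nat} k (M : R) :
  exists (I : finType) (y : I -> 'rV[R]_d),
    forall x, `|x| <= M -> exists i, cell k x = cell k (y i).
Proof.
have [K hK] : exists K : nat, 2 ^+ k * M < K%:R.
  by exists (Num.trunc (2 ^+ k * M)).+1; exact: truncnS_gt.
have k0 : 0 < 2 ^+ k :> R by rewrite exprn_gt0.
exists {ffun 'I_d -> 'I_(K + K).+1}.
exists (fun g : {ffun 'I_d -> 'I_(K + K).+1} => \row_i ((2 ^+ k)^-1 * ((g i)%:Z - K%:Z)%:~R)) => x xM.
have xi i : - K%:R < 2 ^+ k * x ord0 i < K%:R.
  rewrite -ltr_norml normrM gtr0_norm//; apply: le_lt_trans hK.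
  by rewrite ler_wpM2l ?(ltW k0)//; apply: le_trans xM; exact: coord_le_norm.
have fl i : (- K%:Z <= Num.floor (2 ^+ k * x ord0 i) < K%:Z)%R.
  have /andP[h1 h2] := xi i.
  rewrite floor_ge_int floor_lt_int.
  by rewrite intrN !(ltW h1).
exists [ffun i => inord (absz (Num.floor (2 ^+ k * x ord0 i) + K%:Z))].
apply/ffunP => i; rewrite !ffunE !mxE mulrA mulfV ?gt_eqF// mul1r ffunE.
have /andP[h1 h2] := fl i; rewrite inordK; last first.
  rewrite ltnS -lez_nat PoszD gez0_abs ?lerD2r ?(ltW h2)//.
  by rewrite -lerBlDr sub0r.
rewrite gez0_abs; last by rewrite -lerBlDr sub0r.
by rewrite addrK intrKfloor.
Qed.

Lemma two_sided_bound {R : realFieldType} (a b X Y A B K m : R) :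
  b + m * X <= a -> a + m * Y <= b -> 0 <= A -> 0 <= B -> 0 < m ->
  - X <= B + K -> - Y <= A + K -> `|a - b| <= m * (A + B + K).
Proof.
move=> h1 h2 A0 B0 m0 hX hY; rewrite ler_norml.
have {hX}hX : m * - X <= m * (B + K) by rewrite ler_wpM2l// ltW.
have {hY}hY : m * - Y <= m * (A + K) by rewrite ler_wpM2l// ltW.
have mA : 0 <= m * A by rewrite mulr_ge0// ltW.
have mB : 0 <= m * B by rewrite mulr_ge0// ltW.
by apply/andP; split; lra.
Qed.

Lemma dist_three {R : realFieldType} (a b a' b' e : R) :
  `|a - a'| <= e / 8 + e / 8 -> `|b - b'| <= e / 8 + e / 8 ->
  `|a' - b'| <= e / 4 + e / 4 -> `|a - b| <= e.
Proof.
rewrite !ler_norml => /andP[? ?] /andP[? ?] /andP[? ?]; apply/andP; split; lra.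
Qed.

(** * The potential on H1: bounds, vanishing, weak continuity *)

Section Lq_functional.
Context {R : realType} {d : nat} (p : R) (p1 : 1 < p).
Context (C0 z0 : R) (C00 : 0 <= C0) (z01 : 0 <= z0 < 1).
Local Notation rV := 'rV[R]_d.
Local Notation mu := (@lebesgue_rV R d).
Local Notation test := (@test_function R 'rV[R]_d setT).
Context (dyadic : forall (w : rV -> R) k, in_H1 w ->
  (modular (p + 1) (w - avg k w)%R <= (C0 * z0 ^+ k * grad_norm w `^ (p + 1))%:E)%E).
Implicit Types (a b c f g u w : rV -> R) (x y z : rV) (k : nat) (e eta S : R).

Let p0 : 0 < p. Proof. by rewrite (lt_trans _ p1). Qed.
Let q0 : 0 < p + 1. Proof. by rewrite ltr_wpDl ?ltr01// ltW. Qed.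
Let q1 : 1 < p + 1. Proof. by rewrite ltrDr. Qed.
Let q2 : 2 < p + 1. Proof. by rewrite (_ : 2 = 1 + 1) ?ltrD2r// . Qed.

Definition nlf u : rV -> R := fun x => nl p (u x).
(** Without the factor 1/(p+1) of the energy; in this form it equals the pairing of u with its own
    nonlinearity. *)
Definition pot u : R := \int[mu]_x `|u x| `^ (p + 1).

Let measurable_H1 u : in_H1 u -> measurable_fun setT u.
Proof. by move=> /in_H1_L2/in_L2_measurable. Qed.

Lemma measurable_nlf u : measurable_fun setT u -> measurable_fun setT (nlf u).
Proof. by move=> mu_; apply: measurable_funM => //; exact: measurable_norm_powR. Qed.

Lemma grad_norm_le w S : in_H1 w -> snorm ip1 w <= S -> grad_norm w <= d%:R * S.
Proof.
move=> w1 wS; rewrite mulr_natl -{2}(card_ord d) -sumr_const; apply: ler_sum => i _.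
exact: le_trans (snorm_wd_le_H1 i w1) wS.
Qed.

Let dyadic_le w k S : in_H1 w -> snorm ip1 w <= S ->
  (modular (p + 1) (w - avg k w)%R <= (C0 * (d%:R * S) `^ (p + 1) * z0 ^+ k)%:E)%E.
Proof.
move=> w1 wS; apply: le_trans (dyadic k w1) _; rewrite lee_fin mulrAC.
rewrite ler_wpM2r ?exprn_ge0//; first by case/andP: z01.
rewrite ler_wpM2l//; apply: ge0_ler_powR; rewrite ?nnegrE ?(ltW q0)//.
- exact: grad_norm_ge0.
- by rewrite mulr_ge0//; apply: le_trans wS; exact: snorm_ge0.
- exact: grad_norm_le.
Qed.

Let modular_dyadic w k m S : in_H1 w -> snorm ip1 w <= S -> (forall x, `|avg k w x| <= m) ->
  (modular (p + 1) w <= (2 `^ (p + 1) * (m `^ (p - 1) * S ^+ 2 +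
     C0 * (d%:R * S) `^ (p + 1) * z0 ^+ k))%:E)%E.
Proof.
move=> w1 wS am; have w2 := in_H1_L2 w1; have [a2 ac] := avg_contraction k w2.
rewrite mulrDr EFinD.
apply: (@le_trans _ _ ((2 `^ (p + 1))%:E * modular (p + 1) (avg k w) +
   (2 `^ (p + 1))%:E * modular (p + 1) (w - avg k w)%R))%E.
  apply: modular_le; rewrite ?powR_ge0//.
  - exact: measurable_avg.
  - by apply: measurable_funB; [exact: measurable_H1|exact: measurable_avg].
  - exact: measurable_H1.
  - move=> x; rewrite -mulrDr; apply: le_trans _ (convex_half _ _ q1).
    by rewrite le_eqVlt; apply/orP; left; apply/eqP; congr (`|_| `^ _); rewrite !fctE; ring.
have h := modular_interpolation q2 a2 am; have h2 := dyadic_le k w1 wS.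
apply: leeD; rewrite EFinM; apply: lee_wpmul2l; rewrite ?lee_fin ?powR_ge0//.
apply: le_trans h _; rewrite lee_fin (_ : p + 1 - 2 = p - 1); last by ring.
rewrite ler_wpM2l ?powR_ge0//; apply: le_trans ac _.
rewrite -(snorm_sqr L2_semi_inner)// lerXn2r ?nnegrE ?snorm_ge0//.
  by apply: le_trans wS; exact: snorm_ge0.
exact: le_trans (snorm_le_H1 w1) wS.
Qed.

(** At scale k = 0 the cubes have volume 1, so averages are bounded by the L2 norm and the coarse
    and fine parts both scale like the power p + 1 of the H1 norm. *)
Lemma pot_modular_bound : exists2 C, 0 <= C & forall u, in_H1 u ->
  (modular (p + 1) u <= (C * snorm ip1 u `^ (p + 1))%:E)%E.
Proof.
exists (2 `^ (p + 1) * (1 + C0 * d%:R `^ (p + 1))).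
  by rewrite mulr_ge0 ?powR_ge0 ?addr_ge0 ?mulr_ge0 ?powR_ge0.
move=> u u1; have S0 := snorm_ge0 ip1 u.
have am x : `|avg 0 u x| <= snorm ip1 u.
  apply: le_trans (avg_bound 0 x (in_H1_L2 u1)) _.
  by rewrite expr0 expr1n sqrtr1 mul1r snorm_le_H1.
apply: le_trans (modular_dyadic u1 (lexx _) am) _; rewrite lee_fin expr0 mulr1.
rewrite -mulrA ler_wpM2l ?powR_ge0// mulrDl mul1r powRM// -mulrA lerD2r.
have ep : p - 1 + 2 = p + 1 by ring.
by rewrite -powR_mulrn// -powRD ep// gt_eqF.
Qed.

Lemma modular_fin u : in_H1 u -> (modular (p + 1) u < +oo)%E.
Proof.
by move=> u1; have [C _ /(_ _ u1)/le_lt_trans->//] := pot_modular_bound; rewrite ltry.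
Qed.

Lemma pot_integrable u : in_H1 u ->
  mu.-integrable setT (EFin \o (fun x => `|u x| `^ (p + 1))).
Proof.
move=> u1; apply/integrableP; split.
  by apply/measurable_EFinP; apply: measurable_norm_powR; exact: measurable_H1.
apply: le_lt_trans (modular_fin u1); rewrite /modular le_eqVlt; apply/orP; left; apply/eqP.
by apply: eq_integral => x _; rewrite /= ger0_norm ?powR_ge0.
Qed.

Lemma EFin_pot u : in_H1 u -> (pot u)%:E = modular (p + 1) u.
Proof.
move=> u1; rewrite /pot /Rintegral fineK// ge0_fin_numE ?modular_fin//.
exact: modular_ge0.
Qed.

Lemma pot_ge0 u : 0 <= pot u.
Proof. by apply: Rintegral_ge0 => x _; exact: powR_ge0. Qed.

Lemma pot_bound : exists2 C, 0 <= C & forall u, in_H1 u ->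
  pot u <= C * snorm ip1 u `^ (p + 1).
Proof.
have [C C_ h] := pot_modular_bound; exists C => // u u1.
by rewrite -lee_fin EFin_pot//; exact: h.
Qed.

(** Lions' vanishing lemma: k is fixed first, to make the scales finer than 2^-k contribute at most
    half of e, and then m, to control the coarse part by interpolation. Both depend only on S and
    e. *)
Lemma pot_vanish S e : 0 < e -> exists k, exists2 m, 0 < m &
  forall w, in_H1 w -> snorm ip1 w <= S -> (forall x, `|avg k w x| <= m) -> pot w <= e.
Proof.
move=> e0; have D0 : 0 < 2 `^ (p + 1) :> R by rewrite powR_gt0.
have e2 : 0 < e / 2 / 2 `^ (p + 1) by rewrite !divr_gt0.
have [k hk] := geometric_small (C0 * (d%:R * S) `^ (p + 1)) z01 e2.
pose r := e / 2 / 2 `^ (p + 1) / (1 + S ^+ 2).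
have S1 : 0 < 1 + S ^+ 2 by rewrite ltr_wpDr ?sqr_ge0.
have r0 : 0 < r by rewrite divr_gt0.
exists k, (r `^ (p - 1)^-1); first by rewrite powR_gt0.
move=> w w1 wS am; rewrite -lee_fin EFin_pot//.
apply: le_trans (modular_dyadic w1 wS am) _; rewrite lee_fin.
rewrite -powRrM mulVf ?powRr1 ?(ltW r0)//; last by rewrite gt_eqF// subr_gt0.
apply: (@le_trans _ _ (2 `^ (p + 1) * (e / 2 / 2 `^ (p + 1) + e / 2 / 2 `^ (p + 1)))).
  rewrite ler_wpM2l ?powR_ge0// lerD// /r -mulrA ler_piMr ?(ltW e2)//.
  by rewrite ler_pdivrMl// mulr1 lerDr.
rewrite le_eqVlt; apply/orP; left; apply/eqP.
by move: D0; move: (2 `^ _) => Y Y0; field; rewrite gt_eqF.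
Qed.

(** At the fixed scale of [pot_vanish] all averages are controlled by the L2 norm. *)
Lemma pot_small_L2 S e : 0 < e -> exists2 m, 0 < m &
  forall w, in_H1 w -> snorm ip1 w <= S -> snorm ip w <= m -> pot w <= e.
Proof.
move=> /(pot_vanish S)[k [m m0 h]].
have V : 0 < Num.sqrt ((2 ^+ k) ^+ d) :> R by rewrite sqrtr_gt0 !exprn_gt0.
exists (m / Num.sqrt ((2 ^+ k) ^+ d)); first by rewrite divr_gt0.
move=> w w1 wS wm; apply: h => // x.
apply: le_trans (avg_bound k x (in_H1_L2 w1)) _.
by rewrite mulrC -ler_pdivlMr.
Qed.

Lemma nlf_integrable u c : in_H1 u -> in_H1 c ->
  mu.-integrable setT (EFin \o (fun x => nlf u x * c x)).
Proof.
move=> u1 c1.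
apply: (@le_integrable _ _ _ mu setT _ _
  (fun x => (1 * `|u x| `^ (p + 1))%:E + (1^-1 `^ p * `|c x| `^ (p + 1))%:E)%E) => //.
- apply/measurable_EFinP; apply: measurable_funM; last exact: measurable_H1.
  by apply: measurable_nlf; exact: measurable_H1.
- move=> x _; rewrite -EFinD /= lee_fin [leRHS]ger0_norm; last first.
    by rewrite addr_ge0 ?mulr_ge0 ?powR_ge0.
  exact: young_eta.
- apply: integrableD => //; apply: integrable_scale; exact: pot_integrable.
Qed.

Lemma ip_nlf_self u : in_H1 u -> ip (nlf u) u = pot u.
Proof.
move=> u1; rewrite ipE /pot; apply: eq_Rintegral => x _; exact: nl_mul_self.
Qed.

Lemma ip_nlfD u b c : in_H1 u -> in_H1 b -> in_H1 c ->
  ip (nlf u) (b + c) = ip (nlf u) b + ip (nlf u) c.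
Proof.
move=> u1 b1 c1; rewrite !ipE -RintegralD ?nlf_integrable//.
by apply: eq_Rintegral => x _; rewrite fctE mulrDr.
Qed.

Lemma ip_nlfZ u r c : in_H1 u -> in_H1 c -> ip (nlf u) (r *: c) = r * ip (nlf u) c.
Proof.
move=> u1 c1; rewrite !ipE -RintegralZl ?nlf_integrable//.
by apply: eq_Rintegral => x _; rewrite fctE mulrCA.
Qed.

Lemma ip_nlfB u b c : in_H1 u -> in_H1 b -> in_H1 c ->
  ip (nlf u) (b - c) = ip (nlf u) b - ip (nlf u) c.
Proof.
move=> u1 b1 c1; rewrite -scaleN1r ip_nlfD ?ip_nlfZ ?mulN1r//.
by have := sip_domZ H1_semi_inner (-1) c1.
Qed.

Lemma ip_nlf_eta u c eta : in_H1 u -> in_H1 c -> 0 < eta ->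
  `|ip (nlf u) c| <= eta * pot u + (eta^-1) `^ p * pot c.
Proof.
move=> u1 c1 e0; rewrite ipE.
have i1 := integrable_scale eta (pot_integrable u1).
have i2 := integrable_scale ((eta^-1) `^ p) (pot_integrable c1).
apply: le_trans (le_normr_Rintegral measurableT (nlf_integrable u1 c1)) _.
rewrite /pot -!RintegralZl ?pot_integrable// -RintegralD//.
apply: le_Rintegral => //.
- exact: (integrable_norm (nlf_integrable u1 c1)).
- exact: (integrableD _ i1 i2).
- by move=> x _; exact: young_eta.
Qed.

Lemma pot_convex a b : in_H1 a -> in_H1 b ->
  pot b + (p + 1) * ip (nlf b) (a - b) <= pot a.
Proof.
move=> a1 b1; have ab := in_H1B a1 b1; rewrite ipE.
have i2 := integrable_scale (p + 1) (nlf_integrable b1 ab).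
rewrite /pot -RintegralZl ?nlf_integrable// -RintegralD ?pot_integrable//.
apply: le_Rintegral; rewrite ?pot_integrable//.
- exact: (integrableD _ (pot_integrable b1) i2).
- by move=> x _; exact: potential_convex.
Qed.

(** [pot_convex] used in both directions bounds the difference by pairings of the two gradients with
    a - b. *)
Lemma pot_dist a b eta : in_H1 a -> in_H1 b -> 0 < eta ->
  `|pot a - pot b| <= (p + 1) * (eta * (pot a + pot b) + (eta^-1) `^ p * pot (a - b)).
Proof.
move=> a1 b1 e0; have ab := in_H1B a1 b1; have ba := in_H1B b1 a1.
have h1 := pot_convex a1 b1; have h2 := pot_convex b1 a1.
have /ler_normlP[k1 k1'] := ip_nlf_eta b1 ab e0.
have /ler_normlP[k2 k2'] := ip_nlf_eta a1 ba e0.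
have sym : pot (b - a) = pot (a - b).
  by apply: eq_Rintegral => x _; rewrite !fctE distrC.
rewrite sym in k2 k2'.
have := two_sided_bound h1 h2 (mulr_ge0 (ltW e0) (pot_ge0 a)) (mulr_ge0 (ltW e0) (pot_ge0 b)).
by rewrite [eta * (_ + _)]mulrDr => /(_ _ q0 k1 k2).
Qed.

Lemma pot_trans z u : in_H1 u -> pot (trans z u) = pot u.
Proof.
move=> /measurable_H1 mu_; rewrite /pot.
by rewrite -(Rintegral_shift z (measurable_norm_powR (p + 1) mu_)).
Qed.

Lemma ip_nlf_trans z u c : in_H1 u -> in_H1 c ->
  ip (nlf (trans z u)) (trans z c) = ip (nlf u) c.
Proof.
move=> /measurable_H1 mu_ /measurable_H1 mc; rewrite !ipE.
by rewrite -(Rintegral_shift z (measurable_funM (measurable_nlf mu_) mc)).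
Qed.

(** The function h stands for a - b cut off to a set containing all points where c is nonzero: for a
    compactly supported c, local smallness of a - b is then enough. *)
Lemma ip_nlf_diff_eta eta : 0 < eta -> exists2 C, 0 <= C & forall a b c (h : rV -> R),
  in_H1 a -> in_H1 b -> in_H1 c -> measurable_fun setT h ->
  (forall x, `|h x| <= `|a x - b x|) -> (forall x, c x != 0 -> h x = a x - b x) ->
  `|ip (nlf a) c - ip (nlf b) c| <=
    eta * (pot a + pot b + pot c) + C * pot h.
Proof.
move=> e0; have [C C_ hC] := nl_diff_eta p1 e0; exists C => // a b c h a1 b1 c1 mh hab hc.
have ab := in_H1B a1 b1; have ih : mu.-integrable setT (EFin \o (fun x => `|h x| `^ (p + 1))).
  apply: (le_integrable measurableT _ _ (pot_integrable ab)).
    by apply/measurable_EFinP; exact: measurable_norm_powR.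
  move=> x _ /=; rewrite lee_fin [leLHS]ger0_norm ?powR_ge0// [leRHS]ger0_norm ?powR_ge0//.
  by apply: ge0_ler_powR; rewrite ?nnegrE ?(ltW q0)//; exact: hab.
have i1 := nlf_integrable a1 c1; have i2 := nlf_integrable b1 c1.
have i3 := integrable_scale C ih.
have iab := integrableD measurableT (pot_integrable a1) (pot_integrable b1).
have iabc := integrableD measurableT iab (pot_integrable c1).
have i4 := integrable_scale eta iabc.
have i12 := integrableB measurableT i1 i2.
have e : ip (nlf a) c - ip (nlf b) c = \int[mu]_x (nlf a x * c x - nlf b x * c x).
  by rewrite !ipE RintegralB.
have {}e : `|ip (nlf a) c - ip (nlf b) c| <= \int[mu]_x `|nlf a x * c x - nlf b x * c x|.
  by rewrite e; exact: (le_normr_Rintegral measurableT i12).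
apply: le_trans e _; rewrite /pot -[X in _ <= _ * X + _](_ : \int[mu]_x
   (`|a x| `^ (p + 1) + `|b x| `^ (p + 1) + `|c x| `^ (p + 1)) = _); last first.
  by rewrite (RintegralD measurableT iab (pot_integrable c1))
    (RintegralD measurableT (pot_integrable a1) (pot_integrable b1)).
rewrite -(RintegralZl eta measurableT iabc) -(RintegralZl C measurableT ih).
rewrite -(RintegralD measurableT i4 i3).
apply: (le_Rintegral measurableT (integrable_norm i12) (integrableD measurableT i4 i3)).
move=> x _; rewrite /= -mulrBl.
have [->|/hc ->] := eqVneq (c x) 0; last exact: hC.
rewrite mulr0 normr0; apply: addr_ge0; last by apply: mulr_ge0 => //; exact: powR_ge0.
by apply: mulr_ge0; rewrite ?(ltW e0)// !addr_ge0 ?powR_ge0.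
Qed.

(** A quantitative Rellich theorem: averages over the cubes near a ball control the power p + 1 on
    that ball. The splitting into coarse and fine parts comes before the cutoff, since the cut-off
    function leaves H1. *)
Lemma pot_local (M S e : R) : 0 <= M -> 0 < e -> exists k, exists2 m, 0 < m & forall w, in_H1 w ->
  snorm ip1 w <= S -> (forall x, `|x| <= M + 1 -> `|avg k w x| <= m) ->
  pot (fun x => box_indic M x * w x) <= e.
Proof.
move=> M0 e0; have D0 : 0 < 2 `^ (p + 1) :> R by rewrite powR_gt0.
have e2 : 0 < e / 2 / 2 `^ (p + 1) by rewrite !divr_gt0.
have [k hk] := geometric_small (C0 * (d%:R * S) `^ (p + 1)) z01 e2.
pose V : R := ip (@box_indic R d M) (box_indic M).
have V0 : 0 <= V := ip_ge0 _.
(* V is the volume of the cube, and m is taken so that m^(p+1) V fits into half of the budget. *)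
pose r := e / 2 / 2 `^ (p + 1) / (1 + V).
have V1 : 0 < 1 + V by rewrite ltr_wpDr.
have r0 : 0 < r by rewrite divr_gt0.
pose m := r `^ (p + 1)^-1; have m0 : 0 < m by rewrite powR_gt0.
exists k, m => // w w1 wS am.
have w2 := in_H1_L2 w1; have [a2 ac] := avg_contraction k w2.
have B2 := @in_L2_box_indic R d M; have mB := in_L2_measurable B2.
have ma := measurable_avg k w; have mw := measurable_H1 w1.
pose h1 := fun x => box_indic M x * avg k w x.
pose h2 := fun x => box_indic M x * (w - avg k w) x.
have mh1 : measurable_fun setT h1 by exact: measurable_funM.
have mh2 : measurable_fun setT h2 by apply: measurable_funM => //; exact: measurable_funB.
have ind01 x : box_indic M x = 0 \/ box_indic M x = 1.
  by rewrite /box_indic indicE; case: (_ \in _); [right|left].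
have h1m x : `|h1 x| <= `|(m *: box_indic M) x|.
  rewrite /h1 fctE normrM [leRHS]normrM [leRHS]mulrC (ger0_norm (ltW m0)).
  have [->|e1] := ind01 x; first by rewrite normr0 !mul0r.
  rewrite ler_wpM2l//; apply: am; apply: rV_norm_le.
    by rewrite addr_ge0.
  move=> i; move: e1; rewrite /box_indic indicE.
  case: (boolP (_ \in _)) => [/set_mem/(_ i) xB _|_ /eqP]; last by rewrite eq_sym oner_eq0.
  by move: xB; rewrite !mxE -ltr_norml => /ltW.
have mB2 := in_L2Z m B2.
have h12 : in_L2 h1 by exact: le_in_L2 h1m.
have h1m' x : `|h1 x| <= m.
  apply: le_trans (h1m x) _; rewrite fctE normrM (ger0_norm (ltW m0)) ler_piMr ?(ltW m0)//.
  by have [->|->] := ind01 x; rewrite ?normr0 ?normr1.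
have ip_h1 : ip h1 h1 <= m ^+ 2 * V.
  rewrite -(snorm_sqr L2_semi_inner)//.
  apply: (@le_trans _ _ (snorm ip (m *: box_indic M) ^+ 2)).
    by rewrite lerXn2r ?nnegrE ?snorm_ge0//; exact: le_snorm.
  rewrite (snormZ L2_semi_inner)// exprMn (snorm_sqr L2_semi_inner)//.
  by rewrite (ger0_norm (ltW m0)).
have fin1 := modular_interpolation q2 h12 h1m'.
have b1 : (modular (p + 1) h1 <= (e / 2 / 2 `^ (p + 1))%:E)%E.
  apply: le_trans fin1 _; rewrite lee_fin.
  apply: le_trans (ler_wpM2l (powR_ge0 _ _) ip_h1) _.
  rewrite mulrA -powR_mulrn ?(ltW m0)// -powRD subrK ?(gt_eqF q0)//.
  rewrite /m -powRrM mulVf ?(gt_eqF q0)// powRr1 ?(ltW r0)// /r -[leLHS]mulrA ler_piMr ?(ltW e2)//.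
  by rewrite ler_pdivrMl// mulr1 lerDr.
have b2 : (modular (p + 1) h2 <= (e / 2 / 2 `^ (p + 1))%:E)%E.
  apply: (@le_trans _ _ (modular (p + 1) (w - avg k w)%R)).
    apply: ge0_le_integral => //.
    - by apply/measurable_EFinP; exact: measurable_norm_powR.
    - by apply/measurable_EFinP; apply: measurable_norm_powR; exact: measurable_funB.
    move=> x _; rewrite lee_fin; apply: ge0_ler_powR; rewrite ?nnegrE ?(ltW q0)//.
    rewrite /h2 normrM ler_piMl//.
    by have [->|->] := ind01 x; rewrite ?normr0 ?normr1.
  by apply: le_trans (dyadic_le k w1 wS) _; rewrite lee_fin.
rewrite -lee_fin.
have mm : (modular (p + 1) (fun x => (box_indic M x * w x)%R) <= e%:E)%E.
  apply: (@le_trans _ _ ((2 `^ (p + 1))%:E * modular (p + 1) h1 +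
     (2 `^ (p + 1))%:E * modular (p + 1) h2))%E.
    apply: modular_le; rewrite ?powR_ge0//; first exact: measurable_funM.
    move=> x; rewrite -mulrDr; apply: le_trans _ (convex_half _ _ q1).
    by rewrite le_eqVlt; apply/orP; left; apply/eqP; congr (`|_| `^ _); rewrite /h1 /h2 !fctE; ring.
  apply: (@le_trans _ _ ((2 `^ (p + 1))%:E * (e / 2 / 2 `^ (p + 1))%:E +
     (2 `^ (p + 1))%:E * (e / 2 / 2 `^ (p + 1))%:E))%E.
    have D : (0 <= (2 `^ (p + 1))%:E)%E by rewrite lee_fin powR_ge0.
    exact: (leeD (lee_wpmul2l D b1) (lee_wpmul2l D b2)).
  rewrite -!EFinM -EFinD lee_fin le_eqVlt; apply/orP; left; apply/eqP.
  by move: D0; move: (2 `^ _) => Y Y0; field; rewrite gt_eqF.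
rewrite /pot /Rintegral fineK//.
by rewrite ge0_fin_numE ?modular_ge0//; apply: le_lt_trans mm _; rewrite ltry.
Qed.

Lemma test_dense_pot c e : in_H1 c -> 0 < e -> exists2 phi, test phi & pot (c - phi) <= e.
Proof.
move=> c1 /(pot_small_L2 1)[m m0 h].
have m1 : 0 < Num.min 1 m by rewrite lt_min ltr01.
have [phi tphi] := test_dense_H1 c1 m1.
have [phi1 _] := test_in_H1 tphi; have cp := in_H1B c1 phi1.
rewrite (snorm_distC H1_semi_inner)// le_min => /andP[h1 h2].
exists phi => //; apply: h => //; exact: le_trans (snorm_le_H1 cp) h2.
Qed.

(** Replace c by a test function, uniformly over the bounded family; then only a fixed ball matters,
    and there weak convergence gives local L^{p+1} convergence. The filter is arbitrary: it is nbhs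
    t for continuity in time and an ultrafilter for the profiles. *)
Lemma ip_nlf_weak_cvg (T : Type) (F : set_system T) (FF : Filter F) (u : T -> rV -> R) Q c S :
  (forall n, in_H1 (u n)) -> (forall n, snorm ip1 (u n) <= S) -> in_H1 Q -> in_H1 c ->
  (forall g, in_L2 g -> ip g (u n) @[n --> F] --> ip g Q) ->
  ip (nlf (u n)) c @[n --> F] --> ip (nlf Q) c.
Proof.
move=> u1 uS Q1 c1 wk; apply/cvgrPdist_le => e e0.
have [C C_ hC] := pot_bound.
pose P := C * `|S| `^ (p + 1) + pot Q.
have P0 : 0 <= P by rewrite addr_ge0 ?pot_ge0// mulr_ge0// powR_ge0.
have uP n : pot (u n) <= P.
  apply: le_trans (hC _ (u1 n)) _; rewrite /P -[leLHS]addr0 lerD ?pot_ge0//.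
  rewrite ler_wpM2l//; apply: ge0_ler_powR; rewrite ?nnegrE ?(ltW q0)//; first exact: snorm_ge0.
  exact: le_trans (uS n) (ler_norm _).
have QP : pot Q <= P by rewrite /P lerDr mulr_ge0// powR_ge0.
pose eta := e / 8 / (P + 1); have P1 : 0 < P + 1 by rewrite ltr_wpDl.
have eta0 : 0 < eta by rewrite !divr_gt0.
pose D := eta^-1 `^ p; have D0 : 0 < D by rewrite powR_gt0// invr_gt0.
have [phi tphi hphi] := test_dense_pot c1 (divr_gt0 (divr_gt0 e0 (ltr0n R 8)) D0).
have [phi1 _] := test_in_H1 tphi; have cp := in_H1B c1 phi1.
have small v : in_H1 v -> pot v <= P -> `|ip (nlf v) c - ip (nlf v) phi| <= e / 8 + e / 8.
  move=> v1 vP; rewrite -ip_nlfB//; apply: le_trans (ip_nlf_eta v1 cp eta0) _.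
  apply: lerD; last by rewrite -ler_pdivlMl// mulrC.
  rewrite /eta mulrAC -mulrA ler_piMr ?divr_ge0 ?(ltW e0)// ler_pdivrMr// mul1r.
  by apply: le_trans vP _; rewrite lerDl.
pose W := 2 * P + pot phi; have W0 : 0 <= W by rewrite addr_ge0 ?mulr_ge0 ?pot_ge0.
have W1 : 0 < W + 1 by rewrite ltr_wpDl.
have [K K0 hK] := ip_nlf_diff_eta (divr_gt0 (divr_gt0 e0 (ltr0n R 4)) W1).
have K1 : 0 < K + 1 by rewrite ltr_wpDl.
have [M M0 phi0] : exists2 M : R, 0 <= M & forall x, M < `|x| -> phi x = 0.
  by have [M M0 hM] := test_support tphi; exists M => //; exact: ltW.
have [k [m m0 hm]] := pot_local (S + snorm ip1 Q) M0 (divr_gt0 (divr_gt0 e0 (ltr0n R 4)) K1).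
have [I [y hy]] := @finite_cells R d k (M + 1).
(* A ball meets finitely many cells, so convergence of each average makes all of them small on one
   set of the filter. *)
have near_avg : \forall n \near F, forall i, `|avg k (u n - Q) (y i)| <= m.
  apply: filter_forall => i.
  have ci := @in_L2_cell_indic R d k (y i).
  have /cvgrPdist_le/(_ (m / (2 ^+ k) ^+ d)) := wk _ ci.
  rewrite divr_gt0 ?vol0// => /(_ isT); apply: filterS => n.
  rewrite /avg (sip_subr L2_semi_inner)//; try exact: in_H1_L2.
  by rewrite normrM (gtr0_norm (vol0 k)) distrC ler_pdivlMr ?vol0// mulrC.
apply: filterS near_avg => n hn.
have uQ := in_H1B (u1 n) Q1; have mB := in_L2_measurable (@in_L2_box_indic R d M).
have muQ := measurable_H1 uQ.
have uQS : snorm ip1 (u n - Q) <= S + snorm ip1 Q.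
  by apply: le_trans (snormB H1_semi_inner (u1 n) Q1) _; rewrite lerD2r.
have {}hm := hm _ uQ uQS.
have {hm}hm : pot (fun x => box_indic M x * (u n - Q) x) <= e / 4 / (K + 1).
  by apply: hm => x /hy[i ei]; rewrite (avg_cell _ ei).
have h1 := small _ (u1 n) (uP n); have h2 := small _ Q1 QP.
have h3 : `|ip (nlf (u n)) phi - ip (nlf Q) phi| <= e / 4 + e / 4.
  apply: (le_trans (hK _ _ _ _ (u1 n) Q1 phi1 (measurable_funM mB muQ) _ _)).
  - move=> x; rewrite normrM ler_piMl// /box_indic indicE.
    by case: (_ \in _); rewrite ?normr1 ?normr0.
  - move=> x phix /=; rewrite box_indic1 ?mul1r// leNgt; apply/negP => /phi0 px.
    by rewrite px eqxx in phix.
  apply: lerD.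
    rewrite mulrAC -mulrA ler_piMr ?divr_ge0 ?(ltW e0)// ler_pdivrMr// mul1r /W.
    rewrite mulr2n mulrDl mul1r; apply: (@le_trans _ _ (P + P + pot phi)); last by rewrite lerDl.
    exact: (lerD (lerD (uP n) QP) (lexx _)).
  apply: le_trans (ler_wpM2l K0 hm) _; rewrite mulrCA ler_piMr ?divr_ge0 ?(ltW e0)//.
  by rewrite ler_pdivrMr// mul1r lerDl.
by rewrite distrC; exact: (dist_three h1 h2 h3).
Qed.

End Lq_functional.

(** * Continuous weak derivatives on the line are classical *)

Section real_weak_derivative.
Context {R : realType}.
Local Notation mu := (@lebesgue_measure R).
Implicit Types (a b f g eta : R -> R) (s t L e r : R).

Lemma continuous_mul f g : continuous f -> continuous g -> continuous (fun t => f t * g t).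
Proof. by move=> cf cg t; apply: cvgM; [exact: cf|exact: cg]. Qed.

Lemma continuous_bounded_segment f L : continuous f ->
  exists2 C, 0 <= C & forall t, `|t| <= L -> `|f t| <= C.
Proof.
move=> cf; have [L0|L0] := leP 0 L; last first.
  by exists 0 => // t /le_lt_trans/(_ L0); rewrite ltNge normr_ge0.
have LL : - L <= L by rewrite ge0_cp.
have cn : {within `[- L, L], continuous (fun t => `|f t|)}.
  by apply: continuous_subspaceT => t; apply: continuous_comp; [exact: cf|exact: norm_continuous].
have [c _ hc] := EVT_max LL cn; exists `|f c| => // t tL; apply: hc.
by rewrite in_itv/= -ler_norml.
Qed.

Lemma compact_support_integrable f L : continuous f -> (forall t, L <= `|t| -> f t = 0) ->
  mu.-integrable setT (EFin \o f).
Proof.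
move=> cf f0; have i1 : mu.-integrable `[- L, L] (EFin \o f).
  apply: continuous_compact_integrable; first exact: segment_compact.
  exact: continuous_subspaceT.
have -> : EFin \o f = (EFin \o f) \_ `[- L, L]%classic.
  apply/funext => t; rewrite patchE; case: ifPn => // /negP ht /=.
  rewrite f0// leNgt; apply/negP => tL; apply: ht; rewrite inE/= in_itv/=.
  by rewrite -ler_norml ltW.
by have [h _] := integrable_mkcond (mu := mu) (EFin \o f) (measurable_itv `[- L, L]); exact: h.
Qed.

Lemma lebesgue_Rintegral_shift f s : continuous f -> (forall t, 0 <= f t) ->
  \int[mu]_t f (t - s) = \int[mu]_t f t.
Proof.
move=> cf f0; rewrite /Rintegral; congr fine; apply/esym.
have dF t : is_derive t (1:R) (fun t : R => t - s) 1.
  by rewrite -[X in is_derive _ _ _ X]subr0; apply: is_deriveB.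
have dF1 : derive1 (fun t : R => t - s) = cst 1.
  by apply/funext => t; rewrite derive1E; apply: derive_val.
rewrite (@increasing_ge0_integration_by_substitutionT _ (fun t => t - s) f)//.
- by apply: eq_integral => t _; rewrite dF1 /= mulr1.
- by move=> x y xy; rewrite ltrD2r.
- by rewrite dF1; move=> ?; exact: cvg_cst.
- by rewrite dF1; exact: is_cvg_cst.
- by rewrite dF1; exact: is_cvg_cst.
- by apply/cvgrNyPle => A; near=> x; rewrite lerBlDr; near: x; apply: nbhs_ninfty_le; exact: num_real.
- by apply/cvgryPge => A; near=> x; rewrite lerBrDr; near: x; apply: nbhs_pinfty_ge; exact: num_real.
Unshelve. all: end_near. Qed.

Lemma smooth_translate (rho : R -> R) s : smooth rho -> smooth (fun t => rho (t - s)).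
Proof.
move=> sr; have := smooth_comp_scale_shift (V := R) 1 (- s) sr.
by under eq_fun do rewrite scale1r.
Qed.

Lemma derive_translate (rho : R -> R) s t : 'D_1 (fun t => rho (t - s)) t = 'D_1 rho (t - s).
Proof.
have := derive_comp_scale_shift (V := R) 1 (- s) rho 1 t.
by rewrite !scale1r; under eq_fun do rewrite scale1r.
Qed.

Lemma is_derive_smoothing a (rho : R -> R) s e : continuous a -> smooth rho ->
  (forall t, e <= `|t| -> rho t = 0) ->
  is_derive s 1 (fun s => \int[mu]_t (a t * rho (t - s)))
    (- \int[mu]_t (a t * 'D_1 rho (t - s))).
Proof.
move=> ca sr r0.
have dr0 t : e + 1 <= `|t| -> 'D_1 rho t = 0.
  move=> et; have near0 : \forall z \near t, rho z = 0.
    have /cvgrPdist_lt/(_ _ ltr01) : z @[z --> t] --> t by [].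
    apply: filterS => z zt; apply: r0; rewrite -(lerD2r 1); apply: le_trans et _.
    rewrite -[X in `|X|](subrK z) addrC; apply: le_trans (ler_normD _ _) _.
    by rewrite lerD2l ltW.
  have : 'D_1 rho t = 'D_1 (cst 0 : R -> R) t by apply: near_eq_derive.
  by rewrite derive_cst.
have cdr : continuous ('D_1 rho) by apply: smooth_continuous; exact: smooth_derive.
have [C1 C10 hC1] := continuous_bounded_segment (`|s| + `|e| + 3) ca.
have [C2 C20 hC2] := continuous_bounded_segment (`|e| + 1) cdr.
pose L := `|s| + `|e| + 3.
(* A majorant of the derivative valid for all parameters within 1 of s; the radius L leaves room for
   the support of rho, translated by such a parameter. *)
pose G : R -> R := fun t => C1 * C2 * \1_(`[- L, L]) t.
pose f : R -> R -> R := fun s t => a t * rho (t - s).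
have df (x t : R) : is_derive x (1:R) (f^~ t) (- (a t * 'D_1 rho (t - x))).
  have sr' := smooth_comp_scale_shift (V := R) (- 1) t sr.
  have d1 := smooth_derivable (V := R) (x := x) (v := 1) (smooth_scale (a t) sr').
  have e1 : (f^~ t) = (fun z : R => a t * rho (- 1 *: z + t)).
    by apply/funext => z; rewrite /f scaleN1r addrC.
  rewrite e1; apply: DeriveDef => //.
  rewrite deriveZ; last exact: (smooth_derivable (V := R)).
  rewrite (derive_comp_scale_shift (V := R)) scaleN1r.
  rewrite [X in _ *: X](_ : _ = - 'D_1 rho (t - x)).
    by rewrite /GRing.scale/= mulrN.
  rewrite [LHS]derive_real; last exact: smooth_differentiable.
  by rewrite [- x + t]addrC /GRing.scale/= mulr1 mulN1r.
have If x : s - 1 < x < s + 1 -> mu.-integrable setT (EFin \o f x).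
  move=> xs; apply: (@compact_support_integrable _ (`|x| + `|e|)).
    move=> t; apply: cvgM; first exact: ca.
    by apply: smooth_continuous; exact: smooth_translate.
  move=> t ht; rewrite /f r0 ?mulr0//; apply: le_trans (ler_norm e) _.
  rewrite -(lerD2l `|x|); apply: le_trans ht _.
  by rewrite -{1}(subrK x t) addrC ler_normD.
have Gi : mu.-integrable setT (EFin \o G).
  rewrite (_ : _ \o _ = (fun t => (C1 * C2)%:E * (\1_`[- L, L] t)%:E)%E)//.
  apply: integrableZl => //; apply/integrableP; split.
    exact/measurable_EFinP/measurable_indic.
  under eq_integral do rewrite /= ger0_norm//.
  rewrite integral_indic// setIT.
  by apply: compact_finite_measure; exact: segment_compact.
have Is : [set` `]s - 1, s + 1[%R] s by rewrite /= in_itv/= ltrDl ltrBlDr ltrDl ltr01.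
have Itv x : [set` `]s - 1, s + 1[%R] x -> s - 1 < x < s + 1 by rewrite /= in_itv.
have If' x : [set` `]s - 1, s + 1[%R] x -> mu.-integrable setT (EFin \o f x).
  by move=> /Itv; exact: If.
have dble x t : [set` `]s - 1, s + 1[%R] x -> setT t -> derivable (f^~ t) (x:R) (1:R).
  by move=> _ _; have [] := df x t.
have G0 t : 0 <= G t by rewrite /G mulr_ge0 ?mulr_ge0// indicE ler0n.
have Gub x t : [set` `]s - 1, s + 1[%R] x -> setT t -> `|partial1of2 f x t| <= G t.
  move=> /Itv xs _; rewrite partial1of2E.
  have -> : 'D_1 (f^~ t) x = - (a t * 'D_1 rho (t - x)) by have [] := df x t.
  have xs' : `|x| <= `|s| + 1.
    rewrite -(subrK s x) addrC; apply: le_trans (ler_normD _ _) _; rewrite lerD2l.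
    by rewrite ler_norml; move: xs => /andP[]; lra.
  have ee := ler_norm e.
  rewrite normrN normrM; have [tL|Lt] := leP `|t| L; last first.
    rewrite dr0 ?normr0 ?mulr0//.
    have : `|t| <= `|t - x| + `|x| by rewrite -{1}(subrK x t) ler_normD.
    by move: Lt; rewrite /L; lra.
  rewrite /G indicE mem_set ?mulr1; last by rewrite /= in_itv/= -ler_norml.
  apply: ler_pM => //; first exact: hC1.
  have [h|/ltW h] := leP `|t - x| (`|e| + 1); first exact: hC2.
  by rewrite dr0 ?normr0//; move: h; lra.
have := derivable_under_integral measurableT Is If' dble G0 Gi Gub.
have := differentiation_under_integral measurableT Is If' dble G0 Gi Gub.
move=> hv hd; apply: DeriveDef; first exact: hd.
rewrite -derive1E hv -[RHS]mulN1r -RintegralZl//; last first.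
  apply: (@compact_support_integrable _ (`|s| + `|e| + 1)).
    have cdr' : continuous (fun t => 'D_1 rho (t - s)).
      rewrite -(_ : 'D_1 (fun t => rho (t - s)) = fun x => 'D_1 rho (x - s)); last first.
        by apply/funext => x; rewrite derive_translate.
      by apply: smooth_continuous; apply: smooth_derive; exact: smooth_translate.
    by move=> t; apply: cvgM; [exact: ca|exact: cdr'].
  move=> t ht; rewrite dr0 ?mulr0//; apply: le_trans (_ : `|e| + 1 <= _).
    by rewrite lerD2r ler_norm.
  rewrite -(lerD2l `|s|) addrA; apply: le_trans ht _.
  by rewrite -{1}(subrK s t) addrC ler_normD.
apply: eq_Rintegral => t _; rewrite partial1of2E mulN1r.
by have [] := df s t.
Qed.

(** The bump is not normalised: its integral is carried along on both sides and cancelled at the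
    end. *)
Lemma smoothing_error a s e r w : continuous a -> 0 < e ->
  (forall t, `|t - s| <= e -> `|a t - w| <= r) ->
  `|\int[mu]_t (a t * bump (- e) e 1 (t - s)) - w * \int[mu]_t bump (- e) e 1 t|
    <= r * \int[mu]_t bump (- e) e 1 t.
Proof.
move=> ca e0 ha; pose rho := bump (- e) e 1.
have sr : smooth (fun t => rho (t - s)) by apply: smooth_translate; exact: smooth_bump.
have rho0 t : e <= `|t| -> rho t = 0.
  by move=> et; rewrite /rho bump_eq0// -ltr_norml -leNgt.
have rs0 t : `|s| + e <= `|t| -> rho (t - s) = 0.
  move=> ht; apply: rho0; rewrite -(lerD2l `|s|); apply: le_trans ht _.
  by rewrite -{1}(subrK s t) addrC ler_normD.
have intg (f : R -> R) : continuous f -> mu.-integrable setT (EFin \o (fun t => f t * rho (t - s))).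
  move=> cf; apply: (@compact_support_integrable _ (`|s| + e)); last by move=> t /rs0 ->; rewrite mulr0.
  exact: (continuous_mul cf (smooth_continuous sr)).
have cc (k : R) : continuous (cst k : R -> R) by move=> t; exact: cvg_cst.
have i1 := intg _ ca; have i2 := intg _ (cc w); have i3 := intg _ (cc r).
have i0 : mu.-integrable setT (EFin \o (fun t => rho (t - s))).
  exact: (compact_support_integrable (smooth_continuous sr) rs0).
have cr : continuous rho by exact: smooth_continuous (smooth_bump _ _ _).
have sh : \int[mu]_t rho t = \int[mu]_t rho (t - s).
  by rewrite lebesgue_Rintegral_shift// => t; exact: bump_ge0.
rewrite -/rho sh -!RintegralZl// -RintegralB//.
apply: le_trans (le_normr_Rintegral measurableT (integrableB measurableT i1 i2)) _.
apply: (le_Rintegral measurableT (integrable_norm (integrableB measurableT i1 i2)) i3).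
move=> t _ /=; rewrite -mulrBl normrM [X in _ * X]ger0_norm ?bump_ge0//.
have [ts|/ltW ts] := leP `|t - s| e; last by rewrite rho0// !mulr0.
by rewrite ler_wpM2r ?bump_ge0// ha.
Qed.

Lemma bump_integral_gt0 e : 0 < e -> 0 < \int[mu]_t bump (- e) e 1 t.
Proof.
move=> e0; have cr := smooth_continuous (smooth_bump (- e) e 1).
have rho0 t : e <= `|t| -> bump (- e) e 1 t = 0 by move=> et; rewrite bump_eq0// -ltr_norml -leNgt.
have i0 := compact_support_integrable cr rho0.
have b0 : 0 < bump (- e) e 1 0 by rewrite bump_gt0// oppr_lt0 e0.
have h0 : 0 < bump (- e) e 1 0 / 2 by rewrite divr_gt0.
have /cvgrPdist_le/(_ _ h0)[r /= r0 hr] := cr 0.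
have r2 : 0 < r / 2 by rewrite divr_gt0.
pose f t := bump (- e) e 1 0 / 2 * \1_`[- (r / 2), r / 2] t.
have fi : mu.-integrable setT (EFin \o f).
  rewrite (_ : _ \o _ = (fun t => (bump (- e) e 1 0 / 2)%:E * (\1_`[- (r / 2), r / 2] t)%:E)%E)//.
  apply: integrableZl => //; apply/integrableP; split.
    exact/measurable_EFinP/measurable_indic.
  under eq_integral do rewrite /= ger0_norm//.
  rewrite integral_indic// setIT.
  by apply: compact_finite_measure; exact: segment_compact.
apply: (@lt_le_trans _ _ (\int[mu]_t f t)); last first.
  apply: (le_Rintegral measurableT fi i0) => t _; rewrite /f indicE.
  case: (boolP (_ \in _)) => [/set_mem|_]; last by rewrite mulr0 bump_ge0.
  rewrite /= in_itv/= -ler_norml mulr1 => tr.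
  have := hr t; rewrite /= sub0r normrN => /(_ (le_lt_trans tr _)).
  rewrite ltr_pdivrMr// ltr_pMr// ltr1n => /(_ isT).
  by rewrite ler_norml => /andP[_]; lra.
rewrite /Rintegral (_ : (\int[mu]_t (f t)%:E)%E = (bump (- e) e 1 0 / 2 * r)%:E).
  by rewrite /= mulr_gt0.
rewrite /f; under eq_integral do rewrite EFinM.
rewrite ge0_integralZl_EFin ?(ltW h0)//; last exact/measurable_EFinP/measurable_indic.
rewrite integral_indic// setIT [X in (_ * X)%E](_ : _ = r%:E) ?EFinM//.
apply: etrans; first exact: lebesgue_measure_itv.
by rewrite /= lte_fin gtrN// -EFinD opprK; congr EFin; field.
Qed.

(** Mollification at width m: the smoothed a is differentiable and its derivative is the smoothed b,
    so the mean value theorem applies to it; then m tends to 0 with s and tau fixed. *)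
Lemma weak_derivative_real a b s r : 0 < r -> continuous a -> continuous b ->
  (forall eta, smooth eta -> (forall t, r <= `|t - s| -> eta t = 0) ->
     \int[mu]_t (a t * 'D_1 eta t) = - \int[mu]_t (b t * eta t)) ->
  is_derive s 1 a (b s).
Proof.
move=> r0 ca cb hab; apply: is_derive_littleo => e e0.
have /cvgrPdist_le/(_ _ e0)[dl /= dl0 hdl] := cb s.
exists (Num.min (r / 2) (dl / 2)); first by rewrite lt_min !divr_gt0.
move=> tau; rewrite lt_min => /andP[tr td].
apply/ler_addgt0Pr => w w0.
have w2 : 0 < w / 2 by rewrite divr_gt0.
have /cvgrPdist_le/(_ _ w2)[e1 /= e10 he1] := ca s.
have /cvgrPdist_le/(_ _ w2)[e2 /= e20 he2] := ca (s + tau).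
(* Half of the minimum: bumps centred between s and s + tau then stay within r of s, where the weak
   identity is available, and within dl of s, where b is close to b s. *)
pose m := Num.min (Num.min e1 e2) (Num.min r dl) / 2.
have mm : 0 < Num.min (Num.min e1 e2) (Num.min r dl) by rewrite !lt_min e10 e20 r0 dl0.
have m0 : 0 < m by rewrite divr_gt0.
have m2 : m < Num.min (Num.min e1 e2) (Num.min r dl).
  by rewrite ltr_pdivrMr// ltr_pMr// ltr1n.
move: m2; rewrite !lt_min => /andP[/andP[me1 me2] _].
have [mr md] : m <= r / 2 /\ m <= dl / 2.
  by split; rewrite ler_wpM2r ?invr_ge0// !ge_min lexx ?orbT.
pose I := \int[mu]_t bump (- m) m 1 t; have I0 : 0 < I := bump_integral_gt0 m0.
have sm := smooth_bump (- m) m 1.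
have rho0 t : m <= `|t| -> bump (- m) m 1 t = 0.
  by move=> et; rewrite bump_eq0// -ltr_norml -leNgt.
have dg x : Num.min s (s + tau) <= x <= Num.max s (s + tau) -> is_derive x (1:R)
    (fun x => \int[mu]_t (a t * bump (- m) m 1 (t - x))) (\int[mu]_t (b t * bump (- m) m 1 (t - x))).
  move=> xs; have := is_derive_smoothing x ca sm rho0.
  rewrite (_ : - _ = \int[mu]_t (b t * bump (- m) m 1 (t - x)))//.
  apply/eqP; rewrite eqr_oppLR -hab; last 2 first.
  - exact: smooth_translate.
  - move=> t rt; apply: rho0.
    have xs' : `|x - s| <= `|tau|.
      by apply: min0_max0_norm; move: xs; rewrite -{1 3}(addr0 s) -addr_minr -addr_maxr lerBrDl lerBlDl.
    have : `|t - s| <= `|t - x| + `|x - s|.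
      by rewrite (_ : t - s = (t - x) + (x - s)) ?ler_normD//; ring.
    by move: tr mr rt xs'; lra.
  by apply/eqP; apply: eq_Rintegral => t _; rewrite derive_translate.
have [c cs hc] := mvt_real dg; rewrite [s + tau]addrC addrK in hc.
have cs' : `|c - s| <= `|tau|.
  by apply: min0_max0_norm; move: cs; rewrite -{1 3}(addr0 s) -addr_minr -addr_maxr lerBrDl lerBlDl.
have k1 : `|\int[mu]_t (a t * bump (- m) m 1 (t - s)) - a s * I| <= w / 2 * I.
  apply: smoothing_error => // t ts; rewrite distrC; apply: he1 => /=.
  by rewrite distrC; exact: le_lt_trans me1.
have k2 : `|\int[mu]_t (a t * bump (- m) m 1 (t - (s + tau))) - a (s + tau) * I| <= w / 2 * I.
  apply: smoothing_error => // t ts; rewrite distrC; apply: he2 => /=.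
  by rewrite distrC; exact: le_lt_trans me2.
have k3 : `|\int[mu]_t (b t * bump (- m) m 1 (t - c)) - b s * I| <= e * I.
  apply: smoothing_error => // t tc; rewrite distrC; apply: hdl => /=.
  have : `|s - t| <= `|t - c| + `|c - s|.
    by rewrite distrC (_ : t - s = (t - c) + (c - s)) ?ler_normD//; ring.
  by move: tc md td cs'; lra.
rewrite -(ler_pM2r I0).
have : `|tau * (\int[mu]_t (b t * bump (- m) m 1 (t - c)) - b s * I)| <= `|tau| * (e * I).
  by rewrite normrM ler_wpM2l.
have -> : `|a (s + tau) - a s - tau * b s| * I = `|(a (s + tau) - a s - tau * b s) * I|.
  by rewrite normrM (gtr0_norm I0).
rewrite [s + tau]addrC in k2 *.
move: hc k1 k2 {k3}; rewrite [tau + s]addrC.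
move: (\int[mu]_t _) (\int[mu]_t _) (\int[mu]_t _) => X Y Z.
move: (a (s + tau)) (a s) (b s) => A B K.
rewrite !ler_norml => hc /andP[h1 h2] /andP[h3 h4] /andP[h5 h6].
by apply/andP; split; lra.
Qed.

End real_weak_derivative.

Lemma closed_ball_rV_compact {R : realType} {d : nat} (M : R) :
  compact [set x : 'rV[R]_d | `|x| <= M].
Proof.
apply: bounded_closed_compact.
  by exists M; split; [exact: num_real|move=> r Mr x /= xM; exact: le_trans xM (ltW Mr)].
apply: (@closed_comp _ _ (fun x : 'rV[R]_d => `|x|) [set y | y <= M]) => //.
by move=> x _; exact: norm_continuous.
Qed.

Lemma continuous_real {R : realType} (f : R -> R) :
  (forall t e, 0 < e -> exists2 r, 0 < r & forall s, `|s - t| < r -> `|f s - f t| <= e) ->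
  continuous f.
Proof.
move=> h t; apply/cvgrPdist_le => e /(h t)[r r0 hr]; exists r => // s /=.
by rewrite distrC => /hr; rewrite distrC.
Qed.

Lemma derivative_perturbation {R : realFieldType} (t S e w A B A' B' Fc Fs Gc Gs k : R) :
  (3 * `|t| + 2 * S + 1) * k = w -> `|A - A'| <= S * k -> `|B - B'| <= S * k ->
  `|Fc - Gc| <= k -> `|Fs - Gs| <= k -> `|Fs - Fc| <= e / 2 -> A' - B' = Gc * t ->
  `|A - B - t * Fs| <= e * `|t| + w.
Proof.
move=> kw hA hB hc hs hF AB.
have k0 : 0 <= k := le_trans (normr_ge0 _) hc.
have e0 : 0 <= e by have := le_trans (normr_ge0 _) hF; lra.
have -> : A - B - t * Fs = (A - A') - (B - B') + t * ((Gc - Fc) - (Fs - Fc)).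
  by transitivity ((A - A') - (B - B') + (A' - B') - t * Fs); [ring|rewrite AB; ring].
apply: le_trans (ler_normD _ _) _; rewrite normrM.
apply: le_trans (lerD (ler_normB _ _) (ler_wpM2l (normr_ge0 t) (ler_normB _ _))) _.
rewrite (distrC Gc).
have h1 : `|t| * (`|Fc - Gc| + `|Fs - Fc|) <= `|t| * (k + e / 2).
  by rewrite ler_wpM2l// lerD.
have h2 : 0 <= `|t| * k by rewrite mulr_ge0.
have h3 : 0 <= e * `|t| by rewrite mulr_ge0.
by move: h1 h2 h3; rewrite -kw; move: `|t| => T; lra.
Qed.

Lemma weak_form_algebra {R : realFieldType} (A B C m : R) :
  - A - m * - B + C = 0 -> A = - (- 1 * C - m * B).
Proof. by move=> h; lra. Qed.

Lemma sum_le_three {R : realFieldType} (A B C D1 D2 w : R) : 0 <= w ->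
  A <= w / 4 + w / 4 -> B <= D1 -> C <= D2 -> D1 + D2 <= w / 4 -> A + B + C <= w.
Proof. by move=> *; lra. Qed.

(** * Space-time tests of product form, and the Laplacian of a test *)

Section tensor_tests.
Context {R : realType} {d : nat}.
Local Notation rV := 'rV[R]_d.
Local Notation test := (@test_function R 'rV[R]_d setT).
Implicit Types (eta : R -> R) (psi : rV -> R).

Definition tensor eta psi : R * rV -> R := fun z => eta z.1 * psi z.2.

Lemma tensor_test eta psi t0 r : r < t0 -> smooth eta ->
  (forall t, r <= `|t - t0| -> eta t = 0) -> test psi ->
  test_function (spacetime +oo%E) (tensor eta psi).
Proof.
move=> rt seta eta0 tpsi; have [M M0 hM] := test_support tpsi.
have sPhi : smooth (tensor eta psi).
  by apply: smooth_mul; [exact: (smooth_comp_fst seta)|exact: (smooth_comp_snd (test_smooth tpsi))].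
pose K : set (R * rV) := `[t0 - r, t0 + r]%classic `*` [set x : rV | `|x| <= M].
have cK : compact K by apply: compact_setX; [exact: segment_compact|exact: closed_ball_rV_compact].
have clK : closed K by apply: compact_closed cK; exact: norm_hausdorff.
have sub : closure [set z | tensor eta psi z != 0] `<=` K.
  rewrite [X in _ `<=` X]((closure_id _).1 clK); apply: closure_subset => -[t x] /=.
  rewrite /tensor mulf_eq0 negb_or => /andP[/= e px]; split => /=.
    rewrite in_itv/= -ler_distl leNgt; apply/negP => /ltW/eta0 e0.
    by rewrite e0 eqxx in e.
  by rewrite leNgt; apply: contra px => /hM ->.
split=> //.
  by apply: (subclosed_compact _ cK sub); exact: closed_closure.
move=> z /sub[]; rewrite /= in_itv/= => /andP[h _] _; split; last exact: ltry.
by apply: lt_le_trans h; rewrite subr_gt0.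
Qed.

Lemma dt_tensor eta psi : smooth eta -> smooth psi ->
  dt (tensor eta psi) = tensor ('D_1 eta) psi.
Proof.
move=> seta spsi; apply/funext => z; rewrite /dt.
have d1 : derivable (fun z : R * rV => eta z.1) z (1, 0) by exact: smooth_derivable (smooth_comp_fst seta).
have d2 : derivable (fun z : R * rV => psi z.2) z (1, 0) by exact: smooth_derivable (smooth_comp_snd spsi).
have := deriveM d1 d2; rewrite /tensor => ->.
rewrite (@derive_comp_affine _ _ _ fst fst)// (@derive_comp_affine _ _ _ snd snd)//=.
have -> : 'D_0 psi z.2 = 0.
  by have := deriveZv 0 0 (smooth_differentiable z.2 spsi); rewrite scale0r mul0r.
by rewrite scaler0 add0r /GRing.scale/= mulrC.
Qed.

Lemma laplacian_scale (c : R) psi y : smooth psi ->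
  laplacian (fun x => c * psi x) y = c * laplacian psi y.
Proof.
move=> spsi; rewrite /laplacian big_distrr /=; apply: eq_bigr => i _.
rewrite (_ : 'D_(basis_rV i) (fun x => c * psi x) = fun x => c * 'D_(basis_rV i) psi x).
  rewrite deriveZ//; apply: (@smooth_derivable _ _ _ y (basis_rV i)); exact: smooth_derive.
apply/funext => x; rewrite deriveZ//; exact: (@smooth_derivable _ _ _ x (basis_rV i)).
Qed.

Lemma laplacian_tensor eta psi t y : smooth psi ->
  laplacian (fun x => tensor eta psi (t, x)) y = eta t * laplacian psi y.
Proof. exact: (@laplacian_scale (eta t) psi y). Qed.

Lemma test_laplacian psi : test psi -> test (laplacian psi).
Proof.
move=> tpsi; have -> : laplacian psi = \sum_(i < d) 'D_(basis_rV i) ('D_(basis_rV i) psi).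
  by apply/funext => x; rewrite fct_sumE.
elim/big_ind : _ => [|f g|i _]; [exact: test0|exact: test_add|].
by do 2 apply: test_derive.
Qed.

Lemma ip_laplacian w psi : in_H1 w -> test psi ->
  ip w (laplacian psi) = - \sum_(i < d) ip (wder i w) ('D_(basis_rV i) psi).
Proof.
move=> w1 tpsi.
have -> : laplacian psi = \sum_(i < d) 'D_(basis_rV i) ('D_(basis_rV i) psi).
  by apply/funext => x; rewrite fct_sumE.
have t2 i : in_L2 ('D_(basis_rV i) ('D_(basis_rV i) psi)).
  by apply: test_in_L2; do 2 apply: test_derive.
have [_ ->] := ip_sum_r (in_H1_L2 w1) t2.
rewrite -sumrN; apply: eq_bigr => i _.
by rewrite ip_wd ?opprK//; exact: test_derive.
Qed.

Lemma ip1_test w psi : in_H1 w -> test psi -> ip1 w psi = ip w psi - ip w (laplacian psi).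
Proof.
move=> w1 tpsi; rewrite ip_laplacian// opprK /ip1; congr (_ + _).
apply: eq_bigr => i _; have [_ h] := test_in_H1 tpsi.
by rewrite ipC h ?(ipC ('D_ _ psi))//; exact: in_L2_wd.
Qed.

End tensor_tests.

(** * From the distributional equation to derivatives of pairings in time *)

Section weak_formulation.
Context {R : realType} {d : nat}.
Context (alpha p S : R) (p1 : 1 < p).
Context (C0 z0 : R) (C00 : 0 <= C0) (z01 : 0 <= z0 < 1).
Local Notation rV := 'rV[R]_d.
Local Notation test := (@test_function R 'rV[R]_d setT).
Local Notation mu := (@lebesgue_measure R).
Context (dyadic : forall (w : rV -> R) k, in_H1 w ->
  (modular (p + 1) (w - avg k w)%R <= (C0 * z0 ^+ k * grad_norm w `^ (p + 1))%:E)%E).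
Context (u ut : R -> rV -> R).
Context (ec : energy_continuous +oo%E u ut) (td : is_time_derivative +oo%E u ut).
Context (sol : solves_in_distributions alpha p +oo%E u).
Context (uS : forall t, 0 <= t -> ip1 (u t) (u t) + ip (ut t) (ut t) <= S ^+ 2) (S0 : 0 <= S).
Implicit Types (t s e r : R) (psi : rV -> R) (eta : R -> R).

(** Extends a curve to negative times by its value at 0, which turns continuity within [0, +oo) into
    continuity on the whole line. *)
Definition clamp (w : R -> rV -> R) t := w (Num.max 0 t).
Local Notation U := (clamp u).
Local Notation V := (clamp ut).

Let max0 t : 0 <= Num.max 0 t. Proof. by rewrite le_max lexx. Qed.

Lemma clampE w t : 0 <= t -> clamp w t = w t.
Proof. by move=> t0; rewrite /clamp max_r. Qed.

Lemma lifespan_y t : lifespan +oo%E t <-> 0 <= t.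
Proof. by split=> [[]//|t0]; split=> //; exact: ltry. Qed.

Lemma clamp_H1 t : in_H1 (U t).
Proof. by have [[]] := ec ((lifespan_y _).2 (max0 t)). Qed.

Lemma clamp_L2 t : in_L2 (V t).
Proof. by have [[]] := ec ((lifespan_y _).2 (max0 t)). Qed.
Local Hint Resolve clamp_H1 clamp_L2 : core.

Lemma clamp_bound t : snorm ip1 (U t) <= S /\ snorm ip (V t) <= S.
Proof.
have := uS (max0 t); have := ip_ge0 (V t); have := sip_ge0 H1_semi_inner (clamp_H1 t).
rewrite -!/(U t) -!/(V t) => h1 h2 h.
by split; rewrite -(ler_pXn2r (n := 2)) ?nnegrE ?snorm_ge0//;
  rewrite ?(snorm_sqr H1_semi_inner) ?(snorm_sqr L2_semi_inner)//; lra.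
Qed.

Lemma clamp_continuous t e : 0 < e -> exists2 r, 0 < r & forall s, `|s - t| < r ->
  snorm ip1 (U s - U t) <= e /\ snorm ip (V s - V t) <= e.
Proof.
move=> e0; have [_ h] := ec ((lifespan_y _).2 (max0 t)).
have A0 : nbhs (0%:E : \bar R) [set x | (x < e%:E)%E].
  by exists e => //= x /=; rewrite sub0r normrN lte_fin => /(le_lt_trans (ler_norm _)).
have [r /= r0 hr] := h _ A0; exists r => // s st.
have st' : `|Num.max 0 t - Num.max 0 s| < r.
  apply: le_lt_trans st; rewrite !maxEle; do 2 case: ifPn; rewrite -?ltNge => a b;
    rewrite ?subrr ?normr0// ler_norml; apply/andP; split;
    have := ler_norm (s - t); have := ler_norm (- (s - t)); rewrite normrN; lra.
have := hr _ st' ((lifespan_y _).2 (max0 s)).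
rewrite /= -[X in energy_norm X _]/(U s - U t) -[X in energy_norm _ X]/(V s - V t).
have h1 := in_H1B (clamp_H1 s) (clamp_H1 t); have h2 := in_L2B (clamp_L2 s) (clamp_L2 t).
rewrite energy_norm_snorm// lte_fin => /ltW le1.
have i1 := sip_ge0 H1_semi_inner h1; have i2 := ip_ge0 (V s - V t).
by split; apply: le_trans le1; apply: ler_wsqrtr; rewrite ?lerDl ?lerDr.
Qed.

Lemma continuous_ip_u psi : in_L2 psi -> continuous (fun t => ip (U t) psi).
Proof.
move=> psi2; apply: continuous_real => t e e0.
have n1 : 0 < snorm ip psi + 1 by rewrite ltr_wpDl// snorm_ge0.
have [r r0 hr] := clamp_continuous t (divr_gt0 e0 n1); exists r => // s /hr[h _].
have h1 := in_H1B (clamp_H1 s) (clamp_H1 t).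
rewrite -(sip_subl L2_semi_inner)//; try exact: in_H1_L2.
apply: le_trans (sip_CS L2_semi_inner (in_H1_L2 h1) psi2) _.
apply: (@le_trans _ _ (e / (snorm ip psi + 1) * (snorm ip psi + 1))); last by rewrite divfK ?gt_eqF.
by apply: ler_pM; rewrite ?snorm_ge0 ?lerDl//; exact: le_trans (snorm_le_H1 h1) h.
Qed.

Lemma continuous_ip_v psi : in_L2 psi -> continuous (fun t => ip (V t) psi).
Proof.
move=> psi2; apply: continuous_real => t e e0.
have n1 : 0 < snorm ip psi + 1 by rewrite ltr_wpDl// snorm_ge0.
have [r r0 hr] := clamp_continuous t (divr_gt0 e0 n1); exists r => // s /hr[_ h].
have h1 := in_L2B (clamp_L2 s) (clamp_L2 t).
rewrite -(sip_subl L2_semi_inner)//.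
apply: le_trans (sip_CS L2_semi_inner h1 psi2) _.
apply: (@le_trans _ _ (e / (snorm ip psi + 1) * (snorm ip psi + 1))); last by rewrite divfK ?gt_eqF.
by apply: ler_pM; rewrite ?snorm_ge0 ?lerDl.
Qed.

Lemma continuous_ip1_u psi : in_H1 psi -> continuous (fun t => ip1 (U t) psi).
Proof.
move=> psi1; apply: continuous_real => t e e0.
have n1 : 0 < snorm ip1 psi + 1 by rewrite ltr_wpDl// snorm_ge0.
have [r r0 hr] := clamp_continuous t (divr_gt0 e0 n1); exists r => // s /hr[h _].
have h1 := in_H1B (clamp_H1 s) (clamp_H1 t).
rewrite -(sip_subl H1_semi_inner)//.
apply: le_trans (sip_CS H1_semi_inner h1 psi1) _.
apply: (@le_trans _ _ (e / (snorm ip1 psi + 1) * (snorm ip1 psi + 1))); last by rewrite divfK ?gt_eqF.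
by apply: ler_pM; rewrite ?snorm_ge0 ?lerDl.
Qed.

Lemma continuous_nlf_u psi : in_H1 psi -> continuous (fun t => ip (nlf p (U t)) psi).
Proof.
move=> psi1 t.
apply: (@ip_nlf_weak_cvg R d p p1 C0 z0 C00 z01 dyadic R (nbhs t) _ U (U t) psi S) => //.
  by move=> s; have [] := clamp_bound s.
move=> g g2; have := @continuous_ip_u _ g2 t; rewrite /continuous_at.
by under eq_fun do rewrite ipC; rewrite ipC.
Qed.

Let time_integral (f g : R -> R) : (forall t, 0 <= t -> f t = g t) -> (forall t, t < 0 -> g t = 0) ->
  \int[mu]_(t in lifespan +oo%E) f t = \int[mu]_t g t.
Proof.
move=> fg g0; rewrite Rintegral_mkcond; apply: eq_Rintegral => t _.
rewrite patchE; case: ifPn => [/set_mem/lifespan_y/fg//|/negP ht].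
rewrite g0// ltNge; apply/negP => t0; apply: ht; apply/mem_set; exact/lifespan_y.
Qed.

Let eta_neg eta r t0 t : r < t0 -> (forall t, r <= `|t - t0| -> eta t = 0) -> t < 0 -> eta t = 0.
Proof.
move=> rt eta0 tn; apply: eta0; have := ler_norm (- (t - t0)); rewrite normrN; lra.
Qed.

(** Testing with eta(t) psi(x) turns the distributional identity into a scalar weak derivative of
    the pairing with psi. The condition r < t0 keeps the test inside positive times, where the
    clamped curves are the given ones. *)
Let weak1 eta psi t0 r : r < t0 -> smooth eta -> (forall t, r <= `|t - t0| -> eta t = 0) ->
  test psi ->
  \int[mu]_t (ip (U t) psi * 'D_1 eta t) = - \int[mu]_t (ip (V t) psi * eta t).
Proof.
move=> rt seta eta0 tpsi; have psi2 := test_in_L2 tpsi.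
have T := tensor_test rt seta eta0 tpsi; have := td T.
have dn t : t < 0 -> 'D_1 eta t = 0.
  move=> tn; have : 'D_1 eta t = 'D_1 (cst 0 : R -> R) t.
    apply: near_eq_derive; rewrite ?oner_eq0//; near=> z; apply: (eta_neg rt eta0).
    by near: z; exact: lt_nbhsl.
  by rewrite derive_cst.
rewrite dt_tensor//; last exact: test_smooth.
rewrite /spacetime_integral (@time_integral _ (fun t => ip (U t) psi * 'D_1 eta t)); first last.
- by move=> t /dn ->; rewrite mulr0.
- move=> t t0'; rewrite clampE// mulrC ipE -RintegralZl//; last first.
    apply: in_L2_integrable_mul => //; rewrite -(clampE u t0'); exact: in_H1_L2.
  by apply: eq_Rintegral => x _; rewrite /tensor /= mulrCA.
move=> ->; congr (- _); apply: time_integral.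
- move=> t t0'; rewrite clampE// mulrC ipE -RintegralZl//; last first.
    by apply: in_L2_integrable_mul => //; rewrite -(clampE ut t0').
  by apply: eq_Rintegral => x _; rewrite /tensor /= mulrCA.
- by move=> t /(eta_neg rt eta0) ->; rewrite mulr0.
Unshelve. all: end_near. Qed.

Lemma is_derive_ip_u psi s : 0 < s -> test psi ->
  is_derive s 1 (fun t => ip (U t) psi) (ip (V s) psi).
Proof.
move=> s0 tpsi; have psi2 := test_in_L2 tpsi; have s2 : 0 < s / 2 by rewrite divr_gt0.
apply: (@weak_derivative_real _ (fun t => ip (U t) psi) (fun t => ip (V t) psi) s (s / 2)) => //.
- exact: continuous_ip_u.
- exact: continuous_ip_v.
- move=> eta seta eta0; apply: (weak1 (t0 := s) (r := s / 2)) => //.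
  by rewrite ltr_pdivrMr// ltr_pMr// ltr1n.
Qed.

Lemma derive_support eta t0 r r' : (forall t, r <= `|t - t0| -> eta t = 0) -> r < r' ->
  forall t, r' <= `|t - t0| -> 'D_1 eta t = 0.
Proof.
move=> eta0 rr t rt; have : 'D_1 eta t = 'D_1 (cst 0 : R -> R) t.
  apply: near_eq_derive; rewrite ?oner_eq0//.
  exists (r' - r) => /=; first by rewrite subr_gt0.
  move=> z /= tz; apply: eta0.
  have := ler_normD (t - z) (z - t0); rewrite addrA subrK; move: tz rt; lra.
by rewrite derive_cst.
Qed.

(** The value of u_tt on psi prescribed by the equation. The terms Delta u - u are written as minus
    the H1 pairing, so it makes sense for every psi in H1. *)
Definition force t psi :=
  ip (nlf p (U t)) psi - ip1 (U t) psi - 2 * alpha * ip (V t) psi.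

Lemma forceB t psi phi : in_H1 psi -> in_H1 phi ->
  force t (psi - phi) = force t psi - force t phi.
Proof.
move=> psi1 phi1; rewrite /force (ip_nlfB p1 C00 z01 dyadic)// (sip_subr H1_semi_inner)//.
rewrite (sip_subr L2_semi_inner); [ring|exact: in_H1_L2..|exact: clamp_L2].
Qed.

Lemma continuous_force psi : in_H1 psi -> continuous (fun t => force t psi).
Proof.
move=> psi1 t; apply: cvgB; first apply: cvgB.
- exact: (@continuous_nlf_u _ psi1 t).
- exact: (@continuous_ip1_u _ psi1 t).
- by apply: cvgMr; exact: (@continuous_ip_v _ (in_H1_L2 psi1) t).
Qed.

Let weak2 eta psi t0 r : r < t0 -> smooth eta -> (forall t, r <= `|t - t0| -> eta t = 0) ->
  test psi ->
  \int[mu]_t (ip (V t) psi * 'D_1 eta t) = - \int[mu]_t (force t psi * eta t).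
Proof.
move=> rt seta eta0 tpsi; have psi2 := test_in_L2 tpsi.
have [psi1 _] := test_in_H1 tpsi; have lap2 := test_in_L2 (test_laplacian tpsi).
(* [derive_support] enlarges the radius at each differentiation; r' and r'' keep it below t0. *)
pose r' := (r + t0) / 2.
have [rr' r't] : r < r' /\ r' < t0 by rewrite /r'; split; lra.
have sd := smooth_derive (1 : R) seta; have sdd := smooth_derive (1 : R) sd.
have d0 := derive_support eta0 rr'.
pose r'' := (r' + t0) / 2.
have [rr'' r''t] : r' < r'' /\ r'' < t0 by rewrite /r''; split; lra.
have dd0 := derive_support d0 rr''.
have h1 := weak1 r't sd d0 tpsi; have h2 := weak1 rt seta eta0 tpsi.
have T := tensor_test rt seta eta0 tpsi; have := sol T.
have spsi := test_smooth tpsi.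
rewrite !dt_tensor//.
pose k t := ip1 (U t) psi - ip (nlf p (U t)) psi.
have ck : continuous k.
  by move=> t; apply: cvgB; [exact: (@continuous_ip1_u _ psi1 t)|exact: (@continuous_nlf_u _ psi1 t)].
have ca := continuous_ip_u psi2; have cb := continuous_ip_v psi2.
rewrite /spacetime_integral (@time_integral _ (fun t => ip (U t) psi * 'D_1 ('D_1 eta) t -
  2 * alpha * (ip (U t) psi * 'D_1 eta t) + k t * eta t)); first last.
- move=> t tn; rewrite (eta_neg rt eta0 tn) (eta_neg r't d0 tn) (eta_neg r''t dd0 tn).
  by rewrite !mulr0 subr0 addr0.
- move=> t t0'; rewrite /= -[u t](clampE u t0'); have w1 := clamp_H1 t.
  have w2 := in_H1_L2 w1.
  pose chi : rV -> R := 'D_1 ('D_1 eta) t *: psi - eta t *: laplacian psi + eta t *: psi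
     - (2 * alpha * 'D_1 eta t) *: psi.
  have z2 c : in_L2 (c *: psi) by exact: in_L2Z.
  have z3 := in_L2Z (eta t) lap2.
  have b1 := in_L2B (z2 ('D_1 ('D_1 eta) t)) z3; have b2 := in_L2D b1 (z2 (eta t)).
  have chi2 : in_L2 chi by apply: in_L2B.
  have ep1 : in_H1 (eta t *: psi) := sip_domZ H1_semi_inner _ psi1.
  transitivity (\int[lebesgue_rV d]_x (U t x * chi x - nlf p (U t) x * (eta t *: psi) x)).
    apply: eq_Rintegral => x _.
    rewrite (laplacian_tensor eta t x spsi).
    by congr (_ * _ - _); congr (_ - _); exact: mulrA.
  rewrite (RintegralB measurableT (in_L2_integrable_mul w2 chi2)
    (nlf_integrable p1 C00 z01 dyadic w1 ep1)) -!ipE.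
  rewrite (ip_nlfZ p1 C00 z01 dyadic)// /chi (sip_subr L2_semi_inner)//.
  rewrite (sip_addr L2_semi_inner)// (sip_subr L2_semi_inner)// !(sip_scaler L2_semi_inner)//.
  by rewrite /k ip1_test//; ring.
have intg (f g : R -> R) : continuous f -> smooth g -> (forall t, r'' <= `|t - t0| -> g t = 0) ->
    mu.-integrable setT (EFin \o (fun t => f t * g t)).
  move=> cf sg g0; apply: (@compact_support_integrable _ _ (`|t0| + r'')).
    exact: (continuous_mul cf (smooth_continuous sg)).
  move=> t ht; rewrite g0 ?mulr0// -(lerD2l `|t0|); apply: le_trans ht _.
  by rewrite -{1}(subrK t0 t) addrC ler_normD.
have g1 t : r'' <= `|t - t0| -> eta t = 0.
  by move=> h; apply: eta0; exact: le_trans (ltW (lt_trans rr' rr'')) h.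
have g2 t : r'' <= `|t - t0| -> 'D_1 eta t = 0.
  by move=> h; apply: d0; exact: le_trans (ltW rr'') h.
have i1 := intg _ _ ca sdd dd0; have i2 := intg _ _ ca sd g2; have i3 := intg _ _ ck seta g1.
have i2' := integrableZl measurableT (2 * alpha) i2.
have {}i2' : mu.-integrable setT (EFin \o (fun t => 2 * alpha * (ip (U t) psi * 'D_1 eta t))) by [].
have i4 := intg _ _ cb seta g1.
have i4' : mu.-integrable setT (EFin \o (fun t => 2 * alpha * (ip (V t) psi * eta t))).
  exact: (integrableZl measurableT (2 * alpha) i4).
rewrite (RintegralD measurableT (integrableB measurableT i1 i2') i3).
rewrite (RintegralB measurableT i1 i2') (RintegralZl _ measurableT i2) h1 h2 => hs.
have -> : \int[mu]_t (force t psi * eta t) =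
    (- 1) * (\int[mu]_t (k t * eta t)) - 2 * alpha * (\int[mu]_t (ip (V t) psi * eta t)).
  rewrite -(RintegralZl _ measurableT i4) -(RintegralZl _ measurableT i3).
  rewrite -(RintegralB measurableT (integrableZl measurableT (-1) i3) i4').
  by apply: eq_Rintegral => t _; rewrite /force /k; ring.
exact: weak_form_algebra hs.
Qed.

Let is_derive_ip_v_test psi s : 0 < s -> test psi ->
  is_derive s 1 (fun t => ip (V t) psi) (force s psi).
Proof.
move=> s0 tpsi; have [psi1 _] := test_in_H1 tpsi; have s2 : 0 < s / 2 by rewrite divr_gt0.
apply: (@weak_derivative_real _ (fun t => ip (V t) psi) (fun t => force t psi) s (s / 2)) => //.
- exact: continuous_ip_v (in_H1_L2 psi1).
- exact: continuous_force.
- move=> eta seta eta0; apply: (weak2 (t0 := s) (r := s / 2)) => //.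
  by rewrite ltr_pdivrMr// ltr_pMr// ltr1n.
Qed.

Lemma pot_clamp_bound : exists2 P, 0 <= P & forall t, pot p (U t) <= P.
Proof.
have [C C_ hC] := pot_bound p1 C00 z01 dyadic.
exists (C * S `^ (p + 1)); first by rewrite mulr_ge0 ?powR_ge0.
move=> t; apply: le_trans (hC _ (clamp_H1 t)) _; rewrite ler_wpM2l//.
apply: ge0_ler_powR; rewrite ?nnegrE ?snorm_ge0//; last by have [] := clamp_bound t.
by rewrite addr_ge0// ltW// (lt_trans _ p1).
Qed.

(** Uniformity in time is what lets the equation for test functions be extended to psi in H1 by
    density. *)
Lemma force_small w : 0 < w -> exists2 m, 0 < m &
  forall chi, in_H1 chi -> snorm ip1 chi <= m -> forall c, `|force c chi| <= w.
Proof.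
move=> w0; have [P P0 hP] := pot_clamp_bound.
have P1 : 0 < P + 1 by rewrite ltr_wpDl.
pose eta := w / 4 / (P + 1); have eta0 : 0 < eta by rewrite !divr_gt0.
pose D := eta^-1 `^ p; have D0 : 0 < D by rewrite powR_gt0// invr_gt0.
have w4 : 0 < w / 4 by rewrite divr_gt0.
have [m1 m10 hm1] := pot_small_L2 p1 C00 z01 dyadic 1 (divr_gt0 w4 D0).
pose K := S + 2 * `|alpha| * S + 1.
have K0 : 0 < K by rewrite ltr_wpDl// addr_ge0// !mulr_ge0.
exists (Num.min 1 (Num.min m1 (w / 4 / K))).
  by rewrite !lt_min ltr01 m10 divr_gt0.
move=> chi chi1; rewrite !le_min => /and3P[c1 c2 c3] c.
have chi2 := snorm_le_H1 chi1; have [Us Vs] := clamp_bound c.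
have k1 : `|ip (nlf p (U c)) chi| <= w / 4 + w / 4.
  apply: le_trans (ip_nlf_eta p1 C00 z01 dyadic (clamp_H1 c) chi1 eta0) _.
  apply: lerD.
    rewrite /eta mulrAC -mulrA ler_piMr ?(ltW w4)// ler_pdivrMr// mul1r.
    by apply: le_trans (hP c) _; rewrite lerDl.
  rewrite -ler_pdivlMl// mulrC; apply: hm1 => //; exact: le_trans chi2 c2.
have k2 : `|ip1 (U c) chi| <= S * (w / 4 / K).
  apply: le_trans (sip_CS H1_semi_inner (clamp_H1 c) chi1) _.
  by apply: ler_pM; rewrite ?snorm_ge0.
have k3 : `|2 * alpha * ip (V c) chi| <= 2 * `|alpha| * S * (w / 4 / K).
  rewrite normrM [`|2 * alpha|]normrM (ger0_norm (ler0n R 2)) -[leRHS]mulrA ler_wpM2l ?mulr_ge0//.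
  apply: le_trans (sip_CS L2_semi_inner (clamp_L2 c) (in_H1_L2 chi1)) _.
  by apply: ler_pM; rewrite ?snorm_ge0//; exact: le_trans chi2 c3.
have k4 : S * (w / 4 / K) + 2 * `|alpha| * S * (w / 4 / K) <= w / 4.
  rewrite -mulrDl; apply: (@le_trans _ _ (K * (w / 4 / K))).
    by rewrite ler_wpM2r ?lerDl// !divr_ge0// ltW.
  by rewrite mulrC divfK// gt_eqF.
rewrite /force; apply: le_trans (ler_normB _ _) _; apply: le_trans (lerD (ler_normB _ _) (lexx _)) _.
exact: (sum_le_three (ltW w0) k1 k2 k3 k4).
Qed.

(** By compactness of [a, b]. The other time t may leave the interval, as difference quotients at
    its ends require. *)
Lemma clamp_unif_continuous a b e : 0 < e -> exists2 r, 0 < r &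
  forall s, a <= s <= b -> forall t, `|t - s| < r ->
  snorm ip1 (U t - U s) <= e /\ snorm ip (V t - V s) <= e.
Proof.
move=> e0; have e2 : 0 < e / 2 by rewrite divr_gt0.
pose P (r s : R) := forall t, `|t - s| < r ->
  snorm ip1 (U t - U s) <= e /\ snorm ip (V t - V s) <= e.
have cov : \forall r \near 0^'+, (`[a, b]%classic : set R) `<=` P r.
  apply: (compact_near_coveringP _).1; first exact: segment_compact.
  move=> s _; have [r r0 hr] := clamp_continuous s e2.
  have r2 : 0 < r / 2 by rewrite divr_gt0.
  exists (ball s (r / 2), [set x | x < r / 2]).
    by split => /=; [exact: nbhsx_ballx|exact: nbhs_right_lt].
  move=> -[s' x] /= [ss' xr] t ts'.
  have ss'' : `|s' - s| < r by rewrite distrC; apply: lt_trans ss' _; rewrite ltr_pdivrMr// ltr_pMr// ltr1n.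
  have ts : `|t - s| < r.
    have := ler_normD (t - s') (s' - s); rewrite addrA subrK => /le_lt_trans; apply.
    rewrite [ltRHS](splitr r); apply: ltrD; first exact: lt_trans ts' xr.
    by rewrite distrC.
  have [x1 y1] := hr _ ss''; have [x2 y2] := hr _ ts.
  have hU1 := in_H1B (clamp_H1 t) (clamp_H1 s); have hU2 := in_H1B (clamp_H1 s) (clamp_H1 s').
  have hV1 := in_L2B (clamp_L2 t) (clamp_L2 s); have hV2 := in_L2B (clamp_L2 s) (clamp_L2 s').
  rewrite [e](splitr e); split.
    rewrite -[U t](subrK (U s)) -addrA; apply: le_trans (snormD H1_semi_inner hU1 hU2) _.
    by rewrite lerD// (snorm_distC H1_semi_inner).
  rewrite -[V t](subrK (V s)) -addrA; apply: le_trans (snormD L2_semi_inner hV1 hV2) _.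
  by rewrite lerD// (snorm_distC L2_semi_inner).
have hn : \forall r \near 0^'+, (`[a, b]%classic : set R) `<=` P r /\ 0 < r.
  by near=> r; split; near: r; [exact: cov|exact: nbhs_right_gt].
have [r [hr r0]] := @filter_ex _ _ (at_right_proper_filter (0 : R)) _ hn.
by exists r => // s sab; apply: hr; rewrite /= in_itv.
Unshelve. all: end_near. Qed.

(** The curve is differentiable into L2, uniformly on compact intervals of positive times. By
    duality the remainder is tested against phi, where the mean value theorem produces V c - V s
    with c between s and t; the minimum with [a] keeps these times positive. *)
Lemma strong_derivative a b e : 0 < a -> 0 < e -> exists2 r, 0 < r &
  forall s, a <= s <= b -> forall t, `|t - s| < r ->
  snorm ip (U t - U s - (t - s) *: V s) <= e * `|t - s|.
Proof.
move=> a0 e0; have [r r0 hr] := clamp_unif_continuous a b e0.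
exists (Num.min r a); first by rewrite lt_min r0.
move=> s /andP[sa sb] t; rewrite lt_min => /andP[tr ta].
have sab : a <= s <= b by rewrite sa.
have dU := in_L2B (in_H1_L2 (clamp_H1 t)) (in_H1_L2 (clamp_H1 s)).
have tV := in_L2Z (t - s) (clamp_L2 s); have g2 := in_L2B dU tV.
apply: L2_dual_bound => //; first by rewrite mulr_ge0// ltW.
move=> phi tphi; have phi2 := test_in_L2 tphi.
have between x : Num.min s t <= x <= Num.max s t -> `|x - s| <= `|t - s|.
  move=> xs; apply: min0_max0_norm; move: xs.
  by rewrite -{1 2}(addr0 s) -[X in Num.min _ X](subrK s t) -[X in Num.max _ X](subrK s t)
     [t - s + s]addrC -addr_minr -addr_maxr lerBrDl lerBlDl.
have [|c /between cs hc] := @mvt_real _ (fun t => ip (U t) phi) (fun s => ip (V s) phi) s t.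
  move=> x /between xs; apply: is_derive_ip_u => //.
  have := ler_norm (- (x - s)); rewrite normrN; move: xs ta sa; lra.
rewrite (sip_subl L2_semi_inner)// (sip_subl L2_semi_inner)//; try exact: in_H1_L2.
rewrite hc [ip (_ *: _) _]ipC (sip_scaler L2_semi_inner)// (ipC phi).
have [_ hV] := hr _ sab c (le_lt_trans cs tr).
have dV := in_L2B (clamp_L2 c) (clamp_L2 s).
rewrite [X in X - _]mulrC -mulrBr -(sip_subl L2_semi_inner)//.
apply: le_trans (ler_norm _) _; rewrite normrM [e * _]mulrC -mulrA ler_wpM2l//.
apply: le_trans (sip_CS L2_semi_inner dV phi2) _.
by rewrite ler_wpM2r// snorm_ge0.
Qed.

(** The increment t is fixed before psi is approximated by a test function, at a cost w that is then
    sent to 0; the mean value theorem is applied to the approximation. *)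
Lemma is_derive_ip_v psi s : 0 < s -> in_H1 psi ->
  is_derive s 1 (fun t => ip (V t) psi) (force s psi).
Proof.
move=> s0 psi1; apply: is_derive_littleo => e e0.
have e2 : 0 < e / 2 by rewrite divr_gt0.
have /cvgrPdist_le/(_ _ e2)[r /= r0 hr] := @continuous_force _ psi1 s.
exists (Num.min r s); first by rewrite lt_min r0.
move=> t; rewrite lt_min => /andP[tr ts].
apply/ler_addgt0Pr => w w0.
pose K := 3 * `|t| + 2 * S + 1.
have K0 : 0 < K by rewrite ltr_wpDl// addr_ge0// mulr_ge0.
have wK : 0 < w / K by rewrite divr_gt0.
have [m m0 hm] := force_small wK.
have mm : 0 < Num.min m (w / K) by rewrite lt_min m0.
have [phi tphi] := test_dense_H1 psi1 mm; have [phi1 _] := test_in_H1 tphi.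
rewrite (snorm_distC H1_semi_inner)// le_min => /andP[c1 c2].
have chi1 := in_H1B psi1 phi1; have chi2 := le_trans (snorm_le_H1 chi1) c2.
have [|c cs hc] := @mvt_real _ (fun t => ip (V t) phi) (fun s => force s phi) s (s + t).
  move=> x xs; apply: is_derive_ip_v_test => //.
  have : `|x - s| <= `|t|.
    by apply: min0_max0_norm; move: xs; rewrite -{1 3}(addr0 s) -addr_minr -addr_maxr lerBrDl lerBlDl.
  have := ler_norm (- (x - s)); rewrite normrN; move: ts; lra.
have {}cs : `|c - s| <= `|t|.
  by apply: min0_max0_norm; move: cs; rewrite -{1 3}(addr0 s) -addr_minr -addr_maxr lerBrDl lerBlDl.
have cr : `|force s psi - force c psi| <= e / 2.
  by apply: hr => /=; rewrite distrC; exact: le_lt_trans tr.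
have fc := hm _ chi1 c1 c; have fs := hm _ chi1 c1 s.
rewrite forceB// in fc; rewrite forceB// in fs.
have vb x : `|ip (V x) psi - ip (V x) phi| <= S * (w / K).
  rewrite -(sip_subr L2_semi_inner) ?clamp_L2//; try exact: in_H1_L2.
  apply: le_trans (sip_CS L2_semi_inner (clamp_L2 x) (in_H1_L2 chi1)) _.
  by apply: ler_pM; rewrite ?snorm_ge0//; have [] := clamp_bound x.
have v1 := vb (s + t); have v2 := vb s; rewrite addrAC subrr add0r in hc.
have Kw : K * (w / K) = w by rewrite mulrC divfK// gt_eqF.
move: Kw v1 v2 fc fs cr hc; rewrite /K.
move: (force c psi) (force s psi) (force c phi) (force s phi) (w / (3 * `|t| + 2 * S + 1)).
move: (ip (V (s + t)) psi) (ip (V s) psi) (ip (V (s + t)) phi) (ip (V s) phi).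
exact: derivative_perturbation.
Qed.

End weak_formulation.

(** * Integral comparisons and bookkeeping for the energy inequality *)

Lemma antiderivative {R : realType} (a : R) (g : R -> R) : continuous g ->
  let G x := \int[@lebesgue_measure R]_(t in `[a, x]) g t in
  forall t, a < t -> is_derive t 1 G (g t).
Proof.
move=> cg G t at_; have ig : (@lebesgue_measure R).-integrable `[a, t + 1] (EFin \o g).
  apply: continuous_compact_integrable; first exact: segment_compact.
  exact: continuous_subspaceT.
have t1 : t < t + 1 by rewrite ltrDl.
have [h1 h2] := continuous_FTC1_closed t1 ig at_ (cg t).
by rewrite derive1E in h2; exact: DeriveDef h1 h2.
Qed.

(** Compares the suprema over simple functions that define the integrals, so that it applies to the
    L2 norm of the nonlinearity as a bare function of time. *)
Lemma le_integral_lower {R : realType} (D1 D2 : set R) (f g : R -> \bar R) :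
  (forall t, (0 <= g t)%E) -> (forall t, D1 t -> D2 t /\ (0 <= f t <= g t)%E) ->
  (\int[@lebesgue_measure R]_(t in D1) f t <= \int[@lebesgue_measure R]_(t in D2) g t)%E.
Proof.
move=> g0 fg; rewrite integral_mkcond [leRHS]integral_mkcond.
have p0 t : (0 <= (f \_ D1) t)%E.
  by rewrite patchE; case: ifPn => // /set_mem/fg[_ /andP[]].
have pg t : (0 <= (g \_ D2) t)%E by rewrite patchE; case: ifPn.
rewrite ge0_integralTE// [leRHS]ge0_integralTE//.
apply: le_ereal_sup => _ [h hf <-]; exists h => // t; apply: le_trans (hf t) _.
rewrite !patchE; case: ifPn => [/set_mem/fg[D2t /andP[_ ?]]|_]; first by rewrite mem_set.
by case: ifPn.
Qed.

Lemma is_derive_littleoP {R : realType} (k : R -> R) (s l : R) : is_derive s 1 k l ->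
  forall e, 0 < e -> exists2 r, 0 < r & forall t, `|t| < r ->
     `|k (s + t) - k s - t * l| <= e * `|t|.
Proof.
move=> [dk vk] e e0; move: dk; rewrite /derivable -[lim _]/('D_1 k s) vk.
move=> /cvgrPdist_le/(_ _ e0)[r /= r0 hr]; exists r => // t tr.
have [->|t0] := eqVneq t 0; first by rewrite addr0 subrr mul0r subr0 normr0 mulr0.
have := hr t; rewrite /= sub0r normrN => /(_ tr t0).
rewrite /GRing.scale/= mulr1 [t + s]addrC => h.
have -> : k (s + t) - k s - t * l = - (t * (l - t^-1 * (k (s + t) - k s))).
  by rewrite mulrBr mulrA mulfV// mul1r opprB.
by rewrite normrN normrM mulrC ler_wpM2r.
Qed.

Lemma is_derive_shift {R : realType} (F : R -> R) (t c l : R) :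
  is_derive (t + c) 1 F l -> is_derive t 1 (fun t => F (t + c)) l.
Proof.
move=> dF; apply: is_derive_littleo => e /(is_derive_littleoP dF)[r r0 hr].
by exists r => // s /hr; rewrite [t + s + c]addrAC.
Qed.

(** The integral starts at a0 < a so that the antiderivative of Z is differentiable at the end point
    a too; the enlargement is harmless since Z >= 0. *)
Lemma derive_le_integral {R : realType} (Y Y' Z : R -> R) (a0 a b : R) : a0 < a -> a < b ->
  continuous Z -> (forall t, 0 <= Z t) ->
  (forall t, a <= t <= b -> is_derive t 1 Y (Y' t)) -> (forall t, a <= t <= b -> Y' t <= Z t) ->
  Y b - Y a <= \int[@lebesgue_measure R]_(t in `[a0, b]) Z t.
Proof.
move=> a0a ab cZ Z0 dY YZ.
pose W x := \int[@lebesgue_measure R]_(t in `[a0, x]) Z t.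
have dW t : a <= t <= b -> is_derive t 1 W (Z t).
  by move=> /andP[at_ _]; apply: antiderivative => //; exact: lt_le_trans at_.
have dYW t : Num.min a b <= t <= Num.max a b -> is_derive t (1 : R) (fun t => Y t - W t) (Y' t - Z t).
  by rewrite min_l ?max_r ?(ltW ab)// => tab; apply: is_deriveB; [exact: dY|exact: dW].
have [c] := mvt_real dYW; rewrite min_l ?max_r ?(ltW ab)// => cab hc.
have : (Y' c - Z c) * (b - a) <= 0.
  by rewrite mulr_le0_ge0 ?subr_ge0 ?(ltW ab)// subr_le0 YZ.
have : 0 <= W a by apply: Rintegral_ge0.
by rewrite -hc -/(W b); move: (W a) (W b) (Y a) (Y b) => *; lra.
Qed.

(** Arithmetic of [energy_decay]: y, k, g, n and M are of order h and are replaced by h or 2h times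
    the velocity, H1, potential and dissipation terms with errors of order e h; everything is then
    divided by 2h. *)
Lemma energy_algebra {R : realFieldType} (h e K c1 c2 c3 al q ya yb ka kb ga gb na nb
    Ma Mb Da Db va vb ua ub pa pb : R) :
  0 < h -> 0 < al -> 0 < q ->
  (yb + kb + 2 * al * Mb - 2 / q * nb - gb) - (ya + ka + 2 * al * Ma - 2 / q * na - ga)
    <= 2 * (e * h) * K ->
  `|ya - 2 * h * va| <= c1 * (e * h) -> `|yb - 2 * h * vb| <= c1 * (e * h) ->
  `|ka - h * ua| <= c2 * (e * h) -> `|kb - h * ub| <= c2 * (e * h) ->
  `|ga - h * va| <= c2 * (e * h) -> `|gb - h * vb| <= c2 * (e * h) ->
  `|na - h * pa| <= e * h -> `|nb - h * pb| <= e * h ->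
  `|Mb - Ma - 2 * h * (Db - Da)| <= c3 * (e * h) ->
  ((vb + ub) / 2 - pb / q) - ((va + ua) / 2 - pa / q) + 2 * al * (Db - Da)
   <= (K + c1 + 2 * c2 + 2 / q + al * c3) * e.
Proof.
move=> h0 al0 q0 hY.
have scale (c x y z : R) : 0 < c -> `|x - y| <= z -> - (c * z) <= c * x - c * y <= c * z.
  by move=> c0; rewrite -mulrBr -ler_norml normrM (gtr0_norm c0) ler_pM2l.
have q2 : 0 < 2 / q by rewrite divr_gt0.
have al2 : 0 < 2 * al by rewrite mulr_gt0.
rewrite !ler_norml => /andP[? ?] /andP[? ?] /andP[? ?] /andP[? ?] /andP[? ?] /andP[? ?].
rewrite -!ler_norml => /(scale _ _ _ _ q2)/andP[? ?] /(scale _ _ _ _ q2)/andP[? ?].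
move=> /(scale _ _ _ _ al2)/andP[? ?].
rewrite -(ler_pM2l h0) -(ler_pM2l (ltr0n R 2 : 0 < 2)).
have -> : 2 * (h * ((vb + ub) / 2 - pb / q - ((va + ua) / 2 - pa / q) + 2 * al * (Db - Da))) =
  (h * vb + h * ub - 2 / q * (h * pb)) - (h * va + h * ua - 2 / q * (h * pa)) +
   2 * al * (2 * h * (Db - Da)) by field; rewrite gt_eqF.
have -> : 2 * (h * ((K + c1 + 2 * c2 + 2 / q + al * c3) * e)) =
  2 * (e * h) * K + c1 * (e * h) + c1 * (e * h) + 4 * (c2 * (e * h)) + 2 * (2 / q * (e * h)) +
   2 * al * (c3 * (e * h)) by ring.
by move: q2 al2 => _ _; lra.
Qed.

Lemma positive_part_ge0 {R : realFieldType} (y : R) : 0 <= (`|y| + y) / 2.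
Proof. by rewrite divr_ge0// -lerBlDr sub0r -normrN ler_norm. Qed.

Lemma le_positive_part {R : realFieldType} (y : R) : y <= (`|y| + y) / 2.
Proof. by have := ler_norm y; lra. Qed.

Lemma positive_part_le {R : realFieldType} (y x : R) : y <= - x -> (`|y| + y) / 2 <= `|x|.
Proof.
move=> yx; have := ler_norm (- x); rewrite normrN; have := normr_ge0 x.
by have [y0|/ltW y0] := leP 0 y; [rewrite (ger0_norm y0)|rewrite (ler0_norm y0)]; lra.
Qed.

Lemma convexity_algebra {R : realFieldType} (A B C z : R) :
  2 * (A - B) <= z -> A - C - z <= - (A - B - (B - C)).
Proof. by move=> h; lra. Qed.

(** * Continuous curves in a semi-inner product space *)

Section curves.
Context {R : realType} {T : Type} {dom : (T -> R) -> Prop} {b : (T -> R) -> (T -> R) -> R}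
  (bs : semi_inner dom b).
Implicit Types X Z : R -> T -> R.

Definition curve_continuous X := forall t e, 0 < e -> exists2 r, 0 < r &
  forall s, `|s - t| < r -> snorm b (X s - X t) <= e.

Lemma curve_continuous_shift X h : curve_continuous X -> curve_continuous (fun t => X (t + h)).
Proof.
move=> cX t e e0; have [r r0 hr] := cX (t + h) e e0; exists r => // s st.
by apply: hr; rewrite opprD addrACA subrr addr0.
Qed.

Lemma curve_continuousB X Z : (forall t, dom (X t)) -> (forall t, dom (Z t)) ->
  curve_continuous X -> curve_continuous Z -> curve_continuous (fun t => X t - Z t).
Proof.
move=> dX dZ cX cZ t e e0; have e2 : 0 < e / 2 by rewrite divr_gt0.
have [r1 r10 h1] := cX t _ e2; have [r2 r20 h2] := cZ t _ e2.
exists (Num.min r1 r2); first by rewrite lt_min r10.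
move=> s; rewrite lt_min => /andP[s1 s2].
have -> : X s - Z s - (X t - Z t) = (X s - X t) - (Z s - Z t).
  by apply/funext => x; rewrite !fctE; ring.
apply: le_trans (snormB bs (sip_domB bs (dX s) (dX t)) (sip_domB bs (dZ s) (dZ t))) _.
by rewrite [e]splitr lerD// ?h1// h2.
Qed.

Lemma sip_diff_bound x z x' z' e K : dom x -> dom z -> dom x' -> dom z' ->
  snorm b (x - x') <= e -> snorm b (z - z') <= e -> snorm b x' <= K -> snorm b z <= K ->
  `|b x z - b x' z'| <= 2 * K * e.
Proof.
move=> dx dz dx' dz' hx hz hK hK'.
have -> : b x z - b x' z' = b (x - x') z + b x' (z - z').
  by rewrite (sip_subl bs)// (sip_subr bs)//; ring.
apply: le_trans (ler_normD _ _) _.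
have h1 : `|b (x - x') z| <= e * K.
  apply: le_trans (sip_CS bs (sip_domB bs dx dx') dz) _.
  by apply: ler_pM; rewrite ?snorm_ge0.
have h2 : `|b x' (z - z')| <= K * e.
  apply: le_trans (sip_CS bs dx' (sip_domB bs dz dz')) _.
  by apply: ler_pM; rewrite ?snorm_ge0.
by apply: le_trans (lerD h1 h2) _; rewrite le_eqVlt; apply/orP; left; apply/eqP; ring.
Qed.

Lemma curve_sip_continuous X Z K : (forall t, dom (X t)) -> (forall t, dom (Z t)) ->
  (forall t, snorm b (X t) <= K) -> (forall t, snorm b (Z t) <= K) ->
  curve_continuous X -> curve_continuous Z -> continuous (fun t => b (X t) (Z t)).
Proof.
move=> dX dZ KX KZ cX cZ; apply: continuous_real => t e e0.
have K0 : 0 <= K := le_trans (snorm_ge0 b (X 0)) (KX 0).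
have K1 : 0 < 2 * K + 1 by rewrite ltr_wpDl// mulr_ge0.
have eK : 0 < e / (2 * K + 1) by rewrite divr_gt0.
have [r1 r10 h1] := cX t _ eK; have [r2 r20 h2] := cZ t _ eK.
exists (Num.min r1 r2); first by rewrite lt_min r10.
move=> s; rewrite lt_min => /andP[/h1 s1 /h2 s2].
apply: le_trans (sip_diff_bound (dX s) (dZ s) (dX t) (dZ t) s1 s2 (KX t) (KZ s)) _.
by rewrite mulrCA ler_piMr ?(ltW e0)// ler_pdivrMr// mul1r lerDl.
Qed.

End curves.

(** * The energy inequality *)

Section energy.
Context {R : realType} {d : nat}.
Context (alpha p S : R) (alpha0 : 0 < alpha) (p1 : 1 < p).
Context (C0 z0 : R) (C00 : 0 <= C0) (z01 : 0 <= z0 < 1).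
Local Notation rV := 'rV[R]_d.
Local Notation test := (@test_function R 'rV[R]_d setT).
Local Notation mu := (@lebesgue_measure R).
Context (dyadic : forall (w : rV -> R) k, in_H1 w ->
  (modular (p + 1) (w - avg k w)%R <= (C0 * z0 ^+ k * grad_norm w `^ (p + 1))%:E)%E).
Context (U V : R -> rV -> R) (UH1 : forall t, in_H1 (U t)) (VL2 : forall t, in_L2 (V t)).
Context (US : forall t, snorm ip1 (U t) <= S) (VS : forall t, snorm ip (V t) <= S).
Context (cU : curve_continuous (b := @ip1 R d) U) (cV : curve_continuous (b := @ip R d) V).
Context (cV_unif : forall a b e : R, 0 < e -> exists2 r, 0 < r &
  forall s, a <= s <= b -> forall t, `|t - s| < r ->
  snorm ip1 (U t - U s) <= e /\ snorm ip (V t - V s) <= e).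
Context (strong : forall a b e : R, 0 < a -> 0 < e -> exists2 r, 0 < r &
  forall s, a <= s <= b -> forall t, `|t - s| < r ->
  snorm ip (U t - U s - (t - s) *: V s) <= e * `|t - s|).
Local Notation force t psi :=
  (ip (nlf p (U t)) psi - ip1 (U t) psi - 2 * alpha * ip (V t) psi).
Context (dV : forall (psi : rV -> R) (s : R), 0 < s -> in_H1 psi ->
  is_derive s (1 : R) (fun t => ip (V t) psi) (force s psi)).
Context (fL1 : forall b : R, 0 <= b ->
  (\int[mu]_(t in `[0%R, b]) L2_norm (nlf p (U t)) < +oo)%E).
Implicit Types (t s e r h a b : R) (psi : rV -> R).

Let UL2 t : in_L2 (U t). Proof. exact: in_H1_L2. Qed.
Local Hint Resolve UH1 VL2 UL2 : core.
Let S0 : 0 <= S. Proof. exact: le_trans (snorm_ge0 _ _) (US 0). Qed.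

Lemma pot_curve_bound : exists2 P, 0 <= P & forall t, pot p (U t) <= P.
Proof.
have [C C_ hC] := pot_bound p1 C00 z01 dyadic.
exists (C * S `^ (p + 1)); first by rewrite mulr_ge0 ?powR_ge0.
move=> t; apply: le_trans (hC _ (UH1 t)) _; rewrite ler_wpM2l//.
apply: ge0_ler_powR; rewrite ?nnegrE ?snorm_ge0//.
by rewrite addr_ge0// ltW// (lt_trans _ p1).
Qed.

Lemma continuous_nlf_curve Z : (forall t, in_H1 (Z t)) ->
  curve_continuous (b := @ip1 R d) Z -> continuous (fun t => ip (nlf p (U t)) (Z t)).
Proof.
move=> Z1 cZ; apply: continuous_real => t e e0.
have [P P0 hP] := pot_curve_bound; have P1 : 0 < P + 1 by rewrite ltr_wpDl.
have e4 : 0 < e / 4 by rewrite divr_gt0.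
pose eta := e / 4 / (P + 1); have eta0 : 0 < eta by rewrite !divr_gt0.
pose D := eta^-1 `^ p; have D0 : 0 < D by rewrite powR_gt0// invr_gt0.
have [m m0 hm] := pot_small_L2 p1 C00 z01 dyadic 1 (divr_gt0 e4 D0).
have mm : 0 < Num.min 1 m by rewrite lt_min ltr01.
have [r1 r10 h1] := cZ t _ mm.
have wk : ip (nlf p (U s)) (Z t) @[s --> t] --> ip (nlf p (U t)) (Z t).
  apply: (@ip_nlf_weak_cvg R d p p1 C0 z0 C00 z01 dyadic R (nbhs t) _ U (U t) (Z t) S) => //.
  move=> g g2; apply/cvgrPdist_le => w w0.
  have n1 : 0 < snorm ip g + 1 by rewrite ltr_wpDl// snorm_ge0.
  have [r r0 hr] := cU t (divr_gt0 w0 n1); exists r => // s /=; rewrite distrC => /hr h.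
  have hd := in_H1B (UH1 s) (UH1 t).
  rewrite distrC -(sip_subr L2_semi_inner)//.
  apply: le_trans (sip_CS L2_semi_inner g2 (in_H1_L2 hd)) _.
  apply: (@le_trans _ _ ((snorm ip g + 1) * (w / (snorm ip g + 1)))).
    by apply: ler_pM; rewrite ?snorm_ge0 ?lerDl//; exact: le_trans (snorm_le_H1 hd) h.
  by rewrite mulrC divfK ?gt_eqF.
have e2 : 0 < e / 2 by rewrite divr_gt0.
move/cvgrPdist_le : wk => /(_ _ e2)[r2 /= r20 h2].
exists (Num.min r1 r2); first by rewrite lt_min r10.
move=> s; rewrite lt_min => /andP[/h1 s1 s2].
have {h2}k2 : `|ip (nlf p (U t)) (Z t) - ip (nlf p (U s)) (Z t)| <= e / 2.
  by apply: h2; rewrite /= distrC.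
have hd := in_H1B (Z1 s) (Z1 t); move: s1; rewrite le_min => /andP[s1 s1'].
have k1 : `|ip (nlf p (U s)) (Z s - Z t)| <= e / 4 + e / 4.
  apply: le_trans (ip_nlf_eta p1 C00 z01 dyadic (UH1 s) hd eta0) _.
  apply: lerD.
    rewrite /eta mulrAC -mulrA ler_piMr ?(ltW e4)// ler_pdivrMr// mul1r.
    by apply: le_trans (hP s) _; rewrite lerDl.
  rewrite -ler_pdivlMl// mulrC; apply: hm => //; exact: le_trans (snorm_le_H1 hd) s1'.
rewrite (ip_nlfB p1 C00 z01 dyadic)// in k1.
rewrite distrC in k2.
rewrite (_ : _ - _ = (ip (nlf p (U s)) (Z s) - ip (nlf p (U s)) (Z t)) +
  (ip (nlf p (U s)) (Z t) - ip (nlf p (U t)) (Z t))); last by rewrite addrA subrK.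
rewrite (_ : e = e / 4 + e / 4 + e / 2); last by field.
exact: le_trans (ler_normD _ _) (lerD k1 k2).
Qed.

Lemma continuous_pot : continuous (fun t => pot p (U t)).
Proof.
have -> : (fun t => pot p (U t)) = (fun t => ip (nlf p (U t)) (U t)).
  by apply/funext => t; rewrite (ip_nlf_self p1).
exact: continuous_nlf_curve.
Qed.

Lemma is_derive_pairing (X : R -> rV -> R) (X' : rV -> R) t : 0 < t ->
  (forall s, in_H1 (X s)) -> in_L2 X' ->
  (forall e, 0 < e -> exists2 r, 0 < r & forall s, `|s| < r ->
     snorm ip (X (t + s) - X t - s *: X') <= e * `|s|) ->
  is_derive t 1 (fun t => ip (V t) (X t)) (force t (X t) + ip (V t) X').
Proof.
move=> t0 X1 X'2 dX; apply: is_derive_littleo => e e0.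
pose K := S + snorm ip X' + 1.
have K0 : 0 < K by rewrite ltr_wpDl// addr_ge0// snorm_ge0.
have K3 : 0 < e / 3 / K by rewrite !divr_gt0.
have e3 : 0 < e / 3 by rewrite divr_gt0.
have [r1 r10 h1] := is_derive_littleoP (dV t0 (X1 t)) e3.
have [r2 r20 h2] := dX _ K3; have [r3 r30 h3] := cV t K3.
exists (Num.min r1 (Num.min r2 r3)); first by rewrite !lt_min r10 r20.
move=> s; rewrite !lt_min => /and3P[s1 s2 s3].
have X2 x := in_H1_L2 (X1 x).
have dX2 := in_L2B (X2 (t + s)) (X2 t); have sX := in_L2Z s X'2.
have k1 := h1 _ s1; have k2 := h2 _ s2.
have k3 : snorm ip (V (t + s) - V t) <= e / 3 / K by apply: h3; rewrite addrAC subrr add0r.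
have -> : ip (V (t + s)) (X (t + s)) - ip (V t) (X t) - s * (force t (X t) + ip (V t) X') =
  (ip (V (t + s)) (X t) - ip (V t) (X t) - s * force t (X t)) +
  ip (V (t + s)) (X (t + s) - X t - s *: X') + s * ip (V (t + s) - V t) X'.
  rewrite (sip_subr L2_semi_inner)// (sip_subr L2_semi_inner)// (sip_subl L2_semi_inner)//.
  by rewrite (sip_scaler L2_semi_inner)//; ring.
apply: le_trans (ler_normD _ _) _; apply: le_trans (lerD (ler_normD _ _) (lexx _)) _.
have n2 : `|ip (V (t + s)) (X (t + s) - X t - s *: X')| <= e / 3 * `|s|.
  apply: le_trans (sip_CS L2_semi_inner (VL2 _) (in_L2B dX2 sX)) _.
  apply: (@le_trans _ _ (K * (e / 3 / K * `|s|))).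
    apply: ler_pM; rewrite ?snorm_ge0//; apply: le_trans (VS _) _.
    by rewrite /K -addrA lerDl addr_ge0// snorm_ge0.
  by rewrite mulrA [K * _]mulrC divfK ?gt_eqF.
have n3 : `|s * ip (V (t + s) - V t) X'| <= e / 3 * `|s|.
  rewrite normrM mulrC ler_wpM2r//.
  apply: le_trans (sip_CS L2_semi_inner (in_L2B (VL2 _) (VL2 _)) X'2) _.
  apply: (@le_trans _ _ (e / 3 / K * K)); last by rewrite divfK ?gt_eqF.
  apply: ler_pM; rewrite ?snorm_ge0//.
  by rewrite /K -addrA [S + _]addrC -addrA lerDl addr_ge0.
apply: le_trans (lerD (lerD k1 n2) n3) _.
by rewrite -!mulrDl ler_wpM2r// le_eqVlt; apply/orP; left; apply/eqP; field.
Qed.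

Definition energy t := (ip (V t) (V t) + ip1 (U t) (U t)) / 2 - pot p (U t) / (p + 1).

Definition dissipation t := \int[mu]_(s in `[0, t]) ip (V s) (V s).

Lemma is_derive_dissipation t : 0 < t -> is_derive t 1 dissipation (ip (V t) (V t)).
Proof.
move=> t0; apply: (antiderivative (a := 0) (g := fun t => ip (V t) (V t))) => //.
exact: (curve_sip_continuous L2_semi_inner VL2 VL2 VS VS).
Qed.

(** At times when the nonlinearity is outside L2 the right-hand side is infinite; otherwise this is
    Cauchy-Schwarz. *)
Lemma L2_norm_nlf_bound t w c : in_L2 w -> 0 < c -> snorm ip w <= c ->
  ((`|ip (nlf p (U t)) w| / c)%:E <= L2_norm (nlf p (U t)))%E.
Proof.
move=> w2 c0 wc; have mf : measurable_fun setT (nlf p (U t)).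
  by apply: measurable_nlf; exact: in_L2_measurable.
have [->|] := eqVneq (L2_norm (nlf p (U t))) +oo%E; first exact: leey.
rewrite -ltey L2_normE => h.
have f2 : in_L2 (nlf p (U t)) by apply/in_L2P; split => //; exact: lty_poweRy h.
rewrite -L2_normE L2_norm_snorm// lee_fin ler_pdivrMr//.
apply: le_trans (sip_CS L2_semi_inner f2 w2) _.
by rewrite ler_wpM2l// snorm_ge0.
Qed.

Let shift_pos a h t : h < a / 2 -> a / 2 <= t -> 0 < t - h.
Proof. by move=> h1 h2; rewrite subr_gt0; exact: lt_le_trans h1 h2. Qed.

Let near_mvt (k : R -> R) t h v w : 0 < h -> continuous k -> h <= t ->
  (forall c, t - h <= c <= t -> `|k c - v| <= w) ->
  0 < t - h ->
  `|\int[mu]_(s in `[0, t]) k s - \int[mu]_(s in `[0, (t - h)%R]) k s - h * v| <= w * h.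
Proof.
move=> h0 ck ht hk th0; pose K x := \int[mu]_(s in `[0, x]) k s.
have tht : t - h <= t by rewrite gerBl ltW.
have dK x : Num.min (t - h) t <= x <= Num.max (t - h) t -> is_derive x (1 : R) K (k x).
  rewrite min_l ?max_r// => /andP[hx _]; apply: antiderivative => //.
  exact: lt_le_trans hx.
have [c] := mvt_real dK; rewrite min_l ?max_r// => /hk hc.
rewrite -/(K t) -/(K (t - h)) => ->; rewrite opprB addrCA subrr addr0 mulrC -mulrBr normrM.
by rewrite (gtr0_norm h0) mulrC ler_wpM2r// ltW.
Qed.

(** The multiplier is W t = U (t + h) - U (t - h), an H1-valued substitute for 2h u_t. The quadratic
    terms of the equation then become exact increments of integrals over windows of length h. For
    the potential, convexity leaves the pairing of the nonlinearity with the second difference of U,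
    of L2 size at most 2 e h; its time integral is bounded by the integral of
    [L2_norm (nlf p (U t))]. Dividing by 2h and letting e tend to 0 gives the inequality. *)
Lemma energy_decay a b : 0 < a -> a < b ->
  energy b - energy a <= - (2 * alpha * (dissipation b - dissipation a)).
Proof.
move=> a0 ab; rewrite -[leRHS]add0r -lerBlDr opprK.
apply/ler_addgt0Pr => w w0; rewrite add0r.
have b0 : 0 < b := lt_trans a0 ab.
have Kfin := fL1 (ltW b0); set Kb := (\int[mu]_(t in `[0%R, b]) _)%E in Kfin.
have Kb0 : (0 <= Kb)%E by apply: integral_ge0 => t _; exact: Lnorm_ge0.
have q0 : 0 < p + 1 by rewrite ltr_wpDl// ltW// (lt_trans _ p1).
pose C := fine Kb + 2 * S + 2 * (2 * S) + 2 / (p + 1) + alpha * (2 * S * (b - a)).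
have C1 : 0 < C + 1.
  rewrite ltr_wpDl// /C !addr_ge0 ?mulr_ge0 ?fine_ge0 ?subr_ge0 ?invr_ge0//; exact: ltW.
pose e := w / (C + 1); have e0 : 0 < e by rewrite divr_gt0.
have a20 : 0 < a / 2 by rewrite divr_gt0.
have a2a : a / 2 < a by rewrite ltr_pdivrMr// ltr_pMr// ltr1n.
have [r1 r10 str] := strong b a20 e0.
have [r2 r20 unif] := cV_unif a b e0.
have /cvgrPdist_le/(_ _ e0)[r3 /= r30 pa] := @continuous_pot a.
have /cvgrPdist_le/(_ _ e0)[r4 /= r40 pb] := @continuous_pot b.
pose m := Num.min (Num.min r1 r2) (Num.min (Num.min r3 r4) (a / 2)).
have m0 : 0 < m by rewrite !lt_min r10 r20 r30 r40.
pose h := m / 2; have h0 : 0 < h by rewrite divr_gt0.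
have hm : h < m by rewrite ltr_pdivrMr// ltr_pMr// ltr1n.
move: (hm); rewrite !lt_min => /andP[/andP[hr1 hr2] /andP[/andP[hr3 hr4] ha2]].
(* Expansions of U at t with increments h and -h: their difference controls the centred difference,
   their sum the second difference. *)
have hE t : a / 2 <= t <= b ->
    snorm ip (U (t + h) - U (t - h) - (2 * h) *: V t) <= 2 * (e * h) /\
    snorm ip (U (t + h) - U t - (U t - U (t - h))) <= 2 * (e * h).
  move=> tab; have k1 := str _ tab (t + h); have k2 := str _ tab (t - h).
  rewrite addrAC subrr add0r (gtr0_norm h0) in k1.
  rewrite addrAC subrr add0r normrN (gtr0_norm h0) in k2.
  have {}k1 := k1 hr1; have {}k2 := k2 hr1.
  set A := _ - _ - _ in k1; set B := _ - _ - _ in k2.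
  have A2 : in_L2 A by apply: in_L2B; [exact: in_L2B|exact: in_L2Z].
  have B2 : in_L2 B by apply: in_L2B; [exact: in_L2B|exact: in_L2Z].
  have hh : e * h + e * h = 2 * (e * h) by ring.
  rewrite -hh; split.
    have -> : U (t + h) - U (t - h) - (2 * h) *: V t = A - B.
      by apply/funext => x; rewrite /A /B !fctE /GRing.scale/=; ring.
    exact: le_trans (snormB L2_semi_inner A2 B2) (lerD k1 k2).
  have -> : U (t + h) - U t - (U t - U (t - h)) = A + B.
    by apply/funext => x; rewrite /A /B !fctE /GRing.scale/=; ring.
  exact: le_trans (snormD L2_semi_inner A2 B2) (lerD k1 k2).
pose W t := U (t + h) - U (t - h).
have W1 t : in_H1 (W t) by exact: in_H1B.
have W2 t : in_L2 (W t) by exact: in_H1_L2.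
have cUp := curve_continuous_shift h cU; have cUm := curve_continuous_shift (- h) cU.
have cW : curve_continuous (b := @ip1 R d) W.
  exact: (curve_continuousB H1_semi_inner (fun t => UH1 (t + h)) (fun t => UH1 (t - h))).
have cUL : curve_continuous (b := @ip R d) U.
  move=> t w' w0'; have [r r0 hr] := cU t w0'; exists r => // s /hr.
  by apply: le_trans; apply: snorm_le_H1; exact: in_H1B.
have cWL : curve_continuous (b := @ip R d) W.
  move=> t w' w0'; have [r r0 hr] := cW t w' w0'; exists r => // s /hr.
  by apply: le_trans; apply: snorm_le_H1; exact: in_H1B.
have WS t : snorm ip (W t) <= S + S.
  apply: le_trans (snormB L2_semi_inner _ _) _ => //.
  by apply: lerD; apply: le_trans (snorm_le_H1 _) _.
pose k t := ip1 (U t) (U (t + h)); pose g t := ip (V t) (V (t + h)).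
have ck : continuous k by exact: (curve_sip_continuous H1_semi_inner UH1 _ US _ cU cUp).
have cg : continuous g.
  exact: (curve_sip_continuous L2_semi_inner VL2 _ VS _ cV (curve_continuous_shift h cV)).
have cm : continuous (fun t => ip (V t) (W t)).
  apply: (curve_sip_continuous L2_semi_inner VL2 W2 _ WS cV cWL) => t.
  by apply: le_trans (VS t) _; rewrite lerDl.
pose K x := \int[mu]_(s in `[0, x]) k s; pose G x := \int[mu]_(s in `[0, x]) g s.
pose N x := \int[mu]_(s in `[0, x]) pot p (U s).
pose M x := \int[mu]_(s in `[0, x]) ip (V s) (W s).
(* The added terms cancel the H1, damping and kinetic contributions to the derivative of ip (V t) (W
   t), so that Y' keeps only the nonlinear pairing and the increment of the potential. *)
pose Y t := ip (V t) (W t) + (K t - K (t - h)) + 2 * alpha * M t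
  - 2 / (p + 1) * (N (t + h) - N t) - (G t - G (t - h)).
pose Y' t := ip (nlf p (U t)) (W t) - 2 / (p + 1) * (pot p (U (t + h)) - pot p (U t)).
have dY t : a <= t <= b -> is_derive t 1 Y (Y' t).
  move=> /andP[at_ _]; have a2t := le_trans (ltW a2a) at_; have t0 := lt_le_trans a0 at_.
  have th0 : 0 < t - h := shift_pos ha2 a2t.
  have th0' : 0 < t + h by rewrite addr_gt0.
  have d1 : is_derive t 1 (fun t => ip (V t) (W t))
      (force t (W t) + ip (V t) (V (t + h) - V (t - h))).
    apply: is_derive_pairing => //; first exact: in_L2B.
    move=> e' e0'; have e2' : 0 < e' / 2 by rewrite divr_gt0.
    have [r r0 hr] := strong (t + h) th0 e2'; exists r => // s sr.
    have k1 := hr (t + h) _ (t + h + s); have k2 := hr (t - h) _ (t - h + s).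
    have es x : x + s - x = s by rewrite addrAC subrr add0r.
    rewrite !es in k1 k2.
    have {}k1 := k1 _ sr; have {}k2 := k2 _ sr.
    have -> : W (t + s) - W t - s *: (V (t + h) - V (t - h)) =
      (U (t + h + s) - U (t + h) - s *: V (t + h)) - (U (t - h + s) - U (t - h) - s *: V (t - h)).
      rewrite /W [t + s + h]addrAC [t + s - h]addrAC; apply/funext => x.
      by rewrite !fctE /GRing.scale/=; ring.
    apply: le_trans (snormB L2_semi_inner _ _) _.
    - by apply: in_L2B; [exact: in_L2B|exact: in_L2Z].
    - by apply: in_L2B; [exact: in_L2B|exact: in_L2Z].
    rewrite [e' * _](_ : _ = e' / 2 * `|s| + e' / 2 * `|s|); last by field.
    apply: lerD; [apply: k1|apply: k2]; apply/andP; split; rewrite ?lerD2l//.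
      by rewrite (le_trans _ (ltW h0))// oppr_le0 ltW.
    by rewrite (le_trans _ (ltW h0))// oppr_le0 ltW.
  have dK : is_derive t 1 (fun t => K t - K (t - h)) (k t - k (t - h)).
    apply: is_deriveB; first exact: antiderivative.
    by apply: is_derive_shift; exact: antiderivative.
  have dG : is_derive t 1 (fun t => G t - G (t - h)) (g t - g (t - h)).
    apply: is_deriveB; first exact: antiderivative.
    by apply: is_derive_shift; exact: antiderivative.
  have dN : is_derive t 1 (fun t => N (t + h) - N t) (pot p (U (t + h)) - pot p (U t)).
    apply: is_deriveB; last by apply: antiderivative => //; exact: continuous_pot.
    by apply: is_derive_shift; apply: antiderivative => //; exact: continuous_pot.
  have dM : is_derive t 1 M (ip (V t) (W t)) by exact: antiderivative.
  have dY := is_deriveB (is_deriveB (is_deriveD (is_deriveD d1 dK) (is_deriveZ (2 * alpha) dM))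
    (is_deriveZ (2 / (p + 1)) dN)) dG.
  apply: (is_derive_eq dY); rewrite /Y' /GRing.scale/= /k /g /W.
  rewrite !subrK (sip_subr H1_semi_inner)// (sip_subr L2_semi_inner (VL2 _) (VL2 _))//.
  rewrite (sip_sym H1_semi_inner (U (t - h)) (U t)) (sip_sym L2_semi_inner (V (t - h)) (V t)).
  by ring.
(* The positive part of Y' is a continuous nonnegative majorant, and it inherits the upper bound of
   Y' in terms of the nonlinearity. *)
pose Z t := (`|Y' t| + Y' t) / 2.
have cY' : continuous Y'.
  move=> t; apply: cvgB; first exact: (@continuous_nlf_curve W W1 cW t).
  apply: cvgMr; apply: cvgB; last exact: (@continuous_pot t).
  by apply: (continuous_comp (f := fun t => t + h) (g := fun t => pot p (U t)));
    [apply: cvgD; [exact: cvg_id|exact: cvg_cst]|exact: continuous_pot].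
have cZ : continuous Z.
  move=> t; apply: cvgMl; apply: cvgD; last exact: (cY' t).
  by apply: cvg_norm; exact: (cY' t).
have Z0 t : 0 <= Z t.
  exact: positive_part_ge0.
have YZ t : a <= t <= b -> Y' t <= Z t.
  by move=> _; exact: le_positive_part.
have eh0 : 0 < 2 * (e * h) := mulr_gt0 (ltr0n R 2) (mulr_gt0 e0 h0).
have ZL t : a / 2 <= t <= b -> ((Z t / (2 * (e * h)))%:E <= L2_norm (nlf p (U t)))%E.
  move=> tab; have [_ h2] := hE _ tab.
  have D1 : in_H1 (U (t + h) - U t - (U t - U (t - h))) by apply: in_H1B; exact: in_H1B.
  apply: le_trans (L2_norm_nlf_bound t (in_H1_L2 D1) eh0 h2).
  rewrite lee_fin ler_wpM2r ?invr_ge0 ?(ltW eh0)//.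
  have cvx := pot_convex p1 C00 z01 dyadic (UH1 (t + h)) (UH1 t).
  have Yle : Y' t <= - ip (nlf p (U t)) (U (t + h) - U t - (U t - U (t - h))).
    rewrite /Y' /W !(ip_nlfB p1 C00 z01 dyadic)//; try exact: in_H1B.
    rewrite (ip_nlfB p1 C00 z01 dyadic)// in cvx.
    have : 2 / (p + 1) * ((p + 1) * (ip (nlf p (U t)) (U (t + h)) - ip (nlf p (U t)) (U t)))
      <= 2 / (p + 1) * (pot p (U (t + h)) - pot p (U t)).
      by rewrite ler_wpM2l ?divr_ge0 ?(ltW q0)// lerBrDl.
    rewrite mulrA divfK ?gt_eqF//.
    exact: convexity_algebra.
  exact: positive_part_le Yle.
have iZ : mu.-integrable `[a / 2, b] (EFin \o (fun t => Z t / (2 * (e * h)))).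
  apply: continuous_compact_integrable; first exact: segment_compact.
  by apply: continuous_subspaceT => t; apply: cvgMl; exact: (cZ t).
have Yab : Y b - Y a <= 2 * (e * h) * fine Kb.
  apply: le_trans (derive_le_integral a2a ab cZ Z0 dY YZ) _.
  have -> : \int[mu]_(t in `[a / 2, b]) Z t = 2 * (e * h) * (\int[mu]_(t in `[a / 2, b]) (Z t / (2 * (e * h)))).
    rewrite -(RintegralZl _ _ iZ)//; apply: eq_Rintegral => t _.
    by rewrite mulrC divfK// gt_eqF.
  rewrite ler_wpM2l ?(ltW eh0)// /Rintegral fine_le//.
  - exact: (integrable_fin_num _ iZ).
  - by rewrite ge0_fin_numE.
  apply: le_integral_lower => t; first exact: Lnorm_ge0.
  rewrite /= in_itv/= => /andP[t1 t2]; split.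
    by rewrite in_itv/= t2 andbT (le_trans _ t1)// ltW.
  by rewrite lee_fin divr_ge0 ?(ltW eh0)//= ZL// t1.
rewrite (le_trans (_ : _ <= C * e))//; last first.
  by rewrite /e mulrCA ler_piMr ?(ltW w0)// ler_pdivrMr// mul1r lerDl.
rewrite /energy.
have aab : a <= a <= b by rewrite lexx ltW.
have bab : a <= b <= b by rewrite lexx ltW.
have y_bound t : a <= t <= b -> `|ip (V t) (W t) - 2 * h * ip (V t) (V t)| <= 2 * S * (e * h).
  move=> /andP[at_ tb]; have tab : a / 2 <= t <= b by rewrite (le_trans (ltW a2a) at_) tb.
  have [h1 _] := hE t tab.
  rewrite -(sip_scaler L2_semi_inner)// -(sip_subr L2_semi_inner) ?in_L2Z//.
  apply: le_trans (sip_CS L2_semi_inner (VL2 t) (in_L2B (W2 t) (in_L2Z _ (VL2 t)))) _.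
  rewrite [leRHS](_ : _ = S * (2 * (e * h))); last by ring.
  by apply: ler_pM; rewrite ?snorm_ge0.
have close t c : a <= t <= b -> t - h <= c <= t + h ->
    snorm ip1 (U c - U t) <= e /\ snorm ip (V c - V t) <= e.
  move=> tab ch; apply: unif tab _ _; apply: le_lt_trans hr2.
  by rewrite ler_distl.
have kg_bound t : a <= t <= b ->
    `|K t - K (t - h) - h * ip1 (U t) (U t)| <= 2 * S * (e * h) /\
    `|G t - G (t - h) - h * ip (V t) (V t)| <= 2 * S * (e * h).
  move=> tab; have /andP[at_ tb] := tab; have a2t := le_trans (ltW a2a) at_.
  have ht : h <= t by apply: le_trans a2t; exact: ltW.
  have th0 := shift_pos ha2 a2t; rewrite [2 * S * (e * h)]mulrA.
  have cc c : t - h <= c <= t -> t - h <= c <= t + h /\ t - h <= c + h <= t + h.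
    move=> /andP[c1 c2]; rewrite c1 /= lerD2r c2 (le_trans c2) ?lerDl ?(ltW h0)//.
    by split=> //; rewrite andbT (le_trans c1)// lerDl ltW.
  split; apply: near_mvt => // c /cc[/(close _ _ tab)[u1 v1] /(close _ _ tab)[u2 v2]].
    exact: (sip_diff_bound H1_semi_inner _ _ _ _ u1 u2).
  exact: (sip_diff_bound L2_semi_inner _ _ _ _ v1 v2).
have n_bound t r : (forall s, `|t - s| < r -> `|pot p (U t) - pot p (U s)| <= e) -> h < r -> 0 < t ->
    `|N (t + h) - N t - h * pot p (U t)| <= e * h.
  move=> hr hr' t0; have := @near_mvt (fun t => pot p (U t)) (t + h) h (pot p (U t)) e h0 continuous_pot.
  rewrite addrK => near; apply: near => //; first by rewrite lerDr ltW.
  move=> c /andP[c1 c2]; rewrite distrC; apply: hr; rewrite distrC ger0_norm ?subr_ge0//.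
  by apply: le_lt_trans hr'; rewrite lerBlDl.
have M_bound : `|M b - M a - 2 * h * (dissipation b - dissipation a)| <= 2 * S * (b - a) * (e * h).
  have dMD t : Num.min a b <= t <= Num.max a b -> is_derive t (1 : R)
      (fun t => M t - 2 * h * dissipation t) (ip (V t) (W t) - 2 * h * ip (V t) (V t)).
    rewrite min_l ?max_r ?(ltW ab)// => /andP[at_ _]; have t0 := lt_le_trans a0 at_.
    apply: is_deriveB; first exact: antiderivative.
    by apply: (is_deriveZ (2 * h) (is_derive_dissipation t0)).
  have [c] := mvt_real dMD; rewrite min_l ?max_r ?(ltW ab)// => /y_bound yc hc.
  rewrite [X in `|X|](_ : _ = (ip (V c) (W c) - 2 * h * ip (V c) (V c)) * (b - a)); last first.
    by rewrite -hc; ring.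
  have ba0 : 0 < b - a by rewrite subr_gt0.
  by rewrite normrM (gtr0_norm ba0) [leRHS]mulrAC ler_wpM2r// ltW.
have [ka ga] := kg_bound a aab; have [kb gb] := kg_bound b bab.
exact: (energy_algebra h0 alpha0 q0 Yab (y_bound _ aab) (y_bound _ bab) ka kb ga gb
  (n_bound _ _ pa hr3 a0) (n_bound _ _ pb hr4 b0) M_bound).
Qed.

End energy.

(** * A real-variable averaging argument on unit windows *)

Lemma young_small {R : realFieldType} (y e : R) : 0 < e -> 2 * `|y| <= y ^+ 2 / e + e.
Proof.
move=> e0; rewrite -(ler_pM2r e0) [leRHS]mulrDl divfK ?gt_eqF// -(real_normK (num_real y)).
by rewrite -subr_ge0 [X in 0 <= X](_ : _ = (`|y| - e) ^+ 2) ?sqr_ge0//; ring.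
Qed.

Lemma averaging_sign_neg {R : realFieldType} (k m yy Gc Gt A gam : R) :
  `|yy| <= m + A -> `|Gc - Gt| <= gam -> k - Gc - yy + Gt - (k + m) - (A + gam) <= 0.
Proof. by rewrite !ler_norml => /andP[? ?] /andP[? ?]; lra. Qed.

Lemma averaging_sign_pos {R : realFieldType} (k m yy Gc Gt A gam : R) : 0 <= k ->
  `|yy| <= m + A -> `|Gc - Gt| <= gam -> 0 <= k - Gc - yy + Gt + m + (A + gam).
Proof. by move=> k0; rewrite !ler_norml => /andP[? ?] /andP[? ?]; lra. Qed.

Lemma averaging_conclusion {R : realFieldType} (X B k1 k2 k3 gam a b p1 p2 p3 : R) :
  `|b| <= B -> `|a| <= B -> a - b + X - p1 - p3 <= 0 -> 0 <= a - b + X + p2 + p3 ->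
  p1 <= k1 + k2 -> p2 <= p1 -> p3 <= k3 + gam -> `|X| <= 2 * B + k1 + k2 + k3 + gam.
Proof.
by rewrite !ler_norml => /andP[? ?] /andP[? ?] *; apply/andP; split; lra.
Qed.

(** With n of mass at most e^2 on the window, y is small at some time of the first third and some
    time of the last third, since y^2 <= K n. Between them the increment of y is small and n has
    small mass, so G has small mean; as G varies by at most gam, G t is small. The two times are at
    least 1/3 apart, hence the factor 3. *)
Lemma averaging {R : realType} (y D n G : R -> R) (t kap al K e gam : R) :
  0 < e -> 0 <= al -> 0 <= kap -> 0 <= K -> 0 <= gam ->
  (forall s, t <= s <= t + 1 -> is_derive s 1 y (kap * n s - G s - 2 * al * y s)) ->
  (forall s, t <= s <= t + 1 -> is_derive s 1 D (n s)) ->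
  (forall s, 0 <= n s) -> (forall s, y s ^+ 2 <= K * n s) -> D (t + 1) - D t <= e ^+ 2 ->
  (forall s, t <= s <= t + 1 -> `|G s - G t| <= gam) ->
  `|G t| <= 3 * (2 * ((1 + 3 * K) * e) + kap * e ^+ 2 + al * K * e + al * e + gam).
Proof.
move=> e0 al0 kap0 K0 gam0 dy dD n0 yn De Gg.
have sub a b s : t <= a -> a <= b -> b <= t + 1 -> Num.min a b <= s <= Num.max a b ->
    t <= s <= t + 1.
  move=> ta ab bt; rewrite min_l ?max_r// => /andP[as_ sb].
  by rewrite (le_trans ta as_) (le_trans sb bt).
have mono a b : t <= a -> a <= b -> b <= t + 1 -> exists2 c, a <= c <= b & D b - D a = n c * (b - a).
  move=> ta ab bt; have [|c] := @mvt_real _ D n a b; first by move=> s /(sub _ _ _ ta ab bt)/dD.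
  by rewrite min_l ?max_r// => h1 h2; exists c.
have Dle a b : t <= a -> a <= b -> b <= t + 1 -> D a <= D b.
  move=> ta ab bt; have [c _ h] := mono a b ta ab bt.
  by rewrite -subr_ge0 h mulr_ge0// subr_ge0.
have small a b : t <= a -> a <= b -> b <= t + 1 -> b - a = 3^-1 ->
    exists2 c, a <= c <= b & `|y c| <= (1 + 3 * K) * e.
  move=> ta ab bt ba; have [c cab hc] := mono a b ta ab bt; exists c => //.
  have nc : n c <= 3 * e ^+ 2.
    have h1 := Dle a b ta ab bt; have h2 := Dle t a (lexx t) ta (le_trans ab bt).
    have h3 := Dle b (t + 1) (le_trans ta ab) bt (lexx _).
    by rewrite ba in hc; lra.
  (* 1 + 3 K serves as a crude upper bound for the square root of 3 K. *)
  have k0 : 0 <= (1 + 3 * K) * e by rewrite mulr_ge0 ?addr_ge0 ?mulr_ge0 ?(ltW e0).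
  rewrite -(ler_pXn2r (n := 2))// ?nnegrE// real_normK ?num_real//.
  apply: le_trans (yn c) _; apply: le_trans (ler_wpM2l K0 nc) _.
  rewrite exprMn mulrA ler_wpM2r ?sqr_ge0//.
  have := sqr_ge0 (3 * K); rewrite sqrrD expr1n mul1r; lra.
have t1 : t + 3^-1 <= t + 1 by rewrite lerD2l invf_le1// ler1n.
have t3 : t <= t + 3^-1 by rewrite lerDl.
have d3 : t + 3^-1 - t = 3^-1 by rewrite addrAC subrr add0r.
have [t1' c1 y1] := small t (t + 3^-1) (lexx _) t3 t1 d3.
have s1 : t <= t + 2 / 3 by rewrite lerDl.
have s2 : t + 2 / 3 <= t + 1 by rewrite lerD2l ler_pdivrMr// mul1r ler_nat.
have s3 : t + 1 - (t + 2 / 3) = 3^-1 by field.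
have [t2 c2 y2] := small (t + 2 / 3) (t + 1) s1 s2 (lexx _) s3.
have /andP[c11 c12] := c1; have /andP[c21 c22] := c2.
have t12 : t1' <= t2 by apply: le_trans c12 (le_trans _ c21); lra.
have t2t : t2 <= t + 1 by [].
have gap : 3^-1 <= t2 - t1' by move: c12 c21; lra.
have gap1 : t2 - t1' <= 1 by move: c11 c22; lra.
have DD : 0 <= D t2 - D t1' <= e ^+ 2.
  rewrite subr_ge0 (Dle _ _ c11 t12 t2t) /=.
  have := Dle t t1' (lexx _) c11 (le_trans t12 t2t); have := Dle t2 (t + 1) (le_trans c11 t12) t2t (lexx _).
  by move: De; lra.
(* Young's inequality trades the linear damping term for a multiple of n plus a small constant. *)
have absy s : 2 * al * `|y s| <= al * K / e * n s + al * e.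
  have := young_small (y s) e0; have := yn s => h1 h2.
  have h3 : y s ^+ 2 / e <= K * n s / e by rewrite ler_wpM2r ?invr_ge0 ?(ltW e0).
  have : al * (2 * `|y s|) <= al * (K * n s / e + e) by rewrite ler_wpM2l//; move: h2 h3; lra.
  by rewrite mulrDr; congr (_ <= _ + _); ring.
(* Correcting by multiples of D and of s gives the derivative a sign, negative here and positive in
   the next step; the mean value theorem then yields the upper and the lower bound. *)
have [cp cp1 hp] : exists2 c, t <= c <= t + 1 &
   y t2 - y t1' + (t2 - t1') * G t - (kap + al * K / e) * (D t2 - D t1') - (al * e + gam) * (t2 - t1')
   = ((kap * n c - G c - 2 * al * y c) + G t - (kap + al * K / e) * n c - (al * e + gam)) * (t2 - t1').
  have dH s : Num.min t1' t2 <= s <= Num.max t1' t2 -> is_derive s 1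
     (fun s => y s + G t * s - (kap + al * K / e) * D s - (al * e + gam) * s)
     ((kap * n s - G s - 2 * al * y s) + G t - (kap + al * K / e) * n s - (al * e + gam)).
    move=> /(sub _ _ _ c11 t12 t2t) st.
    have d1 (c : R) : is_derive s (1:R) (fun s : R => c * s) c.
      by have := is_deriveZ c (is_derive_id s (1:R)); rewrite /GRing.scale/= mulr1.
    exact: (is_deriveB (is_deriveB (is_deriveD (dy s st) (d1 (G t)))
      (is_deriveZ (kap + al * K / e) (dD s st))) (d1 (al * e + gam))).
  have [c cs hc] := mvt_real dH; exists c; first exact: sub c11 t12 t2t cs.
  by rewrite -hc; ring.
have [cm cm1 hm] : exists2 c, t <= c <= t + 1 &
   y t2 - y t1' + (t2 - t1') * G t + (al * K / e) * (D t2 - D t1') + (al * e + gam) * (t2 - t1')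
   = ((kap * n c - G c - 2 * al * y c) + G t + (al * K / e) * n c + (al * e + gam)) * (t2 - t1').
  have dH s : Num.min t1' t2 <= s <= Num.max t1' t2 -> is_derive s 1
     (fun s => y s + G t * s + (al * K / e) * D s + (al * e + gam) * s)
     ((kap * n s - G s - 2 * al * y s) + G t + (al * K / e) * n s + (al * e + gam)).
    move=> /(sub _ _ _ c11 t12 t2t) st.
    have d1 (c : R) : is_derive s (1:R) (fun s : R => c * s) c.
      by have := is_deriveZ c (is_derive_id s (1:R)); rewrite /GRing.scale/= mulr1.
    exact: (is_deriveD (is_deriveD (is_deriveD (dy s st) (d1 (G t)))
      (is_deriveZ (al * K / e) (dD s st))) (d1 (al * e + gam))).
  have [c cs hc] := mvt_real dH; exists c; first exact: sub c11 t12 t2t cs.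
  by rewrite -hc; ring.
have gap0 : 0 <= t2 - t1' by rewrite subr_ge0.
have aKe0 : 0 <= al * K / e by rewrite divr_ge0 ?(ltW e0)// mulr_ge0.
have age0 : 0 <= al * e + gam by rewrite addr_ge0// mulr_ge0// ltW.
have two_al s : `|2 * al * y s| = 2 * al * `|y s|.
  by rewrite normrM ger0_norm// mulr_ge0.
have neg : ((kap * n cp - G cp - 2 * al * y cp) + G t - (kap + al * K / e) * n cp - (al * e + gam)) <= 0.
  rewrite [(kap + _) * _]mulrDl; apply: averaging_sign_neg; last exact: Gg cp1.
  by rewrite two_al; exact: absy.
have pos : 0 <= ((kap * n cm - G cm - 2 * al * y cm) + G t + (al * K / e) * n cm + (al * e + gam)).
  apply: averaging_sign_pos; [by rewrite mulr_ge0| |exact: Gg cm1].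
  by rewrite two_al; exact: absy.
have {}hp : y t2 - y t1' + (t2 - t1') * G t - (kap + al * K / e) * (D t2 - D t1')
    - (al * e + gam) * (t2 - t1') <= 0 by rewrite hp mulr_le0_ge0.
have {}hm : 0 <= y t2 - y t1' + (t2 - t1') * G t + (al * K / e) * (D t2 - D t1')
    + (al * e + gam) * (t2 - t1') by rewrite hm mulr_ge0.
have q1 : (kap + al * K / e) * (D t2 - D t1') <= kap * e ^+ 2 + al * K * e.
  apply: (@le_trans _ _ ((kap + al * K / e) * e ^+ 2)).
    by rewrite ler_wpM2l ?addr_ge0//; case/andP: DD.
  by rewrite le_eqVlt; apply/orP; left; apply/eqP; field; rewrite gt_eqF.
have q2 : al * K / e * (D t2 - D t1') <= (kap + al * K / e) * (D t2 - D t1').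
  by rewrite ler_wpM2r ?lerDr//; case/andP: DD.
have q3 : (al * e + gam) * (t2 - t1') <= al * e + gam by rewrite ler_piMr.
set A := 2 * _ + _ + _ + _ + _.
have GA : `|(t2 - t1') * G t| <= A.
  exact: (averaging_conclusion y1 y2 hp hm q1 q2 q3).
rewrite -ler_pdivrMl//; apply: le_trans GA; rewrite normrM (ger0_norm gap0).
by rewrite ler_wpM2r.
Qed.

Lemma nondecreasing_bounded_tail {R : realType} (f : R -> R) (B : R) :
  (forall a b, 1 <= a -> a <= b -> f a <= f b) -> (forall t, 1 <= t -> f t <= B) ->
  forall e, 0 < e -> exists2 T, 1 <= T & forall t s, T <= t -> t <= s -> f s - f t <= e.
Proof.
move=> fm fB e e0; pose A := [set f t | t in [set t | 1 <= t]].
have hA : has_sup A.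
  by split; [exists (f 1), 1 => //=|exists B => _ [t /= t1 <-]; exact: fB].
have [_ [T /= T1 <-] hT] := sup_adherent e0 hA; exists T => // t s Tt ts.
have fs : f s <= sup A.
  apply: ub_le_sup; first by case: hA.
  by exists s => //=; rewrite (le_trans T1)// (le_trans Tt).
have := fm T t T1 Tt; move: hT fs; lra.
Qed.

Lemma energy_range {R : realFieldType} (x v u P S2 : R) : 0 <= v -> 0 <= u -> v <= S2 -> u <= S2 ->
  0 <= x <= P -> - P <= (v + u) / 2 - x <= S2.
Proof. by move=> ? ? ? ? /andP[? ?]; apply/andP; split; lra. Qed.

Lemma dist_difference {R : realFieldType} (a a' b b' x y : R) :
  `|a - a'| <= x -> `|b - b'| <= y -> `|a - b - (a' - b')| <= x + y.
Proof.
move=> h1 h2; rewrite (_ : _ - _ = (a - a') - (b - b')); last by ring.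
exact: le_trans (ler_normB _ _) (lerD h1 h2).
Qed.

Lemma linear_difference {R : realFieldType} (c a b a' b' : R) :
  2 * a + c * b - (2 * a' + c * b') = 2 * (a - a') + c * (b - b').
Proof. by ring. Qed.

Lemma averaging_algebra {R : realFieldType} (s a eps x gam e : R) : 0 <= eps -> x <= 2 * eps ->
  eps * (6 * (1 + 3 * s) + 6 + 3 * (a * s) + 3 * a + 1) <= e / 2 -> gam = e / 6 ->
  3 * (2 * ((1 + 3 * s) * eps) + x + a * s * eps + a * eps + gam) <= e.
Proof. by move=> ? ? ? ->; lra. Qed.

(** * Long-time consequences of the finite dissipation *)

Section long_time.
Context {R : realType} {d : nat}.
Context (alpha p S : R) (alpha0 : 0 < alpha) (p1 : 1 < p).
Context (C0 z0 : R) (C00 : 0 <= C0) (z01 : 0 <= z0 < 1).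
Local Notation rV := 'rV[R]_d.
Local Notation test := (@test_function R 'rV[R]_d setT).
Context (dyadic : forall (w : rV -> R) k, in_H1 w ->
  (modular (p + 1) (w - avg k w)%R <= (C0 * z0 ^+ k * grad_norm w `^ (p + 1))%:E)%E).
Context (U V : R -> rV -> R) (UH1 : forall t, in_H1 (U t)) (VL2 : forall t, in_L2 (V t)).
Context (US : forall t, snorm ip1 (U t) <= S) (VS : forall t, snorm ip (V t) <= S).
Local Notation force t psi :=
  (ip (nlf p (U t)) psi - ip1 (U t) psi - 2 * alpha * ip (V t) psi).
Local Notation En := (energy p U V).
Context (dU : forall (psi : rV -> R) (s : R), 0 < s -> in_L2 psi ->
  is_derive s (1 : R) (fun t => ip (U t) psi) (ip (V s) psi)).
Context (dV : forall (psi : rV -> R) (s : R), 0 < s -> in_H1 psi ->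
  is_derive s (1 : R) (fun t => ip (V t) psi) (force s psi)).
Context (dUV : forall t : R, 0 < t ->
  is_derive t (1 : R) (fun t => ip (V t) (U t)) (force t (U t) + ip (V t) (V t))).
Context (D : R -> R) (dD : forall t : R, 0 < t -> is_derive t (1 : R) D (ip (V t) (V t))).
Context (decay : forall a b : R, 0 < a -> a < b ->
  En b - En a <= - (2 * alpha * (D b - D a))).
Context (P : R) (P0 : 0 <= P) (UP : forall t, pot p (U t) <= P).
Implicit Types (t s e r a b : R) (psi : rV -> R).

Let q0 : 0 < p + 1. Proof. by rewrite ltr_wpDl// ltW// (lt_trans _ p1). Qed.
Let UL2 t : in_L2 (U t). Proof. exact: in_H1_L2. Qed.
Local Hint Resolve UH1 VL2 UL2 : core.
Let S0 : 0 <= S. Proof. exact: le_trans (snorm_ge0 _ _) (US 0). Qed.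

Let D_nondecreasing a b : 0 < a -> a <= b -> D a <= D b.
Proof.
move=> a0 ab; have [|c _ hc] := @mvt_real _ D (fun t => ip (V t) (V t)) a b.
  by move=> t; rewrite min_l// => /andP[at_ _]; apply: dD; exact: lt_le_trans at_.
by rewrite -subr_ge0 hc mulr_ge0 ?ip_ge0// subr_ge0.
Qed.

Let energy_bounds t : - P <= En t <= S ^+ 2.
Proof.
have v0 := ip_ge0 (V t); have u0 := sip_ge0 H1_semi_inner (UH1 t).
have vS : ip (V t) (V t) <= S ^+ 2.
  by rewrite -(snorm_sqr L2_semi_inner)// lerXn2r ?nnegrE ?snorm_ge0.
have uS : ip1 (U t) (U t) <= S ^+ 2.
  by rewrite -(snorm_sqr H1_semi_inner)// lerXn2r ?nnegrE ?snorm_ge0.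
have pq : 0 <= pot p (U t) / (p + 1) <= P.
  rewrite divr_ge0 ?pot_ge0 ?(ltW q0)//= ler_pdivrMr//; apply: le_trans (UP t) _.
  by rewrite ler_peMr// ler_wpDl// ltW// (lt_trans _ p1).
exact: energy_range v0 u0 vS uS pq.
Qed.

Let energy_drop a b : 0 < a -> a <= b -> 2 * alpha * (D b - D a) <= En a - En b.
Proof.
move=> a0; rewrite le_eqVlt => /orP[/eqP <-|ab]; first by rewrite !subrr mulr0.
by have := decay a0 ab; move: (2 * alpha * _) (En a) (En b) => *; lra.
Qed.

Lemma dissipation_tail e : 0 < e -> exists2 T, 1 <= T & forall t s, T <= t -> t <= s -> D s - D t <= e.
Proof.
have al2 : 0 < 2 * alpha by rewrite mulr_gt0.
apply: (@nondecreasing_bounded_tail _ D (D 1 + (S ^+ 2 + P) / (2 * alpha))).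
  by move=> a b a1; apply: D_nondecreasing; exact: lt_le_trans a1.
move=> t t1; rewrite -lerBlDl ler_pdivlMr// mulrC.
apply: le_trans (energy_drop ltr01 t1) _.
have /andP[_ h1] := energy_bounds 1; have /andP[h2 _] := energy_bounds t.
by move: (En 1) (En t) h1 h2 => *; lra.
Qed.

Lemma energy_tail e : 0 < e ->
  exists2 T, 1 <= T & forall t s, T <= t -> t <= s -> `|En s - En t| <= e.
Proof.
move=> e0; have al2 : 0 < 2 * alpha by rewrite mulr_gt0.
have mono a b : 1 <= a -> a <= b -> - En a <= - En b.
  move=> a1 ab; have a0 := lt_le_trans ltr01 a1.
  have := energy_drop a0 ab; have : 0 <= 2 * alpha * (D b - D a).
    by rewrite mulr_ge0 ?(ltW al2)// subr_ge0 D_nondecreasing.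
  by move: (2 * alpha * _) (En a) (En b) => *; lra.
have [|T T1 hT] := @nondecreasing_bounded_tail _ (fun t => - En t) P mono _ e e0.
  by move=> t _; have /andP[h _] := energy_bounds t; rewrite lerNl.
exists T => // t s Tt ts; have := hT t s Tt ts; have := mono t s (le_trans T1 Tt) ts.
rewrite ler_norml; move: (En s) (En t) => *; apply/andP; split; lra.
Qed.

(** With z the increment, 2 ip (U x) z - D x - |z|^2 x has derivative -|V x - z|^2 <= 0. Comparing x
    = t with x = t + s gives (2 - s) |z|^2 <= D (t + s) - D t, and s <= 1. *)
Lemma drift_L2 t s : 0 < t -> 0 <= s <= 1 ->
  ip (U (t + s) - U t) (U (t + s) - U t) <= D (t + 1) - D t.
Proof.
move=> t0 /andP[s0 s1]; set z := U (t + s) - U t.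
have z2 : in_L2 z by exact: in_L2B.
have tts : t <= t + s by rewrite lerDl.
have dphi x : Num.min t (t + s) <= x <= Num.max t (t + s) -> is_derive x (1 : R)
    (fun x => 2 * ip (U x) z - D x - ip z z * x) (2 * ip (V x) z - ip (V x) (V x) - ip z z).
  rewrite min_l// => /andP[tx _]; have x0 := lt_le_trans t0 tx.
  have d1 : is_derive x (1:R) (fun x : R => ip z z * x) (ip z z).
    by have := is_deriveZ (ip z z) (is_derive_id x (1:R)); rewrite /GRing.scale/= mulr1.
  exact: (is_deriveB (is_deriveB (is_deriveZ 2 (dU x0 z2)) (dD x0)) d1).
have [c _ hc] := mvt_real dphi.
have neg : 2 * ip (V c) z - ip (V c) (V c) - ip z z <= 0.
  have := ip_ge0 (V c - z); rewrite (sip_sqrB L2_semi_inner)//.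
  by move: (ip _ _) (ip _ _) (ip _ _) => *; lra.
have h1 : (2 * ip (V c) z - ip (V c) (V c) - ip z z) * (t + s - t) <= 0.
  by rewrite mulr_le0_ge0// subr_ge0.
have e1 : ip (U (t + s)) z - ip (U t) z = ip z z by rewrite -(sip_subl L2_semi_inner).
have D1 : D (t + s) <= D (t + 1) by apply: D_nondecreasing; rewrite ?lerD2l// ltr_wpDr.
have zz : ip z z * s <= ip z z by rewrite ler_piMr// ip_ge0.
move: hc h1 e1 D1 zz; rewrite mulrDr [ip z z * t + _]addrC.
move=> <-; move: (ip z z * t) (ip z z * s) (ip z z) (ip _ z) (ip _ z) (D _) (D _) (D _).
by move=> *; lra.
Qed.

Lemma drift_pot e : 0 < e -> exists2 T, 1 <= T & forall t s, T <= t -> 0 <= s <= 1 ->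
  pot p (U (t + s) - U t) <= e.
Proof.
move=> e0; have [m m0 hm] := pot_small_L2 p1 C00 z01 dyadic (S + S) e0.
have [T T1 hT] := dissipation_tail (exprn_gt0 2 m0); exists T => // t s Tt s01.
have t0 : 0 < t by apply: lt_le_trans Tt; exact: lt_le_trans T1.
have z1 : in_H1 (U (t + s) - U t) by exact: in_H1B.
apply: hm => //.
  by apply: le_trans (snormB H1_semi_inner (UH1 _) (UH1 _)) _; exact: lerD.
rewrite -(ler_pXn2r (n := 2))// ?nnegrE ?snorm_ge0 ?(ltW m0)//.
rewrite (snorm_sqr L2_semi_inner); last exact: in_H1_L2.
by apply: le_trans (drift_L2 t0 s01) _; apply: hT => //; rewrite lerDl.
Qed.

Let averaged (y G : R -> R) (kap K : R) : 0 <= kap -> 0 <= K ->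
  (forall s, 0 < s -> is_derive s (1 : R) y (kap * ip (V s) (V s) - G s - 2 * alpha * y s)) ->
  (forall s, y s ^+ 2 <= K * ip (V s) (V s)) ->
  forall gam e T t, 0 < e -> 0 <= gam -> 1 <= T -> T <= t ->
  (forall t s, T <= t -> t <= s -> D s - D t <= e ^+ 2) ->
  (forall s, 0 <= s <= 1 -> `|G (t + s) - G t| <= gam) ->
  `|G t| <= 3 * (2 * ((1 + 3 * K) * e) + kap * e ^+ 2 + alpha * K * e + alpha * e + gam).
Proof.
move=> kap0 K0 dy yn gam e T t e0 gam0 T1 Tt De Gg.
have t0 : 0 < t by apply: lt_le_trans Tt; exact: lt_le_trans T1.
apply: (@averaging _ y D (fun s => ip (V s) (V s)) G) => //; rewrite ?(ltW alpha0)//.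
- by move=> s /andP[ts _]; apply: dy; exact: lt_le_trans ts.
- by move=> s /andP[ts _]; apply: dD; exact: lt_le_trans ts.
- by move=> s; exact: ip_ge0.
- by apply: De => //; rewrite lerDl.
- move=> s /andP[ts st]; have := Gg (s - t); rewrite [t + _]addrC subrK; apply.
  by rewrite subr_ge0 ts lerBlDl.
Qed.

(** The functional is 2 E + (2/(p+1) - 1) pot, where E has a limit and the potential drifts little
    over unit time. It is thus nearly constant on unit windows, and [averaging], applied to ip V U
    with kap = 2, makes it small at each late time. *)
Lemma virial_limit e : 0 < e -> exists2 T, 1 <= T & forall t, T <= t ->
  `|ip (V t) (V t) + ip1 (U t) (U t) - pot p (U t)| <= e.
Proof.
(* The coefficients of the final bound of [averaging] with kap = 2 and K = S^2, the extra 1 making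
   the sum positive; half of e goes to them and half to gam = e/6. *)
move=> e0; pose Kc := 6 * (1 + 3 * S ^+ 2) + 6 + 3 * (alpha * S ^+ 2) + 3 * alpha + 1.
have Kc0 : 0 < Kc.
  by rewrite ltr_wpDl// !addr_ge0 ?mulr_ge0 ?addr_ge0 ?mulr_ge0 ?sqr_ge0 ?(ltW alpha0).
pose eps := Num.min 1 (e / 2 / Kc).
have eps0 : 0 < eps by rewrite lt_min ltr01 !divr_gt0.
pose gam := e / 6; have gam0 : 0 < gam by rewrite divr_gt0.
pose cq := `|2 / (p + 1) - 1| + 1; have cq0 : 0 < cq by rewrite ltr_wpDl.
have g4 : 0 < gam / 4 by rewrite divr_gt0.
have [T1 T11 h1] := dissipation_tail (exprn_gt0 2 eps0).
have [T2 T21 h2] := energy_tail g4.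
pose w := gam / 2 / cq; have w0 : 0 < w by rewrite !divr_gt0.
pose eta := w / (p + 1) / 2 / (P + P + 1).
have PP : 0 < P + P + 1 by rewrite ltr_wpDl// addr_ge0.
have eta0 : 0 < eta by rewrite !divr_gt0.
pose H := eta^-1 `^ p; have H0 : 0 < H by rewrite powR_gt0// invr_gt0.
have wH : 0 < w / (p + 1) / 2 / H by rewrite !divr_gt0.
have [T3 T31 h3] := drift_pot wH.
exists (Num.max T1 (Num.max T2 T3)); first by rewrite le_max T11.
move=> t; rewrite !ge_max => /and3P[t1 t2 t3].
pose G s := ip (V s) (V s) + ip1 (U s) (U s) - pot p (U s).
have GE s : G s = 2 * En s + (2 / (p + 1) - 1) * pot p (U s).
  by rewrite /G /energy; field; rewrite gt_eqF.
have Gg s : 0 <= s <= 1 -> `|G (t + s) - G t| <= gam.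
  move=> s01; have /andP[s0 s1] := s01; rewrite !GE.
  have e1 : `|En (t + s) - En t| <= gam / 4 by apply: h2 => //; rewrite lerDl.
  have e2 : `|pot p (U (t + s)) - pot p (U t)| <= w.
    apply: le_trans (pot_dist p1 C00 z01 dyadic (UH1 _) (UH1 _) eta0) _.
    rewrite -ler_pdivlMl// [X in _ <= X](_ : _ = w / (p + 1) / 2 + w / (p + 1) / 2); last first.
      by field; rewrite gt_eqF.
    apply: lerD; last by rewrite -ler_pdivlMl// mulrC; exact: h3.
    have wq0 : 0 < w / (p + 1) / 2 by rewrite !divr_gt0.
    rewrite /eta mulrAC -mulrA ler_piMr ?(ltW wq0)// ler_pdivrMr// mul1r.
    by apply: le_trans (lerD (UP _) (UP _)) _; rewrite lerDl.
  have e3 : `|(2 / (p + 1) - 1) * (pot p (U (t + s)) - pot p (U t))| <= gam / 2.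
    rewrite normrM; apply: (@le_trans _ _ (cq * w)).
      by apply: ler_pM => //; rewrite /cq lerDl.
    by rewrite /w mulrC divfK// gt_eqF.
  rewrite linear_difference.
  apply: le_trans (ler_normD _ _) _; rewrite normrM (ger0_norm (ler0n R 2)).
  by move: e1 e3; move: (`|_|) (`|_|) => *; lra.
have dy s : 0 < s -> is_derive s (1 : R) (fun t => ip (V t) (U t))
    (2 * ip (V s) (V s) - G s - 2 * alpha * ip (V s) (U s)).
  by move=> s0; apply: is_derive_eq (dUV s0) _; rewrite (ip_nlf_self p1)// /G; ring.
have yn s : ip (V s) (U s) ^+ 2 <= S ^+ 2 * ip (V s) (V s).
  apply: le_trans (sip_CS_sqr L2_semi_inner (VL2 s) (UL2 s)) _.
  rewrite mulrC ler_wpM2r ?ip_ge0//; apply: le_trans (ip_le_ip1 (UH1 s)) _.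
  by rewrite -(snorm_sqr H1_semi_inner)// lerXn2r ?nnegrE ?snorm_ge0.
apply: le_trans (@averaged _ G 2 (S ^+ 2) (ler0n R 2) (sqr_ge0 S) dy yn gam eps T1 t eps0
  (ltW gam0) T11 t1 h1 Gg) _.
have epsle : eps * Kc <= e / 2 by rewrite -ler_pdivlMr// /eps ge_min lexx orbT.
have eps1 : eps <= 1 by rewrite /eps ge_min lexx.
apply: averaging_algebra epsle (erefl _); first exact: ltW.
by rewrite ler_wpM2l// expr2 ler_piMr ?(ltW eps0).
Qed.

Lemma laplacian_trans z psi : laplacian (trans z psi) = trans z (laplacian psi).
Proof.
apply/funext => x; apply: eq_bigr => i _.
rewrite (_ : 'D_(basis_rV i) (trans z psi) = trans z ('D_(basis_rV i) psi)).
  exact: derive_trans.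
by apply/funext => y; exact: derive_trans.
Qed.

(** Uniformity in z is essential, since the translations used later depend on the time. It holds
    because psi enters only through the translation-invariant quantities [K], [N] and
    [pot p psi]. *)
Lemma equilibrium_limit psi e : test psi -> 0 < e -> exists2 T, 1 <= T & forall t, T <= t ->
  forall z, `|ip1 (U t) (trans z psi) - ip (nlf p (U t)) (trans z psi)| <= e.
Proof.
move=> tpsi e0; have psi2 := test_in_L2 tpsi; have [psi1 _] := test_in_H1 tpsi.
have lap2 := test_in_L2 (test_laplacian tpsi).
pose K := ip psi psi; have K0 : 0 <= K := ip_ge0 psi.
pose Kc := 6 * (1 + 3 * K) + 6 + 3 * (alpha * K) + 3 * alpha + 1.
have Kc0 : 0 < Kc.
  by rewrite ltr_wpDl// !addr_ge0 ?mulr_ge0 ?addr_ge0 ?mulr_ge0 ?(ltW alpha0).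
pose eps := Num.min 1 (e / 2 / Kc).
have eps0 : 0 < eps by rewrite lt_min ltr01 !divr_gt0.
pose gam := e / 6; have gam0 : 0 < gam by rewrite divr_gt0.
have g4 : 0 < gam / 4 by rewrite divr_gt0.
pose N := snorm ip (psi - laplacian psi).
have N1 : 0 < N + 1 by rewrite ltr_wpDl// snorm_ge0.
pose del := gam / 2 / (N + 1); have del0 : 0 < del by rewrite !divr_gt0.
pose Q := P + P + pot p psi; have Q1 : 0 < Q + 1 by rewrite ltr_wpDl// !addr_ge0 ?pot_ge0.
have [C C_ hC] := ip_nlf_diff_eta p1 C00 z01 dyadic (divr_gt0 g4 Q1).
have C1 : 0 < C + 1 by rewrite ltr_wpDl.
have [T1 T11 h1] := dissipation_tail (exprn_gt0 2 eps0).
have [T2 T21 h2] := dissipation_tail (exprn_gt0 2 del0).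
have [T3 T31 h3] := drift_pot (divr_gt0 g4 C1).
exists (Num.max T1 (Num.max T2 T3)); first by rewrite le_max T11.
move=> t; rewrite !ge_max => /and3P[t1 t2 t3] z.
have t0 : 0 < t by apply: lt_le_trans t1; exact: lt_le_trans T11.
have tz : test (trans z psi) by exact: test_shift.
have [z1 _] := test_in_H1 tz; have z2 := test_in_L2 tz.
pose G s := ip1 (U s) (trans z psi) - ip (nlf p (U s)) (trans z psi).
have Gg s : 0 <= s <= 1 -> `|G (t + s) - G t| <= gam.
  move=> s01; have /andP[s0 s1] := s01.
  pose w : rV -> R := U (t + s) - U t; have w1 : in_H1 w by exact: in_H1B.
  have wdel : snorm ip w <= del.
    rewrite -(ler_pXn2r (n := 2))// ?nnegrE ?snorm_ge0 ?(ltW del0)//.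
    rewrite (snorm_sqr L2_semi_inner); last exact: in_H1_L2.
    by apply: le_trans (drift_L2 t0 s01) _; apply: h2 => //; rewrite lerDl.
  (* Both derivatives are moved onto psi: the H1 pairing becomes an L2 pairing with psi - Delta psi,
     for which the L2 drift suffices. *)
  have e1 : `|ip1 (U (t + s)) (trans z psi) - ip1 (U t) (trans z psi)| <= gam / 2.
    rewrite -(sip_subl H1_semi_inner)// -/w ip1_test// laplacian_trans.
    have w2 := in_H1_L2 w1; have lz2 := in_L2_trans z lap2.
    rewrite -(sip_subr L2_semi_inner z2 lz2 w2) -transB; have d2 := in_L2B psi2 lap2.
    apply: le_trans (sip_CS L2_semi_inner w2 (in_L2_trans z d2)) _.
    rewrite [X in _ * X](_ : _ = N); last by rewrite /N /snorm (ip_trans z d2 d2).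
    apply: (@le_trans _ _ (del * (N + 1))); last by rewrite /del divfK// gt_eqF.
    by apply: ler_pM; rewrite ?snorm_ge0 ?lerDl.
  have e2 : `|ip (nlf p (U (t + s))) (trans z psi) - ip (nlf p (U t)) (trans z psi)| <= gam / 4 + gam / 4.
    have mw : measurable_fun setT w by exact: in_L2_measurable (in_H1_L2 w1).
    apply: le_trans (hC _ _ _ w (UH1 _) (UH1 _) z1 mw (fun=> lexx _) (fun _ _ => erefl)) _.
    rewrite (pot_trans p z psi1); apply: lerD.
      rewrite mulrAC -mulrA ler_piMr ?(ltW g4)// ler_pdivrMr// mul1r.
      apply: le_trans (lerD (lerD (UP _) (UP _)) (lexx _)) _; by rewrite /Q lerDl.
    apply: le_trans (ler_wpM2l C_ (h3 t s t3 s01)) _.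
    by rewrite mulrCA ler_piMr ?(ltW g4)// ler_pdivrMr// mul1r lerDl.
  rewrite [gam](_ : _ = gam / 2 + (gam / 4 + gam / 4)); last by field.
  exact: dist_difference e1 e2.
have dy s : 0 < s -> is_derive s (1 : R) (fun t => ip (V t) (trans z psi))
    (0 * ip (V s) (V s) - G s - 2 * alpha * ip (V s) (trans z psi)).
  by move=> s0; apply: is_derive_eq (dV s0 z1) _; rewrite /G; ring.
have yn s : ip (V s) (trans z psi) ^+ 2 <= K * ip (V s) (V s).
  apply: le_trans (sip_CS_sqr L2_semi_inner (VL2 s) z2) _.
  by rewrite mulrC ip_trans.
apply: le_trans (@averaged _ G 0 K (lexx 0) K0 dy yn gam eps T1 t eps0
  (ltW gam0) T11 t1 h1 Gg) _.
have epsle : eps * Kc <= e / 2 by rewrite -ler_pdivlMr// /eps ge_min lexx orbT.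
apply: averaging_algebra epsle (erefl _); first exact: ltW.
by rewrite mul0r mulr_ge0// ltW.
Qed.

End long_time.

(** * Limits along an ultrafilter *)

Section ultrafilter_limits.
Context {I : Type} (F : set_system I) (UF : UltraFilter F).

Let PF : ProperFilter F := @ultra_proper _ F UF.
Local Existing Instance PF.

(** An ultrafilter contains each set or its complement, so the cluster point given by compactness is
    a limit. *)
Lemma ultra_compact_cvg {T : topologicalType} (K : set T) (f : I -> T) : compact K ->
  (\forall n \near F, K (f n)) -> exists l : T, f n @[n --> F] --> l.
Proof.
move=> cK fK; have [l [_ cl]] := cK (f @ F) _ fK; exists l => B Bl.
have [//|FB] := in_ultra_setVsetC (f @^-1` B) UF.
have [y [h1 h2]] := cl (~` B) B FB Bl; by case: h1.
Qed.

Lemma ultra_real_cvg {R : realType} (f : I -> R) (B : R) : (forall n, `|f n| <= B) ->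
  exists l : R, f n @[n --> F] --> l.
Proof.
move=> fB; apply: (@ultra_compact_cvg R `[- B, B]%classic); first exact: segment_compact.
by near=> n; rewrite /= in_itv/= -ler_norml.
Unshelve. all: end_near. Qed.

Lemma ultra_not (P : I -> Prop) : ~ (\forall n \near F, P n) -> \forall n \near F, ~ P n.
Proof. by move=> nP; have [|h] := in_ultra_setVsetC [set n | P n] UF. Qed.

End ultrafilter_limits.

Lemma cvg_sum_ord {R : realType} {I : Type} (F : set_system I) {FF : Filter F} k
    (f : 'I_k -> I -> R) (l : 'I_k -> R) : (forall j, f j n @[n --> F] --> l j) ->
  \sum_j f j n @[n --> F] --> \sum_j l j.
Proof.
elim: k f l => [|k IH] f l fl.
  by under eq_fun do rewrite big_ord0; rewrite big_ord0; exact: cvg_cst.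
by under eq_fun do rewrite big_ord_recl; rewrite big_ord_recl; apply: cvgD; [exact: fl|exact: IH].
Qed.

Lemma sip_sum {R : realType} {T : Type} (dom : (T -> R) -> Prop) (b : (T -> R) -> (T -> R) -> R)
    (bs : semi_inner dom b) k (f : 'I_k -> T -> R) : (forall j, dom (f j)) ->
  dom (\sum_j f j) /\ forall g, dom g -> b g (\sum_j f j) = \sum_j b g (f j).
Proof.
elim: k f => [|k IH] f df.
  rewrite !big_ord0; split; first exact: (sip_dom0 bs).
  move=> g dg; rewrite big_ord0 -[X in b g X](scale0r (0 : T -> R)).
  by rewrite (sip_scaler bs) ?mul0r//; exact: (sip_dom0 bs).
have [d1 h1] := IH _ (fun j => df (lift ord0 j)).
rewrite big_ord_recl; split; first exact: (sip_domD bs).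
by move=> g dg; rewrite big_ord_recl (sip_addr bs)// h1.
Qed.

Lemma floorB_int {R : realType} (t : R) (m : int) : Num.floor (t - m%:~R) = Num.floor t - m.
Proof.
apply: floor_def; have /andP[h1 h2] := floor_itv t.
by rewrite addrAC !rmorphB /= lerD2r ltrD2r h1.
Qed.

(** * Translations in H1 and averages over translated cubes *)

Section translations_H1.
Context {R : realType} {d : nat}.
Local Notation rV := 'rV[R]_d.
Local Notation test := (@test_function R 'rV[R]_d setT).
Implicit Types (f g w psi : rV -> R) (x y z : rV).

Lemma in_H1_trans z f : in_H1 f -> in_H1 (trans z f).
Proof. by move=> /(H1_transP z)[]. Qed.

Lemma ip1_trans z f g : in_H1 f -> in_H1 g -> ip1 (trans z f) (trans z g) = ip1 f g.
Proof.
move=> f1 g1; have [_ hf] := H1_transP z f1; have [tg1 hg] := H1_transP z g1.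
rewrite /ip1 ip_trans; [|exact: in_H1_L2..]; congr (_ + _); apply: eq_bigr => i _.
rewrite hf ?in_L2_wd// ipC hg; last by apply: in_L2_trans; exact: in_L2_wd.
by rewrite ipC ip_trans; [|exact: in_L2_wd..].
Qed.

Lemma ip1_transl z f g : in_H1 f -> in_H1 g -> ip1 (trans z f) g = ip1 f (trans (- z) g).
Proof.
move=> f1 g1; rewrite -{1}(trans0 g) -(subrr z) -(trans_trans z (- z)) ip1_trans//.
exact: in_H1_trans.
Qed.

Lemma snorm_ip1_trans z f : in_H1 f -> snorm ip1 (trans z f) = snorm ip1 f.
Proof. by move=> f1; rewrite /snorm ip1_trans. Qed.

(** Approximate both functions by tests; once |z| exceeds the sum of the support radii, these and
    their derivatives have disjoint supports. *)
Lemma ip1_decorrelation f g e : in_H1 f -> in_H1 g -> 0 < e ->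
  exists M, forall z, M <= `|z| -> `|ip1 (trans z f) g| <= e.
Proof.
move=> f1 g1 e0; pose K := snorm ip1 f + snorm ip1 g + 1.
have K0 : 0 < K by rewrite ltr_wpDl// addr_ge0// snorm_ge0.
pose m := Num.min 1 (e / 2 / K); have m0 : 0 < m by rewrite lt_min ltr01 !divr_gt0.
have [a ta ha] := test_dense_H1 f1 m0; have [b tb hb] := test_dense_H1 g1 m0.
have [a1 da] := test_in_H1 ta; have [b1 db] := test_in_H1 tb.
have [Ma _ sa] := test_support ta; have [Mb _ sb] := test_support tb.
exists (Ma + Mb + 1) => z zM.
have disj (a' b' : rV -> R) : (forall x, Ma < `|x| -> a' x = 0) -> (forall x, Mb < `|x| -> b' x = 0) ->
    ip (trans z a') b' = 0.
  move=> sa' sb'; rewrite ipE /Rintegral (eq_integral (fun=> 0%E)) ?integral0//.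
  move=> x _; rewrite /trans; have [xb|/sb' ->] := leP `|x| Mb; last by rewrite mulr0.
  rewrite sa' ?mul0r//; have := ler_normB (x + z) x; rewrite [x + z]addrC addrK.
  by rewrite [z + x]addrC; move: zM xb; lra.
have dsupp (c : rV -> R) M i : test c -> (forall x, M < `|x| -> c x = 0) ->
    forall x, M < `|x| -> 'D_(basis_rV i) c x = 0.
  move=> tc sc x Mx; have : 'D_(basis_rV i) c x = 'D_(basis_rV i) (cst 0 : rV -> R) x.
    have [->|b0] := eqVneq (basis_rV i : rV) 0.
      have h1 := deriveZv 0 0 (smooth_differentiable x (test_smooth tc)).
      have h2 := deriveZv (0:R) (0:rV) (differentiable_cst (0:R) x); rewrite scale0r !mul0r in h1 h2.
      by rewrite h1 h2.
    apply: near_eq_derive => //.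
    have xM0 : 0 < `|x| - M by rewrite subr_gt0.
    have /cvgrPdist_lt/(_ _ xM0) := @norm_continuous R 'rV[R]_d x.
    apply: filterS => y xy; apply: sc; have := ler_norm (`|x| - `|y|); move: xy; lra.
  by rewrite derive_cst.
have ab0 : ip1 (trans z a) b = 0.
  rewrite /ip1 (disj _ _ sa sb) add0r big1// => i _.
  have [_ hz] := H1_transP z a1.
  rewrite hz; last exact: in_L2_wd.
  have ta2 := test_in_L2 (test_derive (basis_rV i) ta).
  have tb2 := test_in_L2 (test_derive (basis_rV i) tb).
  rewrite ipC db; last by apply: in_L2_trans; exact: in_L2_wd.
  rewrite ipC ip_transl//; last exact: in_L2_wd.
  rewrite da; last exact: in_L2_trans.
  by rewrite -ip_transl//; apply: disj; apply: dsupp.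
have af1 := in_H1B a1 f1; have bg1 := in_H1B b1 g1.
have -> : ip1 (trans z f) g = - ip1 (trans z (a - f)) g - ip1 (trans z a) (b - g) + ip1 (trans z a) b.
  have a1z := in_H1_trans z a1; rewrite transB (sip_subl H1_semi_inner a1z (in_H1_trans z f1) g1).
  by rewrite (sip_subr H1_semi_inner b1 g1 a1z); ring.
rewrite ab0 addr0; apply: le_trans (ler_normB _ _) _; rewrite normrN.
have h1 := sip_CS H1_semi_inner (in_H1_trans z af1) g1.
have h2 := sip_CS H1_semi_inner (in_H1_trans z a1) bg1.
rewrite !snorm_ip1_trans// in h1 h2.
have na : snorm ip1 a <= snorm ip1 f + 1.
  rewrite -[a](subrK f) addrC; apply: le_trans (snormD H1_semi_inner f1 af1) _.
  by rewrite lerD2l; apply: le_trans ha _; rewrite ge_min lexx.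
have k1 : `|ip1 (trans z (a - f)) g| <= m * snorm ip1 g.
  by apply: le_trans h1 _; rewrite ler_wpM2r ?snorm_ge0.
have k2 : `|ip1 (trans z a) (b - g)| <= m * (snorm ip1 f + 1).
  by apply: le_trans h2 _; rewrite mulrC; apply: ler_pM; rewrite ?snorm_ge0.
apply: le_trans (lerD k1 k2) _; rewrite -mulrDr.
apply: (@le_trans _ _ (e / 2 / K * K)); last by rewrite divfK ?gt_eqF// ler_pdivrMr// ler_peMr ?(ltW e0)// ler1n.
apply: ler_pM; rewrite ?(ltW m0) ?addr_ge0 ?snorm_ge0//; first by rewrite ge_min lexx orbT.
by rewrite /K [snorm ip1 f + snorm ip1 g]addrC -addrA.
Qed.

(** The lower corner of the dyadic cube of x; shifting by it carries the cube of the origin onto the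
    cube of x. *)
Definition corner m x : rV := \row_i ((2 ^+ m)^-1 * (Num.floor (2 ^+ m * x ord0 i))%:~R).

Lemma cell_indic_corner m x : cell_indic m x = trans (- corner m x) (cell_indic m 0).
Proof.
have m0 : (2 ^+ m : R) != 0 by rewrite expf_neq0.
apply/funext => z; rewrite /trans /cell_indic; congr ((nat_of_bool _)%:R).
have key i : 2 ^+ m * (z - corner m x) ord0 i =
    2 ^+ m * z ord0 i - (Num.floor (2 ^+ m * x ord0 i))%:~R.
  by rewrite !mxE mulrBr mulrA mulfV// mul1r.
apply/eqP/eqP => h; apply/ffunP => i; have /ffunP/(_ i) := h.
  by rewrite !ffunE key !mxE mulr0 floor0 floorB_int => <-; rewrite subrr.
by rewrite !ffunE key !mxE mulr0 floor0 floorB_int => /esym/eqP; rewrite subr_eq0 => /eqP ->.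
Qed.

(** Every cube average becomes a pairing of a translate of w with one fixed function. An average
    that does not vanish is therefore seen by a weak limit of translates. *)
Lemma avg_corner m w x : in_L2 w ->
  avg m w x = (2 ^+ m) ^+ d * ip (cell_indic m 0) (trans (corner m x) w).
Proof.
move=> w2; rewrite /avg cell_indic_corner ip_transl ?opprK//; exact: in_L2_cell_indic.
Qed.

End translations_H1.

(** * Weak limits in H1 along an ultrafilter *)

Section weak_limits.
Context {R : realType} {d : nat}.
Local Notation rV := 'rV[R]_d.
Context (F : set_system nat) (UF : UltraFilter F).
Let PF : ProperFilter F := @ultra_proper _ F UF.
Local Existing Instance PF.
Implicit Types (f : nat -> rV -> R) (Q psi g : rV -> R).

(** The limits of the pairings along F form a bounded linear functional, which Riesz represents by
    an element of H1. *)
Lemma weak_limit_H1 f S : (forall n, in_H1 (f n)) -> (forall n, snorm ip1 (f n) <= S) ->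
  exists2 Q, in_H1 Q & forall psi, in_H1 psi -> ip1 (f n) psi @[n --> F] --> ip1 Q psi.
Proof.
move=> f1 fS; have S0 : 0 <= S := le_trans (snorm_ge0 _ _) (fS 0%N).
have bd psi : in_H1 psi -> forall n, `|ip1 (f n) psi| <= S * snorm ip1 psi.
  move=> p1 n; apply: le_trans (sip_CS H1_semi_inner (f1 n) p1) _.
  by rewrite ler_wpM2r ?snorm_ge0.
pose l psi : R := lim (ip1 (f n) psi @[n --> F]).
have lP psi : in_H1 psi -> ip1 (f n) psi @[n --> F] --> l psi.
  by move=> p1; have [z hz] := ultra_real_cvg UF (bd _ p1); apply/cvg_ex; exists z.
have luniq psi z : in_H1 psi -> ip1 (f n) psi @[n --> F] --> z -> l psi = z.
  by move=> p1 hz; apply: cvg_lim hz.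
have lD a c : in_H1 a -> in_H1 c -> l (a + c) = l a + l c.
  move=> a1 c1; apply: luniq; first exact: (sip_domD H1_semi_inner).
  under eq_fun do rewrite (sip_addr H1_semi_inner)//.
  by apply: cvgD; exact: lP.
have lZ k a : in_H1 a -> l (k *: a) = k * l a.
  move=> a1; apply: luniq; first exact: (sip_domZ H1_semi_inner).
  under eq_fun do rewrite (sip_scaler H1_semi_inner)//.
  by apply: cvgMr; exact: lP.
have lC a : in_H1 a -> `|l a| <= S * snorm ip1 a.
  move=> a1; apply: (closed_cvg (fun y => `|y| <= S * snorm ip1 a)) (lP a a1).
    apply: (@closed_comp _ _ (fun x : R => `|x|) [set y | y <= S * snorm ip1 a]) => //.
    by move=> x _; exact: norm_continuous.
  by near=> n; exact: bd.
have [Q [Q1 hQ _]] := @sip_riesz _ _ _ _ (H1_semi_inner) in_H1 l (fun _ h => h) in_H10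
  (sip_domD H1_semi_inner) (sip_domZ H1_semi_inner) lD lZ S lC H1_complete.
by exists Q => // psi p1; rewrite hQ//; exact: lP.
Unshelve. all: end_near. Qed.

(** The functional ip g is bounded on H1, hence equal to ip1 w for some w in H1. *)
Lemma weak_H1_L2 f Q : (forall n, in_H1 (f n)) -> in_H1 Q ->
  (forall psi, in_H1 psi -> ip1 (f n) psi @[n --> F] --> ip1 Q psi) ->
  forall g, in_L2 g -> ip g (f n) @[n --> F] --> ip g Q.
Proof.
move=> f1 Q1 h g g2.
have [w [w1 hw _]] := @sip_riesz _ _ _ _ H1_semi_inner in_H1 (ip g) (fun _ h => h) in_H10
  (sip_domD H1_semi_inner) (sip_domZ H1_semi_inner)
  (fun a c a1 c1 => sip_addr L2_semi_inner (in_H1_L2 a1) (in_H1_L2 c1) g2)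
  (fun k a a1 => sip_scaler L2_semi_inner k (in_H1_L2 a1) g2) (snorm ip g)
  (fun a a1 => le_trans (sip_CS L2_semi_inner g2 (in_H1_L2 a1))
     (ler_wpM2l (snorm_ge0 _ _) (snorm_le_H1 a1))) H1_complete.
rewrite -hw// (sip_sym H1_semi_inner).
under eq_fun do rewrite -hw// (sip_sym H1_semi_inner).
exact: h.
Qed.

End weak_limits.

Lemma sip_snorm_sum {R : realType} {T : Type} (dom : (T -> R) -> Prop)
    (b : (T -> R) -> (T -> R) -> R) (bs : semi_inner dom b) k (f : 'I_k -> T -> R) :
  (forall j, dom (f j)) -> snorm b (\sum_j f j) <= \sum_j snorm b (f j).
Proof.
elim: k f => [|k IH] f df.
  have h := snormZ bs 0 (sip_dom0 bs); rewrite scale0r normr0 mul0r in h.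
  by rewrite !big_ord0 h.
have [d1 _] := sip_sum bs (fun j => df (lift ord0 j)).
rewrite !big_ord_recl; apply: le_trans (snormD bs (df ord0) d1) _.
by rewrite lerD2l; exact: IH.
Qed.

Lemma cvg_real_eq {R : realType} {T : Type} (F : set_system T) (f g : T -> R) (a b : R) :
  (forall n, g n = f n) -> f n @[n --> F] --> a -> a = b -> g n @[n --> F] --> b.
Proof. by move=> gf fa <-; rewrite (_ : g = f)//; exact/funext. Qed.

(** * Extraction of equilibrium profiles *)

Section profiles.
Context {R : realType} {d : nat} (p : R) (p1 : 1 < p).
Context (C0 z0 : R) (C00 : 0 <= C0) (z01 : 0 <= z0 < 1).
Local Notation rV := 'rV[R]_d.
Local Notation test := (@test_function R 'rV[R]_d setT).
Context (dyadic : forall (w : rV -> R) k, in_H1 w ->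
  (modular (p + 1) (w - avg k w)%R <= (C0 * z0 ^+ k * grad_norm w `^ (p + 1))%:E)%E).

Lemma equilibrium_extend (Q : rV -> R) : in_H1 Q ->
  (forall psi, test psi -> ip1 Q psi = ip (nlf p Q) psi) ->
  forall psi, in_H1 psi -> ip1 Q psi = ip (nlf p Q) psi.
Proof.
move=> Q1 h psi psi1; apply/eqP; rewrite -subr_eq0 -normr_eq0 eq_le normr_ge0 andbT.
apply/ler_addgt0Pr => e e0; rewrite add0r.
have P1 : 0 < pot p Q + 1 by rewrite ltr_wpDl// pot_ge0.
have N1 : 0 < snorm ip1 Q + 1 by rewrite ltr_wpDl// snorm_ge0.
have e4 : 0 < e / 4 by rewrite divr_gt0.
pose eta := e / 4 / (pot p Q + 1); have eta0 : 0 < eta by rewrite !divr_gt0.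
pose D := eta^-1 `^ p; have D0 : 0 < D by rewrite powR_gt0// invr_gt0.
have [m m0 hm] := pot_small_L2 p1 C00 z01 dyadic 1 (divr_gt0 e4 D0).
have mm : 0 < Num.min 1 (Num.min m (e / 4 / (snorm ip1 Q + 1))).
  by rewrite !lt_min ltr01 m0 divr_gt0.
have [phi tphi] := test_dense_H1 psi1 mm; have [phi1 _] := test_in_H1 tphi.
rewrite (snorm_distC H1_semi_inner)// !le_min => /and3P[c1 c2 c3].
have chi1 := in_H1B psi1 phi1; have chi2 := le_trans (snorm_le_H1 chi1) c2.
have k1 := ip_nlf_eta p1 C00 z01 dyadic Q1 chi1 eta0.
have k1' : `|ip (nlf p Q) (psi - phi)| <= e / 4 + e / 4.
  apply: le_trans k1 _; apply: lerD; last by rewrite -ler_pdivlMl// mulrC hm.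
  by rewrite /eta mulrAC -mulrA ler_piMr ?(ltW e4)// ler_pdivrMr// mul1r lerDl.
have k2 : `|ip1 Q (psi - phi)| <= e / 4.
  apply: le_trans (sip_CS H1_semi_inner Q1 chi1) _.
  apply: (@le_trans _ _ ((snorm ip1 Q + 1) * (e / 4 / (snorm ip1 Q + 1)))).
    by apply: ler_pM; rewrite ?snorm_ge0 ?lerDl.
  by rewrite mulrC divfK ?gt_eqF.
have -> : ip1 Q psi - ip (nlf p Q) psi = ip1 Q (psi - phi) - ip (nlf p Q) (psi - phi).
  rewrite (sip_subr H1_semi_inner)// (ip_nlfB p1 C00 z01 dyadic)// (h _ tphi); ring.
apply: le_trans (ler_normB _ _) _; apply: le_trans (lerD k2 k1') _.
by rewrite -[X in _ <= X](_ : e / 4 + (e / 4 + e / 4) + e / 4 = e) ?lerDl ?(ltW e4)//; field.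
Qed.

(** For an equilibrium |Q|^2 = pot Q <= C |Q|^(p+1), so a nonzero Q has |Q|^(p-1) >= 1/C; C + 1
    keeps the threshold finite when C = 0. *)
Lemma equilibrium_gap : exists2 del : R, 0 < del & forall Q : rV -> R, in_H1 Q ->
  ip1 Q Q = pot p Q -> 0 < ip1 Q Q -> del <= ip1 Q Q.
Proof.
have [C C_ hC] := pot_bound p1 C00 z01 dyadic; have C1 : 0 < C + 1 by rewrite ltr_wpDl.
have pm : 0 < p - 1 by rewrite subr_gt0.
pose r := (C + 1)^-1 `^ (p - 1)^-1; have r0 : 0 < r by rewrite powR_gt0// invr_gt0.
have rp : r `^ (p - 1) = (C + 1)^-1.
  by rewrite /r -powRrM mulVf ?gt_eqF// powRr1// invr_ge0 ltW.
exists (r ^+ 2); first by rewrite exprn_gt0.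
move=> Q Q1 eQ QQ; rewrite leNgt; apply/negP => lt.
have N2 := snorm_sqr H1_semi_inner Q1; set N := snorm ip1 Q in N2.
have N0 : 0 <= N by exact: snorm_ge0.
have Nr : N < r by rewrite -(ltr_pXn2r (n := 2)) ?nnegrE ?(ltW r0)// N2.
have Np : N `^ (p - 1) <= (C + 1)^-1.
  by rewrite -rp; apply: ge0_ler_powR; rewrite ?nnegrE ?(ltW pm) ?(ltW r0) ?(ltW Nr).
have NN : N `^ (p + 1) = N `^ (p - 1) * N ^+ 2.
  have ep : p - 1 + 2 = p + 1 by ring.
  by rewrite -powR_mulrn// -powRD ep// gt_eqF// addr_gt0// (lt_trans _ p1).
have := hC Q Q1; rewrite -eQ -/N NN -N2 => h; rewrite -N2 in QQ.
have : C * (N `^ (p - 1) * N ^+ 2) <= C * ((C + 1)^-1 * N ^+ 2).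
  by rewrite ler_wpM2l// ler_wpM2r ?sqr_ge0.
move=> /(le_trans h); rewrite mulrA ler_pMl// leNgt ltr_pdivrMr// mul1r.
by rewrite ltrDl ltr01.
Qed.

Context (F : set_system nat) (UF : UltraFilter F).
Let PF : ProperFilter F := @ultra_proper _ F UF.
Local Existing Instance PF.
Let FF : Filter F := _.
Context (u : nat -> rV -> R) (S : R) (u1 : forall n, in_H1 (u n)).
Context (uS : forall n, snorm ip1 (u n) <= S).
Context (nv : nat -> R) (nv0 : forall n, 0 <= nv n).
Context (virial : nv n + ip1 (u n) (u n) - pot p (u n) @[n --> F] --> (0 : R)).
Context (limit_eq : forall (psi : rV -> R) (e : R), test psi -> 0 < e ->
  \forall n \near F, forall z, `|ip1 (u n) (trans z psi) - ip (nlf p (u n)) (trans z psi)| <= e).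
Implicit Types (k n m : nat) (x y : nat -> rV) (psi Q f g : rV -> R).
Local Hint Resolve u1 : core.

Let S0 : 0 <= S. Proof. exact: le_trans (snorm_ge0 _ _) (uS 0%N). Qed.

Lemma weak_limit_equilibrium y Q : in_H1 Q ->
  (forall psi, in_H1 psi -> ip1 (u n) (trans (- y n) psi) @[n --> F] --> ip1 Q psi) ->
  forall psi, in_H1 psi -> ip1 Q psi = ip (nlf p Q) psi.
Proof.
move=> Q1 wk; apply: equilibrium_extend => // psi tpsi; have [psi1 _] := test_in_H1 tpsi.
pose f n := trans (y n) (u n).
have f1 n : in_H1 (f n) by exact: in_H1_trans.
have fS n : snorm ip1 (f n) <= S by rewrite /f snorm_ip1_trans.
have wf phi : in_H1 phi -> ip1 (f n) phi @[n --> F] --> ip1 Q phi.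
  by move=> phi1; under eq_fun do rewrite /f ip1_transl//; exact: wk.
have c1 := ip_nlf_weak_cvg p1 C00 z01 dyadic FF f1 fS Q1 psi1 (weak_H1_L2 f1 Q1 wf).
have c2 := wf _ psi1.
apply/eqP; rewrite -subr_eq0; apply/eqP.
have c3 : ip1 (f n) psi - ip (nlf p (f n)) psi @[n --> F] --> ip1 Q psi - ip (nlf p Q) psi.
  by apply: cvgB.
apply: (cvg_unique _ c3); first exact: Rhausdorff.
apply/cvgrPdist_le => e e0; apply: filterS (limit_eq tpsi e0) => n /(_ (- y n)).
rewrite sub0r normrN; have -> : ip1 (u n) (trans (- y n) psi) = ip1 (f n) psi by rewrite /f ip1_transl.
rewrite -(ip_nlf_trans p (y n) (u1 n) (in_H1_trans (- y n) psi1)).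
by rewrite trans_trans subrr trans0.
Qed.

Definition far x := forall M : R, \forall n \near F, M <= `|x n|.

Lemma far_decorrelation x f g : far x -> in_H1 f -> in_H1 g ->
  ip1 (trans (x n) f) g @[n --> F] --> (0 : R).
Proof.
move=> fx f1 g1; apply/cvgrPdist_le => e /(ip1_decorrelation f1 g1)[M hM].
by apply: filterS (fx M) => n /hM; rewrite sub0r normrN.
Qed.

Context (del : R) (del0 : 0 < del) (gap : forall Q : rV -> R, in_H1 Q ->
  ip1 Q Q = pot p Q -> 0 < ip1 Q Q -> del <= ip1 Q Q).

(** The last clause says that Q j is the weak limit of u n(. + x j n), with the translation moved
    onto psi. The lower bound [del] excludes the zero profile and limits the number of profiles. *)
Definition profiles k (Q : 'I_k -> rV -> R) (x : 'I_k -> nat -> rV) : Prop :=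
  [/\ forall j, in_H1 (Q j) /\ forall psi, in_H1 psi -> ip1 (Q j) psi = ip (nlf p (Q j)) psi,
      forall j, del <= ip1 (Q j) (Q j),
      forall i j, i != j -> far (fun n => x i n - x j n) &
      forall j psi, in_H1 psi ->
        ip1 (u n) (trans (- x j n) psi) @[n --> F] --> ip1 (Q j) psi].

Definition residual k (Q : 'I_k -> rV -> R) (x : 'I_k -> nat -> rV) n : rV -> R :=
  u n - \sum_(j < k) trans (- x j n) (Q j).

Section residual_theory.
Context k (Q : 'I_k -> rV -> R) (x : 'I_k -> nat -> rV) (pr : profiles Q x).
Local Notation res := (residual Q x).

Let Q1 j : in_H1 (Q j). Proof. by have [/(_ j)[]] := pr. Qed.
Local Hint Resolve Q1 : core.
Let T1 n j : in_H1 (trans (- x j n) (Q j)). Proof. exact: in_H1_trans. Qed.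

Lemma residual_H1 n : in_H1 (res n).
Proof. by apply: in_H1B => //; have [] := sip_sum H1_semi_inner (T1 n). Qed.
Local Hint Resolve residual_H1 : core.

Lemma ip1_residual g n : in_H1 g ->
  ip1 g (res n) = ip1 g (u n) - \sum_j ip1 g (trans (- x j n) (Q j)).
Proof.
move=> g1; have [d1 h1] := sip_sum H1_semi_inner (T1 n).
by rewrite /residual (sip_subr H1_semi_inner)// h1.
Qed.

Lemma residual_bound n : snorm ip1 (res n) <= S + \sum_j snorm ip1 (Q j).
Proof.
have [d1 _] := sip_sum H1_semi_inner (T1 n).
apply: le_trans (snormB H1_semi_inner (u1 n) d1) _; apply: lerD => //.
apply: le_trans (sip_snorm_sum H1_semi_inner (T1 n)) _.
by apply: ler_sum => j _; rewrite snorm_ip1_trans.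
Qed.

Let pairing_trans i y psi n : in_H1 psi ->
  ip1 (trans (- y n) psi) (trans (- x i n) (Q i)) = ip1 (trans (y n - x i n) (Q i)) psi.
Proof.
move=> psi1; rewrite (sip_sym H1_semi_inner) -(trans_trans (y n) (- x i n)).
by rewrite (ip1_transl (y n) (T1 n i) psi1).
Qed.

Lemma residual_weak0 j psi : in_H1 psi ->
  ip1 (trans (- x j n) psi) (res n) @[n --> F] --> (0 : R).
Proof.
move=> psi1; have [_ _ sep wk] := pr.
have e n : ip1 (trans (- x j n) psi) (res n) = ip1 (u n) (trans (- x j n) psi) -
    \sum_i ip1 (trans (x j n - x i n) (Q i)) psi.
  rewrite (ip1_residual n (in_H1_trans (- x j n) psi1)) (sip_sym H1_semi_inner _ (u n)).
  by congr (_ - _); apply: eq_bigr => i _; exact: pairing_trans.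
have l0 : ip1 (Q j) psi - \sum_(i < k) (if i == j then ip1 (Q j) psi else 0) = 0.
  by rewrite -big_mkcond big_pred1_eq subrr.
apply: (cvg_real_eq e _ l0); apply: cvgB; first exact: wk.
apply: cvg_sum_ord => i.
have [->|ij] := eqVneq i j; last by apply: far_decorrelation => //; apply: sep; rewrite eq_sym.
by under eq_fun do rewrite subrr trans0; exact: cvg_cst.
Qed.

(** Asymptotic Pythagoras: u n pairs with the j-th translate to |Q j|^2 in the limit, while the
    residual is asymptotically orthogonal to every translate by [residual_weak0]. *)
Lemma residual_norm :
  ip1 (res n) (res n) - ip1 (u n) (u n) @[n --> F] --> - \sum_j ip1 (Q j) (Q j).
Proof.
have [_ _ sep wk] := pr.
have e n : ip1 (res n) (res n) - ip1 (u n) (u n) =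
    - \sum_j ip1 (u n) (trans (- x j n) (Q j)) - \sum_j ip1 (trans (- x j n) (Q j)) (res n).
  rewrite ip1_residual// (sip_sym H1_semi_inner (res n) (u n)) ip1_residual//.
  have -> : \sum_j ip1 (res n) (trans (- x j n) (Q j)) = \sum_j ip1 (trans (- x j n) (Q j)) (res n).
    by apply: eq_bigr => j _; rewrite (sip_sym H1_semi_inner).
  by ring.
have l0 : - \sum_j ip1 (Q j) (Q j) - \sum_(j < k) 0 = - \sum_j ip1 (Q j) (Q j).
  by rewrite [X in _ - X]big1// subr0.
apply: (cvg_real_eq e _ l0); apply: cvgB; first by apply: cvgN; apply: cvg_sum_ord => j; exact: wk.
by apply: cvg_sum_ord => j; exact: residual_weak0.
Qed.

Lemma profile_count : k%:R * del <= S ^+ 2.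
Proof.
have [_ big _ _] := pr.
apply: (@le_trans _ _ (\sum_j ip1 (Q j) (Q j))).
  by rewrite mulr_natl -{1}(card_ord k) -sumr_const; apply: ler_sum.
have hn : \forall n \near F, - S ^+ 2 <= ip1 (res n) (res n) - ip1 (u n) (u n).
  apply: nearW => n; have h1 := sip_ge0 H1_semi_inner (residual_H1 n).
  have h2 : ip1 (u n) (u n) <= S ^+ 2.
    by rewrite -(snorm_sqr H1_semi_inner)// lerXn2r ?nnegrE ?snorm_ge0.
  by move: h1 h2; move: (ip1 _ _) (ip1 _ _) => a b; lra.
have := closed_cvg (FF := PF) (fun y : R => - S ^+ 2 <= y) (@closed_ge R _) hn _ residual_norm.
by rewrite lerN2.
Qed.

Definition vanishing := forall m (e : R), 0 < e ->
  \forall n \near F, forall z, `|avg m (res n) z| <= e.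

(** A cube average of the residual that stays above e gives translations y n along which its weak
    limit is nonzero. Around the old centres the residual converges weakly to 0, so y n separates
    from them; hence the old profiles do not contribute near y n, and u n has the same weak limit
    there. *)
Lemma new_profile : ~ vanishing -> exists (Q' : 'I_k.+1 -> rV -> R) (x' : 'I_k.+1 -> nat -> rV),
  profiles Q' x'.
Proof.
move=> /existsNP[m /existsNP[e /not_implyP[e0 /(ultra_not UF) nv_]]].
have [Qeq Qbig sep wk] := pr.
pose I0 : rV -> R := cell_indic m 0; have I02 : in_L2 I0 := in_L2_cell_indic m 0.
pose vol : R := (2 ^+ m) ^+ d; have vol_gt0 : 0 < vol := vol0 m.
(* [xget] falls back on 0 when no translation qualifies, which happens only outside a set of F. *)
pose y n : rV := xget 0 [set y | e / vol <= `|ip I0 (trans y (res n))|].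
have hy : \forall n \near F, e / vol <= `|ip I0 (trans (y n) (res n))|.
  apply: filterS nv_ => n /existsNP[z /negP]; rewrite -ltNge => ez.
  apply: (@xgetPex _ 0 [set y | e / vol <= `|ip I0 (trans y (res n))|]); exists (corner m z) => /=.
  rewrite avg_corner ?normrM in ez; last exact: in_H1_L2.
  by rewrite (gtr0_norm vol_gt0) in ez; rewrite ler_pdivrMr// mulrC ltW.
have ev0 : 0 < e / vol by rewrite divr_gt0.
pose f n := trans (y n) (res n).
pose S' := S + \sum_j snorm ip1 (Q j).
have f1 n : in_H1 (f n) by exact: in_H1_trans.
have fS n : snorm ip1 (f n) <= S' by rewrite /f snorm_ip1_trans// residual_bound.
have [Qn Qn1 wQ] := weak_limit_H1 UF f1 fS.
have wI := weak_H1_L2 f1 Qn1 wQ I02.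
have IQ : e / vol <= `|ip I0 Qn|.
  apply: (closed_cvg (FF := PF) (fun z => e / vol <= `|z|) _ hy _ wI).
  apply: (@closed_comp _ _ (fun x : R => `|x|) [set z | e / vol <= z]); last exact: closed_ge.
  by move=> z _; exact: norm_continuous.
have Qn_pos : 0 < ip1 Qn Qn.
  rewrite lt_neqAle (sip_ge0 H1_semi_inner)// andbT eq_sym; apply/negP => /eqP z.
  have := sip_CS L2_semi_inner I02 (in_H1_L2 Qn1); have := snorm_le_H1 Qn1.
  rewrite /snorm z sqrtr0 => h /(le_trans IQ); rewrite leNgt => /negP; apply.
  by apply: le_lt_trans ev0; rewrite mulr_ge0_le0 ?sqrtr_ge0.
(* If y n - x j n stayed bounded it would converge to some z along F. The pairing with the indicator
   would then be close to that of the residual seen from x j n with a fixed translate of the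
   indicator, which tends to 0. *)
have yfar j : far (fun n => y n - x j n).
  move=> M; apply: contrapT => /(ultra_not UF) nM.
  have nb : \forall n \near F, [set z : rV | `|z| <= M] (y n - x j n).
    by apply: filterS nM => n /negP; rewrite -ltNge => /ltW.
  have [z hz] := ultra_compact_cvg UF (@closed_ball_rV_compact R d M) nb.
  pose r n := trans (x j n) (res n).
  have r1 n : in_H1 (r n) by exact: in_H1_trans.
  have r0 : forall psi, in_H1 psi -> ip1 (r n) psi @[n --> F] --> ip1 0 psi.
    move=> psi psi1; have -> : ip1 0 psi = 0.
      by rewrite -(scale0r (0 : rV -> R)) (sip_scalel H1_semi_inner) ?mul0r//; exact: in_H10.
    under eq_fun do rewrite /r ip1_transl// (sip_sym H1_semi_inner).
    exact: residual_weak0.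
  have rz := weak_H1_L2 r1 in_H10 r0 (in_L2_trans (- z) I02).
  have ip0 g : in_L2 g -> ip g 0 = 0.
    move=> g2; rewrite -(scale0r (0 : rV -> R)) (sip_scaler L2_semi_inner) ?mul0r//.
    exact: in_L20.
  rewrite (ip0 _ (in_L2_trans (- z) I02)) in rz.
  have S1 : 0 < S' + 1.
    by rewrite ltr_wpDl// addr_ge0// sumr_ge0// => i _; exact: snorm_ge0.
  have ee : 0 < e / vol / 4 by rewrite divr_gt0.
  have [rad rad0 hrad] := trans_cvg I02 (divr_gt0 ee S1).
  move/cvgrPdist_le : rz => /(_ _ ee) rz.
  move/(cvgrPdist_lt (F := (fun n => y n - x j n) @ F)) : hz => /(_ _ rad0) hz.
  have : \forall n \near F, False.
    apply: filterS3 hy rz hz => n; rewrite /= => h1 h2 h3.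
    have e1 : ip I0 (trans (y n) (res n)) = ip (trans (- (y n - x j n)) I0) (r n).
      have r2 := in_H1_L2 (r1 n); rewrite ip_transl// opprK /r trans_trans subrK//.
    have k1 : `|ip (trans (- (y n - x j n)) I0 - trans (- z) I0) (r n)| <= e / vol / 4.
      have t2 := in_L2B (in_L2_trans (- (y n - x j n)) I02) (in_L2_trans (- z) I02).
      apply: le_trans (sip_CS L2_semi_inner t2 (in_H1_L2 (r1 n))) _.
      have -> : snorm ip (trans (- (y n - x j n)) I0 - trans (- z) I0) =
          snorm ip (trans (z - (y n - x j n)) I0 - I0).
        have t3 := in_L2B (in_L2_trans (z - (y n - x j n)) I02) I02.
        rewrite /snorm -(ip_trans (- z) t3 t3) transB trans_trans addrA [- z + z]addrC subrr.
        by rewrite add0r.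
      apply: (@le_trans _ _ (e / vol / 4 / (S' + 1) * (S' + 1))); last by rewrite divfK ?gt_eqF.
      apply: ler_pM; rewrite ?snorm_ge0//; first exact: hrad.
      rewrite /r; apply: le_trans (snorm_le_H1 (r1 n)) _.
      by rewrite /r snorm_ip1_trans//; apply: le_trans (residual_bound n) _; rewrite lerDl.
    rewrite (sip_subl L2_semi_inner) in k1; [|exact: in_L2_trans|exact: in_L2_trans|exact: in_H1_L2].
    rewrite e1 in h1; rewrite sub0r normrN in h2.
    move: h1 h2 k1 ev0; move: (ip _ _) (ip _ _) (e / vol) => A B E.
    rewrite !ler_norml => h1 /andP[? ?] /andP[? ?] ?.
    by move: h1; have [B0|/ltW B0] := leP 0 B; [rewrite (ger0_norm B0)|rewrite (ler0_norm B0)]; lra.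
  by move=> /filter_ex[].
have wkn psi : in_H1 psi -> ip1 (u n) (trans (- y n) psi) @[n --> F] --> ip1 Qn psi.
  move=> psi1; have l0 : ip1 Qn psi + \sum_(j < k) 0 = ip1 Qn psi by rewrite [X in _ + X]big1// addr0.
  have e1 n : ip1 (u n) (trans (- y n) psi) = ip1 (f n) psi +
      \sum_j ip1 (trans (y n - x j n) (Q j)) psi.
    rewrite /f ip1_transl// (sip_sym H1_semi_inner (res n)).
    rewrite (ip1_residual n (in_H1_trans (- y n) psi1)).
    rewrite (eq_bigr (fun j => ip1 (trans (y n - x j n) (Q j)) psi)).
      by rewrite subrK (sip_sym H1_semi_inner).
    by move=> j _; rewrite (pairing_trans j y).
  apply: (cvg_real_eq e1 _ l0).
  by apply: cvgD; [exact: wQ|apply: cvg_sum_ord => j; exact: far_decorrelation].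
have eqn := weak_limit_equilibrium Qn1 wkn.
exists (fun j => if unlift ord0 j is Some i then Q i else Qn).
exists (fun j => if unlift ord0 j is Some i then x i else y).
split.
- by move=> j; case: unliftP => [i _|_]; [exact: Qeq|split].
- move=> j; case: unliftP => [i _|_]; first exact: Qbig.
  by apply: gap => //; rewrite eqn// (ip_nlf_self p1).
- move=> i j; case: unliftP => [i' ->|->]; case: unliftP => [j' ->|->] ij.
  + by apply: sep; apply: contra ij => /eqP ->.
  + by move=> M; apply: filterS (yfar i' M) => n; rewrite distrC.
  + exact: yfar.
  + by rewrite eqxx in ij.
- by move=> j psi psi1; case: unliftP => [i _|_]; [exact: wk|exact: wkn].
Qed.

(** The potential is expanded as the pairing of the nonlinearity of u n with u n, linear in the
    second slot: the residual contributes 0, being small in L^{p+1}, and each profile contributes |Q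
    j|^2 by weak continuity. With [residual_norm] the virial limit becomes nv n + |residual|^2 -> 0,
    a sum of nonnegative terms. *)
Lemma profiles_complete : vanishing ->
  nv n @[n --> F] --> (0 : R) /\ ip1 (res n) (res n) @[n --> F] --> (0 : R).
Proof.
move=> van; have [Qeq Qbig sep wk] := pr; have [P P0 hP] := pot_bound p1 C00 z01 dyadic.
have potw : pot p (res n) @[n --> F] --> (0 : R).
  apply/cvgrPdist_le => e e0.
  have [m [r r0 hr]] := pot_vanish p1 C00 z01 dyadic (S + \sum_j snorm ip1 (Q j)) e0.
  apply: filterS (van m r r0) => n hn; rewrite sub0r normrN (ger0_norm (pot_ge0 p _)).
  by apply: hr => //; exact: residual_bound.
pose B := P * S `^ (p + 1); have B0 : 0 <= B by rewrite mulr_ge0// powR_ge0.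
have uB n : pot p (u n) <= B.
  apply: le_trans (hP _ (u1 n)) _; rewrite /B ler_wpM2l//.
  by apply: ge0_ler_powR; rewrite ?nnegrE ?snorm_ge0// addr_ge0// ltW// (lt_trans _ p1).
have ipw : ip (nlf p (u n)) (res n) @[n --> F] --> (0 : R).
  apply/cvgrPdist_le => e e0; have B1 : 0 < B + 1 by rewrite ltr_wpDl.
  have e2 : 0 < e / 2 by rewrite divr_gt0.
  pose eta := e / 2 / (B + 1); have eta0 : 0 < eta by rewrite !divr_gt0.
  pose D := eta^-1 `^ p; have D0 : 0 < D by rewrite powR_gt0// invr_gt0.
  move/cvgrPdist_le : potw => /(_ _ (divr_gt0 e2 D0)); apply: filterS => n.
  rewrite !sub0r !normrN (ger0_norm (pot_ge0 p _)) => h.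
  apply: le_trans (ip_nlf_eta p1 C00 z01 dyadic (u1 n) (residual_H1 n) eta0) _.
  rewrite [e]splitr; apply: lerD; last by rewrite -ler_pdivlMl// mulrC.
  rewrite /eta mulrAC -mulrA ler_piMr ?(ltW e2)// ler_pdivrMr// mul1r.
  by apply: le_trans (uB n) _; rewrite lerDl.
have potu : pot p (u n) @[n --> F] --> \sum_j ip1 (Q j) (Q j).
  have e1 n : pot p (u n) = ip (nlf p (u n)) (res n) + \sum_j ip (nlf p (trans (x j n) (u n))) (Q j).
    have ip_sum k' (f : 'I_k' -> rV -> R) : (forall j, in_H1 (f j)) ->
        ip (nlf p (u n)) (\sum_j f j) = \sum_j ip (nlf p (u n)) (f j).
      elim: k' f => [|k' IH] f f1.
        rewrite !big_ord0 -(scale0r (0 : rV -> R)) (ip_nlfZ p1 C00 z01 dyadic) ?mul0r//.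
        exact: in_H10.
      have [d1 _] := sip_sum H1_semi_inner (fun j => f1 (lift ord0 j)).
      by rewrite !big_ord_recl (ip_nlfD p1 C00 z01 dyadic)// IH.
    have [d1 _] := sip_sum H1_semi_inner (T1 n).
    rewrite -(ip_nlf_self p1)// {1}/residual (ip_nlfB p1 C00 z01 dyadic)// ip_sum//.
    rewrite -[LHS](subrK (\sum_j ip (nlf p (u n)) (trans (- x j n) (Q j)))); congr (_ + _).
    apply: eq_bigr => j _.
    rewrite -{2}(trans0 (Q j)) -(subrr (x j n)) -(trans_trans (x j n)).
    by rewrite (ip_nlf_trans p).
  apply: (cvg_real_eq e1 _ (add0r _)); apply: cvgD => //; apply: cvg_sum_ord => j.
  have [Qj1 Qje] := Qeq j; rewrite Qje//.
  have f1 n : in_H1 (trans (x j n) (u n)) by exact: in_H1_trans.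
  have fS n : snorm ip1 (trans (x j n) (u n)) <= S by rewrite snorm_ip1_trans.
  apply: (ip_nlf_weak_cvg p1 C00 z01 dyadic FF f1 fS Qj1 Qj1 (weak_H1_L2 f1 Qj1 _)) => psi psi1.
  by under eq_fun do rewrite ip1_transl//; exact: wk.
have sum0 : nv n + ip1 (res n) (res n) @[n --> F] --> (0 : R).
  have e n : nv n + ip1 (res n) (res n) =
      (nv n + ip1 (u n) (u n) - pot p (u n)) + (ip1 (res n) (res n) - ip1 (u n) (u n)) + pot p (u n).
    by ring.
  have l0 : 0 - \sum_j ip1 (Q j) (Q j) + \sum_j ip1 (Q j) (Q j) = 0 by rewrite subrK.
  apply: (cvg_real_eq e _ l0).
  by apply: cvgD => //; apply: cvgD => //; exact: residual_norm.
split; apply/cvgrPdist_le => e' e0; move/cvgrPdist_le : sum0 => /(_ _ e0); apply: filterS => n;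
  have h1 := nv0 n; have h2 := sip_ge0 H1_semi_inner (residual_H1 n);
  rewrite !sub0r !normrN (ger0_norm (addr_ge0 h1 h2)).
  by rewrite (ger0_norm h1); apply: le_trans; rewrite lerDl.
by rewrite (ger0_norm h2); apply: le_trans; rewrite lerDr.
Qed.

End residual_theory.

Lemma profile_decomposition : exists k (Q : 'I_k -> rV -> R) (x : 'I_k -> nat -> rV),
  [/\ profiles Q x, nv n @[n --> F] --> (0 : R) &
      ip1 (residual Q x n) (residual Q x n) @[n --> F] --> (0 : R)].
Proof.
pose st k := `[< exists (Q : 'I_k -> rV -> R) (x : 'I_k -> nat -> rV), profiles Q x >].
have st0 : st 0%N.
  apply/asboolP; exists (fun _ => 0), (fun _ _ => 0).
  by split => [[]|[]|[]|[]].
have bound k : st k -> (k <= Num.trunc (S ^+ 2 / del))%N.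
  move=> /asboolP[Q [x pr]]; rewrite -ltnS -(ltr_nat R).
  apply: le_lt_trans (truncnS_gt _); rewrite ler_pdivlMr//; exact: profile_count pr.
have [k /asboolP[Q [x pr]] kmax] := ex_maxnP (ex_intro _ 0%N st0) bound.
exists k, Q, x; have van : vanishing Q x.
  apply: contrapT => /(new_profile pr)[Q' [x' pr']].
  by have := kmax k.+1 (asboolT (ex_intro _ Q' (ex_intro _ x' pr'))); rewrite ltnn.
by have [h1 h2] := profiles_complete pr van; split.
Qed.

End profiles.

Lemma subcritical_base {R : realType} (d : nat) (p : R) : (1 <= d <= 4)%N -> 1 < p ->
  (p%:E < critical_exponent d)%E ->
  exists A : R, [/\ 0 < A, A ^+ 2 = 2 ^+ d / 4 & A `^ (p + 1 - 2) < 4].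
Proof.
move=> d14 p1 hp; pose B : R := 2 ^+ d / 4; have B0 : 0 < B by rewrite divr_gt0// exprn_gt0.
exists (Num.sqrt B); split; [by rewrite sqrtr_gt0|by rewrite sqr_sqrtr// ltW|].
have -> : Num.sqrt B `^ (p + 1 - 2) = B `^ ((p - 1) / 2).
  rewrite -powR12_sqrt ?(ltW B0)// -powRrM; congr (_ `^ _); by field.
have q0 : 0 < (p - 1) / 2 by rewrite divr_gt0// subr_gt0.
have small : B <= 1 -> B `^ ((p - 1) / 2) < 4.
  move=> B1; apply: (@le_lt_trans _ _ (1 `^ ((p - 1) / 2))).
    by apply: ge0_ler_powR; rewrite ?nnegrE ?(ltW q0) ?(ltW B0).
  by rewrite powR1 ltr1n.
have large r : 1 < B -> (p - 1) / 2 < r -> B `^ r = 4 -> B `^ ((p - 1) / 2) < 4.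
  move=> B1 qr <-; rewrite -[X in _ < _ `^ X](subrK ((p - 1) / 2)).
  rewrite powRD; last by rewrite (gt_eqF B0) implybT.
  rewrite ltr_pMl ?powR_gt0//; have e1 : 1 = 1 `^ (r - (p - 1) / 2) :> R by rewrite powR1.
  rewrite [X in X < _]e1; apply: gt0_ltr_powR; rewrite ?nnegrE ?subr_gt0 ?(ltW B0)//.
have : [\/ d = 1%N, d = 2%N, d = 3%N | d = 4%N].
  by move: d14; clear; move: d => [|[|[|[|[|?]]]]]// _; constructor.
case=> ed.
- by apply: small; rewrite /B ed expr1; lra.
- by apply: small; rewrite /B ed expr2; lra.
- have Be : B = 2 by rewrite /B ed; field.
  have p5 : p < 1 + 4 / (3%:R - 2) by move: hp; rewrite ed /critical_exponent lte_fin.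
  have e5 : 1 + 4 / (3%:R - 2) = 5 :> R by field.
  have p5' : p < 5 by rewrite -e5.
  apply: (large 2); [by rewrite Be ltr1n|by clear -p5'; lra|].
  by rewrite Be powR_mulrn// expr2 -natrM.
- have Be : B = 4 by rewrite /B ed; field.
  have p3 : p < 1 + 4 / (4%:R - 2) by move: hp; rewrite ed /critical_exponent lte_fin.
  have e3 : 1 + 4 / (4%:R - 2) = 3 :> R by field.
  have p3' : p < 3 by rewrite -e3.
  apply: (large 1); [by rewrite Be ltr1n|by clear -p3'; lra|].
  by rewrite Be powRr1.
Qed.

(** Return from the ultrafilter to sequences: each set of F meets every tail, so indices satisfying
    the i-th condition can be chosen increasingly. *)
Lemma subsequence_extraction (P : nat -> nat -> Prop) (F : set_system nat) :
  ProperFilter F -> (forall A : set nat, (\forall n \near \oo, A n) -> F A) ->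
  (forall i, \forall n \near F, P i n) ->
  exists2 sub : nat -> nat, {homo sub : m n / (m < n)%N} & forall i, P i (sub i).
Proof.
move=> PF Foo FP.
have ex N i : exists n, (N < n)%N /\ P i n.
  have h1 : F [set n | (N < n)%N] by apply: Foo; exists N.+1.
  by have [n [a b]] := filter_ex (filterI h1 (FP i)); exists n.
pose g N i := xget 0%N [set n | (N < n)%N /\ P i n].
have gP N i : (N < g N i)%N /\ P i (g N i).
  by apply: (@xgetPex _ 0%N [set n | (N < n)%N /\ P i n]); exact: ex.
pose fix sub i := if i is j.+1 then g (sub j) j.+1 else g 0%N 0%N.
exists sub; last by case=> [|i]; [have [] := gP 0%N 0%N|have [] := gP (sub i) i.+1].
by apply: homo_ltn => [? ? ?|i]; [exact: ltn_trans|have [] := gP (sub i) i.+1].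
Qed.

Lemma norm_le_euclidean {R : realType} {d : nat} (x : 'rV[R]_d) : `|x| <= euclidean_norm x.
Proof.
apply: rV_norm_le => [|i]; first exact: sqrtr_ge0.
rewrite -sqrtr_sqr; apply: ler_wsqrtr; rewrite (bigD1 i)//= lerDl.
by apply: sumr_ge0 => k _; exact: sqr_ge0.
Qed.

(** * Resolution of global bounded solutions *)

Section global_bounded_solutions.
Context {R : realType} {d : nat}.
Context (alpha p S : R) (alpha0 : 0 < alpha) (p1 : 1 < p).
Context (C0 z0 : R) (C00 : 0 <= C0) (z01 : 0 <= z0 < 1).
Local Notation rV := 'rV[R]_d.
Local Notation test := (@test_function R 'rV[R]_d setT).
Context (dyadic : forall (w : rV -> R) k, in_H1 w ->
  (modular (p + 1) (w - avg k w)%R <= (C0 * z0 ^+ k * grad_norm w `^ (p + 1))%:E)%E).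
Context (u ut : R -> rV -> R).
Context (ec : energy_continuous +oo%E u ut) (td : is_time_derivative +oo%E u ut).
Context (l1 : L1loc_L2 +oo%E (fun t => nonlinearity p (u t))).
Context (sol : solves_in_distributions alpha p +oo%E u).
Context (uS : forall t, 0 <= t -> ip1 (u t) (u t) + ip (ut t) (ut t) <= S ^+ 2) (S0 : 0 <= S).
Local Notation U := (clamp u).
Local Notation V := (clamp ut).

Let UH1 t : in_H1 (U t) := clamp_H1 ec t.
Let VL2 t : in_L2 (V t) := clamp_L2 ec t.
Let US t : snorm ip1 (U t) <= S. Proof. by have [] := clamp_bound ec uS S0 t. Qed.
Let VS t : snorm ip (V t) <= S. Proof. by have [] := clamp_bound ec uS S0 t. Qed.

Let cU : curve_continuous (b := @ip1 R d) U.
Proof.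
by move=> t e e0; have [r r0 hr] := clamp_continuous ec t e0; exists r => // s /hr[].
Qed.

Let cV : curve_continuous (b := @ip R d) V.
Proof.
by move=> t e e0; have [r r0 hr] := clamp_continuous ec t e0; exists r => // s /hr[].
Qed.

Let strong (a b e : R) : 0 < a -> 0 < e -> exists2 r, 0 < r & forall s, a <= s <= b ->
  forall t, `|t - s| < r -> snorm ip (U t - U s - (t - s) *: V s) <= e * `|t - s|.
Proof. exact: strong_derivative. Qed.

Let dV (psi : rV -> R) (s : R) : 0 < s -> in_H1 psi ->
  is_derive s (1 : R) (fun t => ip (V t) psi)
    (ip (nlf p (U s)) psi - ip1 (U s) psi - 2 * alpha * ip (V s) psi).
Proof. exact: (is_derive_ip_v p1 C00 z01 dyadic ec td sol uS S0). Qed.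

Let local_strong (t e : R) : 0 < t -> 0 < e -> exists2 r, 0 < r & forall s, `|s| < r ->
  snorm ip (U (t + s) - U t - s *: V t) <= e * `|s|.
Proof.
move=> t0 e0; have [r r0 hr] := strong t t0 e0; exists r => // s sr.
by have := hr t; rewrite !lexx => /(_ isT (t + s)); rewrite [t + s - t]addrAC subrr add0r; apply.
Qed.

Let dU (psi : rV -> R) (s : R) : 0 < s -> in_L2 psi ->
  is_derive s (1 : R) (fun t => ip (U t) psi) (ip (V s) psi).
Proof.
move=> s0 psi2; apply: is_derive_littleo => e e0.
have n1 : 0 < snorm ip psi + 1 by rewrite ltr_wpDl// snorm_ge0.
have [r r0 hr] := local_strong s0 (divr_gt0 e0 n1); exists r => // t /hr h.
have U2 x := in_H1_L2 (UH1 x); have d2 := in_L2B (U2 (s + t)) (U2 s).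
have tV := in_L2Z t (VL2 s).
have -> : ip (U (s + t)) psi - ip (U s) psi - t * ip (V s) psi = ip (U (s + t) - U s - t *: V s) psi.
  by rewrite (sip_subl L2_semi_inner)// (sip_subl L2_semi_inner)// (sip_scalel L2_semi_inner).
apply: le_trans (sip_CS L2_semi_inner (in_L2B d2 tV) psi2) _.
apply: (@le_trans _ _ (e / (snorm ip psi + 1) * `|t| * (snorm ip psi + 1))).
  by apply: ler_pM; rewrite ?snorm_ge0 ?lerDl.
by rewrite mulrAC divfK ?gt_eqF.
Qed.

Let fL1 (b : R) : 0 <= b ->
  (\int[lebesgue_measure]_(t in `[0%R, b]) L2_norm (nlf p (U t)) < +oo)%E.
Proof.
move=> b0; have [_] := l1 b0 (ltry _); congr (_ < _)%E.
by apply: eq_integral => t; rewrite inE/= in_itv/= => /andP[t0 _]; rewrite clampE.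
Qed.

Let D := dissipation V.
Let dD (t : R) : 0 < t -> is_derive t (1 : R) D (ip (V t) (V t)).
Proof. exact: (is_derive_dissipation VL2 VS cV). Qed.

Let decay (a b : R) : 0 < a -> a < b ->
  energy p U V b - energy p U V a <= - (2 * alpha * (D b - D a)).
Proof.
apply: (energy_decay alpha0 p1 C00 z01 dyadic UH1 VL2 US VS cU cV _ strong dV fL1).
by move=> a' b' e e0; exact: clamp_unif_continuous.
Qed.

Let dUV (t : R) : 0 < t -> is_derive t (1 : R) (fun t => ip (V t) (U t))
  (ip (nlf p (U t)) (U t) - ip1 (U t) (U t) - 2 * alpha * ip (V t) (U t) + ip (V t) (V t)).
Proof.
move=> t0; apply: (is_derive_pairing VL2 US VS cV dV t0 UH1 (VL2 t)).
by move=> e; exact: local_strong.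
Qed.

Lemma bounded_sequence_decomposition (tn : nat -> R) (F : set_system nat) (UF : UltraFilter F) :
  (forall A : set nat, (\forall n \near \oo, A n) -> F A) ->
  tn n @[n --> \oo] --> +oo%R ->
  exists k (Q : 'I_k -> rV -> R) (x : 'I_k -> nat -> rV),
  [/\ forall j, in_H1 (Q j) /\ forall psi, in_H1 psi -> ip1 (Q j) psi = ip (nlf p (Q j)) psi,
      forall i j, i != j -> forall M : R, \forall n \near F, M <= `|x i n - x j n|,
      forall n, in_H1 (residual (fun n => U (tn n)) Q x n),
      ip (V (tn n)) (V (tn n)) @[n --> F] --> (0 : R) &
      ip1 (residual (fun n => U (tn n)) Q x n) (residual (fun n => U (tn n)) Q x n)
        @[n --> F] --> (0 : R)].
Proof.
move=> Foo tny; have [P P0 UP] := pot_curve_bound p1 C00 z01 dyadic UH1 US.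
have [del del0 gap] := @equilibrium_gap R d p p1 C0 z0 C00 z01 dyadic.
have tnT T : \forall n \near F, T <= tn n by apply: Foo; move/cvgryPge : tny; exact.
have vir : ip (V (tn n)) (V (tn n)) + ip1 (U (tn n)) (U (tn n)) - pot p (U (tn n))
    @[n --> F] --> (0 : R).
  apply/cvgrPdist_le => e e0.
  have [T _ hT] := virial_limit alpha0 p1 C00 z01 dyadic UH1 VL2 US VS dU dUV dD decay P0 UP e0.
  by apply: filterS (tnT T) => n /hT; rewrite sub0r normrN.
have [k [Q [x [pr h1 h2]]]] := profile_decomposition p1 C00 z01 dyadic UF (fun n => UH1 (tn n))
  (fun n => US (tn n)) (fun n => ip_ge0 (V (tn n))) vir
  (fun psi e tpsi e0 => let: ex_intro2 T _ hT := equilibrium_limit alpha0 p1 C00 z01 dyadic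
     UH1 VL2 US VS dU dV dD decay P0 UP tpsi e0 in
     filterS (fun n h z => hT (tn n) h z) (tnT T)) del0 gap.
exists k, Q, x; split=> //; first by have [] := pr.
- by have [_ _ sep _] := pr => i j ij M; exact: sep.
- by move=> n; exact: (residual_H1 (fun n => UH1 (tn n)) pr).
Qed.

(** Otherwise the velocity stays above some e along times tending to infinity; the decomposition
    along an ultrafilter contradicts this, since it sends the velocity to 0 together with the
    residual. *)
Lemma velocity_vanishes : L2_norm (ut t) @[t --> +oo%R] --> 0%E.
Proof.
have key : snorm ip (V t) @[t --> +oo%R] --> (0 : R).
  apply/cvgrPdist_le => e e0; apply: contrapT => ne.
  have ex N : exists t : R, N <= t /\ e < snorm ip (V t).
    apply: contrapT => nex; apply: ne; exists N; split; first exact: num_real.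
    move=> t Nt; rewrite sub0r normrN ger0_norm ?snorm_ge0// leNgt; apply/negP => h.
    by apply: nex; exists t; rewrite ltW.
  pose tn (n : nat) := xget 0 [set t : R | n%:R <= t /\ e < snorm ip (V t)].
  have tnP n : n%:R <= tn n /\ e < snorm ip (V (tn n)).
    exact: (@xgetPex _ 0 [set t : R | n%:R <= t /\ e < snorm ip (V t)] (ex n%:R)).
  have tny : tn n @[n --> \oo] --> +oo%R.
    apply/cvgryPge => A; exists (Num.trunc A).+1 => // n /= An.
    apply: le_trans (ltW (truncnS_gt A)) (le_trans _ (proj1 (tnP n))).
    by rewrite ler_nat.
  have [F [UF Foo]] := ultraFilterLemma (eventually_filter : ProperFilter \oo).
  have [k [Q [x [_ _ _ h _]]]] := bounded_sequence_decomposition UF Foo tny.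
  move/cvgrPdist_lt : h => /(_ _ (exprn_gt0 2 e0)) h.
  have [n] := @filter_ex _ _ (@ultra_proper _ F UF) _ h.
  rewrite sub0r normrN ger0_norm ?ip_ge0// -(snorm_sqr L2_semi_inner)//.
  rewrite ltNge lerXn2r ?nnegrE ?snorm_ge0 ?(ltW e0)//.
  by have [_ /ltW] := tnP n.
have h : (snorm ip (V t))%:E @[t --> +oo%R] --> 0%E by apply: cvg_EFin => //; exact: nearW.
apply: cvg_trans h; apply: near_eq_cvg; near=> t.
have t0 : 0 <= t by near: t; apply: nbhs_pinfty_ge; exact: num_real.
by rewrite -(L2_norm_snorm (VL2 t)) clampE.
Unshelve. all: end_near. Qed.

Lemma equilibriumP (Q : rV -> R) : in_H1 Q ->
  (forall psi, in_H1 psi -> ip1 Q psi = ip (nlf p Q) psi) -> is_equilibrium p Q.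
Proof.
move=> Q1 h; split=> // phi tphi; have [phi1 _] := test_in_H1 tphi.
have Q2 := in_H1_L2 Q1; have phi2 := in_H1_L2 phi1; have lap2 := test_in_L2 (test_laplacian tphi).
have chi2 := in_L2B phi2 lap2.
transitivity (ip Q (phi - laplacian phi) - ip (nlf p Q) phi).
  rewrite !ipE -(RintegralB measurableT (in_L2_integrable_mul Q2 chi2)
    (nlf_integrable p1 C00 z01 dyadic Q1 phi1)).
  by apply: eq_Rintegral => x _; congr (_ * _ - _); rewrite addrC.
by rewrite (sip_subr L2_semi_inner)// -ip1_test// h// subrr.
Qed.

Lemma sequence_soliton_resolution (tn : nat -> R) : tn n @[n --> \oo] --> +oo%R ->
  exists (sub : nat -> nat) (J : nat) (Q : 'I_J -> rV -> R) (x : 'I_J -> nat -> rV),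
  [/\ {homo sub : m n / (m < n)%N},
      forall j, is_equilibrium p (Q j),
      cvg_to0_H1 (fun n y => u (tn (sub n)) y - \sum_(j < J) Q j (y - x j n)) &
      forall i j, i != j -> euclidean_norm (x j n - x i n) @[n --> \oo] --> +oo%R].
Proof.
move=> tny; have [F [UF Foo]] := ultraFilterLemma (eventually_filter : ProperFilter \oo).
have PF : ProperFilter F := @ultra_proper _ F UF.
have [k [Q [x [Qeq sep res1 _ res0]]]] := bounded_sequence_decomposition UF Foo tny.
pose res n := residual (fun n => U (tn n)) Q x n.
(* The accuracy is tied to the index i, so that choosing the i-th term in P i makes the residual
   tend to 0 and the centres separate along the whole subsequence. *)
pose P (i n : nat) := [/\ 0 <= tn n, ip1 (res n) (res n) <= (i.+1%:R^-1) ^+ 2 &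
  forall a b, a != b -> i%:R <= `|x a n - x b n|].
have FP i : \forall n \near F, P i n.
  have i0 : 0 < (i.+1%:R^-1 : R) ^+ 2 by rewrite exprn_gt0// invr_gt0.
  have h1 : \forall n \near F, 0 <= tn n by apply: Foo; move/cvgryPge : tny; exact.
  move/cvgrPdist_le : res0 => /(_ _ i0) h2.
  have h3 : \forall n \near F, forall a b : 'I_k, a != b -> i%:R <= `|x a n - x b n|.
    apply: filter_forall => a; apply: filter_forall => b.
    have [->|ab] := eqVneq a b; first by apply: nearW.
    by apply: filterS (sep a b ab i%:R).
  apply: filterS3 h1 h2 h3 => n t0; rewrite sub0r normrN => h sp; split=> //.
  exact: le_trans (ler_norm _) h.
have [sub sub_lt subP] := subsequence_extraction PF Foo FP.
exists sub, k, Q, (fun j n => x j (sub n)); split=> //.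
- by move=> j; have [Q1 Qe] := Qeq j; exact: equilibriumP.
- have e n : (fun y => u (tn (sub n)) y - \sum_(j < k) Q j (y - x j (sub n))) = res (sub n).
    apply/funext => y; have [t0 _ _] := subP n.
    by rewrite /res /residual clampE// !fctE fct_sumE.
  split=> [n|]; first by rewrite e; exact: res1.
  have bd n : snorm ip1 (res (sub n)) <= n.+1%:R^-1.
    rewrite -(ler_pXn2r (n := 2))// ?nnegrE ?snorm_ge0 ?invr_ge0//.
    by rewrite (snorm_sqr H1_semi_inner); [have [] := subP n|exact: res1].
  have lim : snorm ip1 (res (sub n)) @[n --> \oo] --> (0 : R).
    apply: (@squeeze_cvgr _ _ _ _ (fun=> 0) (fun n => n.+1%:R^-1)).
    - by apply: nearW => n; rewrite snorm_ge0 bd.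
    - exact: cvg_cst.
    - exact: cvg_harmonic.
  have limE : (snorm ip1 (res (sub n)))%:E @[n --> \oo] --> 0%E by exact: cvg_to_EFin.
  apply: cvg_trans limE; apply: near_eq_cvg; apply: nearW => n.
  by rewrite e H1_norm_snorm//; exact: res1.
- move=> i j ij; apply/cvgryPge => A; exists (Num.trunc A).+1 => // n /= An.
  apply: le_trans (norm_le_euclidean _); have [_ _ /(_ j i)] := subP n.
  rewrite eq_sym => /(_ ij); apply: le_trans; apply: le_trans (ltW (truncnS_gt A)) _.
  by rewrite ler_nat.
Qed.

End global_bounded_solutions.

Theorem theorem1p1 (R : realType) (d : nat) (alpha p : R)
    (u0 u1 : 'rV[R]_d -> R) (Tplus : \bar R) (u ut : R -> 'rV[R]_d -> R)
    (halpha : 0 < alpha) (hd : (1 <= d <= 4)%N)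
    (hp1 : 1 < p) (hp : (p%:E < critical_exponent d)%E)
    (hdata : in_energy_space u0 u1)
    (hu : is_maximal_solution alpha p u0 u1 Tplus u ut) :
  (Tplus < +oo)%E
  \/ (Tplus = +oo%E /\
      ereal_sup [set energy_norm (u t) (ut t) | t in [set t | 0 <= t]] = +oo%E)
  \/ [/\ Tplus = +oo%E,
         L2_norm (ut t) @[t --> +oo%R] --> 0%E &
         forall tn : nat -> R, tn n @[n --> \oo] --> +oo%R ->
           exists (sub : nat -> nat) (J : nat) (Q : 'I_J -> 'rV[R]_d -> R)
                  (x : 'I_J -> nat -> 'rV[R]_d),
             [/\ {homo sub : m n / (m < n)%N},
                 forall j, is_equilibrium p (Q j),
                 cvg_to0_H1 (fun n y =>
                   u (tn (sub n)) y - \sum_(j < J) Q j (y - x j n)) &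
                 forall i j, i != j ->
                   euclidean_norm (x j n - x i n) @[n --> \oo] --> +oo%R]].
Proof.
have [Ty|] := eqVneq Tplus +oo%E; last by rewrite -ltey; left.
subst Tplus; right; set E := ereal_sup _.
have [|Efin] := eqVneq E +oo%E; [by left|right].
case: hu => _ [[ec td] l1 sol _ _] _.
have en t : 0 <= t -> energy_norm (u t) (ut t) = (Num.sqrt (ip1 (u t) (u t) + ip (ut t) (ut t)))%:E.
  by move=> t0; have [[? ?] _] := ec t ((lifespan_y t).2 t0); rewrite energy_norm_snorm.
have Ele t : 0 <= t -> ((Num.sqrt (ip1 (u t) (u t) + ip (ut t) (ut t)))%:E <= E)%E.
  by move=> t0; apply: ereal_sup_ubound; exists t => //; exact: en.
have [S ES] : exists S, E = S%:E.
  (* The value -oo is excluded because the supremum dominates the energy norm at time 0. *)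
  case: E Efin Ele => [r _ _|//|_ /(_ 0 (lexx 0))]; first by exists r.
  by rewrite leeNy_eq.
have S0 : 0 <= S by have := Ele 0 (lexx 0); rewrite ES lee_fin; apply: le_trans; exact: sqrtr_ge0.
have uS t : 0 <= t -> ip1 (u t) (u t) + ip (ut t) (ut t) <= S ^+ 2.
  move=> t0; have := Ele t t0; rewrite ES lee_fin => h.
  have [[U1 V2] _] := ec t ((lifespan_y t).2 t0).
  have pos : 0 <= ip1 (u t) (u t) + ip (ut t) (ut t).
    by rewrite addr_ge0 ?ip_ge0// (sip_ge0 H1_semi_inner).
  by rewrite -[leLHS]sqr_sqrtr// lerXn2r ?nnegrE ?sqrtr_ge0.
have [A [A0 A2 Aq]] := subcritical_base hd hp1 hp.
have q2 : 2 < p + 1 by rewrite -[2]/(1 + 1) ltrD2r.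
have [C0 [z0 [C00 z01 dyadic]]] := dyadic_sobolev q2 A0 A2 Aq.
have dyadic' (w : 'rV[R]_d -> R) k := @dyadic w k.
split=> //; first exact: (velocity_vanishes halpha hp1 C00 z01 dyadic' ec td l1 sol uS S0).
exact: (sequence_soliton_resolution halpha hp1 C00 z01 dyadic' ec td l1 sol uS S0).
Qed.
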